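(* Let $s\in(0,1)$ and let $f:\mathbb{R}\to\mathbb{R}$ be locally Lipschitz and such that, for some $C>0$ and some $p$, $|f(t)|\le C(1+|t|)^p$ for all $t\in\mathbb{R}$, where $1<p<\frac{1+2s}{1-2s}$ if $s<\frac12$ and $1<p<\infty$ if $s\ge\frac12$. Let $u\in X$ be a weak solution of $\mathcal{L}u=f(u)$ in $(0,2\pi)$. Then $u\in C^{2s+\alpha}(\mathbb{R})$ for every $\alpha\in(0,1)$, and $u$ is a $2\pi$-periodic classical solution of $(-\Delta)^s u=f(u)$ in $\mathbb{R}$.
   Context: For $s\in(0,1)$, $(-\Delta)^s u(x)=c_s\,\mathrm{P.V.}\!\int_{\mathbb{R}}\frac{u(x)-u(y)}{|x-y|^{1+2s}}\,dy$, with $c_s=\left(\int_{\mathbb{R}}\frac{1-\cos t}{|t|^{1+2s}}dt\right)^{-1}$. A classical solution is a function regular enough for this to be evaluated pointwise, satisfying the equation at every point. Set $H(z)=c_s\sum_{n=-\infty}^{\infty}\frac{1}{|z-2\pi n|^{1+2s}}$ for $0<|z|<2\pi$, and $\mathcal{L}u(x)=\mathrm{P.V.}\int_0^{2\pi}(u(x)-u(y))H(x-y)\,dy$ for $x\in(0,2\pi)$. $X$ is the Hilbert space obtained as the closure of the set of $2\pi$-periodic functions $u\in C^1(\mathbb{R})$ in the norm $\|u\|^2=\frac12\int_0^{2\pi}\!\int_0^{2\pi}(u(x)-u(y))^2H(x-y)\,dy\,dx+\int_0^{2\pi}u^2\,dx$; its elements are regarded as $2\pi$-periodic functions on $\mathbb{R}$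 (defined a.e.). A weak solution of $\mathcal{L}u=f(u)$ in $(0,2\pi)$ is $u\in X$ with $\frac12\int_0^{2\pi}\!\int_0^{2\pi}(u(x)-u(y))(\phi(x)-\phi(y))H(x-y)\,dy\,dx=\int_0^{2\pi}f(u)\phi\,dx$ for all $\phi\in X$. $C^{\beta}(\mathbb{R})$, $\beta>0$ non-integer, is the Hölder space $C^{m,\beta-m}$ with $m=\lfloor\beta\rfloor$; for integer $\beta$ it is understood in the Hölder–Zygmund sense. Regularity of $u$ is understood after modification on a null set. *)

(* Defs.v *)
From HB Require Import structures.
From mathcomp Require Import all_boot all_order all_algebra.
From mathcomp Require Import all_classical all_reals all_analysis.

Set Implicit Arguments.
Unset Strict Implicit.
Unset Printing Implicit Defensive.

Import Order.TTheory GRing.Theory Num.Theory.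
Import numFieldNormedType.Exports.

Local Open Scope classical_set_scope.
Local Open Scope ring_scope.

Section fractional_laplacian.
Context {R : realType}.
Local Notation mu := (@lebesgue_measure R).
Implicit Types (s x z e : R) (u v phi f : R -> R).

(* Since 0 `^ a = 0 for a <> 0 and 0^-1 = 0, the singular term of every kernel
   below is 0; in each integral this concerns a null set only. *)
Definition frac_cst s : R :=
  (\int[mu]_t ((1 - cos t) / `|t| `^ (1 + 2 * s)))^-1.

Definition frac_quot s v x (y : R) : R :=
  (v x - v y) / `|x - y| `^ (1 + 2 * s).

Definition frac_trunc s v x e : R :=
  \int[mu]_(y in [set y | e < `|x - y|]) frac_quot s v x y.

Definition frac_lap_ex s v x : Prop :=
  (forall e, 0 < e ->
     mu.-integrable [set y | e < `|x - y|] (EFin \o frac_quot s v x)) /\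
  cvg (frac_trunc s v x e @[e --> 0^'+]).

Definition frac_lap s v x : R :=
  frac_cst s * lim (frac_trunc s v x e @[e --> 0^'+]).

Definition classical_solution s f v : Prop :=
  forall x, frac_lap_ex s v x /\ frac_lap s v x = f (v x).

Definition per_kernel s z : R :=
  frac_cst s * fine (\esum_(n in [set: int])
    ((`|z - (pi *+ 2) *~ n| `^ (1 + 2 * s))^-1)%:E).

Definition per_itv : set R := `]0, pi *+ 2[%classic.

Definition X_sqnorm s u : \bar R :=
  ((2^-1)%:E * (\int[mu]_(x in per_itv) \int[mu]_(y in per_itv)
      ((u x - u y) ^+ 2 * per_kernel s (x - y))%:E)
   + \int[mu]_(x in per_itv) (u x ^+ 2)%:E)%E.

Definition X_norm s u : \bar R := poweR (X_sqnorm s u) 2^-1.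

Definition C1_periodic v : Prop :=
  [/\ periodic v (pi *+ 2), forall x, derivable v x 1 & continuous (derive1 v)].

(* The closure is taken among measurable functions that are periodic almost
   everywhere; elements are representatives, with no identification of
   functions that agree almost everywhere.  Since X_norm dominates the L^2
   norm, no element of the abstract completion is lost. *)
Definition X_space s : set (R -> R) :=
  [set u : R -> R | [/\ measurable_fun setT u,
    {ae mu, forall x, u (x + pi *+ 2) = u x} &
    forall e, 0 < e ->
      exists2 v, C1_periodic v & (X_norm s (u \- v)%R < e%:E)%E]].

Definition X_form s u phi : R :=
  2^-1 * \int[mu]_(x in per_itv) (\int[mu]_(y in per_itv)
     ((u x - u y) * (phi x - phi y) * per_kernel s (x - y))).

Definition weak_solution s f u : Prop :=
  X_space s u /\
  forall phi, X_space s phi ->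
    X_form s u phi = \int[mu]_(x in per_itv) (f (u x) * phi x).

Definition bounded_derivs (m : nat) v : Prop :=
  (forall j, (j < m)%N -> forall x, derivable (derive1n j v) x 1) /\
  (forall j, (j <= m)%N -> exists M : R, forall x, `|derive1n j v x| <= M).

Definition holder_space (m : nat) (gamma : R) : set (R -> R) :=
  [set v : R -> R | bounded_derivs m v /\
    exists M : R, forall x y,
      `|derive1n m v x - derive1n m v y| <= M * `|x - y| `^ gamma].

(* The Zygmund space of integer order m + 1. *)
Definition zygmund_space (m : nat) : set (R -> R) :=
  [set v : R -> R | [/\ bounded_derivs m v, continuous (derive1n m v) &
    exists M : R, forall x h,
      `|derive1n m v (x + h) - 2 * derive1n m v x + derive1n m v (x - h)| <= M * `|h|]].

Definition holder_zygmund (beta : R) : set (R -> R) :=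
  if beta \is a Num.nat then zygmund_space (Num.truncn beta).-1
  else holder_space (Num.truncn beta) (beta - (Num.truncn beta)%:R).

End fractional_laplacian.

(* Main.v *)
Require Import Defs.
From HB Require Import structures.
From mathcomp Require Import all_boot all_order all_algebra.
From mathcomp Require Import all_classical all_reals all_analysis.
From mathcomp Require Import measurable_realfun.
From mathcomp Require Import ring lra.

Set Implicit Arguments.
Unset Strict Implicit.
Unset Printing Implicit Defensive.

Import Order.TTheory GRing.Theory Num.Theory.
Import numFieldNormedType.Exports.

Local Open Scope classical_set_scope.
Local Open Scope ring_scope.

(* Replace u by its periodic representative.  Unfolding the periodic kernel shows that the
   energy form of the weak formulation is diagonal in cos(k x), sin(k x) with symbol |k|^(2s),
   so the Fourier coefficients of u and f(u) satisfy |k|^(2s) u^(k) = f(u)^(k).  With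
   g = f(u), V(t) = P_t * g and P_t the Poisson kernel of the circle, whose multipliers are
   e^(-t|k|), uniqueness of Fourier coefficients gives almost everywhere
     u = mean(u) + Gamma(2s)^-1 int_0^oo t^(2s-1) V(t) dt.
   Boundedness: averaging |u(x) - u(x+h)| over short intervals turns an L^q bound into an
   L^(2+2sq) bound, so that a = (1+|u|)^(p-1) lies in L^m for some m > 1/(2s); truncating the
   time integral to ]0, delta[ then yields a symmetric positive operator T with T(1) <= 1/2 and
   1 + |u| <= C + T(1 + |u|), which excludes large values.
   Regularity: Hoelder data of exponent a make the j-th derivative of V(t) of size
   t^(a-j) e^(-ct); interpolating increments and integrating in t gains almost 2s derivatives.
   Classical solution: u has second differences O(|h|^(2 theta)) with theta > s, so the
   symmetrized principal value converges absolutely to a continuous function whose Fourier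
   coefficients are those of f(u). *)

(** * Fubini and real-valued integrals *)

(** The inverse symbol is [|k|^(-2s) = Gamma(2s)^-1 int_0^oo t^(2s-1) e^(-t|k|) dt], so the solution
    operator is a superposition of Poisson kernels. These are positive, symmetric, of mass one and
    given by a closed formula; mapping properties are therefore elementary estimates at fixed t
    followed by one integration in t. Convergence for large t requires data of mean zero, which
    frequency 0 of the equation supplies. The growth condition decides the boundedness step. For s <
    1/2 the iteration q -> 2 + 2sq approaches 2/(1-2s), while p < (1+2s)/(1-2s) says (p-1)(1-2s) <
    4s; this is exactly the room for some m > 1/(2s) with (p-1)m below that limit. Since P_t maps
    L^m into L^oo with norm O(t^(-1/m)) for t <= 1, the condition m > 1/(2s) makes the time integral
    converge at 0 and its short-time part small. As f is only locally Lipschitz, it is composed with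
    a truncation once u is bounded; the regularity part then deals with a bounded, globally
    Lipschitz nonlinearity. *)

Section product_domains.
Context d1 d2 (T1 : measurableType d1) (T2 : measurableType d2) (R : realType).
Variables (m1 : {sigma_finite_measure set T1 -> \bar R})
          (m2 : {sigma_finite_measure set T2 -> \bar R}).
Variables (A : set T1) (B : set T2) (f : T1 * T2 -> R).
Hypotheses (mA : measurable A) (mB : measurable B) (mf : measurable_fun setT f).

(** Indicator factors absorb the restriction to [A] and [B], which reduces the iterated integrals to
    integrals over the whole product space. *)
Let g : T1 * T2 -> \bar R := fun z => (f z * \1_A z.1 * \1_B z.2)%:E.

Let mg : measurable_fun setT g.
Proof.
apply/measurable_EFinP; apply: measurable_funM; first apply: measurable_funM => //.
- by apply: measurableT_comp => //; exact: measurable_indic.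
- by apply: measurableT_comp => //; exact: measurable_indic.
Qed.

Let gE1 x : (\int[m2]_y g (x, y) = (\1_A x)%:E * \int[m2]_(y in B) (f (x, y))%:E)%E.
Proof.
rewrite [in RHS]integral_mkcond /g /= indicE.
have [xA|xA] := boolP (x \in A); last first.
  by rewrite mul0e integral0_eq// => y _; rewrite mulr0 mul0r.
rewrite mul1e; apply: eq_integral => y _; rewrite mulr1 patchE indicE.
by case: ifPn => _; rewrite ?mulr1 ?mulr0.
Qed.

Let gE2 y : (\int[m1]_x g (x, y) = (\1_B y)%:E * \int[m1]_(x in A) (f (x, y))%:E)%E.
Proof.
rewrite [in RHS]integral_mkcond /g /= indicE.
have [xA|xA] := boolP (y \in B); last first.
  by rewrite mul0e integral0_eq// => x _; rewrite mulr0.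
rewrite mul1e; apply: eq_integral => x _; rewrite mulr1 patchE indicE.
by case: ifPn => _; rewrite ?mulr1 ?mulr0.
Qed.

Let indE d (T : measurableType d) (m : {measure set T -> \bar R}) (D : set T) (F : T -> \bar R) :
  (\int[m]_x ((\1_D x)%:E * F x) = \int[m]_(x in D) F x)%E.
Proof.
rewrite [in RHS]integral_mkcond; apply: eq_integral => x _.
by rewrite patchE indicE; case: ifPn => _; rewrite ?mul1e ?mul0e.
Qed.

Lemma tonelli_in : (forall z, 0 <= f z) ->
  (\int[m1]_(x in A) \int[m2]_(y in B) (f (x, y))%:E =
   \int[m2]_(y in B) \int[m1]_(x in A) (f (x, y))%:E)%E.
Proof.
move=> f0; rewrite -[LHS]indE -[RHS]indE.
under eq_integral do rewrite -gE1.
under [RHS]eq_integral do rewrite -gE2.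
rewrite fubini_tonelli // => z; rewrite /g lee_fin !mulr_ge0 //; exact: indic_ge0.
Qed.

End product_domains.

(** [fine] sends infinite values to 0, so the bound needs no finiteness. *)
Lemma abse_fine_le (R : realType) (e : \bar R) : (`|fine e|%:E <= `|e|)%E.
Proof. by case: e => [r| |]; rewrite ?abse_EFin /= ?normr0 ?lexx ?leey. Qed.

Section inner_measurable.
Context d1 d2 (T1 : measurableType d1) (T2 : measurableType d2) (R : realType).
Variables (m2 : {sigma_finite_measure set T2 -> \bar R}) (B : set T2).
Hypothesis mB : measurable B.

Lemma measurable_inner_ge0 (f : T1 * T2 -> R) : measurable_fun setT f ->
  (forall z, 0 <= f z) ->
  measurable_fun setT (fun x => \int[m2]_(y in B) (f (x, y))%:E)%E.
Proof.
move=> mf f0.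
have -> : (fun x => \int[m2]_(y in B) (f (x, y))%:E)%E =
    fubini_F m2 (fun z => (f z * \1_B z.2)%:E).
  apply/funext => x; rewrite /fubini_F [LHS]integral_mkcond; apply: eq_integral => y _.
  by rewrite patchE /= indicE; case: ifPn; rewrite ?mulr1 ?mulr0.
apply: measurable_fun_fubini_tonelli_F.
  apply/measurable_EFinP; apply: measurable_funM => //.
  by apply: measurableT_comp => //; exact: measurable_indic.
by move=> z; rewrite lee_fin mulr_ge0 //; exact: indic_ge0.
Qed.

Lemma measurable_inner (f : T1 * T2 -> R) : measurable_fun setT f ->
  measurable_fun setT (fun x => \int[m2]_(y in B) (f (x, y))%:E)%E.
Proof.
move=> mf.
have -> : (fun x => \int[m2]_(y in B) (f (x, y))%:E)%E =
   (fun x => \int[m2]_(y in B) (Num.max (f (x, y)) 0)%:E -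
             \int[m2]_(y in B) (Num.max (- f (x, y)) 0)%:E)%E.
  apply/funext => x; rewrite integralE; congr (_ - _)%E.
    by apply: eq_integral => y _; rewrite funeposE -EFin_max.
  by apply: eq_integral => y _; rewrite funenegE -EFin_max.
apply: emeasurable_funB.
  apply: (measurable_inner_ge0 (f := fun z => Num.max (f z) 0)).
    exact: measurable_maxr.
  by move=> z; rewrite le_max lexx orbT.
apply: (measurable_inner_ge0 (f := fun z => Num.max (- f z) 0)).
  by apply: measurable_maxr => //; exact: measurableT_comp.
by move=> z; rewrite le_max lexx orbT.
Qed.

Lemma measurable_Rinner (f : T1 * T2 -> R) : measurable_fun setT f ->
  measurable_fun setT (fun x => \int[m2]_(y in B) f (x, y)).
Proof.
move=> mf; apply: measurableT_comp (measurable_inner mf).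
exact: fine_measurable.
Qed.

End inner_measurable.

Section fubini_domains.
Context d1 d2 (T1 : measurableType d1) (T2 : measurableType d2) (R : realType).
Variables (m1 : {sigma_finite_measure set T1 -> \bar R})
          (m2 : {sigma_finite_measure set T2 -> \bar R}).
Variables (A : set T1) (B : set T2) (f : T1 * T2 -> R).
Hypotheses (mA : measurable A) (mB : measurable B) (mf : measurable_fun setT f).
Hypothesis intf : (\int[m1]_(x in A) \int[m2]_(y in B) `|f (x, y)|%:E < +oo)%E.

Let mnf : measurable_fun setT (fun z => `|f z|).
Proof. exact: measurableT_comp. Qed.

Lemma ae_inner_integrable :
  {ae m1, forall x, A x -> m2.-integrable B (fun y => (f (x, y))%:E)}.
Proof.
have i1 : m1.-integrable A (fun x => \int[m2]_(y in B) `|f (x, y)|%:E)%E.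
  apply/integrableP; split.
    by apply: measurable_funTS; apply: measurable_inner mnf.
  apply: le_lt_trans intf; rewrite le_eqVlt; apply/orP; left; apply/eqP.
  by apply: eq_integral => x _; rewrite gee0_abs// integral_ge0.
have := integrable_ae mA i1; apply: filterS => x /= h Ax; apply/integrableP; split.
  by apply/measurable_EFinP; apply: measurable_funTS; exact: measurableT_comp.
by have := h Ax; rewrite ge0_fin_numE// integral_ge0.
Qed.

Lemma inner_integrable : m1.-integrable A (EFin \o (fun x => \int[m2]_(y in B) f (x, y))).
Proof.
apply/integrableP; split.
  apply/measurable_EFinP; apply: measurable_funTS; exact: measurable_Rinner.
apply: le_lt_trans intf; apply: ge0_le_integral => //.
- apply/measurable_EFinP; apply: measurable_funTS; apply: measurableT_comp => //.
  exact: measurable_Rinner.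
- by apply: measurable_funTS; apply: measurable_inner mnf.
- move=> x Ax /=; apply: (@le_trans _ _ `|\int[m2]_(y in B) (f (x, y))%:E|%E).
    exact: abse_fine_le.
  apply: le_abse_integral => //; apply/measurable_EFinP; apply: measurable_funTS.
  exact: measurableT_comp.
Qed.

(** Where the inner integral is not finite, the real-valued one takes the default value of [fine];
    by [ae_inner_integrable] this concerns a null set only. *)
Lemma Rinner_outer : (\int[m1]_(x in A) (\int[m2]_(y in B) f (x, y))%:E =
  \int[m1]_(x in A) \int[m2]_(y in B) (f (x, y))%:E)%E.
Proof.
apply: ae_eq_integral => //.
- apply/measurable_EFinP; apply: measurable_funTS; exact: measurable_Rinner.
- by apply: measurable_funTS; exact: measurable_inner.
have := ae_inner_integrable; apply: filterS => x h Ax.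
by rewrite /Rintegral fineK//; apply: integrable_fin_num => //; exact: h.
Qed.

End fubini_domains.

Section fubini_swap.
Context d1 d2 (T1 : measurableType d1) (T2 : measurableType d2) (R : realType).
Variables (m1 : {sigma_finite_measure set T1 -> \bar R})
          (m2 : {sigma_finite_measure set T2 -> \bar R}).
Variables (A : set T1) (B : set T2) (f : T1 * T2 -> R).
Hypotheses (mA : measurable A) (mB : measurable B) (mf : measurable_fun setT f).
Hypothesis intf : (\int[m1]_(x in A) \int[m2]_(y in B) `|f (x, y)|%:E < +oo)%E.

Let fs z := f (z.2, z.1).
Let mfs : measurable_fun setT fs.
Proof.
apply: (measurableT_comp mf); apply: measurable_fun_pair => //.
Qed.

Lemma fubini_in :
  \int[m1]_(x in A) \int[m2]_(y in B) f (x, y) =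
  \int[m2]_(y in B) \int[m1]_(x in A) f (x, y).
Proof.
have intfs : (\int[m2]_(y in B) \int[m1]_(x in A) `|f (x, y)|%:E < +oo)%E.
  rewrite -(@tonelli_in _ _ _ _ _ m1 m2 A B (fun z => `|f z|)) //; exact: measurableT_comp.
rewrite /Rintegral; congr fine.
rewrite (Rinner_outer mA mB mf intf) (Rinner_outer mB mA mfs intfs).
pose g : T1 * T2 -> \bar R := fun z => (f z * \1_A z.1 * \1_B z.2)%:E.
have mg : measurable_fun setT g.
  apply/measurable_EFinP; apply: measurable_funM; first apply: measurable_funM => //.
  - by apply: measurableT_comp => //; exact: measurable_indic.
  - by apply: measurableT_comp => //; exact: measurable_indic.
have gE1 x : (\int[m2]_y g (x, y) = (\1_A x)%:E * \int[m2]_(y in B) (f (x, y))%:E)%E.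
  rewrite [in RHS]integral_mkcond /g /= indicE.
  have [xA|xA] := boolP (x \in A); last first.
    by rewrite mul0e integral0_eq// => y _; rewrite mulr0 mul0r.
  rewrite mul1e; apply: eq_integral => y _; rewrite mulr1 patchE indicE.
  by case: ifPn => _; rewrite ?mulr1 ?mulr0.
have gE2 y : (\int[m1]_x g (x, y) = (\1_B y)%:E * \int[m1]_(x in A) (f (x, y))%:E)%E.
  rewrite [in RHS]integral_mkcond /g /= indicE.
  have [xA|xA] := boolP (y \in B); last first.
    by rewrite mul0e integral0_eq// => x _; rewrite mulr0.
  rewrite mul1e; apply: eq_integral => x _; rewrite mulr1 patchE indicE.
  by case: ifPn => _; rewrite ?mulr1 ?mulr0.
have indE d (T : measurableType d) (m : {measure set T -> \bar R}) (D : set T) (F : T -> \bar R) :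
    (\int[m]_x ((\1_D x)%:E * F x) = \int[m]_(x in D) F x)%E.
  rewrite [in RHS]integral_mkcond; apply: eq_integral => x _.
  by rewrite patchE indicE; case: ifPn => _; rewrite ?mul1e ?mul0e.
have L1 : (\int[m1]_x \int[m2]_y g (x, y) =
    \int[m1]_(x in A) \int[m2]_(y in B) (f (x, y))%:E)%E.
  by under eq_integral do rewrite gE1; rewrite indE.
have L2 : (\int[m2]_y \int[m1]_x g (x, y) =
    \int[m2]_(y in B) \int[m1]_(x in A) (f (x, y))%:E)%E.
  by under eq_integral do rewrite gE2; rewrite indE.
rewrite /= -L1 -L2; apply: Fubini; apply/(integrable12ltyP _ _ mg).
under eq_integral => x _.
  have -> : (\int[m2]_y `|g (x, y)| = (\1_A x)%:E * \int[m2]_(y in B) (`|f (x, y)|)%:E)%E.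
    rewrite [in RHS]integral_mkcond /g /= indicE.
    have [xA|xA] := boolP (x \in A); last first.
      by rewrite mul0e integral0_eq// => y _; rewrite mulr0 mul0r normr0.
    rewrite mul1e; apply: eq_integral => y _; rewrite mulr1 patchE indicE.
    by case: ifPn => _; rewrite ?mulr1 ?mulr0 ?normr0.
  over.
by rewrite /= indE.
Qed.

End fubini_swap.

Section real_integrable.
Context d (T : measurableType d) (R : realType).
Variables (m : {measure set T -> \bar R}) (D : set T).
Hypothesis mD : measurable D.

Lemma integrable_cmul (f : T -> R) (k : R) :
  m.-integrable D (fun x => (f x)%:E) -> m.-integrable D (fun x => (k * f x)%:E).
Proof. by move=> h; have := integrableZl mD k h; apply: eq_integrable => // x _. Qed.

Lemma integrable_add (f g : T -> R) :
  m.-integrable D (fun x => (f x)%:E) -> m.-integrable D (fun x => (g x)%:E) ->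
  m.-integrable D (fun x => (f x + g x)%:E).
Proof. by move=> h h'; have := integrableD mD h h'; apply: eq_integrable => // x _. Qed.

Lemma integrable_sub (f g : T -> R) :
  m.-integrable D (fun x => (f x)%:E) -> m.-integrable D (fun x => (g x)%:E) ->
  m.-integrable D (fun x => (f x - g x)%:E).
Proof. by move=> h h'; have := integrableB mD h h'; apply: eq_integrable => // x _. Qed.

Lemma integrable_abs (f : T -> R) :
  m.-integrable D (fun x => (f x)%:E) -> m.-integrable D (fun x => `|f x|%:E).
Proof. by move=> h; have := integrable_abse h; apply: eq_integrable => // x _. Qed.

Lemma integrable_ge0 (f : T -> R) : measurable_fun D f -> (forall x, D x -> 0 <= f x) ->
  (\int[m]_(x in D) (f x)%:E < +oo)%E -> m.-integrable D (fun x => (f x)%:E).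
Proof.
move=> mf f0 fi; apply/integrableP; split; first exact/measurable_EFinP.
apply: le_lt_trans fi; rewrite le_eqVlt; apply/orP; left; apply/eqP.
by apply: eq_integral => x /set_mem Dx; rewrite gee0_abs// lee_fin f0.
Qed.

Lemma integrable_lty_abs (f : T -> R) : measurable_fun D f ->
  (\int[m]_(x in D) `|f x|%:E < +oo)%E -> m.-integrable D (fun x => (f x)%:E).
Proof. by move=> mf fi; apply/integrableP; split=> //; exact/measurable_EFinP. Qed.

Lemma integrable_dom (g f : T -> R) : measurable_fun D f ->
  (forall x, D x -> `|f x| <= g x) ->
  m.-integrable D (fun x => (g x)%:E) -> m.-integrable D (fun x => (f x)%:E).
Proof.
move=> mf fg; apply: le_integrable => //; first exact/measurable_EFinP.
by move=> x Dx /=; rewrite lee_fin (le_trans (fg x Dx))// ler_norm.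
Qed.

Lemma integrable_mf (f : T -> R) :
  m.-integrable D (fun x => (f x)%:E) -> measurable_fun D f.
Proof. by move=> /integrableP[/measurable_EFinP]. Qed.

Lemma integrable_ae_lty (f : T -> R) : 
  m.-integrable D (fun x => (f x)%:E) -> (\int[m]_(x in D) `|f x|%:E < +oo)%E.
Proof. by move=> /integrableP[]. Qed.

Lemma Rintegral_cmul (f : T -> R) (k : R) :
  m.-integrable D (fun x => (f x)%:E) ->
  \int[m]_(x in D) (k * f x) = k * \int[m]_(x in D) f x.
Proof. by move=> h; exact: RintegralZl. Qed.

Lemma ge0_integral_cmul (f : T -> R) (k : R) : 0 <= k -> measurable_fun D f ->
  (forall x, D x -> 0 <= f x) ->
  (\int[m]_(x in D) (k * f x)%:E = k%:E * \int[m]_(x in D) (f x)%:E)%E.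
Proof.
move=> k0 mf f0; rewrite -ge0_integralZl//; first exact/measurable_EFinP.
Qed.

Lemma Rintegral_add (f g : T -> R) :
  m.-integrable D (fun x => (f x)%:E) -> m.-integrable D (fun x => (g x)%:E) ->
  \int[m]_(x in D) (f x + g x) = \int[m]_(x in D) f x + \int[m]_(x in D) g x.
Proof. by move=> h h'; exact: RintegralD. Qed.

Lemma Rintegral_sub (f g : T -> R) :
  m.-integrable D (fun x => (f x)%:E) -> m.-integrable D (fun x => (g x)%:E) ->
  \int[m]_(x in D) (f x - g x) = \int[m]_(x in D) f x - \int[m]_(x in D) g x.
Proof. by move=> h h'; exact: RintegralB. Qed.

Lemma Rintegral_abs (f : T -> R) : m.-integrable D (fun x => (f x)%:E) ->
  `|\int[m]_(x in D) f x| <= \int[m]_(x in D) `|f x|.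
Proof. by move=> h; exact: le_normr_Rintegral. Qed.

Lemma Rintegral_le (f g : T -> R) :
  m.-integrable D (fun x => (f x)%:E) -> m.-integrable D (fun x => (g x)%:E) ->
  (forall x, D x -> f x <= g x) ->
  \int[m]_(x in D) f x <= \int[m]_(x in D) g x.
Proof. by move=> h h'; exact: le_Rintegral. Qed.

Lemma RintegralE (f : T -> R) : m.-integrable D (fun x => (f x)%:E) ->
  ((\int[m]_(x in D) f x)%:E = \int[m]_(x in D) (f x)%:E)%E.
Proof. by move=> h; rewrite /Rintegral fineK// integrable_fin_num. Qed.

Lemma integrable_cstR (k : R) : (m D < +oo)%E -> m.-integrable D (fun=> k%:E).
Proof.
move=> mDoo; apply/integrableP; split; first exact: measurable_cst.
by rewrite integral_cst// lte_mul_pinfty.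
Qed.

End real_integrable.

(** * Changes of variables *)

Section real_line.
Context {R : realType}.
Notation mu := (@lebesgue_measure R).

(** The inverse is written [x * (x^2)^(-1)] with a real power of a nonnegative number, and real
    powers with fixed exponent are measurable; at 0 both sides are 0. *)
Lemma inv_measurable : measurable_fun setT (GRing.inv : R -> R).
Proof.
have -> : (GRing.inv : R -> R) = (fun x => x * (x ^+ 2) `^ (- 1)).
  apply/funext => x; rewrite powRN powRr1 ?sqr_ge0//.
  have [->|x0] := eqVneq x 0; first by rewrite invr0 mul0r.
  by field.
apply: measurable_funM => //.
apply: (@measurableT_comp _ _ _ _ _ _ (@powR R ^~ (- 1)) _ (fun x : R => x ^+ 2)).
  exact: measurable_powR.
exact: exprn_measurable.
Qed.

Lemma measurable_funV d (T : measurableType d) (f : T -> R) D :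
  measurable_fun D f -> measurable_fun D (fun x => (f x)^-1).
Proof. by move=> mf; apply: measurableT_comp inv_measurable mf. Qed.

(** The image of Lebesgue measure under [x -> a x + b], multiplied by [a], gives every half-open
    interval its length, hence is Lebesgue measure by uniqueness. *)
Lemma ge0_integral_affine (F : R -> \bar R) (a b : R) :
  measurable_fun setT F -> (forall x, 0 <= F x)%E -> 0 < a ->
  (\int[mu]_x F (a * x + b)%R = a^-1%:E * \int[mu]_x F x)%E.
Proof.
move=> mF F0 a0.
pose phi : R -> measurableTypeR R := fun x => a * x + b.
have mphi : measurable_fun setT phi.
  by apply: measurable_funD => //; exact: mulrl_measurable.
have ia0 : 0 <= a by exact: ltW.
pose k : {nonneg R} := NngNum ia0.
pose P0 := fun m : measurable_fun setT phi =>
  (pushforward mu phi : {measure set (measurableTypeR R) -> \bar R}).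
pose P : {measure set (measurableTypeR R) -> \bar R} := P0 mphi mphi.
have E (A : set (measurableTypeR R)) : measurable A -> mu A = mscale k P A.
  apply: (@lebesgue_measure_unique R (mscale k P)) => _ [[u v]] _ <-.
  rewrite /= /mscale /P /= /pushforward.
  have -> : phi @^-1` `]u, v] = `](u - b) / a, (v - b) / a]%classic.
    apply/seteqP; split => x /=; rewrite !in_itv /= /phi ltr_pdivrMr// ler_pdivlMr//;
    by rewrite ltrBlDr lerBrDr (mulrC x).
  rewrite !lebesgue_measure_itv /= !lte_fin ltr_pM2r ?invr_gt0// ltrD2r.
  case: ifPn => _; last by rewrite mule0.
  by rewrite -!EFinB -EFinM; congr EFin; rewrite /=; field; rewrite gt_eqF.
have -> : (\int[mu]_x F x = \int[mscale k P]_x F x)%E.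
  by apply: eq_measure_integral => A mA _; exact: E.
rewrite (ge0_integral_mscale P measurableT k) // /P /=.
rewrite ge0_integral_pushforward //= preimage_setT muleA -EFinM mulVf ?gt_eqF// mul1e.
by [].
Qed.

Lemma ge0_integral_shift (F : R -> \bar R) (b : R) :
  measurable_fun setT F -> (forall x, 0 <= F x)%E ->
  (\int[mu]_x F (x + b)%R = \int[mu]_x F x)%E.
Proof.
move=> mF F0; have := ge0_integral_affine b mF F0 ltr01.
by rewrite invr1 mul1e => <-; apply: eq_integral => x _; rewrite mul1r.
Qed.

Lemma ge0_integral_oppr (F : R -> \bar R) :
  measurable_fun setT F -> (forall x, 0 <= F x)%E ->
  (\int[mu]_x F (- x)%R = \int[mu]_x F x)%E.
Proof.
move=> mF F0.
have -> : (\int[mu]_x F x =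
   \int[pushforward mu (-%R : R -> measurableTypeR R)]_x F x)%E.
  apply: eq_measure_integral => A mA _; exact/esym/lebesgue_measureN.
by rewrite ge0_integral_pushforward //= preimage_setT.
Qed.

Local Notation tau := ((pi : R) *+ 2).
Local Notation I := (@per_itv R).

Lemma tau_gt0 : 0 < tau. Proof. by rewrite mulrn_wgt0// pi_gt0. Qed.

Lemma measurable_per : measurable (I : set (measurableTypeR R)). Proof. exact: measurable_itv. Qed.

Lemma per_mu : mu I = tau%:E.
Proof. by rewrite /per_itv lebesgue_measure_itv /= lte_fin tau_gt0 -EFinB subr0. Qed.

Lemma integral_per_co (F : R -> R) : measurable_fun setT F ->
  (\int[mu]_(x in I) (F x)%:E = \int[mu]_(x in `[0%R, tau[) (F x)%:E)%E.
Proof.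
move=> mF; apply: integral_itv_obnd_cbnd; apply/measurable_EFinP.
exact: measurable_funTS.
Qed.

Lemma ge0_integral_shift_in (F : R -> R) (A : set R) (b : R) :
  measurable A -> measurable_fun setT F -> (forall x, 0 <= F x) ->
  (\int[mu]_(x in A) (F (x + b)%R)%:E =
   \int[mu]_(x in [set y : R | A (y - b)%R]) (F x)%:E)%E.
Proof.
move=> mA mF F0.
rewrite [LHS]integral_mkcond [RHS]integral_mkcond.
pose G : R -> \bar R := (fun x => (F x)%:E) \_ [set y : R | A (y - b)%R].
have mAb : measurable [set y : R | A (y - b)%R].
  rewrite -[X in measurable X]setTI.
  apply: (_ : measurable_fun setT (fun y : R => y - b)) => //.
  exact: measurable_funB.
rewrite -[RHS](@ge0_integral_shift G b).
- apply: eq_integral => x _; rewrite /G !patchE; congr (if _ then _ else _).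
  by apply/idP/idP; rewrite !inE /= addrK.
- apply/(measurable_restrictT _ _).1 => //.
  by apply/measurable_EFinP; exact: measurable_funTS.
- by move=> x; apply: erestrict_ge0 => y _; rewrite lee_fin.
Qed.

End real_line.

Lemma integral_maxr d (T : measurableType d) (R : realType)
    (m : {measure set T -> \bar R}) (D : set T) (f : T -> R) :
  (\int[m]_(x in D) (f x)%:E = \int[m]_(x in D) (Num.max (f x) 0)%:E -
     \int[m]_(x in D) (Num.max (- f x) 0)%:E)%E.
Proof.
rewrite integralE; congr (_ - _)%E.
  by apply: eq_integral => y _; rewrite funeposE -EFin_max.
by apply: eq_integral => y _; rewrite funenegE -EFin_max.
Qed.

Lemma max0_measurable d (T : measurableType d) (R : realType) (f : T -> R) :
  measurable_fun setT f -> measurable_fun setT (fun x => Num.max (f x) 0).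
Proof. by move=> mf; exact: measurable_maxr. Qed.

(** * Integrals over a period and unfolding of lattice sums *)

Section periodic_integrals.
Context {R : realType}.
Notation mu := (@lebesgue_measure R).
Local Notation tau := ((pi : R) *+ 2).
Local Notation I := (@per_itv R).

Lemma measurable_shift_set (A : set R) (b : R) : measurable A ->
  measurable [set y : R | A (y - b)].
Proof.
move=> mA; rewrite -[X in measurable X]setTI.
apply: (_ : measurable_fun setT (fun y : R => y - b)) => //.
exact: measurable_funB.
Qed.

Lemma periodicz (F : R -> R) : periodic F tau ->
  forall (n : int) x, F (x + tau *~ n) = F x.
Proof.
move=> pF [n|n] x; first by rewrite -pmulrn (periodicn pF).
by rewrite NegzE mulrNz -pmulrn -[in RHS](subrK (tau *+ n.+1) x) (periodicn pF).
Qed.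

(** The shifted period [[h, tau + h[] is cut at [tau] and the part beyond [tau] is moved back by one
    period. Half-open intervals are used because their translates fit together without gaps. *)
Let shift01 (F : R -> R) (h : R) : measurable_fun setT F -> (forall x, 0 <= F x) ->
  periodic F tau -> 0 <= h < tau ->
  (\int[mu]_(x in I) (F (x + h)%R)%:E = \int[mu]_(x in I) (F x)%:E)%E.
Proof.
move=> mF F0 pF /andP[h0 ht].
have mE A : measurable_fun A (fun x => (F x)%:E).
  by apply/measurable_EFinP; exact: measurable_funTS.
have mFh : measurable_fun setT (fun x : R => F (x + h)).
  apply: (measurableT_comp mF); exact: measurable_funD.
rewrite (integral_per_co mF) (integral_per_co mFh).
rewrite ge0_integral_shift_in//.
have -> : [set y : R | `[0, tau[%classic (y - h)] = `[h, tau[%classic `|` `[tau, tau + h[%classic.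
  apply/seteqP; split => x /=; rewrite !in_itv /=.
    move=> /andP[h1 h2]; case: (ltP x tau) => h3; [left|right]; lra.
  by move=> [] /andP[h1 h2]; lra.
have -> : `[0, tau[%classic = `[0, h[%classic `|` `[h, tau[%classic :> set R.
  apply/seteqP; split => x /=; rewrite !in_itv /=.
    move=> /andP[h1 h2]; case: (ltP x h) => h3; [left|right]; lra.
  by move=> [] /andP[h1 h2]; lra.
rewrite ge0_integral_setU //=; last 3 first.
- exact: mE.
- by move=> x _; rewrite lee_fin.
- apply/disj_setPS => x /= []; rewrite !in_itv /= => /andP[a1 a2] /andP[a3 a4].
  by move: (lt_le_trans a2 a3); rewrite ltxx.
rewrite ge0_integral_setU //=; last 3 first.
- exact: mE.
- by move=> x _; rewrite lee_fin.
- apply/disj_setPS => x /= []; rewrite !in_itv /= => /andP[a1 a2] /andP[a3 a4].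
  by move: (lt_le_trans a2 a3); rewrite ltxx.
rewrite addeC; congr (_ + _)%E.
have -> : `[tau, tau + h[%classic = [set y : R | `[0, h[%classic (y - tau)].
  by apply/seteqP; split => x /=; rewrite !in_itv /= => /andP[h1 h2]; apply/andP; split; lra.
rewrite -ge0_integral_shift_in//.
by apply: eq_integral => x _; rewrite pF.
Qed.

Lemma ge0_per_shift (F : R -> R) (h : R) : measurable_fun setT F -> (forall x, 0 <= F x) ->
  periodic F tau ->
  (\int[mu]_(x in I) (F (x + h)%R)%:E = \int[mu]_(x in I) (F x)%:E)%E.
Proof.
move=> mF F0 pF; have t0 := @tau_gt0 R.
pose n := Num.floor (h / tau); pose h0 := h - tau *~ n.
rewrite -(@shift01 F h0) //.
  by apply: eq_integral => x _; rewrite /h0 -[in RHS](periodicz pF n) -addrA subrK.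
have := Num.Theory.floor_itv (h / tau); rewrite -/n => /andP[a b].
rewrite /h0 -mulrzr; move: a b; rewrite ler_pdivlMr// ltr_pdivrMr// intrD.
by rewrite mulrC => a b; apply/andP; split; lra.
Qed.

Lemma per_shift (f : R -> R) (h : R) : measurable_fun setT f -> periodic f tau ->
  (\int[mu]_(x in I) (f (x + h)%R)%:E = \int[mu]_(x in I) (f x)%:E)%E.
Proof.
move=> mf pf; rewrite [LHS]integral_maxr [RHS]integral_maxr; congr (_ - _)%E.
  apply: (ge0_per_shift (F := fun x => Num.max (f x) 0)).
  - exact: max0_measurable.
  - by move=> x; rewrite le_max lexx orbT.
  - by move=> x; rewrite pf.
apply: (ge0_per_shift (F := fun x => Num.max (- f x) 0)).
- by apply: max0_measurable; exact: measurableT_comp.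
- by move=> x; rewrite le_max lexx orbT.
- by move=> x; rewrite pf.
Qed.

Lemma Rper_shift (f : R -> R) (h : R) : measurable_fun setT f -> periodic f tau ->
  \int[mu]_(x in I) f (x + h) = \int[mu]_(x in I) f x.
Proof. by move=> mf pf; rewrite /Rintegral per_shift. Qed.

(** Enumerates the integers by the parity of the index, so that a sum over all integers becomes a
    series, which may be exchanged with an integral of nonnegative terms. *)
Definition int_of_nat (k : nat) : int := if odd k then Negz k./2 else Posz k./2.

Lemma int_of_nat_bij : set_bij [set: nat] [set: int] int_of_nat.
Proof.
have K : cancel (fun z : int => match z with Posz n => n.*2 | Negz n => n.*2.+1 end) int_of_nat.
  move=> [n|n]; rewrite /int_of_nat /= odd_double /= ?doubleK //.
  by rewrite uphalf_double.
have K' : cancel int_of_nat (fun z : int => match z with Posz n => n.*2 | Negz n => n.*2.+1 end).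
  move=> k; rewrite /int_of_nat; case: ifP => ok; rewrite -[RHS]odd_double_half ok ?add1n ?add0n//.
split => //.
- by move=> x y _ _ /(can_inj K').
- by move=> z _; exists (match z with Posz n => n.*2 | Negz n => n.*2.+1 end) => //; exact: K.
Qed.

Lemma ge0_integral_tile (G : R -> R) : measurable_fun setT G -> (forall x, 0 <= G x) ->
  (\int[mu]_x (G x)%:E =
   \sum_(k <oo) \int[mu]_(y in I) (G (y + tau *~ int_of_nat k)%R)%:E)%E.
Proof.
move=> mG G0; have t0 := @tau_gt0 R.
pose F (k : nat) : set R := [set y : R | `[0, tau[%classic (y - tau *~ int_of_nat k)].
have FE k : F k = `[tau *~ int_of_nat k, tau *~ int_of_nat k + tau[%classic.
  rewrite /F; move: (tau *~ _) => c.
  by apply/seteqP; split => x /=; rewrite !in_itv /= => /andP[h1 h2]; apply/andP; split; lra.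
have [_ einj esur] := int_of_nat_bij.
have UF : \bigcup_k F k = setT.
  apply/seteqP; split => // x _.
  have := Num.Theory.floor_itv (x / tau); move=> /andP[a b].
  have [k _ kE] := esur (Num.floor (x / tau)) Logic.I.
  exists k => //; rewrite /F /= kE in_itv /= -mulrzr.
  move: a b; rewrite ler_pdivlMr// ltr_pdivrMr// intrD.
  by rewrite mulrC => a b; apply/andP; split; lra.
have mF k : measurable (F k) by rewrite FE; exact: measurable_itv.
have tF : trivIset setT F.
  apply/trivIsetP => i j _ _ ij; apply/seteqP; split => // x [].
  rewrite !FE /= !in_itv /= => /andP[a1 a2] /andP[b1 b2].
  case/eqP: ij; apply: einj; rewrite ?inE//.
  apply/eqP; rewrite eq_le -[(_ <= int_of_nat j)%O]ltzD1 -[(_ <= int_of_nat i)%O]ltzD1.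
  move: a1 a2 b1 b2; rewrite -!(mulrzr tau) => a1 a2 b1 b2.
  apply/andP; split; rewrite -(ltr_int R) intrD -(ltr_pM2l t0) mulrDr mulr1; lra.
rewrite -[in LHS]UF ge0_integral_bigcup //; last first.
  by move=> x _; rewrite lee_fin.
  by rewrite UF; apply/measurable_EFinP.
apply: eq_eseriesr => k _.
rewrite (@integral_per_co R (fun y => G (y + tau *~ int_of_nat k))).
  by rewrite ge0_integral_shift_in.
apply: (measurableT_comp mG); exact: measurable_funD.
Qed.

(** After the exchange of sum and integral, periodicity of [F] moves each shift of [K] onto the
    domain of integration, and the translated periods reassemble the line. The kernel is evaluated
    at [- h] because [x - y = - h] for [y = x + h]. *)
Lemma unfold_ge0 (F K : R -> R) (x : R) : measurable_fun setT F -> (forall y, 0 <= F y) ->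
  periodic F tau -> measurable_fun setT K -> (forall y, 0 <= K y) ->
  (\int[mu]_(y in I) ((F y)%:E * \esum_(n in [set: int]) (K (x - y - tau *~ n)%R)%:E) =
   \int[mu]_h (F (x + h) * K (- h))%:E)%E.
Proof.
move=> mF F0 pF mK K0.
have mKn (y0 : R) (n : int) : measurable_fun setT (fun y : R => K (y0 - y - tau *~ n)).
  apply: (measurableT_comp mK); apply: measurable_funB => //; exact: measurable_funB.
transitivity (\int[mu]_(y in I) \sum_(k <oo) (F y * K (x - y - tau *~ int_of_nat k)%R)%:E)%E.
  apply: eq_integral => y _.
  rewrite (@reindex_esum R _ _ _ _ _ _ int_of_nat_bij) -nneseries_esumT; last by move=> n; rewrite lee_fin.
  rewrite -nneseriesZl; first by apply: eq_eseriesr => k _; rewrite EFinM.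
  by move=> *; rewrite lee_fin.
rewrite integral_nneseries; last 3 first.
- exact: measurable_per.
- move=> n; apply/measurable_EFinP; apply: measurable_funTS; apply: measurable_funM => //; exact: mKn.
- by move=> n y _; rewrite lee_fin mulr_ge0.
pose G y := F y * K (x - y).
have mG : measurable_fun setT G.
  apply: measurable_funM => //; apply: (measurableT_comp mK); exact: measurable_funB.
transitivity (\int[mu]_y (G y)%:E)%E.
  rewrite ge0_integral_tile//; last by move=> y; rewrite mulr_ge0.
  apply: eq_eseriesr => k _; apply: eq_integral => y _.
  by rewrite /G periodicz// opprD addrA.
rewrite -(@ge0_integral_shift _ (fun y => (G y)%:E) x).
- by apply: eq_integral => h _; rewrite /G addrC opprD addNKr.
- exact/measurable_EFinP.
- by move=> y; rewrite lee_fin mulr_ge0.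
Qed.

End periodic_integrals.

(** * Power and exponential integrals *)

Section power_integrals.
Context {R : realType}.
Notation mu := (@lebesgue_measure R).

Lemma is_derive_powR (a x : R) : 0 < x -> is_derive x 1 (@powR R ^~ a) (a * x `^ (a - 1)).
Proof.
move=> x0; have xin : x \in `]0, +oo[ by rewrite in_itv /= x0.
apply: DeriveDef; first exact: derivable_powR.
by rewrite -derive1E powR_derive1.
Qed.

(** On compact intervals inside []0, +oo[] the integral is a difference of two values of [F], hence
    at most [2 M]; monotone convergence along an exhaustion preserves the bound. Only boundedness of
    the primitive is required, so its limits at 0 and at infinity never have to be computed. *)
Lemma ge0_integral_primitive (f F : R -> R) (M : R) :
  (forall x : R, 0 < x -> is_derive x 1 F (f x)) ->
  (forall x : R, 0 < x -> 0 <= f x) ->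
  (forall x : R, 0 < x -> {for x, continuous f}) ->
  (forall x : R, 0 < x -> `|F x| <= M) ->
  (\int[mu]_(x in `]0%R, +oo[) (f x)%:E <= (2 * M)%:E)%E.
Proof.
move=> dF f0 cf FM.
pose E (n : nat) : set R := `[n.+1%:R^-1, n.+2%:R]%classic.
have E0 n x : E n x -> 0 < x.
  by rewrite /E /= in_itv /= => /andP[+ _]; apply: lt_le_trans; rewrite invr_gt0.
have UE : \bigcup_n E n = (`]0, +oo[%classic : set R).
  apply/seteqP; split => x /=.
    by move=> [n _ /E0 x0]; rewrite in_itv /= x0.
  rewrite in_itv /= andbT => x0.
  (* The sum serves both ends at once: the index exceeds [x^-1] and also [x], up to one unit. *)
  pose n := Num.trunc (x^-1 + x); exists n => //.
  have xx : 0 <= x^-1 + x by rewrite addr_ge0 ?invr_ge0 ?ltW.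
  have := truncnS_gt (x^-1 + x); rewrite -/n => h.
  have ix0 : 0 < x^-1 by rewrite invr_gt0.
  rewrite /E /= in_itv /=; apply/andP; split.
    rewrite -[leRHS]invrK lef_pV2 ?posrE ?ltr0n ?invr_gt0//.
    apply: ltW; apply: le_lt_trans h; lra.
  apply: ltW; apply: (@le_lt_trans _ _ (x^-1 + x)); first lra.
  by apply: lt_trans h _; rewrite ltr_nat.
have mf : measurable_fun (`]0, +oo[%classic : set R) f.
  apply: open_continuous_measurable_fun => // x; rewrite inE /= in_itv /= andbT.
  exact: cf.
rewrite -UE.
have /cvg_lim <- // : (\int[mu]_(x in E i) (f x)%:E)%E @[i --> \oo] -->
    (\int[mu]_(x in \bigcup_n E n) (f x)%:E)%E.
  apply: ge0_nondecreasing_set_cvg_integral.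
  - move=> i j ij; rewrite subsetEset => x; rewrite /E /= !in_itv /= => /andP[h1 h2].
    apply/andP; split.
      by apply: le_trans h1; rewrite lef_pV2 ?posrE ?ltr0n// ler_nat.
    by apply: le_trans h2 _; rewrite ler_nat.
  - by move=> i; exact: measurable_itv.
  - move=> i; apply/measurable_EFinP; apply: measurable_funS mf => // x /E0 x0.
    by rewrite /= in_itv /= x0.
  - by move=> i x /E0 x0; rewrite lee_fin f0.
apply: lime_le.
  apply: ereal_nondecreasing_is_cvgn.
  move=> i j ij; apply: ge0_subset_integral => //=.
  - exact: measurable_itv.
  - exact: measurable_itv.
  - apply/measurable_EFinP; apply: measurable_funS mf => // x /E0 x0.
    by rewrite /= in_itv /= x0.
  - by move=> x /E0 x0; rewrite lee_fin f0.
  - move=> x; rewrite /E /= !in_itv /= => /andP[h1 h2].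
    apply/andP; split.
      by apply: le_trans h1; rewrite lef_pV2 ?posrE ?ltr0n// ler_nat.
    by apply: le_trans h2 _; rewrite ler_nat.
apply: nearW => n.
have n1 : (n.+1%:R : R)^-1 < n.+2%:R.
  apply: (@le_lt_trans _ _ 1); last by rewrite ltr1n.
  by rewrite invf_le1 ?ltr0n// ler1n.
have n0 : 0 < (n.+1%:R : R)^-1 by rewrite invr_gt0.
have dFx x : 0 < x -> derivable F x 1 by move=> /dF [].
have cF x : 0 < x -> {for x, continuous F}.
  by move=> x0; apply/differentiable_continuous/derivable1_diffP/dFx.
rewrite (@continuous_FTC2 _ f F)//.
- rewrite -EFinB lee_fin (le_trans (ler_norm _))// (le_trans (ler_normB _ _))//.
  by rewrite mulr2n mulrDl mul1r lerD// FM// ltr0n.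
- apply: continuous_in_subspaceT => x; rewrite inE => /E0; exact: cf.
- split.
  + by move=> x; rewrite in_itv /= => /andP[h1 _]; apply: dFx; exact: lt_trans h1.
  + by apply: cvg_at_right_filter; apply: cF.
  + by apply: cvg_at_left_filter; apply: cF; rewrite ltr0n.
- move=> x; rewrite in_itv /= => /andP[h1 _].
  have [|_ <-] := dF x; first exact: lt_trans h1.
  by rewrite derive1E.
Qed.

(** Up to the factor [b], this is the derivative of the bounded function [(t / (1 + t))^b]. It
    behaves like [t^(b-1)] at 0 and like [t^(-2)] at infinity, and it is the basic integrable
    majorant near 0. *)
Let fa (b t : R) := (t / (1 + t)) `^ (b - 1) / (1 + t) ^+ 2.

Lemma cont_for_is_derive (g : R -> R) (x l : R) : is_derive x 1 g l -> {for x, continuous g}.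
Proof. by move=> [h _]; apply/differentiable_continuous/derivable1_diffP. Qed.

Let dq (t : R) : 0 < t -> is_derive t 1 (fun t : R => t / (1 + t)) ((1 + t) ^- 2).
Proof.
move=> t0; have h : 1 + t != 0 by rewrite gt_eqF//; lra.
have h1 : is_derive t 1 (fun t : R => 1 + t) 1.
  have -> : (fun t : R => 1 + t) = cst 1 \+ id by [].
  by apply: is_derive_eq; rewrite add0r.
have h2 : is_derive t 1 (fun t : R => (1 + t)^-1) (- (1 + t) ^- 2 *: 1) by exact: is_deriveV.
have h3 : is_derive t 1 (id * (fun t : R => (1 + t)^-1)) ((t *: (- (1 + t) ^- 2 *: 1) + (1 + t)^-1 *: 1)).
  exact: is_deriveM.
apply: is_derive_eq h3 _; rewrite /GRing.scale /= !mulr1; field.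
exact: h.
Qed.

Lemma fa_int (b : R) : 0 < b ->
  (\int[mu]_(t in `]0%R, +oo[) (fa b t)%:E < +oo)%E.
Proof.
move=> b0; apply: (@le_lt_trans _ _ (2 * b^-1)%:E); last exact: ltry.
apply: (@ge0_integral_primitive _ (fun t => b^-1 * (t / (1 + t)) `^ b)).
- move=> x x0.
  have q0 : 0 < x / (1 + x) by rewrite divr_gt0//; lra.
  have h := @is_derive1_comp R (@powR R ^~ b) (fun t => t / (1 + t)) x _ _ (is_derive_powR b q0) (dq x0).
  have h' : is_derive x 1 (fun t : R => b^-1 * (t / (1 + t)) `^ b)
    (b^-1 * (b * (x / (1 + x)) `^ (b - 1) / (1 + x) ^+ 2)) := is_deriveZ b^-1 h.
  apply: (is_derive_eq h'); rewrite /fa; field; apply/andP; split; rewrite gt_eqF//; lra.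
- by move=> x x0; rewrite /fa divr_ge0 ?powR_ge0 ?sqr_ge0.
- move=> x x0; rewrite /fa.
  have q0 : 0 < x / (1 + x) by rewrite divr_gt0//; lra.
  have h := @is_derive1_comp R (@powR R ^~ (b - 1)) (fun t => t / (1 + t)) x _ _ (is_derive_powR (b - 1) q0) (dq x0).
  apply: (@cvgM _ _ _ _ (fun t => (t / (1 + t)) `^ (b - 1)) (fun t => ((1 + t) ^+ 2)^-1)).
    exact: (cont_for_is_derive h).
  apply: cvgV; first by rewrite expf_neq0// gt_eqF//; lra.
  apply: (@continuous_comp _ _ _ (fun t : R => 1 + t) (fun t : R => t ^+ 2)).
    by apply: cvgD; [exact: cvg_cst|exact: cvg_id].
  exact: exprn_continuous.
- move=> x x0; rewrite ger0_norm; last by rewrite mulr_ge0 ?powR_ge0// invr_ge0 ltW.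
  rewrite -[leRHS]mulr1; apply: ler_wpM2l; first by rewrite invr_ge0 (ltW b0).
  have q0 : 0 < x / (1 + x) by rewrite divr_gt0//; lra.
  rewrite -[leRHS](powRr0 (x / (1 + x))); apply: ger_powR; last exact: ltW.
  by rewrite q0 ler_pdivrMr//; lra.
Qed.

Let powE (b t : R) : 0 < t -> t `^ (b - 1) = fa b t * (1 + t) `^ (b + 1).
Proof.
move=> t0; have h : 0 < 1 + t by lra.
rewrite /fa powRM ?invr_ge0 ?ltW//.
rewrite -powR_inv1 ?ltW// -powRrM mulN1r powRN.
have -> : (1 + t) `^ (b + 1) = (1 + t) `^ (b - 1) * (1 + t) ^+ 2.
  rewrite -powR_mulrn ?ltW// -powRD; first by congr (_ `^ _); lra.
  by rewrite (gt_eqF h) implybT.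
by field; rewrite !gt_eqF// powR_gt0.
Qed.

(** Take [a]-th roots: [1 + t <= (1 + a/c) (1 + c t / a) <= (1 + a/c) e^(c t / a)]. *)
Lemma poly_expR_bound (a c : R) : 0 < a -> 0 < c ->
  exists2 C : R, 0 < C & forall t, 0 <= t -> (1 + t) `^ a * expR (- (c * t)) <= C.
Proof.
move=> a0 c0; have d0 : 0 < c / a by rewrite divr_gt0.
pose K := 1 + a / c; have K0 : 0 < K by rewrite /K addr_gt0// divr_gt0.
exists (K `^ a); first exact: powR_gt0.
move=> t t0; rewrite expRN ler_pdivrMr ?expR_gt0//.
have -> : expR (c * t) = expR (c / a * t) `^ a.
  by rewrite -expRM; congr expR; field; rewrite gt_eqF.
rewrite -powRM; [|exact: ltW|exact: expR_ge0].
apply: ge0_ler_powR; rewrite ?nnegrE; first exact: ltW.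
- by rewrite addr_ge0.
- by rewrite mulr_ge0 ?expR_ge0// ltW.
apply: (@le_trans _ _ (K * (1 + c / a * t))); last first.
  by rewrite ler_wpM2l ?expR_ge1Dx// ltW.
have -> : K * (1 + c / a * t) = 1 + a / c + c / a * t + t.
  by rewrite /K; field; rewrite !gt_eqF.
have : 0 <= a / c by rewrite divr_ge0// ltW.
have : 0 <= c / a * t by rewrite mulr_ge0// ltW.
lra.
Qed.

Lemma measurable_powRl d (T : measurableType d) (D : set T) (f : T -> R) a :
  measurable_fun D f -> measurable_fun D (fun x => f x `^ a).
Proof. by move=> mf; exact: (@measurableT_comp _ _ _ _ _ _ (@powR R ^~ a) D f (measurable_powR a) mf). Qed.

Lemma measurable_expR_comp d (T : measurableType d) (D : set T) (f : T -> R) :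
  measurable_fun D f -> measurable_fun D (fun x => expR (f x)).
Proof. by move=> mf; exact: (@measurableT_comp _ _ _ _ _ _ expR D f (@measurable_expR R) mf). Qed.

(** By [powE] the power is [fa b t * (1 + t)^(b+1)], and the exponential absorbs the polynomial
    factor. *)
Lemma gamma_integrable (b c : R) : 0 < b -> 0 < c ->
  mu.-integrable `]0, +oo[ (fun t => (t `^ (b - 1) * expR (- (c * t)))%:E).
Proof.
move=> b0 c0; have [C C0 hC] := @poly_expR_bound (b + 1) c (ltr_wpDr ler01 b0) c0.
have mfa : measurable_fun setT (fa b).
  apply: measurable_funM.
    apply: measurable_powRl; apply: measurable_funM => //; apply: measurable_funV.
    exact: measurable_funD.
  by apply: measurable_funV; apply: measurable_funX; exact: measurable_funD.
have fa0 t : 0 <= fa b t by rewrite /fa divr_ge0 ?powR_ge0 ?sqr_ge0.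
have ifa : mu.-integrable `]0, +oo[ (fun t => (C * fa b t)%:E).
  apply: integrable_cmul => //; apply: integrable_ge0 => //.
    exact: measurable_funTS.
  exact: fa_int.
apply: integrable_dom ifa => //.
  apply: measurable_funTS; apply: measurable_funM.
    exact: measurable_powRl.
  by apply: measurable_expR_comp; apply: measurableT_comp => //; exact: measurable_funM.
move=> t /=; rewrite in_itv /= andbT => t0.
rewrite ger0_norm ?mulr_ge0 ?powR_ge0 ?expR_ge0//.
by rewrite powE// -mulrA mulrC; apply: ler_wpM2r => //; apply: hC; exact: ltW.
Qed.

Lemma tail_int (b : R) : 0 < b ->
  (\int[mu]_(t in `]0%R, +oo[) ((1 + t) `^ (- (1 + b)))%:E < +oo)%E.
Proof.
move=> b0; apply: (@le_lt_trans _ _ (2 * b^-1)%:E); last exact: ltry.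
have d1 (a x : R) : 0 < x -> is_derive x 1 (fun t : R => (1 + t) `^ a) (a * (1 + x) `^ (a - 1)).
  move=> x0; have h0 : 0 < 1 + x by lra.
  have h1 : is_derive x 1 (fun t : R => 1 + t) 1.
    have -> : (fun t : R => 1 + t) = cst 1 \+ id by [].
    by apply: is_derive_eq; rewrite add0r.
  have := @is_derive1_comp R (@powR R ^~ a) (fun t => 1 + t) x _ _ (is_derive_powR a h0) h1.
  by move=> h; apply: (is_derive_eq h); rewrite mulr1.
apply: (@ge0_integral_primitive _ (fun t => (- b^-1) * (1 + t) `^ (- b))).
- move=> x x0.
  have h' : is_derive x 1 (fun t : R => (- b^-1) * (1 + t) `^ (- b))
    ((- b^-1) * (- b * (1 + x) `^ (- b - 1))) := is_deriveZ (- b^-1) (d1 (- b) x x0).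
  apply: (is_derive_eq h'); rewrite (_ : - b - 1 = - (1 + b)); last by lra.
  by field; rewrite gt_eqF.
- by move=> x x0; exact: powR_ge0.
- by move=> x x0; apply: cont_for_is_derive (d1 _ _ x0).
- move=> x x0; rewrite normrM normrN.
  have ib : 0 <= b^-1 by rewrite invr_ge0 (ltW b0).
  rewrite (ger0_norm ib) (ger0_norm (powR_ge0 _ _)).
  rewrite -[leRHS]mulr1; apply: ler_wpM2l => //.
  by rewrite -[leRHS](powRr0 (1 + x)); apply: ler_powR; lra.
Qed.

Lemma even_integral_lty (F : R -> R) : measurable_fun setT F -> (forall x, 0 <= F x) ->
  (forall x, F (- x) = F x) -> (\int[mu]_(x in `]0%R, +oo[) (F x)%:E < +oo)%E ->
  (\int[mu]_x (F x)%:E < +oo)%E.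
Proof.
move=> mF F0 eF hF.
pose G : R -> R := fun x => F x * \1_(`[0, +oo[%classic : set R) x.
have mG : measurable_fun setT G.
  by apply: measurable_funM => //; exact: measurable_indic.
have G0 x : 0 <= G x by rewrite mulr_ge0//; exact: indic_ge0.
have GF : (\int[mu]_x (G x)%:E = \int[mu]_(x in `]0%R, +oo[) (F x)%:E)%E.
  rewrite integral_itv_obnd_cbnd; last by apply/measurable_EFinP; exact: measurable_funTS.
  rewrite [RHS]integral_mkcond; apply: eq_integral => x _.
  by rewrite /G patchE indicE; case: ifPn => _; rewrite ?mulr1 ?mulr0.
have mGN : measurable_fun setT (fun x : R => G (- x)) by exact: (measurableT_comp mG).
apply: (@le_lt_trans _ _ (\int[mu]_x ((G x)%:E + (G (- x))%:E))%E).
  apply: ge0_le_integral => //.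
  - by move=> x _; rewrite lee_fin.
  - exact/measurable_EFinP.
  - by apply: emeasurable_funD; exact/measurable_EFinP.
  - move=> x _; rewrite -EFinD lee_fin.
    have Gp y : 0 <= y -> G y = F y.
      by move=> y0; rewrite /G indicE mem_set ?mulr1//= in_itv /= y0.
    case: (lerP 0 x) => x0; first by rewrite Gp// lerDl.
    by rewrite (Gp (- x)) ?oppr_ge0 ?(ltW x0)// eF lerDr.
rewrite ge0_integralD //; last 4 first.
- by move=> x _; rewrite lee_fin.
- exact/measurable_EFinP.
- by move=> x _; rewrite lee_fin.
- exact/measurable_EFinP.
rewrite (@ge0_integral_oppr _ (fun x => (G x)%:E)); last 2 first.
- exact/measurable_EFinP.
- by move=> x; rewrite lee_fin.
by rewrite GF lte_add_pinfty.
Qed.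

Definition kern (s h : R) : R := (`|h| `^ (1 + 2 * s))^-1.

Lemma kern_ge0 s h : 0 <= kern s h. Proof. by rewrite invr_ge0 powR_ge0. Qed.

Lemma kernN s h : kern s (- h) = kern s h. Proof. by rewrite /kern normrN. Qed.

Lemma measurable_kern s : measurable_fun setT (kern s).
Proof.
by apply: measurable_funV; apply: measurable_powRl; exact: normr_measurable.
Qed.

Lemma kern_min_lty s : 0 < s < 1 ->
  (\int[mu]_h (Num.min 1 (h ^+ 2) * kern s h)%:E < +oo)%E.
Proof.
move=> /andP[s0 s1].
have min0 (x : R) : 0 <= Num.min 1 (x ^+ 2) by rewrite le_min ler01 sqr_ge0.
have mmin : measurable_fun setT (fun h : R => Num.min 1 (h ^+ 2) * kern s h).
  apply: measurable_funM; last exact: measurable_kern.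
  by apply: measurable_minr => //; exact: exprn_measurable.
apply: even_integral_lty => //.
- by move=> x; rewrite mulr_ge0 ?kern_ge0.
- by move=> x; rewrite sqrrN kernN.
have b0 : 0 < 2 - 2 * s by lra.
have b1 : 0 < 2 * s by lra.
have mfa b : measurable_fun setT (fa b).
  apply: measurable_funM.
    apply: measurable_powRl; apply: measurable_funM => //; apply: measurable_funV.
    exact: measurable_funD.
  by apply: measurable_funV; apply: measurable_funX; exact: measurable_funD.
have fa0 b t : 0 <= fa b t by rewrite /fa divr_ge0 ?powR_ge0 ?sqr_ge0.
have mt : measurable_fun setT (fun t : R => (1 + t) `^ (- (1 + 2 * s))).
  by apply: measurable_powRl; exact: measurable_funD.
(* [C1] bounds [(1 + t)^(b+1)] for [t <= 1] with [b = 2 - 2s], the exponent left when [h^2] meets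
   the kernel; [C2] comes from [1 + t <= 2 t] for [t >= 1]. *)
pose C1 := (2 : R) `^ (2 - 2 * s + 1).
pose C2 := (2 : R) `^ (1 + 2 * s).
have mC1 : measurable_fun setT (fun t : R => C1 * fa (2 - 2 * s) t).
  by apply: measurable_funM => //; exact: mfa.
have mC2 : measurable_fun setT (fun t : R => C2 * (1 + t) `^ (- (1 + 2 * s))).
  exact: measurable_funM.
apply: (@le_lt_trans _ _ (\int[mu]_(t in `]0%R, +oo[)
   ((C1 * fa (2 - 2 * s) t)%:E + (C2 * (1 + t) `^ (- (1 + 2 * s)))%:E))%E).
  apply: ge0_le_integral => //.
  - by move=> x _; rewrite lee_fin mulr_ge0 ?kern_ge0.
  - by apply/measurable_EFinP; exact: measurable_funTS.
  - by apply: measurable_funTS; apply: emeasurable_funD; exact/measurable_EFinP.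
  - move=> t /=; rewrite in_itv /= andbT => t0; rewrite -EFinD lee_fin /kern gtr0_norm//.
    have e0 : 0 <= C1 * fa (2 - 2 * s) t by rewrite mulr_ge0 ?powR_ge0.
    have e1 : 0 <= C2 * (1 + t) `^ (- (1 + 2 * s)) by rewrite mulr_ge0 ?powR_ge0.
    have [t1|t1] := leP t 1.
      apply: (@le_trans _ _ (C1 * fa (2 - 2 * s) t)); last by rewrite lerDl.
      apply: (@le_trans _ _ (t `^ (2 - 2 * s - 1))).
        rewrite -powRN; apply: (@le_trans _ _ (t ^+ 2 * t `^ (- (1 + 2 * s)))).
          by apply: ler_wpM2r; [exact: powR_ge0|rewrite ge_min lexx orbT].
        rewrite -powR_mulrn ?(ltW t0)// -powRD ?(gt_eqF t0) ?implybT//.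
        by rewrite le_eqVlt; apply/orP; left; apply/eqP; congr (_ `^ _); lra.
      rewrite powE// mulrC; apply: ler_wpM2r => //.
      by apply: ge0_ler_powR; rewrite ?nnegrE; lra.
    apply: (@le_trans _ _ (C2 * (1 + t) `^ (- (1 + 2 * s)))); last by rewrite lerDr.
    apply: (@le_trans _ _ (t `^ (1 + 2 * s))^-1).
      rewrite -[leRHS]mul1r; apply: ler_wpM2r; first by rewrite invr_ge0 powR_ge0.
      by rewrite ge_min lexx.
    rewrite powRN ler_pdivlMr ?powR_gt0; last by lra.
    rewrite mulrC ler_pdivrMr ?powR_gt0// /C2 -powRM; [|lra|lra].
      by apply: ge0_ler_powR; rewrite ?nnegrE; lra.
    by [].
rewrite ge0_integralD //=; last 4 first.
- by move=> x _; rewrite lee_fin mulr_ge0 ?powR_ge0.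
- by apply/measurable_EFinP; apply: measurable_funTS.
- by move=> x _; rewrite lee_fin mulr_ge0 ?powR_ge0.
- by apply/measurable_EFinP; apply: measurable_funTS.
have c1 : 0 <= C1 by exact: powR_ge0.
have c2 : 0 <= C2 by exact: powR_ge0.
under eq_integral do rewrite EFinM.
under [X in (_ + X < _)%E]eq_integral do rewrite EFinM.
rewrite !ge0_integralZl //; last 4 first.
- by apply/measurable_EFinP; apply: measurable_funTS; first [exact: mfa|exact: mt].
- by move=> x _; rewrite lee_fin ?powR_ge0 ?fa0.
- by apply/measurable_EFinP; apply: measurable_funTS; first [exact: mfa|exact: mt].
- by move=> x _; rewrite lee_fin ?powR_ge0 ?fa0.
apply: lte_add_pinfty; apply: lte_mul_pinfty => //; first exact: fa_int.
exact: tail_int.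
Qed.

End power_integrals.

(** * The Poisson kernel of the circle *)

Section poisson_kernel.
Context {R : realType}.
Notation mu := (@lebesgue_measure R).
Local Notation tau := ((pi : R) *+ 2).
Local Notation I := (@per_itv R).

Lemma per_fin : (mu I < +oo)%E. Proof. by rewrite per_mu ltry. Qed.

Lemma per_bounded_integrable (f : R -> R) (M : R) : measurable_fun setT f ->
  (forall x, I x -> `|f x| <= M) -> mu.-integrable I (fun x => (f x)%:E).
Proof.
move=> mf fM; apply: (@integrable_dom _ _ _ mu I (@measurable_per R) (fun=> M)) => //.
  exact: measurable_funTS.
by apply: integrable_cstR; [exact: measurable_per|exact: per_fin].
Qed.

Lemma integrable_bmul (D : set R) (f w : R -> R) (M : R) : measurable D ->
  measurable_fun setT f -> (forall x, `|f x| <= M) ->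
  mu.-integrable D (fun x => (w x)%:E) -> mu.-integrable D (fun x => (f x * w x)%:E).
Proof.
move=> mD mf fM iw.
apply: (@integrable_dom _ _ _ mu D mD (fun x => M * `|w x|)).
- apply: measurable_funM; [exact: measurable_funTS|exact: (integrable_mf iw)].
- by move=> x _; rewrite normrM ler_wpM2r.
- by apply: integrable_cmul => //; exact: integrable_abs.
Qed.

Definition sh (t : R) : R := (expR t - expR (- t)) / 2.
Definition ch (t : R) : R := (expR t + expR (- t)) / 2.
(** The half-argument [sinh(t/2)] is the time scale of the kernel: [qk t x] equals
    [2 (rho t ^ 2 + sin(x/2) ^ 2)], so [rho] and [|sin(x/2)|] play the roles of height and
    horizontal distance to the singularity. *)
Definition rho (t : R) : R := sh (t / 2).
Definition qk (t x : R) : R := ch t - cos x.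
(** This is [(1 - r^2) / (1 - 2 r cos x + r^2) / (2 pi)] at radius [r = e^(-t)], after division of
    numerator and denominator by [2 r]. *)
Definition pk (t x : R) : R := sh t / qk t x / tau.

Lemma expRK_half (t : R) : expR t = expR (t / 2) ^+ 2.
Proof. by rewrite expr2 -expRD; congr expR; field. Qed.

Lemma expR_mulN (t : R) : expR t * expR (- t) = 1.
Proof. by rewrite -expRD subrr expR0. Qed.

Lemma ch_rho t : ch t = 1 + 2 * rho t ^+ 2.
Proof.
rewrite /ch /rho /sh (expRK_half t) (expRK_half (- t)) mulNr.
have := expR_mulN (t / 2); set a := expR _; set b := expR _ => ab.
have -> : 2 * ((a - b) / 2) ^+ 2 = (a ^+ 2 + b ^+ 2) / 2 - a * b by field.
by rewrite ab; field.
Qed.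

Lemma sh_gt0 t : 0 < t -> 0 < sh t.
Proof. by move=> t0; rewrite /sh divr_gt0// subr_gt0 ltr_expR; lra. Qed.

Lemma rho_gt0 t : 0 < t -> 0 < rho t.
Proof. by move=> t0; apply: sh_gt0; lra. Qed.

Lemma ch_sub_sh t : ch t - sh t = expR (- t). Proof. by rewrite /ch /sh; field. Qed.

Lemma qkE t x : qk t x = 2 * (rho t ^+ 2 + sin (x / 2) ^+ 2).
Proof.
rewrite /qk ch_rho; have -> : cos x = cos (x / 2 *+ 2) by congr cos; rewrite -mulr_natr; field.
by rewrite cos_mulr2n cos2sin2 -mulr_natr; ring.
Qed.

Lemma qk_ge_rho t x : 2 * rho t ^+ 2 <= qk t x.
Proof. by rewrite qkE; have := sqr_ge0 (sin (x / 2)); lra. Qed.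

Lemma qk_gt0 t x : 0 < t -> 0 < qk t x.
Proof.
by move=> t0; apply: lt_le_trans (qk_ge_rho t x); rewrite mulr_gt0// exprn_gt0// rho_gt0.
Qed.

Lemma pk_ge0 t x : 0 < t -> 0 <= pk t x.
Proof.
move=> t0; rewrite /pk divr_ge0 ?ltW ?(tau_gt0)//.
by rewrite divr_gt0 ?sh_gt0 ?qk_gt0.
Qed.

Lemma pkN t x : pk t (- x) = pk t x. Proof. by rewrite /pk /qk cosN. Qed.

Lemma pkC t x y : pk t (x - y) = pk t (y - x). Proof. by rewrite -pkN opprB. Qed.

Lemma periodic_pk t : periodic (pk t) tau.
Proof. by move=> x; rewrite /pk /qk cosD2pi. Qed.

Lemma pk_le t x : 0 < t -> pk t x <= sh t / (2 * rho t ^+ 2) / tau.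
Proof.
move=> t0; rewrite /pk ler_pM2r ?invr_gt0 ?tau_gt0// ler_pM2l ?sh_gt0//.
rewrite lef_pV2 ?posrE ?qk_gt0 ?qk_ge_rho//.
by rewrite mulr_gt0// exprn_gt0// rho_gt0.
Qed.

Lemma measurable_cos : measurable_fun setT (@cos R).
Proof. by apply: continuous_measurable_fun => x; exact: continuous_cos. Qed.

Lemma measurable_sin : measurable_fun setT (@sin R).
Proof. by apply: continuous_measurable_fun => x; exact: continuous_sin. Qed.

Lemma measurable_sh : measurable_fun setT sh.
Proof.
apply: measurable_funM => //; apply: measurable_funB; first exact: measurable_expR.
by apply: measurable_expR_comp; exact: oppr_measurable.
Qed.

Lemma measurable_ch : measurable_fun setT ch.
Proof.
apply: measurable_funM => //; apply: measurable_funD; first exact: measurable_expR.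
by apply: measurable_expR_comp; exact: oppr_measurable.
Qed.

Lemma measurable_qk2 d (T : measurableType d) (f g : T -> R) :
  measurable_fun setT f -> measurable_fun setT g ->
  measurable_fun setT (fun z => qk (f z) (g z)).
Proof.
move=> mf mg; apply: measurable_funB.
  exact: (measurableT_comp measurable_ch).
exact: (measurableT_comp measurable_cos).
Qed.

Lemma measurable_pk2 d (T : measurableType d) (f g : T -> R) :
  measurable_fun setT f -> measurable_fun setT g ->
  measurable_fun setT (fun z => pk (f z) (g z)).
Proof.
move=> mf mg; apply: measurable_funM => //; apply: measurable_funM.
  exact: (measurableT_comp measurable_sh).
by apply: measurable_funV; exact: measurable_qk2.
Qed.

Lemma measurable_pkx t x : measurable_fun setT (fun y : R => pk t (x - y)).
Proof. by apply: measurable_pk2 => //; exact: measurable_funB. Qed.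

(** By Bernoulli's inequality [e^n >= 1 + n (e - 1)], so a positive [a] would make the sequence
    unbounded. *)
Lemma bounded_geometric (a e M : R) : 0 <= a -> 1 < e ->
  (forall n : nat, a * e ^+ n <= M) -> a = 0.
Proof.
move=> a0 e1 h; apply/eqP; rewrite eq_le a0 andbT leNgt; apply/negP => a_gt0.
have d0 : 0 < e - 1 by lra.
pose n := (Num.truncn (M / (a * (e - 1)))).+1.
have := truncnS_gt (M / (a * (e - 1))); rewrite -/n.
rewrite ltr_pdivrMr ?mulr_gt0// => hn.
have b : 1 + n%:R * (e - 1) <= e ^+ n.
  elim: n {hn} => [|n IH]; first by rewrite mul0r addr0 expr0.
  rewrite exprS; apply: (@le_trans _ _ (e * (1 + n%:R * (e - 1)))); last first.
    by apply: ler_wpM2l => //; lra.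
  rewrite -subr_ge0.
  have -> : e * (1 + n%:R * (e - 1)) - (1 + n.+1%:R * (e - 1)) = n%:R * (e - 1) ^+ 2.
    by rewrite -natr1; ring.
  by rewrite mulr_ge0 ?sqr_ge0.
have := h n; have : a * (1 + n%:R * (e - 1)) <= a * e ^+ n by rewrite ler_wpM2l.
rewrite mulrDr mulr1; nra.
Qed.

(** The characteristic roots are [e^t] and [e^(-t)]. The combination [X (k+1) - e^(-t) X k] removes
    the decaying mode and is multiplied by [e^t] at each step, so a bounded sequence makes it
    vanish. *)
Lemma bounded_recurrence (t M : R) (X : nat -> R) : 0 < t ->
  (forall k, X k.+2 = 2 * ch t * X k.+1 - X k) -> (forall k, `|X k| <= M) ->
  forall k, X k.+1 = expR (- t) * X k.
Proof.
move=> t0 rec bd k.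
pose d k := X k.+1 - expR (- t) * X k.
have dS j : d j.+1 = expR t * d j.
  rewrite /d rec /ch; have := expR_mulN t; set a := expR t; set b := expR (- t) => ab.
  have -> : 2 * ((a + b) / 2) = a + b by field.
  have -> : a * (X j.+1 - b * X j) = a * X j.+1 - (a * b) * X j by ring.
  by rewrite ab; ring.
have dn n : d (k + n)%N = expR t ^+ n * d k.
  elim: n => [|n IH]; first by rewrite addn0 expr0 mul1r.
  by rewrite addnS dS IH exprS mulrA.
have dM j : `|d j| <= 2 * M.
  rewrite /d (le_trans (ler_normB _ _))// normrM (ger0_norm (expR_ge0 _)).
  have e1 : expR (- t) <= 1 by rewrite expR_le1; lra.
  have := bd j; have := bd j.+1; have : 0 <= `|X j| by [].
  by have := expR_ge0 (- t); nra.
suff : `|d k| = 0 by move/eqP; rewrite normr_eq0 /d subr_eq0 => /eqP.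
apply: (@bounded_geometric _ (expR t) (2 * M)) => //; first by rewrite expR_gt1.
by move=> n; rewrite mulrC -[X in X * _](ger0_norm (exprn_ge0 _ (expR_ge0 _))) -normrM -dn.
Qed.

(** * Three-term recurrence for the moments of the kernel *)

Section recurrence.
Variables (t x : R) (C : nat -> R -> R) (w : R -> R).
Hypothesis t0 : 0 < t.
Hypothesis mC : forall k, measurable_fun setT (C k).
Hypothesis C1 : forall k z, `|C k z| <= 1.
Hypothesis Crec : forall k z, C k.+2 z = 2 * cos z * C k.+1 z - C k z.
Hypothesis iw : mu.-integrable I (fun y => (w y)%:E).

Let A k := \int[mu]_(y in I) (pk t (x - y) * C k (x - y) * w y).

Let mCx k : measurable_fun setT (fun y : R => C k (x - y)).
Proof. by apply: (measurableT_comp (mC k)); exact: measurable_funB. Qed.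

Let P := sh t / (2 * rho t ^+ 2) / tau.

Let pC_le k y : `|pk t (x - y) * C k (x - y)| <= P.
Proof.
rewrite normrM (ger0_norm (pk_ge0 _ t0)) -[leRHS]mulr1.
by apply: ler_pM => //; [exact: pk_ge0|exact: pk_le].
Qed.

Let iA k : mu.-integrable I (fun y => (pk t (x - y) * C k (x - y) * w y)%:E).
Proof.
apply: (@integrable_bmul _ _ _ P) => //; first exact: measurable_per.
by apply: measurable_funM => //; exact: measurable_pkx.
Qed.

Let ic k : mu.-integrable I (fun y => (C k (x - y) * w y)%:E).
Proof. by apply: (@integrable_bmul _ _ _ 1) => //; exact: measurable_per. Qed.

Lemma poisson_bounded k : `|A k| <= P * \int[mu]_(y in I) `|w y|.
Proof.
have mI := @measurable_per R.
apply: (@le_trans _ _ (\int[mu]_(y in I) `|pk t (x - y) * C k (x - y) * w y|)).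
  by apply: le_normr_Rintegral => //; exact: iA.
rewrite -RintegralZl//; last exact: integrable_abs.
apply: le_Rintegral => //.
- exact: integrable_abs.
- by apply: integrable_cmul => //; exact: integrable_abs.
- by move=> y _; rewrite normrM; apply: ler_wpM2r.
Qed.

(** Because [pk * (ch - cos)] is constant in the angle, the recurrence of the [C k] passes to the
    moments [A k], up to a multiple of the integral of [C (k+1)] against [w], which vanishes by
    hypothesis. Boundedness then selects the decaying solution. The Fourier coefficients of the
    kernel are found this way, with no series expansion of the kernel. *)
Lemma poisson_rec : (forall k, \int[mu]_(y in I) (C k.+1 (x - y) * w y) = 0) ->
  forall k, A k.+1 = expR (- t) * A k.
Proof.
move=> c0; have mI := @measurable_per R.
apply: (@bounded_recurrence _ (P * \int[mu]_(y in I) `|w y|)) => // k; last exact: poisson_bounded.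
have E y : pk t (x - y) * C k.+2 (x - y) * w y =
   2 * ch t * (pk t (x - y) * C k.+1 (x - y) * w y) -
   (pk t (x - y) * C k (x - y) * w y) - 2 * sh t / tau * (C k.+1 (x - y) * w y).
  rewrite Crec /pk; set z := x - y; have := qk_gt0 z t0; rewrite /qk.
  move: (@tau_gt0 R); move: tau => T T0 q0; field.
  by apply/andP; split; rewrite gt_eqF//.
rewrite {1}/A; under eq_Rintegral do rewrite E.
rewrite RintegralB //; last 2 first.
- by apply: integrable_sub => //; exact: integrable_cmul.
- exact: integrable_cmul.
rewrite RintegralB; [|exact: mI|by apply: integrable_cmul|exact: iA].
rewrite (Rintegral_cmul mI _ (iA k.+1)) (Rintegral_cmul mI _ (ic k.+1)).
by rewrite c0 mulr0 subr0.
Qed.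

End recurrence.

Lemma cosrec (k : nat) (z : R) : cos (k.+2%:R * z) = 2 * cos z * cos (k.+1%:R * z) - cos (k%:R * z).
Proof.
have -> : k.+2%:R * z = k.+1%:R * z + z by rewrite -natr1; ring.
have -> : k%:R * z = k.+1%:R * z - z by rewrite -[k.+1%:R]natr1; ring.
by rewrite cosD cosB; ring.
Qed.

Lemma sinrec (k : nat) (z : R) : sin (k.+2%:R * z) = 2 * cos z * sin (k.+1%:R * z) - sin (k%:R * z).
Proof.
have -> : k.+2%:R * z = k.+1%:R * z + z by rewrite -natr1; ring.
have -> : k%:R * z = k.+1%:R * z - z by rewrite -[k.+1%:R]natr1; ring.
by rewrite sinD sinB; ring.
Qed.

Lemma measurable_cosk (k : R) : measurable_fun setT (fun z : R => cos (k * z)).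
Proof. by apply: (measurableT_comp measurable_cos); exact: mulrl_measurable. Qed.

Lemma measurable_sink (k : R) : measurable_fun setT (fun z : R => sin (k * z)).
Proof. by apply: (measurableT_comp measurable_sin); exact: mulrl_measurable. Qed.

Lemma periodic_cosk (k : nat) : periodic (fun z : R => cos (k%:R * z)) tau.
Proof.
move=> z; rewrite mulrDr (mulr_natl tau k).
by rewrite (periodicn (@cosD2pi R)).
Qed.

Lemma periodic_sink (k : nat) : periodic (fun z : R => sin (k%:R * z)) tau.
Proof.
move=> z; rewrite mulrDr (mulr_natl tau k).
by rewrite (periodicn (@sinD2pi R)).
Qed.

(** The integral over a period is invariant under the shift by [h], which changes its sign. *)
Lemma Rintegral_alternating (F : R -> R) (h : R) : measurable_fun setT F -> (forall z, `|F z| <= 1) ->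
  periodic F tau -> (forall z, F (z + h) = - F z) -> \int[mu]_(y in I) F y = 0.
Proof.
move=> mF F1 pF aF; have := Rper_shift h mF pF.
under eq_Rintegral do rewrite aF -mulN1r.
rewrite RintegralZl; last 2 first.
- exact: measurable_per.
- by apply: (@per_bounded_integrable _ 1).
by set J := Rintegral _ _ _ => H; lra.
Qed.

Lemma periodic_subl (F : R -> R) x : periodic F tau -> periodic (fun y => F (x - y)) tau.
Proof. by move=> pF y; rewrite opprD addrA -[in RHS](subrK tau (x - y)) pF. Qed.

Lemma cos_mean0 (k : nat) x : \int[mu]_(y in I) (cos (k.+1%:R * (x - y)) * 1) = 0.
Proof.
under eq_Rintegral do rewrite mulr1.
apply: (@Rintegral_alternating _ (- (pi / k.+1%:R))).
- by apply: (measurableT_comp (measurable_cosk _)); exact: measurable_funB.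
- by move=> z; exact: cos_max.
- exact: (@periodic_subl (fun z => cos (k.+1%:R * z)) x (periodic_cosk k.+1)).
- move=> z; have -> : k.+1%:R * (x - (z - pi / k.+1%:R)) = k.+1%:R * (x - z) + pi :> R.
    have k0 : (k.+1%:R : R) != 0 by rewrite pnatr_eq0.
    by move: (k.+1%:R) k0 => c c0; field.
  by rewrite cosDpi.
Qed.

Lemma sin_mean0 (k : nat) x : \int[mu]_(y in I) (sin (k.+1%:R * (x - y)) * 1) = 0.
Proof.
under eq_Rintegral do rewrite mulr1.
apply: (@Rintegral_alternating _ (- (pi / k.+1%:R))).
- by apply: (measurableT_comp (measurable_sink _)); exact: measurable_funB.
- by move=> z; exact: sin_max.
- exact: (@periodic_subl (fun z => sin (k.+1%:R * z)) x (periodic_sink k.+1)).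
- move=> z; have -> : k.+1%:R * (x - (z - pi / k.+1%:R)) = k.+1%:R * (x - z) + pi :> R.
    have k0 : (k.+1%:R : R) != 0 by rewrite pnatr_eq0.
    by move: (k.+1%:R) k0 => c c0; field.
  by rewrite sinDpi.
Qed.

Let i1 : mu.-integrable I (fun=> 1%:E).
Proof. by apply: integrable_cstR; [exact: measurable_per|exact: per_fin]. Qed.

Let Rint1 : \int[mu]_(y in I) 1 = tau.
Proof. by rewrite Rintegral_cst ?mul1r; [rewrite [X in fine X]per_mu|exact: measurable_per]. Qed.

(* p (cosh t - cos) = sinh t / tau *)
Lemma poisson_first (t x : R) (w : R -> R) : 0 < t -> mu.-integrable I (fun y => (w y)%:E) ->
  \int[mu]_(y in I) (pk t (x - y) * cos (1%:R * (x - y)) * w y) =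
  ch t * \int[mu]_(y in I) (pk t (x - y) * cos (0%:R * (x - y)) * w y) -
  sh t / tau * \int[mu]_(y in I) w y.
Proof.
move=> t0 iw; have mI := @measurable_per R.
have ik (k : R) : mu.-integrable I (fun y => (pk t (x - y) * cos (k * (x - y)) * w y)%:E).
  apply: (@integrable_bmul _ _ _ (sh t / (2 * rho t ^+ 2) / tau)) => //.
    apply: measurable_funM; first exact: measurable_pkx.
    by apply: (measurableT_comp (measurable_cosk _)); exact: measurable_funB.
  move=> y; rewrite normrM (ger0_norm (pk_ge0 _ t0)) -[leRHS]mulr1.
  by apply: ler_pM => //; [exact: pk_ge0|exact: pk_le|exact: cos_max].
have E y : pk t (x - y) * cos (1 * (x - y)) * w y =
    ch t * (pk t (x - y) * cos (0 * (x - y)) * w y) - sh t / tau * w y.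
  rewrite mul0r cos0 mul1r /pk; set z := x - y; have := qk_gt0 z t0; rewrite /qk.
  move: (@tau_gt0 R); move: tau => T T0 q0; field.
  by apply/andP; split; rewrite gt_eqF.
under eq_Rintegral do rewrite E.
rewrite RintegralB; [|exact: mI|by apply: integrable_cmul|by apply: integrable_cmul].
by rewrite !RintegralZl//; exact: ik.
Qed.

(** The ratio of consecutive moments is [e^(-t)] by [poisson_rec]. The zeroth one is fixed by
    comparing [A 1 = e^(-t) A 0] with [A 1 = ch t * A 0 - sh t]: since [ch t - sh t = e^(-t)], this
    leaves [sh t * (A 0 - 1) = 0]. *)
Lemma poisson_coef (k : nat) t x : 0 < t ->
  \int[mu]_(y in I) (pk t (x - y) * cos (k%:R * (x - y))) = expR (- t) ^+ k.
Proof.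
move=> t0.
pose A k := \int[mu]_(y in I) (pk t (x - y) * cos (k%:R * (x - y)) * 1).
have AS j : A j.+1 = expR (- t) * A j.
  apply: (@poisson_rec t x (fun k z => cos (k%:R * z)) (fun=> 1)) => //.
  - by move=> n; exact: measurable_cosk.
  - by move=> n z; exact: cos_max.
  - exact: cosrec.
  - by move=> n; exact: cos_mean0.
have A0 : A 0%N = 1.
  have := poisson_first x t0 i1; rewrite -/(A 1%N) -/(A 0%N) AS Rint1.
  have -> : sh t / tau * tau = sh t by rewrite divfK// gt_eqF// tau_gt0.
  have s0 := sh_gt0 t0; have := ch_sub_sh t => h1 h2.
  have : sh t * (A 0%N - 1) = 0 by rewrite mulrBr mulr1; nra.
  by move/eqP; rewrite mulf_eq0 (gt_eqF s0) /= subr_eq0 => /eqP.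
transitivity (A k); first by apply: eq_Rintegral => y _; rewrite mulr1.
by elim: k => [|k IH]; rewrite ?A0 ?expr0// AS IH exprS.
Qed.

Lemma poisson_coef_sin (k : nat) t x : 0 < t ->
  \int[mu]_(y in I) (pk t (x - y) * sin (k%:R * (x - y))) = 0.
Proof.
move=> t0.
pose A k := \int[mu]_(y in I) (pk t (x - y) * sin (k%:R * (x - y)) * 1).
have AS j : A j.+1 = expR (- t) * A j.
  apply: (@poisson_rec t x (fun k z => sin (k%:R * z)) (fun=> 1)) => //.
  - by move=> n; exact: measurable_sink.
  - by move=> n z; exact: sin_max.
  - exact: sinrec.
  - by move=> n; exact: sin_mean0.
have A0 : A 0%N = 0.
  rewrite /A; under eq_Rintegral do rewrite mul0r sin0 mulr0 mul0r.
  by rewrite Rintegral_cst ?mul0r//; exact: measurable_per.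
transitivity (A k); first by apply: eq_Rintegral => y _; rewrite mulr1.
by elim: k => [//|k IH]; rewrite AS IH mulr0.
Qed.

Lemma poisson_mass t x : 0 < t -> \int[mu]_(y in I) pk t (x - y) = 1.
Proof.
move=> t0; rewrite -[RHS](poisson_coef 0 x t0).
by apply: eq_Rintegral => y _; rewrite mul0r cos0 mulr1.
Qed.

Lemma pk_integrable t x : 0 < t -> mu.-integrable I (fun y => (pk t (x - y))%:E).
Proof.
move=> t0; apply: (@per_bounded_integrable _ (sh t / (2 * rho t ^+ 2) / tau)).
  exact: measurable_pkx.
by move=> y _; rewrite ger0_norm ?pk_ge0 ?pk_le.
Qed.

Lemma poisson_cos (k : nat) t x : 0 < t ->
  \int[mu]_(y in I) (pk t (x - y) * cos (k%:R * y)) = expR (- t) ^+ k * cos (k%:R * x).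
Proof.
move=> t0; have mI := @measurable_per R.
have i (C : R -> R) : measurable_fun setT C -> (forall z, `|C z| <= 1) ->
    mu.-integrable I (fun y => (pk t (x - y) * C (x - y))%:E).
  move=> mC C1.
  have : mu.-integrable I (fun y => (C (x - y) * pk t (x - y))%:E).
    apply: (@integrable_bmul I (fun y => C (x - y)) (fun y => pk t (x - y)) 1) => //.
      by apply: (measurableT_comp mC); exact: measurable_funB.
    exact: pk_integrable.
  by apply: eq_integrable => // y _; rewrite mulrC.
have ic := i _ (measurable_cosk k%:R) (fun z => cos_max _).
have is_ := i _ (measurable_sink k%:R) (fun z => sin_max _).
have E y : pk t (x - y) * cos (k%:R * y) =
  cos (k%:R * x) * (pk t (x - y) * cos (k%:R * (x - y))) +
  sin (k%:R * x) * (pk t (x - y) * sin (k%:R * (x - y))).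
  have -> : k%:R * y = k%:R * x - k%:R * (x - y) by ring.
  by rewrite cosB; ring.
under eq_Rintegral do rewrite E.
rewrite RintegralD //; [|exact: integrable_cmul|exact: integrable_cmul].
by rewrite !RintegralZl// poisson_coef// poisson_coef_sin// mulr0 addr0 mulrC.
Qed.

Lemma poisson_sin (k : nat) t x : 0 < t ->
  \int[mu]_(y in I) (pk t (x - y) * sin (k%:R * y)) = expR (- t) ^+ k * sin (k%:R * x).
Proof.
move=> t0; have mI := @measurable_per R.
have i (C : R -> R) : measurable_fun setT C -> (forall z, `|C z| <= 1) ->
    mu.-integrable I (fun y => (pk t (x - y) * C (x - y))%:E).
  move=> mC C1.
  have : mu.-integrable I (fun y => (C (x - y) * pk t (x - y))%:E).
    apply: (@integrable_bmul I (fun y => C (x - y)) (fun y => pk t (x - y)) 1) => //.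
      by apply: (measurableT_comp mC); exact: measurable_funB.
    exact: pk_integrable.
  by apply: eq_integrable => // y _; rewrite mulrC.
have ic := i _ (measurable_cosk k%:R) (fun z => cos_max _).
have is_ := i _ (measurable_sink k%:R) (fun z => sin_max _).
have E y : pk t (x - y) * sin (k%:R * y) =
  sin (k%:R * x) * (pk t (x - y) * cos (k%:R * (x - y))) -
  cos (k%:R * x) * (pk t (x - y) * sin (k%:R * (x - y))).
  have -> : k%:R * y = k%:R * x - k%:R * (x - y) by ring.
  by rewrite sinB; ring.
under eq_Rintegral do rewrite E.
rewrite RintegralB //; [|exact: integrable_cmul|exact: integrable_cmul].
by rewrite !RintegralZl// poisson_coef// poisson_coef_sin// mulr0 subr0 mulrC.
Qed.

End poisson_kernel.

(** * Uniqueness of Fourier coefficients *)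

Lemma Rdominated_cvg d (T : measurableType d) (R : realType)
    (m : {measure set T -> \bar R}) (D : set T) (fn : nat -> T -> R) (f g : T -> R) :
  measurable D -> (forall n, measurable_fun D (fn n)) -> measurable_fun D f ->
  {ae m, forall x, D x -> fn ^~ x @ \oo --> f x} ->
  m.-integrable D (fun x => (g x)%:E) ->
  (forall n x, D x -> `|fn n x| <= g x) ->
  (\int[m]_(x in D) fn n x) @[n --> \oo] --> \int[m]_(x in D) f x.
Proof.
move=> mD mfn mf ffn ig le_g.
have ae1 : {ae m, forall x, D x -> (fun n => (fn n x)%:E) @ \oo --> (f x)%:E}.
  by apply: filterS ffn => x h Dx; apply: cvg_EFin; [exact: nearW|exact: h].
have ae2 : {ae m, forall x n, D x -> (`|(fn n x)%:E| <= (g x)%:E)%E}.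
  by apply: aeW => x n Dx; rewrite lee_fin le_g.
have [iF _ C] := dominated_convergence mD (fun n => (measurable_EFinP D (fn n)).2 (mfn n))
  ((measurable_EFinP D f).2 mf) ae1 ig ae2.
apply: fine_cvg.
by rewrite -[X in _ --> X]/((_)%:E) RintegralE.
Qed.

Section curried.
Context {R : realType}.
Notation mu := (@lebesgue_measure R).

Lemma measurable_Rint d (T : measurableType d) (B : set (measurableTypeR R)) (f : T -> R -> R) :
  measurable B -> measurable_fun setT (fun z : T * R => f z.1 z.2) ->
  measurable_fun setT (fun x => \int[mu]_(y in B) f x y).
Proof.
move=> mB mf.
exact: (@measurable_Rinner _ _ T (measurableTypeR R) R mu B mB (fun z => f z.1 z.2)).
Qed.

Lemma measurable_eint d (T : measurableType d) (B : set (measurableTypeR R)) (f : T -> R -> R) :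
  measurable B -> measurable_fun setT (fun z : T * R => f z.1 z.2) ->
  measurable_fun setT (fun x => \int[mu]_(y in B) (f x y)%:E)%E.
Proof.
move=> mB mf.
exact: (@measurable_inner _ _ T (measurableTypeR R) R mu B mB (fun z => f z.1 z.2)).
Qed.

Lemma Rfubini (A B : set (measurableTypeR R)) (f : R -> R -> R) :
  measurable A -> measurable B -> measurable_fun setT (fun z : R * R => f z.1 z.2) ->
  (\int[mu]_(x in A) \int[mu]_(y in B) `|f x y|%:E < +oo)%E ->
  \int[mu]_(x in A) \int[mu]_(y in B) f x y = \int[mu]_(y in B) \int[mu]_(x in A) f x y.
Proof.
move=> mA mB mf fi.
exact: (@fubini_in _ _ (measurableTypeR R) (measurableTypeR R) R mu mu A B (fun z => f z.1 z.2)).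
Qed.

Lemma Rtonelli (A B : set (measurableTypeR R)) (f : R -> R -> R) :
  measurable A -> measurable B -> measurable_fun setT (fun z : R * R => f z.1 z.2) ->
  (forall x y, 0 <= f x y) ->
  (\int[mu]_(x in A) \int[mu]_(y in B) (f x y)%:E =
   \int[mu]_(y in B) \int[mu]_(x in A) (f x y)%:E)%E.
Proof.
move=> mA mB mf f0.
exact: (@tonelli_in _ _ (measurableTypeR R) (measurableTypeR R) R mu mu A B (fun z => f z.1 z.2)).
Qed.

Lemma Rinner_integrable (A B : set (measurableTypeR R)) (f : R -> R -> R) :
  measurable A -> measurable B -> measurable_fun setT (fun z : R * R => f z.1 z.2) ->
  (\int[mu]_(x in A) \int[mu]_(y in B) `|f x y|%:E < +oo)%E ->
  mu.-integrable A (fun x => (\int[mu]_(y in B) f x y)%:E).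
Proof.
move=> mA mB mf fi.
exact: (@inner_integrable _ _ (measurableTypeR R) (measurableTypeR R) R mu mu A B (fun z => f z.1 z.2)).
Qed.

End curried.

Section fourier_unique.
Context {R : realType}.
Notation mu := (@lebesgue_measure R).
Local Notation tau := ((pi : R) *+ 2).
Local Notation I := (@per_itv R).

Lemma cos_lt1 (z : R) : 0 < z < tau -> cos z < 1.
Proof.
move=> /andP[z0 zt]; have -> : cos z = cos (z / 2 *+ 2) by congr cos; rewrite -mulr_natr; field.
have s0 : 0 < sin (z / 2) by apply: sin_gt0_pi; move: zt; rewrite -mulr_natr; lra.
by rewrite cos_mulr2n cos2sin2 -mulr_natr; nra.
Qed.

Lemma cos_le_itv (a b : R) : 0 < a -> a <= b -> b < tau ->
  exists2 m, m < 1 & forall z, a <= z <= b -> cos z <= m.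
Proof.
move=> a0 ab bt.
have [|c] := @EVT_max R cos a b ab.
  by apply: continuous_subspaceT => x; exact: continuous_cos.
rewrite in_itv /= => /andP[ca cb] h; exists (cos c).
  by apply: cos_lt1; rewrite (lt_le_trans a0 ca) (le_lt_trans cb bt).
by move=> z hz; apply: h; rewrite in_itv.
Qed.

Lemma ch_ge1 (t : R) : 1 <= ch t.
Proof. by rewrite ch_rho lerDl mulr_ge0// sqr_ge0. Qed.

Lemma pk_le_cos (t m z : R) : 0 < t -> m < 1 -> cos z <= m -> pk t z <= sh t / (1 - m) / tau.
Proof.
move=> t0 m1 h; rewrite /pk ler_pM2r ?invr_gt0 ?tau_gt0// ler_pM2l ?sh_gt0//.
rewrite lef_pV2 ?posrE ?qk_gt0//; last by lra.
by rewrite /qk; have := ch_ge1 t; lra.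
Qed.

Lemma sh_inv_cvg0 : (sh (n.+1%:R^-1 : R)) @[n --> \oo] --> (0 : R).
Proof.
have -> : (0 : R) = sh 0 by rewrite /sh oppr0 subrr mul0r.
have c : {for 0, continuous (@sh R)}.
  rewrite /sh; apply: cvgM; last exact: cvg_cst.
  apply: cvgB; first exact: continuous_expR.
  apply: (@continuous_comp _ _ _ (-%R : R -> R) expR); first exact: oppr_continuous.
  exact: continuous_expR.
by apply: (@cvg_comp _ _ _ _ (@sh R) _ _ _ (@cvg_harmonic R) c).
Qed.

(** The recurrence is now applied with the weight [w] itself, all of whose moments vanish. It gives
    [A 1 = e^(-t) A 0], while [poisson_first] gives [A 1 = ch t * A 0]; the two factors differ by
    [sh t > 0], so [A 0 = 0]. *)
Lemma poisson_zero (w : R -> R) : mu.-integrable I (fun y => (w y)%:E) ->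
  (forall k : nat, \int[mu]_(y in I) (cos (k%:R * y) * w y) = 0) ->
  (forall k : nat, \int[mu]_(y in I) (sin (k%:R * y) * w y) = 0) ->
  forall t x, 0 < t -> \int[mu]_(y in I) (pk t (x - y) * w y) = 0.
Proof.
move=> iw c0 s0 t x t0; have mI := @measurable_per R.
have ik (C : R -> R) : measurable_fun setT C -> (forall z, `|C z| <= 1) ->
    mu.-integrable I (fun y => (C y * w y)%:E).
  by move=> mC C1; exact: (@integrable_bmul _ _ _ _ 1).
have icos k := ik _ (@measurable_cosk R k%:R) (fun z => cos_max _).
have isin k := ik _ (@measurable_sink R k%:R) (fun z => sin_max _).
have cx (k : nat) : \int[mu]_(y in I) (cos (k%:R * (x - y)) * w y) = 0.
  have E y : cos (k%:R * (x - y)) * w y = cos (k%:R * x) * (cos (k%:R * y) * w y) +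
     sin (k%:R * x) * (sin (k%:R * y) * w y).
    by rewrite mulrBr cosB; ring.
  under eq_Rintegral do rewrite E.
  rewrite Rintegral_add //; [|exact: integrable_cmul|exact: integrable_cmul].
  by rewrite !Rintegral_cmul// c0 s0 !mulr0 addr0.
pose A k := \int[mu]_(y in I) (pk t (x - y) * cos (k%:R * (x - y)) * w y).
have A1 : A 1%N = expR (- t) * A 0%N.
  apply: (@poisson_rec R t x (fun k z => cos (k%:R * z)) w) => //.
  - by move=> n; exact: measurable_cosk.
  - by move=> n z; exact: cos_max.
  - exact: cosrec.
have W0 : \int[mu]_(y in I) w y = 0.
  by rewrite -[RHS](c0 0%N); apply: eq_Rintegral => y _; rewrite mul0r cos0 mul1r.
have := poisson_first x t0 iw; rewrite -/(A 1%N) -/(A 0%N) A1 W0 mulr0 subr0.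
have := sh_gt0 t0; have := ch_sub_sh t => h1 h2 h3.
have : sh t * A 0%N = 0 by nra.
move/eqP; rewrite mulf_eq0 (gt_eqF h2) /= => /eqP <-.
by apply: eq_Rintegral => y _; rewrite mul0r cos0 mulr1.
Qed.

(** The Poisson extension of the indicator of []0, b[], evaluated at [y]. *)
Let hb (b t y : R) := \int[mu]_(x in `]0, b[) pk t (x - y).

Let pki (b t y : R) (A : set R) : 0 < t -> measurable A -> A `<=` I ->
  mu.-integrable A (fun x => (pk t (x - y))%:E).
Proof.
move=> t0 mA AI; apply: (@integrableS _ _ _ mu I A) => //; first exact: measurable_per.
have := pk_integrable y t0; apply: eq_integrable => //; first exact: measurable_per.
by move=> x _; rewrite pkC.
Qed.

Let hb_mass (b t y : R) : 0 < t -> 0 < b < tau -> 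
  hb b t y + \int[mu]_(x in `[b, tau[) pk t (x - y) = 1.
Proof.
move=> t0 /andP[b0 bt]; rewrite -(poisson_mass y t0).
have IE : I = `]0, b[%classic `|` `[b, tau[%classic.
  rewrite /per_itv; apply/seteqP; split => x /=; rewrite !in_itv /=.
    by move=> /andP[h1 h2]; case: (ltP x b) => h3; [left|right]; apply/andP.
  by move=> [] /andP[h1 h2]; apply/andP; split => //; lra.
under [RHS]eq_Rintegral do rewrite pkC.
rewrite /hb [in RHS]IE Rintegral_setU //.
  by rewrite -IE; apply: pki => //; exact: measurable_per.
apply/disj_setPS => x /= []; rewrite !in_itv /= => /andP[a1 a2] /andP[a3 a4].
by move: (lt_le_trans a2 a3); rewrite ltxx.
Qed.

Let Rint_le (A : set R) (F : R -> R) (K : R) : measurable A -> A `<=` I ->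
  mu.-integrable A (fun x => (F x)%:E) -> 0 <= K ->
  (forall x, A x -> F x <= K) -> \int[mu]_(x in A) F x <= K * tau.
Proof.
move=> mA AI iF K0 FK.
have Afin : (mu A < +oo)%E.
  by apply: le_lt_trans (@per_fin R); apply: le_measure => //; rewrite inE //; exact: measurable_per.
apply: (@le_trans _ _ (\int[mu]_(x in A) K)).
  by apply: Rintegral_le => //; exact: integrable_cstR.
rewrite Rintegral_cst//; apply: ler_wpM2l => //.
have Af : (mu A = (fine (mu A))%:E)%E by rewrite fineK// ge0_fin_numE.
rewrite -lee_fin -Af -per_mu.
by apply: le_measure => //; rewrite inE //; exact: measurable_per.
Qed.

Let hb_ge0 b t y : 0 < t -> 0 <= hb b t y.
Proof. by move=> t0; apply: Rintegral_ge0 => x _; exact: pk_ge0. Qed.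

Let hb_le1 b t y : 0 < t -> 0 < b < tau -> hb b t y <= 1.
Proof.
move=> t0 bb; rewrite -(hb_mass y t0 bb) lerDl; apply: Rintegral_ge0 => x _; exact: pk_ge0.
Qed.

(** The error is the mass of the kernel on the side of [b] that does not contain [y]. There [x - y]
    stays away from the multiples of [tau], [cos] stays below some [m < 1], and the kernel is
    [O(sh t)]. At the jump [y = b] the argument fails, but one point does not affect the later limit
    of integrals. *)
Let hb_cvg (b y : R) : 0 < b < tau -> I y -> y != b ->
  hb b n.+1%:R^-1 y @[n --> \oo] --> (\1_(`]0, b[%classic : set R) y : R).
Proof.
move=> bb; rewrite /per_itv /= in_itv /= => /andP[y0 yt] yb.
have [b0 bt] := andP bb.
suff [m m1 H] : exists2 m, m < 1 & forall t, 0 < t ->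
    `|(\1_(`]0, b[%classic : set R) y : R) - hb b t y| <= sh t * ((1 - m)^-1 / tau * tau).
  apply/cvgrPdist_le => e e0.
  have c : (sh (n.+1%:R^-1 : R) * ((1 - m)^-1 / tau * tau)) @[n --> \oo] --> (0 : R).
    rewrite -[X in _ --> X](mul0r ((1 - m)^-1 / tau * tau)).
    by apply: cvgM; [exact: sh_inv_cvg0|exact: cvg_cst].
  move/cvgrPdist_le : c => /(_ e e0); apply: filterS => n; rewrite sub0r normrN => h.
  apply: le_trans h; apply: le_trans (H _ _) (ler_norm _).
  by rewrite invr_gt0.
have [yb'|yb'] := ltP y b.
  have [| | |m m1 Hm] := @cos_le_itv (b - y) (tau - y); [lra|lra|lra|].
  exists m => // t t0.
  have e : (\1_(`]0, b[%classic : set R) y : R) - hb b t y = \int[mu]_(x in `[b, tau[) pk t (x - y).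
    rewrite indicE mem_set /=; last by rewrite in_itv /= y0.
    by have := hb_mass y t0 bb; lra.
  rewrite e ger0_norm; last first.
    by apply: Rintegral_ge0 => x _; exact: pk_ge0.
  have AI : `[b, tau[%classic `<=` I.
    by move=> x; rewrite /per_itv /= !in_itv /= => /andP[h1 h2]; rewrite h2 andbT; lra.
  have K0 : 0 <= sh t / (1 - m) / tau.
    by apply: divr_ge0; [apply: divr_ge0; [exact: ltW (sh_gt0 t0)|lra]|exact: ltW (@tau_gt0 R)].
  rewrite !mulrA; apply: Rint_le => //; first by apply: pki.
  move=> x /=; rewrite in_itv /= => /andP[h1 h2].
  apply: pk_le_cos => //; apply: Hm; apply/andP; split; lra.
have yb2 : b < y by rewrite lt_neqAle eq_sym yb.
have [| | |m m1 Hm] := @cos_le_itv (y - b) y; [lra|lra|lra|].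
exists m => // t t0.
rewrite indicE memNset /=; last by rewrite in_itv /= => /andP[]; lra.
rewrite sub0r normrN ger0_norm; last exact: hb_ge0.
have AI : `]0, b[%classic `<=` I.
  by move=> x; rewrite /per_itv /= !in_itv /= => /andP[h1 h2]; rewrite h1 /=; lra.
have K0 : 0 <= sh t / (1 - m) / tau.
  by apply: divr_ge0; [apply: divr_ge0; [exact: ltW (sh_gt0 t0)|lra]|exact: ltW (@tau_gt0 R)].
rewrite !mulrA; apply: Rint_le => //; first by apply: pki.
move=> x /=; rewrite in_itv /= => /andP[h1 h2]; rewrite pkC.
apply: pk_le_cos => //; apply: Hm; apply/andP; split; lra.
Qed.

(** Pairing [w] with [hb] gives 0, because the exchange of integrals puts the Poisson kernel on [w].
    Letting [t = 1/(n+1)] tend to 0 turns [hb] into the indicator of []0, b[] by dominated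
    convergence. *)
Lemma mean_zero_itv (w : R -> R) (b : R) : mu.-integrable I (fun y => (w y)%:E) ->
  measurable_fun setT w ->
  (forall t x, 0 < t -> \int[mu]_(y in I) (pk t (x - y) * w y) = 0) -> 0 < b < tau ->
  \int[mu]_(y in `]0, b[) w y = 0.
Proof.
move=> iw mw P0 bb; have mI := @measurable_per R.
have [b0 bt] := andP bb.
have mhb t : measurable_fun setT (hb b t).
  rewrite /hb; apply: (@measurable_Rint R _ R `]0, b[%classic (fun y x => pk t (x - y))) => //.
  by apply: measurable_pk2 => //; exact: measurable_funB.
have J0 n : \int[mu]_(y in I) (w y * hb b n.+1%:R^-1 y) = 0.
  have t0 : 0 < (n.+1%:R^-1 : R) by rewrite invr_gt0.
  move: (n.+1%:R^-1) t0 => t t0.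
  pose P := sh t / (2 * rho t ^+ 2) / tau.
  transitivity (\int[mu]_(y in I) \int[mu]_(x in `]0, b[) (w y * pk t (x - y))).
    apply: eq_Rintegral => y _; rewrite Rintegral_cmul//.
    apply: pki => // x; rewrite /per_itv /= !in_itv /= => /andP[h1 h2]; rewrite h1 /=; lra.
  rewrite (@Rfubini R I `]0, b[%classic (fun y x => w y * pk t (x - y))) //=.
  - transitivity (\int[mu]_(y in `]0, b[) (0 : R)).
      apply: eq_Rintegral => x _; rewrite -[RHS](P0 t x t0).
      by apply: eq_Rintegral => y _; rewrite mulrC.
    by rewrite Rintegral_cst// mul0r.
  - apply: measurable_funM; first exact: (measurableT_comp mw).
    by apply: measurable_pk2 => //; exact: measurable_funB.
  apply: (@le_lt_trans _ _ (\int[mu]_(y in I) (P * tau * `|w y|)%:E)%E); last first.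
    have := integrable_ae_lty (integrable_cmul mI (P * tau) (integrable_abs mI iw)).
    apply: le_lt_trans; apply: ge0_le_integral => //.
    + move=> y _; rewrite lee_fin mulr_ge0//.
      by rewrite mulr_ge0 ?(ltW (@tau_gt0 R))//; exact: le_trans (pk_ge0 0 t0) (pk_le _ t0).
    + by apply/measurable_EFinP; apply: measurable_funM => //; apply: measurableT_comp => //; exact: measurable_funTS.
    + by apply/measurable_EFinP; apply: measurableT_comp => //; apply: measurable_funM => //; apply: measurableT_comp => //; exact: measurable_funTS.
    + by move=> y _; rewrite lee_fin ler_norm.
  apply: ge0_le_integral => //.
  - by move=> y _; apply: integral_ge0.
  - apply: measurable_funTS.
    apply: (measurable_eint (f := fun y x => `|w y * pk t (x - y)|)) => //.
    apply: measurableT_comp => //; apply: measurable_funM; first exact: (measurableT_comp mw).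
    by apply: measurable_pk2 => //; exact: measurable_funB.
  - by apply/measurable_EFinP; apply: measurable_funM => //; apply: measurableT_comp => //; exact: measurable_funTS.
  move=> y _.
  have AI : `]0, b[%classic `<=` I.
    by move=> x; rewrite /per_itv /= !in_itv /= => /andP[h1 h2]; rewrite h1 /=; lra.
  have ii := pki b y t0 (measurable_itv `]0, b[) AI.
  rewrite -RintegralE//; last first.
    by apply: integrable_abs => //; apply: integrable_cmul.
  rewrite lee_fin.
  apply: (@le_trans _ _ (P * `|w y| * tau)); last by rewrite -!mulrA [tau * _]mulrC.
  apply: Rint_le => //.
  - by apply: integrable_abs => //; apply: integrable_cmul.
  - by rewrite mulr_ge0//; exact: le_trans (pk_ge0 0 t0) (pk_le _ t0).
  move=> x _; rewrite normrM mulrC; apply: ler_wpM2r => //.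
  by rewrite (ger0_norm (pk_ge0 _ t0)); exact: pk_le.
have C : (\int[mu]_(y in I) (w y * hb b n.+1%:R^-1 y)) @[n --> \oo] -->
    \int[mu]_(y in I) (w y * \1_(`]0, b[%classic : set R) y).
  apply: (@Rdominated_cvg _ _ _ mu I _ _ (fun y => `|w y|)) => //.
  - by move=> n; apply: measurable_funTS; apply: measurable_funM => //; exact: mhb.
  - by apply: measurable_funTS; apply: measurable_funM => //; exact: measurable_indic.
  - have : mu [set b] = 0 by rewrite lebesgue_measure_set1.
    move=> b00; exists [set b]; split => //.
    move=> y /= h; apply: contrapT => yb; apply: h => Iy.
    by apply: cvgM; [exact: cvg_cst|apply: hb_cvg => //; apply/eqP].
  - exact: integrable_abs.
  - move=> n y _; rewrite normrM -[leRHS]mulr1; apply: ler_wpM2l => //.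
    have t0 : 0 < (n.+1%:R^-1 : R) by rewrite invr_gt0.
    by rewrite ger0_norm ?hb_ge0// hb_le1.
have <- : \int[mu]_(y in I) (w y * \1_(`]0, b[%classic : set R) y) = \int[mu]_(y in `]0, b[) w y.
  have -> : `]0, b[%classic = I `&` `]0, b[%classic.
    apply/seteqP; split => x; rewrite /per_itv /= !in_itv /=.
      by move=> /andP[h1 h2]; split => //; rewrite h1 /=; lra.
    by move=> [].
  rewrite Rintegral_mkcondr; apply: eq_Rintegral => y /set_mem Iy.
  rewrite patchE indicE; have -> : (y \in I `&` `]0, b[%classic) = (y \in `]0, b[%classic).
    apply/idP/idP; rewrite !inE; first by case.
    by move=> h; split.
  by case: ifPn => _; rewrite ?mulr1 ?mulr0.
have : (fun n => \int[mu]_(y in I) (w y * hb b n.+1%:R^-1 y)) = cst 0 by apply/funext => n; exact: J0.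
move=> E; rewrite E in C; apply: (cvg_unique _ C (cvg_cst _)) => //.
Qed.

(** All the integrals of [w] over []0, b[] vanish, and Lebesgue's differentiation theorem recovers
    [w] almost everywhere as the derivative of this zero primitive. *)
Theorem fourier_unique (w : R -> R) : mu.-integrable I (fun y => (w y)%:E) ->
  measurable_fun setT w ->
  (forall k : nat, \int[mu]_(y in I) (cos (k%:R * y) * w y) = 0) ->
  (forall k : nat, \int[mu]_(y in I) (sin (k%:R * y) * w y) = 0) ->
  {ae mu, forall x, I x -> w x = 0}.
Proof.
move=> iw mw c0 s0; have mI := @measurable_per R.
have P0 := poisson_zero iw c0 s0.
pose f := w \_ I.
have intf : mu.-integrable setT (EFin \o f).
  have := (@integrable_mkcond _ (measurableTypeR R) R mu I (fun x => (w x)%:E) mI).1 iw.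
  by apply: eq_integrable => // x _; rewrite /f /= restrict_EFin.
have H := @FTC1 R f (BRight 0) _ (integrable_locally mI iw).
have intf' y : mu.-integrable [set` Interval (BRight 0) (BRight y)] (EFin \o f).
  by apply: (@integrableS _ _ _ mu setT).
have {}H := H intf'.
move: H; apply: filterS; first exact: (ae_filter_ringOfSetsType mu).
move=> x /= H Ix.
have [x0 xt] : 0 < x /\ x < tau by move: Ix; rewrite /per_itv /= in_itv /= => /andP[].
have x0' : (0%R%:E < x%:E)%E by rewrite lte_fin.
have [_ H2] := H x0'.
have <- : f x = w x by rewrite /f patchE mem_set.
rewrite -H2.
rewrite derive1E -[RHS](derive_cst 0 x 1); apply: near_eq_derive.
near=> y.
have y0 : 0 < y by near: y; exact: lt_nbhsr.
have yt : y < tau by near: y; exact: lt_nbhsl.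
rewrite /cst -[RHS](@mean_zero_itv w y iw mw P0) ?y0 ?yt//.
rewrite -(@Rintegral_itv_bndo_bndc R (BRight 0) y).
  apply: eq_Rintegral => z /set_mem; rewrite /= in_itv /= => /andP[z0 zy].
  by rewrite /f patchE mem_set// /per_itv /= in_itv /= z0 (lt_trans zy).
by apply: integrableS intf.
Unshelve. all: by end_near.
Qed.

End fourier_unique.

(** * The symbol of the fractional Laplacian *)

Section symbol.
Context {R : realType}.
Notation mu := (@lebesgue_measure R).
Local Notation tau := ((pi : R) *+ 2).
Local Notation I := (@per_itv R).

Lemma aeS (P Q : R -> Prop) : (forall x, P x -> Q x) ->
  {ae mu, forall x, P x} -> {ae mu, forall x, Q x}.
Proof. by move=> PQ; apply: (@filterS _ _ (ae_filter_ringOfSetsType mu)). Qed.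

Lemma aeS2 (P Q S : R -> Prop) : (forall x, P x -> Q x -> S x) ->
  {ae mu, forall x, P x} -> {ae mu, forall x, Q x} -> {ae mu, forall x, S x}.
Proof.
by move=> PQ; apply: (@filterS2 _ _ (ae_filter_ringOfSetsType mu)).
Qed.

Lemma sin_le (x : R) : 0 <= x -> sin x <= x.
Proof.
move=> x0.
have [|c _] := @MVT_segment R sin cos 0 x x0 (fun y _ => is_derive_sin y).
  by apply: continuous_subspaceT => y; exact: continuous_sin.
by rewrite sin0 !subr0 => ->; rewrite -[leRHS]mul1r ler_wpM2r// cos_le1.
Qed.

Lemma sin2_le (x : R) : sin x ^+ 2 <= x ^+ 2.
Proof.
wlog x0 : x / 0 <= x.
  move=> H; have [x0|x0] := leP 0 x; first exact: H.
  by have := H (- x); rewrite sinN !sqrrN; apply; lra.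
have [x1|x1] := leP x 1.
  have s0 : 0 <= sin x.
    by apply: sin_ge0_pi; rewrite x0 (le_trans x1)// (le_trans _ (@pi_ge2 R))//; lra.
  by have := sin_le x0; nra.
have := sin_le1 x; have := sin_geN1 x; nra.
Qed.

Lemma one_sub_cos (h : R) : 1 - cos h = 2 * sin (h / 2) ^+ 2.
Proof.
have -> : cos h = cos (h / 2 *+ 2) by congr cos; rewrite -mulr_natr; field.
by rewrite cos_mulr2n cos2sin2 -mulr_natr; ring.
Qed.

Lemma one_sub_cos_ge0 (h : R) : 0 <= 1 - cos h.
Proof. by rewrite subr_ge0 cos_le1. Qed.

Lemma one_sub_cos_le (h : R) : 1 - cos h <= 2 * Num.min 1 (h ^+ 2).
Proof.
have := sin2_le (h / 2); rewrite one_sub_cos exprMn => H1.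
have := sin_le1 (h / 2); have := sin_geN1 (h / 2) => a b.
have c := sqr_ge0 h.
by rewrite /Num.min; case: ifP => _; nra.
Qed.

Lemma measurable_onesubcos (k : R) : measurable_fun setT (fun h : R => 1 - cos (k * h)).
Proof. by apply: measurable_funB => //; exact: measurable_cosk. Qed.

Lemma symbol_lty (s : R) : 0 < s < 1 -> (\int[mu]_h ((1 - cos h) * kern s h)%:E < +oo)%E.
Proof.
move=> s01.
have mcos : measurable_fun setT (fun h : R => (1 - cos h) * kern s h).
  apply: measurable_funM; last exact: measurable_kern.
  by apply: measurable_funB => //; exact: measurable_cos.
have mmin : measurable_fun setT (fun h : R => Num.min 1 (h ^+ 2) * kern s h).
  apply: measurable_funM; last exact: measurable_kern.
  by apply: measurable_minr => //; exact: exprn_measurable.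
apply: (@le_lt_trans _ _ (\int[mu]_h (2%:E * (Num.min 1 (h ^+ 2) * kern s h)%:E))%E).
  apply: ge0_le_integral => //.
  - by move=> h _; rewrite lee_fin mulr_ge0 ?kern_ge0 ?one_sub_cos_ge0.
  - exact/measurable_EFinP.
  - by apply: measurable_funeM; exact/measurable_EFinP.
  - by move=> h _; rewrite -EFinM lee_fin mulrA ler_wpM2r ?kern_ge0 ?one_sub_cos_le.
rewrite ge0_integralZl//.
- by apply: lte_mul_pinfty => //; exact: kern_min_lty.
- exact/measurable_EFinP.
- by move=> h _; rewrite lee_fin mulr_ge0 ?kern_ge0// le_min ler01 sqr_ge0.
Qed.

Lemma symbol_gt0 (s : R) : 0 < s < 1 -> (0 < \int[mu]_h ((1 - cos h) * kern s h)%:E)%E.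
Proof.
move=> /andP[s0 s1].
have mcos : measurable_fun setT (fun h : R => (1 - cos h) * kern s h).
  apply: measurable_funM; last exact: measurable_kern.
  by apply: measurable_funB => //; exact: measurable_cos.
(* A lower bound of the integrand on [[1, 2]]: [cos] decreases there because [pi >= 2], and the
   kernel is smallest at [h = 2]. *)
pose m := (1 - cos 1) * ((2 : R) `^ (1 + 2 * s))^-1.
have m0 : 0 < m.
  rewrite mulr_gt0// ?invr_gt0 ?powR_gt0// subr_gt0; apply: cos_lt1.
  by rewrite ltr01 /= mulr2n; have := @pi_ge2 R; lra.
apply: (@lt_le_trans _ _ (\int[mu]_(h in `[1%R, 2%R]) m%:E)%E).
  rewrite integral_cst; last exact: measurable_itv.
  have e : lebesgue_measure (`[1, 2]%classic : set R) = 1%E.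
    by rewrite lebesgue_measure_itv /= lte_fin ltr1n -EFinB; congr EFin; lra.
  by rewrite [X in (_ < _ * X)%E](_ : _ = 1%E); [rewrite mule1 lte_fin|exact: e].
apply: (@le_trans _ _ (\int[mu]_(h in `[1%R, 2%R]) ((1 - cos h) * kern s h)%:E)%E).
  apply: ge0_le_integral => //.
  - by move=> x _; rewrite lee_fin ltW.
  - by apply/measurable_EFinP; exact: measurable_funTS.
  - move=> h /=; rewrite in_itv /= => /andP[h1 h2]; rewrite lee_fin.
    have pi2 := @pi_ge2 R.
    apply: ler_pM.
    + by rewrite subr_ge0 cos_le1.
    + by rewrite invr_ge0 powR_ge0.
    + rewrite lerD2l lerN2 leNgt ltr_cos ?in_itv /=; [rewrite -leNgt//|..].
        by apply/andP; split; lra.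
      by apply/andP; split; lra.
    + rewrite /kern ger0_norm; last by lra.
      rewrite lef_pV2 ?posrE ?powR_gt0//; last by lra.
      by apply: ge0_ler_powR; rewrite ?nnegrE; lra.
apply: ge0_subset_integral => //.
- exact/measurable_EFinP.
- by move=> x _; rewrite lee_fin mulr_ge0 ?kern_ge0 ?one_sub_cos_ge0.
Qed.

Definition kc (s h : R) : R := frac_cst s * kern s h.

Lemma frac_cstE (s : R) : frac_cst s = (\int[mu]_h ((1 - cos h) * kern s h))^-1.
Proof. by []. Qed.

Lemma frac_cst_gt0 (s : R) : 0 < s < 1 -> 0 < frac_cst s.
Proof.
move=> s01; rewrite frac_cstE invr_gt0 /Rintegral fine_gt0//.
by rewrite symbol_gt0// symbol_lty.
Qed.

Lemma kc_ge0 (s h : R) : 0 < s < 1 -> 0 <= kc s h.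
Proof. by move=> s01; rewrite mulr_ge0 ?kern_ge0// ltW// frac_cst_gt0. Qed.

Lemma measurable_kc (s : R) : measurable_fun setT (kc s).
Proof. by apply: measurable_funM => //; exact: measurable_kern. Qed.

Lemma kc_min_lty (s : R) : 0 < s < 1 ->
  (\int[mu]_h (Num.min 1 (h ^+ 2) * kc s h)%:E < +oo)%E.
Proof.
move=> s01; have c0 := ltW (frac_cst_gt0 s01).
have -> : (\int[mu]_h (Num.min 1 (h ^+ 2) * kc s h)%:E =
   \int[mu]_h ((frac_cst s)%:E * (Num.min 1 (h ^+ 2) * kern s h)%:E))%E.
  by apply: eq_integral => h _; rewrite -EFinM /kc mulrCA.
rewrite ge0_integralZl//.
- by apply: lte_mul_pinfty => //; exact: kern_min_lty.
- apply/measurable_EFinP; apply: measurable_funM; last exact: measurable_kern.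
  by apply: measurable_minr => //; exact: exprn_measurable.
- by move=> h _; rewrite lee_fin mulr_ge0 ?kern_ge0// le_min ler01 sqr_ge0.
Qed.

Lemma symbol_scale (s : R) (k : R) : 0 < k -> 0 < s < 1 ->
  \int[mu]_h ((1 - cos (k * h)) * kern s h) = k `^ (2 * s) * \int[mu]_h ((1 - cos h) * kern s h).
Proof.
move=> k0 s01.
have mcos : measurable_fun setT (fun h : R => (1 - cos h) * kern s h).
  apply: measurable_funM; last exact: measurable_kern.
  by apply: measurable_funB => //; exact: measurable_cos.
pose F h : \bar R := ((1 - cos h) * kern s h)%:E.
have kF h : kern s (k * h) = (k `^ (1 + 2 * s))^-1 * kern s h.
  rewrite /kern normrM (gtr0_norm k0) powRM ?(ltW k0)// invfM //.
have E : (\int[mu]_h ((1 - cos (k * h)) * kern s h)%:E =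
   (k `^ (2 * s))%:E * \int[mu]_h F h)%E.
  transitivity (\int[mu]_h (k `^ (1 + 2 * s) * ((1 - cos (k * h + 0)) * kern s (k * h + 0)))%:E)%E.
    apply: eq_integral => h _; rewrite addr0 kF; congr EFin.
    by field; rewrite gt_eqF// powR_gt0.
  rewrite ge0_integral_cmul; [|exact: measurableT|exact: powR_ge0| |]; first last.
  - by move=> h _; rewrite mulr_ge0 ?kern_ge0 ?one_sub_cos_ge0.
  - apply: (measurableT_comp mcos).
    by apply: measurable_funD => //; exact: mulrl_measurable.
  rewrite (@ge0_integral_affine R F k 0); [|exact/measurable_EFinP| |exact: k0]; last first.
    by move=> h; rewrite lee_fin mulr_ge0 ?kern_ge0 ?one_sub_cos_ge0.
  rewrite muleA -EFinM; congr (_%:E * _)%E.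
  rewrite addrC powRD; last by rewrite (gt_eqF k0) implybT.
  by rewrite powRr1 ?(ltW k0)// mulfK// gt_eqF.
rewrite /Rintegral E fineM// ge0_fin_numE; first exact: symbol_lty.
by apply: integral_ge0 => h _; rewrite lee_fin mulr_ge0 ?kern_ge0 ?one_sub_cos_ge0.
Qed.

Lemma symbol_int (s : R) (k : nat) : 0 < s < 1 ->
  mu.-integrable setT (fun h => ((1 - cos (k%:R * h)) * kc s h)%:E).
Proof.
move=> s01; have c0 := ltW (frac_cst_gt0 s01).
have mmin : measurable_fun setT (fun h : R => Num.min 1 (h ^+ 2) * kc s h).
  apply: measurable_funM; last exact: measurable_kc.
  by apply: measurable_minr => //; exact: exprn_measurable.
have K0 : 0 <= 2 * (1 + k%:R ^+ 2) :> R by rewrite mulr_ge0// addr_ge0// sqr_ge0.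
apply: (@integrable_dom _ _ _ mu setT _ (fun h => 2 * (1 + k%:R ^+ 2) * (Num.min 1 (h ^+ 2) * kc s h))) => //.
- by apply: measurable_funM; [exact: measurable_onesubcos|exact: measurable_kc].
- move=> h _; rewrite ger0_norm; last first.
    by apply: mulr_ge0; [exact: one_sub_cos_ge0|exact: kc_ge0].
  rewrite [leRHS]mulrA; apply: ler_wpM2r; first exact: kc_ge0.
  apply: (le_trans (one_sub_cos_le _)); rewrite -mulrA; apply: ler_wpM2l => //.
  rewrite exprMn; have c := sqr_ge0 h; have d := sqr_ge0 (k%:R : R).
  by rewrite /Num.min; case: ifP => h1; case: ifP => h2; nra.
- apply: integrable_cmul => //; apply: integrable_ge0 => //.
    by move=> h _; rewrite mulr_ge0 ?kc_ge0// le_min ler01 sqr_ge0.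
  exact: kc_min_lty.
Qed.

(** [frac_cst] is the reciprocal of the integral for [k = 1], and the change of variables [h -> k h]
    produces [k^(2s)]. For [k = 0] both sides are 0, since [0^(2s) = 0]. *)
Lemma symbolE (s : R) (k : nat) : 0 < s < 1 ->
  \int[mu]_h ((1 - cos (k%:R * h)) * kc s h) = k%:R `^ (2 * s).
Proof.
move=> s01; have [s0 s1] := andP s01; have c0 := frac_cst_gt0 s01.
have [->|k0] := eqVneq k 0%N.
  under eq_Rintegral do rewrite mul0r cos0 subrr mul0r.
  by rewrite Rintegral_cst// mul0r powR0// mulf_eq0 negb_or gt_eqF//= gt_eqF.
have kp : 0 < k%:R :> R by rewrite ltr0n lt0n.
under eq_Rintegral do rewrite /kc mulrCA.
rewrite Rintegral_cmul//; last first.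
  have := integrable_cmul measurableT (frac_cst s)^-1 (symbol_int k s01).
  apply: eq_integrable => // h _; rewrite /kc; congr EFin; field; by rewrite gt_eqF.
rewrite symbol_scale// mulrCA -[frac_cst s]invrK frac_cstE invrK mulVf ?mulr1//.
by rewrite gt_eqF// -invr_gt0 -frac_cstE.
Qed.

Lemma cos_eq1 (z : R) : cos z = 1 -> exists n : int, z = tau *~ n.
Proof.
move=> cz; have t0 := @tau_gt0 R.
pose n := Num.floor (z / tau); pose z0 := z - tau *~ n.
have z0I : 0 <= z0 < tau.
  have := Num.Theory.floor_itv (z / tau); rewrite -/n => /andP[a b].
  rewrite /z0 -mulrzr; move: a b; rewrite ler_pdivlMr// ltr_pdivrMr// intrD.
  by rewrite mulrC => a b; apply/andP; split; lra.
exists n; apply/eqP; rewrite -subr_eq0 -/z0; apply/eqP.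
have [/andP[z1 z2]|] := boolP (0 < z0 < tau).
  have := cos_lt1 (introT andP (conj z1 z2)).
  have -> : cos z0 = cos z by rewrite /z0 -mulrNz (periodicz (@cosD2pi R)).
  by rewrite cz ltxx.
by move: z0I => /andP[z1 ->]; rewrite andbT lt_neqAle z1 andbT negbK => /eqP.
Qed.

(** The lattice sum inside [per_kernel] before [fine] is applied; in this form it can be integrated
    before it is known to be finite. *)
Definition Hsum (s z : R) : \bar R := \esum_(n in [set: int]) (kern s (z - tau *~ n))%:E.

Lemma HsumE (s z : R) : (Hsum s z = \sum_(k <oo) (kern s (z - tau *~ int_of_nat k))%:E)%E.
Proof.
rewrite /Hsum (@reindex_esum R _ _ _ _ _ _ int_of_nat_bij) -nneseries_esumT//.
by move=> n; rewrite lee_fin kern_ge0.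
Qed.

Lemma Hsum_ge0 (s z : R) : (0 <= Hsum s z)%E.
Proof. by apply: esum_ge0 => n _; rewrite lee_fin kern_ge0. Qed.

Lemma measurable_Hsum (s x : R) : measurable_fun setT (fun y : R => Hsum s (x - y)).
Proof.
under eq_fun do rewrite HsumE.
have := @ge0_emeasurable_sum _ R R setT (fun k y => (kern s (x - y - tau *~ int_of_nat k))%:E) xpredT.
apply.
- by move=> k y _ _; rewrite lee_fin kern_ge0.
- move=> k _; apply/measurable_EFinP; apply: (measurableT_comp (measurable_kern s)).
  by apply: measurable_funB => //; exact: measurable_funB.
Qed.

Lemma per_kernelE (s z : R) : per_kernel s z = frac_cst s * fine (Hsum s z).
Proof. by []. Qed.

Lemma unfold_Hsum (F : R -> R) (s x : R) : measurable_fun setT F -> (forall y, 0 <= F y) ->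
  periodic F tau ->
  (\int[mu]_(y in I) ((F y)%:E * Hsum s (x - y)) = \int[mu]_h (F (x + h) * kern s h)%:E)%E.
Proof.
move=> mF F0 pF; rewrite (@unfold_ge0 R F (kern s) x mF F0 pF (measurable_kern s) (kern_ge0 s)).
by apply: eq_integral => h _; rewrite kernN.
Qed.

(** Integrated in [y] over a period against [1 - cos (x - y)], the sum unfolds to the finite
    integral that defines [frac_cst]. Hence the product is finite almost everywhere, and the weight
    is positive off the countable set [x - tau n]. *)
Lemma Hsum_fin_ae (s x : R) : 0 < s < 1 -> {ae mu, forall y, I y -> Hsum s (x - y) \is a fin_num}.
Proof.
move=> s01; have mI := @measurable_per R.
have mF : measurable_fun setT (fun y : R => 1 - cos (x - y)).
  by apply: measurable_funB => //; apply: (measurableT_comp measurable_cos); exact: measurable_funB.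
have iF : mu.-integrable I (fun y => ((1 - cos (x - y))%:E * Hsum s (x - y))%E).
  apply/integrableP; split.
    apply: measurable_funTS; apply: emeasurable_funM; first exact/measurable_EFinP.
    exact: measurable_Hsum.
  have -> : (\int[mu]_(y in I) `|((1 - cos (x - y))%:E * Hsum s (x - y))| =
      \int[mu]_(y in I) ((1 - cos (x - y))%:E * Hsum s (x - y)))%E.
    by apply: eq_integral => y _; rewrite gee0_abs// mule_ge0 ?Hsum_ge0// lee_fin one_sub_cos_ge0.
  rewrite unfold_Hsum//.
  - under eq_integral do rewrite opprD addNKr cosN.
    exact: symbol_lty.
  - by move=> y; rewrite (@periodic_subl R (@cos R) x (@cosD2pi R)).
have N0 : mu.-negligible [set y | cos (x - y) = 1].
  pose N := [set x - tau *~ n | n in [set: int]].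
  have cN : countable N.
    by apply: (@card_le_trans _ _ _ [set: int]); [exact: card_image_le|exact: countableP].
  exists N; split.
  - exact: countable_measurable.
  - exact: countable_lebesgue_measure0.
  - move=> y /= /cos_eq1 [n nE]; exists n => //.
    by rewrite -nE opprB addrC subrK.
have A : {ae mu, forall y, cos (x - y) <> 1}.
  case: N0 => N [mN N00 sN]; exists N; split => // y /= h; apply: sN.
  exact: contrapT.
have B := integrable_ae mI iF.
apply: (aeS2 _ A B) => y /= cy hy Iy.
have {}hy := hy Iy.
have c0 : 0 < 1 - cos (x - y).
  by rewrite lt_neqAle one_sub_cos_ge0 andbT eq_sym subr_eq0 eq_sym; apply/eqP.
have := Hsum_ge0 s (x - y); move: hy; case: (Hsum s (x - y)) => [r| |] //=.
by rewrite gt0_muley ?lte_fin.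
Qed.

Lemma unfold_kernel_ge0 (F : R -> R) (s x : R) : 0 < s < 1 -> measurable_fun setT F ->
  (forall y, 0 <= F y) -> periodic F tau ->
  (\int[mu]_(y in I) (F y * per_kernel s (x - y))%:E = \int[mu]_h (F (x + h) * kc s h)%:E)%E.
Proof.
move=> s01 mF F0 pF; have mI := @measurable_per R; have c0 := ltW (frac_cst_gt0 s01).
transitivity ((frac_cst s)%:E * \int[mu]_(y in I) ((F y)%:E * Hsum s (x - y)))%E.
  rewrite -ge0_integralZl//; last 2 first.
  - apply: measurable_funTS; apply: emeasurable_funM; first exact/measurable_EFinP.
    exact: measurable_Hsum.
  - by move=> y _; rewrite mule_ge0 ?Hsum_ge0// lee_fin.
  apply: ge0_ae_eq_integral => //.
  - apply/measurable_EFinP; apply: measurable_funTS; apply: measurable_funM => //.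
    apply: measurable_funM => //; apply: measurableT_comp (measurable_Hsum s x).
    exact: fine_measurable.
  - apply: measurable_funTS; apply: measurable_funeM; apply: emeasurable_funM.
      exact/measurable_EFinP.
    exact: measurable_Hsum.
  - move=> y _; rewrite lee_fin mulr_ge0// per_kernelE mulr_ge0// fine_ge0//; exact: Hsum_ge0.
  - by move=> y _; rewrite !mule_ge0 ?Hsum_ge0 ?lee_fin.
  apply: aeS (Hsum_fin_ae x s01) => y h Iy.
  rewrite per_kernelE mulrCA EFinM EFinM fineK//; exact: h.
rewrite unfold_Hsum// -ge0_integralZl//.
- by apply: eq_integral => h _; rewrite -EFinM mulrCA.
- apply/measurable_EFinP; apply: measurable_funM; last exact: measurable_kern.
  by apply: (measurableT_comp mF); exact: measurable_funD.
- by move=> h _; rewrite lee_fin mulr_ge0 ?kern_ge0.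
Qed.

Lemma unfold_kernel (F : R -> R) (s x : R) : 0 < s < 1 -> measurable_fun setT F ->
  periodic F tau ->
  (\int[mu]_(y in I) (F y * per_kernel s (x - y))%:E = \int[mu]_h (F (x + h) * kc s h)%:E)%E.
Proof.
move=> s01 mF pF; have mI := @measurable_per R; have c0 := ltW (frac_cst_gt0 s01).
have pk0 z : 0 <= per_kernel s z.
  by rewrite per_kernelE mulr_ge0// fine_ge0//; exact: Hsum_ge0.
rewrite [LHS]integral_maxr [RHS]integral_maxr; congr (_ - _)%E.
  transitivity (\int[mu]_(y in I) (Num.max (F y) 0 * per_kernel s (x - y))%:E)%E.
    by apply: eq_integral => y _; rewrite maxr_pMl// mul0r.
  rewrite (@unfold_kernel_ge0 (fun y => Num.max (F y) 0))//.
  - by apply: eq_integral => h _; rewrite maxr_pMl ?mul0r// kc_ge0.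
  - exact: max0_measurable.
  - by move=> y; rewrite le_max lexx orbT.
  - by move=> y; rewrite pF.
transitivity (\int[mu]_(y in I) (Num.max (- F y) 0 * per_kernel s (x - y))%:E)%E.
  by apply: eq_integral => y _; rewrite maxr_pMl// mul0r mulNr.
rewrite (@unfold_kernel_ge0 (fun y => Num.max (- F y) 0))//.
- by apply: eq_integral => h _; rewrite maxr_pMl ?mul0r ?mulNr// kc_ge0.
- by apply: max0_measurable; exact: measurableT_comp.
- by move=> y; rewrite le_max lexx orbT.
- by move=> y; rewrite pF.
Qed.

End symbol.

(** * The weak formulation *)

Section weak_form.
Context {R : realType}.
Notation mu := (@lebesgue_measure R).
Local Notation tau := ((pi : R) *+ 2).
Local Notation I := (@per_itv R).

Lemma ae_shift (P : R -> Prop) (c : R) :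
  {ae mu, forall x, P x} -> {ae mu, forall x, P (x + c)}.
Proof.
move=> [N [mN N0 sN]].
have mNc : measurable [set x : R | N (x + c)].
  by have := @measurable_shift_set R N (- c) mN; under eq_fun do rewrite opprK.
exists [set x : R | N (x + c)]; split => //; last by move=> x h; apply: sN.
have := @integral_indic _ _ R mu setT measurableT _ mNc.
rewrite setIT => <-.
have := @integral_indic _ _ R mu setT measurableT _ mN.
rewrite setIT => h; have {}h : (\int[mu]_x (\1_N x)%:E = 0)%E by rewrite h; exact: N0.
rewrite -[RHS]h -(@ge0_integral_shift R (fun x => (\1_N x)%:E) c).
- by apply: eq_integral => x _.
- by apply/measurable_EFinP; exact: measurable_indic.
- by move=> x; rewrite lee_fin indicE; case: (_ \in _).
Qed.

(** Elements of [X_space] are periodic only almost everywhere; this version is periodic at every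
    point and keeps the values on [[0, tau[]. *)
Definition per_rep (u : R -> R) : R -> R := fun x => u (x - tau *~ Num.floor (x / tau)).

Lemma per_rep_periodic (u : R -> R) : periodic (per_rep u) tau.
Proof.
move=> x; rewrite /per_rep; have t0 := @tau_gt0 R.
have -> : Num.floor ((x + tau) / tau) = Num.floor (x / tau) + 1.
  rewrite mulrDl divff ?gt_eqF//; apply: floor_def.
  have /andP[a b] := Num.Theory.floor_itv (x / tau).
  by rewrite !intrD lerD2r a /= -intrD ltrD2r b.
by rewrite mulrzDr mulr1z opprD addrACA subrr addr0.
Qed.

Lemma per_rep_eq (u : R -> R) (x : R) : 0 <= x < tau -> per_rep u x = u x.
Proof.
move=> /andP[x0 xt]; rewrite /per_rep; have t0 := @tau_gt0 R.
rewrite (@floor_def _ _ 0); first by rewrite mulr0z subr0.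
by rewrite divr_ge0 ?(ltW t0)//= ltr_pdivrMr// mul1r.
Qed.

Lemma per_rep_measurable (u : R -> R) : measurable_fun setT u -> measurable_fun setT (per_rep u).
Proof.
move=> mu_; apply: (measurableT_comp mu_); apply: measurable_funB => //.
have -> : (fun x : R => tau *~ Num.floor (x / tau)) = (fun x => tau * (Num.floor (x / tau))%:~R).
  by apply/funext => x; rewrite mulrzr.
apply: measurable_funM => //.
apply: nondecreasing_measurable => // x y xy.
by rewrite ler_int le_floor// ler_pM2r// invr_gt0 tau_gt0.
Qed.

(** The exceptional null set is translated by every multiple of [tau]; off the countable union,
    periodicity holds along the whole orbit of [x]. *)
Lemma per_rep_ae (u : R -> R) : {ae mu, forall x, u (x + tau) = u x} ->
  {ae mu, forall x, u x = per_rep u x}.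
Proof.
move=> h.
have H (k : nat) : {ae mu, forall x, u (x + tau *~ int_of_nat k + tau) = u (x + tau *~ int_of_nat k)}.
  exact: (ae_shift (tau *~ int_of_nat k) h).
have {}H := ae_foralln H.
apply: aeS H => x H.
have Hz (n : int) : u (x + tau *~ (n + 1)) = u (x + tau *~ n).
  have [_ _ /(_ n Logic.I) [k _ <-]] := int_of_nat_bij.
  by rewrite mulrzDr mulr1z addrA H.
have Hn (n : nat) : u (x + tau *~ n%:Z) = u x.
  elim: n => [|n IH]; first by rewrite mulr0z addr0.
  by rewrite -[in LHS](addn1 n) PoszD Hz.
have Hm (n : nat) : u (x + tau *~ (- n%:Z)) = u x.
  elim: n => [|n IH]; first by rewrite oppr0 mulr0z addr0.
  by rewrite -[RHS]IH -Hz -[in LHS](addn1 n) PoszD opprD addrNK.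
rewrite /per_rep -mulrNz; case: (Num.floor _) => n; first by rewrite Hm.
by rewrite NegzE opprK Hn.
Qed.

Definition dsq (s : R) (u : R -> R) (x h : R) : R := (u x - u (x + h)) ^+ 2 * kc s h.
(** The energy after unfolding: the increment [h] runs over the whole line with the kernel of the
    line, so that translation invariance can be used for each fixed [h]. *)
Definition En (s : R) (u : R -> R) : \bar R := (\int[mu]_(x in I) \int[mu]_h (dsq s u x h)%:E)%E.

Lemma dsq_ge0 (s : R) (u : R -> R) (x h : R) : 0 < s < 1 -> 0 <= dsq s u x h.
Proof. by move=> s01; rewrite mulr_ge0 ?sqr_ge0 ?kc_ge0. Qed.

Lemma measurable_shift2 (u : R -> R) : measurable_fun setT u ->
  measurable_fun setT (fun z : R * R => u (z.1 + z.2)).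
Proof. by move=> mu_; apply: (measurableT_comp mu_); exact: measurable_funD. Qed.

Lemma measurable_fst2 (u : R -> R) : measurable_fun setT u ->
  measurable_fun setT (fun z : R * R => u z.1).
Proof. by move=> mu_; apply: (measurableT_comp mu_). Qed.

Lemma measurable_snd2 (u : R -> R) : measurable_fun setT u ->
  measurable_fun setT (fun z : R * R => u z.2).
Proof. by move=> mu_; apply: (measurableT_comp mu_). Qed.

Lemma measurable_diff2 (u : R -> R) : measurable_fun setT u ->
  measurable_fun setT (fun z : R * R => u z.1 - u (z.1 + z.2)).
Proof.
by move=> mu_; apply: measurable_funB; [exact: measurable_fst2|exact: measurable_shift2].
Qed.

Lemma measurable_dsq (s : R) (u : R -> R) : measurable_fun setT u ->
  measurable_fun setT (fun z : R * R => dsq s u z.1 z.2).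
Proof.
move=> mu_; apply: measurable_funM; last exact: (measurable_snd2 (measurable_kc s)).
by apply: measurable_funX; exact: measurable_diff2.
Qed.

Lemma measurable_dsq1 (s : R) (u : R -> R) (x : R) : measurable_fun setT u -> measurable_fun setT (dsq s u x).
Proof.
move=> mu_; apply: measurable_funM; last exact: measurable_kc.
apply: measurable_funX; apply: measurable_funB => //; apply: (measurableT_comp mu_).
exact: measurable_funD.
Qed.

Lemma measurable_dsq_int (s : R) (u : R -> R) : measurable_fun setT u ->
  measurable_fun setT (fun x => \int[mu]_h (dsq s u x h)%:E)%E.
Proof. by move=> mu_; apply: measurable_eint => //; exact: measurable_dsq. Qed.

Lemma energyE (s : R) (u : R -> R) : 0 < s < 1 -> measurable_fun setT u -> periodic u tau ->
  (\int[mu]_(x in I) \int[mu]_(y in I) ((u x - u y) ^+ 2 * per_kernel s (x - y))%:E = En s u)%E.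
Proof.
move=> s01 mu_ pu; apply: eq_integral => x _.
rewrite (@unfold_kernel_ge0 R (fun y => (u x - u y) ^+ 2) s x)//.
- by apply: measurable_funX; exact: measurable_funB.
- by move=> y; exact: sqr_ge0.
- by move=> y; rewrite pu.
Qed.

Lemma energyD (s : R) (u v : R -> R) : 0 < s < 1 -> measurable_fun setT u -> measurable_fun setT v ->
  (En s u < +oo)%E -> (En s v < +oo)%E -> (En s (u \+ v)%R < +oo)%E.
Proof.
move=> s01 mu_ mv Eu Ev; have mI := @measurable_per R.
have muv : measurable_fun setT (u \+ v) by exact: measurable_funD.
have i0 w x : (0 <= \int[mu]_h (dsq s w x h)%:E)%E.
  by apply: integral_ge0 => h _; rewrite lee_fin dsq_ge0.
apply: (@le_lt_trans _ _ (\int[mu]_(x in I) (2%:E * \int[mu]_h (dsq s u x h)%:E +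
     2%:E * \int[mu]_h (dsq s v x h)%:E))%E).
  apply: ge0_le_integral => //.
  - by apply: measurable_funTS; exact: measurable_dsq_int.
  - apply: measurable_funTS; apply: emeasurable_funD; apply: measurable_funeM;
      exact: measurable_dsq_int.
  move=> x _; rewrite -!ge0_integral_cmul//; last 4 first.
  - exact: measurable_dsq1.
  - by move=> h _; exact: dsq_ge0.
  - exact: measurable_dsq1.
  - by move=> h _; exact: dsq_ge0.
  have m2 w : measurable_fun setT w -> measurable_fun setT (fun h => 2 * dsq s w x h).
    by move=> mw; apply: measurable_funM => //; exact: measurable_dsq1.
  rewrite -ge0_integralD//; last 4 first.
  - by move=> h _; rewrite lee_fin mulr_ge0 ?dsq_ge0.
  - by apply/measurable_EFinP; exact: m2.
  - by move=> h _; rewrite lee_fin mulr_ge0 ?dsq_ge0.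
  - by apply/measurable_EFinP; exact: m2.
  apply: ge0_le_integral => //.
  - by move=> h _; rewrite lee_fin dsq_ge0.
  - by apply/measurable_EFinP; exact: measurable_dsq1.
  - by apply: emeasurable_funD; apply/measurable_EFinP; exact: m2.
  move=> h _; rewrite -EFinD lee_fin /dsq /= mulrA [X in _ <= _ + X]mulrA -mulrDl.
  apply: ler_wpM2r; first exact: kc_ge0.
  set a := u x; set b := v x; set c := u (x + h); set d := v (x + h).
  have := sqr_ge0 ((a - c) - (b - d)); nra.
rewrite ge0_integralD//; last 4 first.
- by move=> x _; rewrite mule_ge0.
- by apply: measurable_funTS; apply: measurable_funeM; exact: measurable_dsq_int.
- by move=> x _; rewrite mule_ge0.
- by apply: measurable_funTS; apply: measurable_funeM; exact: measurable_dsq_int.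
rewrite !ge0_integralZl//.
- by apply: lte_add_pinfty; apply: lte_mul_pinfty.
- by apply: measurable_funTS; exact: measurable_dsq_int.
- by apply: measurable_funTS; exact: measurable_dsq_int.
Qed.

(** The increment is at most [2 M] and at most [M |h|], so its square is at most
    [4 M^2 min(1, h^2)], which the kernel integrates. *)
Lemma energy_lip (s : R) (v : R -> R) (M : R) : 0 < s < 1 -> measurable_fun setT v ->
  (forall x, `|v x| <= M) -> (forall x y, `|v x - v y| <= M * `|x - y|) ->
  (En s v < +oo)%E.
Proof.
move=> s01 mv vM vL; have mI := @measurable_per R.
have M0 : 0 <= M by apply: le_trans (vM 0).
have mmin : measurable_fun setT (fun h : R => Num.min 1 (h ^+ 2) * kc s h).
  apply: measurable_funM; last exact: measurable_kc.
  by apply: measurable_minr => //; exact: exprn_measurable.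
have min0 (h : R) : 0 <= Num.min 1 (h ^+ 2) * kc s h.
  by rewrite mulr_ge0 ?kc_ge0// le_min ler01 sqr_ge0.
pose K := (\int[mu]_h (4 * M ^+ 2 * (Num.min 1 (h ^+ 2) * kc s h))%:E)%E.
have K0 : (0 <= K)%E by apply: integral_ge0 => h _; rewrite lee_fin mulr_ge0// mulr_ge0// sqr_ge0.
have Kfin : (K < +oo)%E.
  rewrite /K ge0_integral_cmul//; last by rewrite mulr_ge0// sqr_ge0.
  by apply: lte_mul_pinfty => //; [rewrite lee_fin mulr_ge0// sqr_ge0|exact: kc_min_lty].
apply: (@le_lt_trans _ _ (\int[mu]_(x in I) K)%E); last first.
  by rewrite integral_cst// lte_mul_pinfty// ?ge0_fin_numE//; exact: per_fin.
apply: ge0_le_integral => //.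
- by move=> x _; apply: integral_ge0 => h _; rewrite lee_fin dsq_ge0.
- by apply: measurable_funTS; exact: measurable_dsq_int.
move=> x _; apply: ge0_le_integral => //.
- by move=> h _; rewrite lee_fin dsq_ge0.
- by apply/measurable_EFinP; exact: measurable_dsq1.
- by apply/measurable_EFinP; exact: measurable_funM.
move=> h _; rewrite lee_fin /dsq [leRHS]mulrA; apply: ler_wpM2r; first exact: kc_ge0.
have n0 : 0 <= `|v x - v (x + h)| by [].
have h0 : 0 <= `|h| by [].
have a1 : `|v x - v (x + h)| <= 2 * M.
  by apply: (le_trans (ler_normB _ _)); have := vM x; have := vM (x + h); lra.
have a2 : `|v x - v (x + h)| <= M * `|h|.
  by have := vL x (x + h); rewrite opprD addNKr normrN.
have hh : `|h| ^+ 2 = h ^+ 2 by rewrite real_normK// num_real.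
rewrite -[X in X <= _]real_normK ?num_real//.
have b0 : 0 <= M * `|h| by rewrite mulr_ge0.
rewrite /Num.min; case: ifP => _.
  by rewrite mulr1; nra.
by rewrite -hh; have : (M * `|h|) ^+ 2 = M ^+ 2 * `|h| ^+ 2 by [rewrite exprMn]; nra.
Qed.

Lemma continuous_periodic_bounded (v : R -> R) : continuous v -> periodic v tau ->
  exists M, forall x, `|v x| <= M.
Proof.
move=> cv pv; have t0 := @tau_gt0 R.
have [|c _ h] := @EVT_max R (fun x => `|v x|) 0 tau (ltW t0).
  apply: continuous_subspaceT => x.
  by apply: continuous_comp; [exact: cv|exact: norm_continuous].
exists `|v c| => x.
have -> : v x = per_rep v x by rewrite /per_rep -mulrNz periodicz.
apply: h; rewrite in_itv /=.
have := Num.Theory.floor_itv (x / tau) => /andP[a b].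
rewrite -mulrzr; move: a b; rewrite ler_pdivlMr// ltr_pdivrMr// intrD.
by rewrite mulrC => a b; apply/andP; split; lra.
Qed.

Lemma derivable_lipschitz (v : R -> R) (M : R) : (forall x, derivable v x 1) ->
  (forall x, `|derive1 v x| <= M) -> forall x y, `|v x - v y| <= M * `|x - y|.
Proof.
move=> dv vM.
have H x y : x <= y -> `|v x - v y| <= M * `|x - y|.
  move=> xy.
  have [||c _ E] := @MVT_segment R v (derive1 v) x y xy.
  - by move=> z _; apply: DeriveDef => //; rewrite derive1E.
  - apply: continuous_subspaceT => z.
    exact/differentiable_continuous/derivable1_diffP/dv.
  by rewrite distrC E normrM [`|x - y|]distrC ler_wpM2r.
move=> x y; have [xy|xy] := leP x y; first exact: H.
by rewrite distrC [`|x - y|]distrC; apply: H; exact: ltW.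
Qed.

Lemma C1_facts (v : R -> R) : C1_periodic v ->
  [/\ measurable_fun setT v, periodic v tau & exists M, (forall x, `|v x| <= M) /\
     (forall x y, `|v x - v y| <= M * `|x - y|)].
Proof.
move=> [pv dv cv].
have cv0 : continuous v.
  by move=> x; exact/differentiable_continuous/derivable1_diffP/dv.
split => //; first exact: continuous_measurable_fun.
have [M1 h1] := continuous_periodic_bounded cv0 pv.
have pd : periodic (derive1 v) tau.
  move=> x; rewrite /derive1.
  suff -> : (fun h => h^-1 *: (v (h + (x + tau)) - v (x + tau))) =
     (fun h => h^-1 *: (v (h + x) - v x)) by [].
  by apply/funext => h; rewrite addrA !pv.
have [M2 h2] := continuous_periodic_bounded cv pd.
exists (Num.max M1 M2); split => [x|x y].
  by rewrite le_max h1.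
apply: (le_trans (derivable_lipschitz dv h2 x y)).
by apply: ler_wpM2r => //; rewrite le_max lexx orbT.
Qed.

(** A single approximant [v] at distance less than 1 is enough: [u - v] has finite norm by
    definition of the closure, [v] has finite energy because it is Lipschitz and bounded, and
    finiteness passes to the sum. The norm only sees values on [per_itv], where [u] and [per_rep u]
    coincide. *)
Lemma X_space_rep (s : R) (u : R -> R) : 0 < s < 1 -> X_space s u ->
  [/\ measurable_fun setT (per_rep u), {ae mu, forall x, u x = per_rep u x},
     (En s (per_rep u) < +oo)%E & (\int[mu]_(x in I) (per_rep u x ^+ 2)%:E < +oo)%E].
Proof.
move=> s01 [mu_ pu app]; have mI := @measurable_per R.
have mw := per_rep_measurable mu_; have pw := per_rep_periodic u.
have [v C1v uv] := app 1 ltr01.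
have [mv pv [M [vM vL]]] := C1_facts C1v.
have md : measurable_fun setT (per_rep u \- v) by exact: measurable_funB.
have pd : periodic (per_rep u \- v) tau by move=> x /=; rewrite pw pv.
have onI x : I x -> per_rep u x = u x.
  by rewrite /per_itv /= in_itv /= => /andP[h1 h2]; rewrite per_rep_eq// (ltW h1).
have sq : (X_sqnorm s (u \- v)%R < +oo)%E.
  rewrite ltey; apply/negP => /eqP E; move: uv; rewrite /X_norm E.
  by rewrite (@eqy_poweR R _ 2^-1)// ?invr_gt0.
have E1 : X_sqnorm s (u \- v) = ((2^-1)%:E * En s (per_rep u \- v)%R +
    \int[mu]_(x in I) ((per_rep u \- v)%R x ^+ 2)%:E)%E.
  rewrite /X_sqnorm -(energyE s01 md pd).
  have -> : (\int[mu]_(x in I) \int[mu]_(y in I) (((u \- v)%R x - (u \- v)%R y) ^+ 2 *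
      per_kernel s (x - y))%:E = \int[mu]_(x in I) \int[mu]_(y in I)
      (((per_rep u \- v)%R x - (per_rep u \- v)%R y) ^+ 2 * per_kernel s (x - y))%:E)%E.
    apply: eq_integral => x /set_mem Ix; apply: eq_integral => y /set_mem Iy.
    by rewrite /= !onI.
  congr (_ + _)%E.
  by apply: eq_integral => x /set_mem Ix; rewrite /= onI.
have En0 w : (0 <= En s w)%E.
  by apply: integral_ge0 => x _; apply: integral_ge0 => h _; rewrite lee_fin dsq_ge0.
have S0 w : (0 <= \int[mu]_(x in I) ((w x : R) ^+ 2)%:E)%E.
  by apply: integral_ge0 => x _; rewrite lee_fin sqr_ge0.
have [Ed Sd] : (En s (per_rep u \- v)%R < +oo)%E /\
    (\int[mu]_(x in I) ((per_rep u \- v)%R x ^+ 2)%:E < +oo)%E.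
  move: sq; rewrite E1; have := En0 (per_rep u \- v); have := S0 (per_rep u \- v).
  case: (En s _) => [a| |] //; case: (\int[mu]_(x in I) _)%E => [b| |] // _ _.
  - by rewrite !ltry.
  - by rewrite gt0_muley ?lte_fin ?invr_gt0.
  - by rewrite gt0_muley ?lte_fin ?invr_gt0.
have wE : per_rep u = (per_rep u \- v) \+ v by apply/funext => x /=; rewrite subrK.
have mv2 : measurable_fun I (fun x => M ^+ 2 + (per_rep u \- v)%R x ^+ 2).
  by apply: measurable_funTS; apply: measurable_funD => //; exact: measurable_funX.
have S1 : (\int[mu]_(x in I) (per_rep u x ^+ 2)%:E < +oo)%E.
  have i1 : mu.-integrable I (fun x => (2 * (M ^+ 2 + (per_rep u \- v)%R x ^+ 2))%:E).
    apply: integrable_cmul => //; apply: integrable_add => //.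
      by apply: integrable_cstR => //; exact: per_fin.
    apply: integrable_ge0 => //; first by apply: measurable_funTS; exact: measurable_funX.
    by move=> x _; exact: sqr_ge0.
  have i2 : mu.-integrable I (fun x => (per_rep u x ^+ 2)%:E).
    apply: (integrable_dom mI _ _ i1).
      by apply: measurable_funTS; exact: measurable_funX.
    move=> x _; rewrite ger0_norm ?sqr_ge0//=.
    have := vM x; rewrite ler_norml => /andP[a b].
    have := sqr_ge0 (per_rep u x - 2 * v x); have := sqr_ge0 (v x); nra.
  have := integrable_ae_lty i2.
  by under eq_integral do rewrite (ger0_norm (sqr_ge0 _)).
have S2 : (En s (per_rep u) < +oo)%E.
  by rewrite [per_rep u]wE; apply: (energyD s01 md mv Ed); exact: (energy_lip s01 mv vM vL).
split; [exact: mw|exact: per_rep_ae|exact: S2|exact: S1].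
Qed.

Lemma trig_X_space (s : R) (phi : R -> R) : C1_periodic phi -> X_space s phi.
Proof.
move=> C1; have [mphi pphi _] := C1_facts C1; split => //; first by apply: aeW.
move=> e e0; exists phi => //.
rewrite (_ : X_norm s (phi \- phi)%R = 0%E) ?lte_fin// /X_norm.
have -> : X_sqnorm s (phi \- phi) = 0%E.
  rewrite /X_sqnorm integral0_eq ?mule0 ?add0e; last first.
    move=> x _; apply: integral0_eq => y _.
    by rewrite /= !subrr expr0n /= mul0r.
  by apply: integral0_eq => y _; rewrite /= subrr expr0n.
by rewrite poweR_EFin powR0// invr_neq0.
Qed.

Lemma cos_C1 (k : nat) : C1_periodic (fun x : R => cos (k%:R * x)).
Proof.
have dk (x : R) : is_derive x 1 (fun x => cos (k%:R * x)) (- sin (k%:R * x) * k%:R).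
  apply: (@is_derive1_comp R cos (fun x => k%:R * x)).
  have h : is_derive x 1 (fun x : R => k%:R * x) (k%:R * 1) := is_deriveZ k%:R (is_derive_id x 1).
  by apply: (is_derive_eq h); rewrite mulr1.
split.
- exact: periodic_cosk.
- by move=> x; have [] := dk x.
- have -> : derive1 (fun x : R => cos (k%:R * x)) = (fun x => - sin (k%:R * x) * k%:R).
    by apply/funext => x; rewrite derive1E; have [_ ->] := dk x.
  move=> x; apply: cvgM; last exact: cvg_cst.
  apply: cvgN; apply: (@continuous_comp _ _ _ (fun x : R => k%:R * x) sin).
    exact: mulrl_continuous.
  exact: continuous_sin.
Qed.

Lemma sin_C1 (k : nat) : C1_periodic (fun x : R => sin (k%:R * x)).
Proof.
have dk (x : R) : is_derive x 1 (fun x => sin (k%:R * x)) (cos (k%:R * x) * k%:R).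
  apply: (@is_derive1_comp R sin (fun x => k%:R * x)).
  have h : is_derive x 1 (fun x : R => k%:R * x) (k%:R * 1) := is_deriveZ k%:R (is_derive_id x 1).
  by apply: (is_derive_eq h); rewrite mulr1.
split.
- exact: periodic_sink.
- by move=> x; have [] := dk x.
- have -> : derive1 (fun x : R => sin (k%:R * x)) = (fun x => cos (k%:R * x) * k%:R).
    by apply/funext => x; rewrite derive1E; have [_ ->] := dk x.
  move=> x; apply: cvgM; last exact: cvg_cst.
  apply: (@continuous_comp _ _ _ (fun x : R => k%:R * x) cos).
    exact: mulrl_continuous.
  exact: continuous_cos.
Qed.

Lemma L2_L1 (w : R -> R) : measurable_fun setT w ->
  (\int[mu]_(x in I) (w x ^+ 2)%:E < +oo)%E -> mu.-integrable I (fun x => (w x)%:E).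
Proof.
move=> mw w2; have mI := @measurable_per R.
apply: (@integrable_dom _ _ _ mu I mI (fun x => 1 + w x ^+ 2)).
- exact: measurable_funTS.
- move=> x _; rewrite ler_norml; have := sqr_ge0 (w x - 1); have := sqr_ge0 (w x + 1).
  by move=> a b; apply/andP; split; nra.
apply: integrable_add => //; first by apply: integrable_cstR => //; exact: per_fin.
apply: integrable_ge0 => //.
- by apply: measurable_funTS; exact: measurable_funX.
- by move=> x _; exact: sqr_ge0.
Qed.

(** * Moving finite differences onto the test function *)

Section shifts.
Variables (w phi : R -> R) (B : R).
Hypotheses (mw : measurable_fun setT w) (pw : periodic w tau)
  (iw : mu.-integrable I (fun x => (w x)%:E))
  (mphi : measurable_fun setT phi) (pphi : periodic phi tau) (phiB : forall x, `|phi x| <= B).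

Let mI := @measurable_per R.

Lemma measurable_shiftc (f : R -> R) h : measurable_fun setT f ->
  measurable_fun setT (fun x : R => f (x + h)).
Proof. by move=> mf; apply: (measurableT_comp mf); exact: measurable_funD. Qed.

Lemma shift_integrable h : mu.-integrable I (fun x => (w (x + h))%:E).
Proof.
have mwh : measurable_fun setT (fun x : R => `|w x|) by exact: measurableT_comp.
apply: integrable_lty_abs => //; first by apply: measurable_funTS; exact: measurable_shiftc.
rewrite (@per_shift R (fun x => `|w x|) h)//; first exact: integrable_ae_lty iw.
by move=> x; rewrite pw.
Qed.

Let iwphi h k : mu.-integrable I (fun x => (w (x + h) * phi (x + k))%:E).
Proof.
have : mu.-integrable I (fun x => (phi (x + k) * w (x + h))%:E).
  apply: (@integrable_bmul R I (fun x => phi (x + k)) (fun x => w (x + h)) B) => //.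
    exact: measurable_shiftc.
  exact: shift_integrable.
by apply: eq_integrable => // x _; rewrite mulrC.
Qed.

Let i00 : mu.-integrable I (fun x => (w x * phi x)%:E).
Proof. by have := iwphi 0 0; apply: eq_integrable => // x _; rewrite !addr0. Qed.

Let i0k k : mu.-integrable I (fun x => (w x * phi (x + k))%:E).
Proof. by have := iwphi 0 k; apply: eq_integrable => // x _; rewrite !addr0. Qed.

Let ih0 h : mu.-integrable I (fun x => (w (x + h) * phi x)%:E).
Proof. by have := iwphi h 0; apply: eq_integrable => // x _; rewrite !addr0. Qed.

Let swap h : \int[mu]_(x in I) (w (x + h) * phi x) = \int[mu]_(x in I) (w x * phi (x - h)).
Proof.
rewrite -(@Rper_shift R (fun x => w x * phi (x - h)) h).
- by apply: eq_Rintegral => x _; rewrite addrK.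
- by apply: measurable_funM => //; exact: measurable_shiftc.
- by move=> x; rewrite pw addrAC pphi.
Qed.

Let both h : \int[mu]_(x in I) (w (x + h) * phi (x + h)) = \int[mu]_(x in I) (w x * phi x).
Proof.
rewrite -(@Rper_shift R (fun x => w x * phi x) h)//; first exact: measurable_funM.
by move=> x; rewrite pw pphi.
Qed.

(** Translation invariance puts every shift on [phi]. The right-hand side is the same as in
    [second_diff_shift], which is why the weak form and the pointwise operator act identically on
    Fourier coefficients. *)
Lemma bilinear_shift h :
  \int[mu]_(x in I) ((w x - w (x + h)) * (phi x - phi (x + h))) =
  2 * \int[mu]_(x in I) (w x * phi x) - \int[mu]_(x in I) (w x * phi (x + h))
   - \int[mu]_(x in I) (w x * phi (x - h)).
Proof.
have E x : (w x - w (x + h)) * (phi x - phi (x + h)) =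
  w x * phi x - w x * phi (x + h) - w (x + h) * phi x + w (x + h) * phi (x + h) by ring.
under eq_Rintegral do rewrite E.
rewrite Rintegral_add//; last by do 2 apply: integrable_sub => //.
rewrite Rintegral_sub//; last exact: integrable_sub.
by rewrite Rintegral_sub// both swap; ring.
Qed.

Lemma second_diff_shift h :
  \int[mu]_(x in I) ((2 * w x - w (x + h) - w (x - h)) * phi x) =
  2 * \int[mu]_(x in I) (w x * phi x) - \int[mu]_(x in I) (w x * phi (x + h))
   - \int[mu]_(x in I) (w x * phi (x - h)).
Proof.
have E x : (2 * w x - w (x + h) - w (x - h)) * phi x =
  2 * (w x * phi x) - w (x + h) * phi x - w (x - h) * phi x by ring.
under eq_Rintegral do rewrite E.
have i2 : mu.-integrable I (fun x => (2 * (w x * phi x))%:E) by exact: integrable_cmul.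
rewrite Rintegral_sub//; last exact: integrable_sub.
by rewrite Rintegral_sub// Rintegral_cmul// !swap opprK; ring.
Qed.

End shifts.

End weak_form.

(** * Fourier coefficients of a weak solution *)

Section weak_fourier.
Context {R : realType}.
Notation mu := (@lebesgue_measure R).
Local Notation tau := ((pi : R) *+ 2).
Local Notation I := (@per_itv R).
Let mI := @measurable_per R.

Definition is_trig (k : nat) (phi : R -> R) : Prop :=
  phi = (fun x => cos (k%:R * x)) \/ phi = (fun x => sin (k%:R * x)).

Lemma trig_sum k phi : is_trig k phi -> forall x h,
  phi (x + h) + phi (x - h) = 2 * cos (k%:R * h) * phi x.
Proof.
case=> -> x h; rewrite !mulrDr mulrN.
  by rewrite cosD cosB; ring.
by rewrite sinD sinB; ring.
Qed.

Lemma trig_C1 k phi : is_trig k phi -> C1_periodic phi.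
Proof. by case=> ->; [exact: cos_C1|exact: sin_C1]. Qed.

Lemma trig_le1 k phi : is_trig k phi -> forall x, `|phi x| <= 1.
Proof. by case=> -> x; [exact: cos_max|exact: sin_max]. Qed.

Lemma measurable_trig k phi : is_trig k phi -> measurable_fun setT phi.
Proof. by move=> /trig_C1/C1_facts[]. Qed.

Lemma periodic_trig k phi : is_trig k phi -> periodic phi tau.
Proof. by move=> /trig_C1/C1_facts[]. Qed.

Lemma trig_shift_sum k phi (w : R -> R) h : is_trig k phi ->
  measurable_fun setT w -> mu.-integrable I (fun x => (w x)%:E) ->
  2 * \int[mu]_(x in I) (w x * phi x) - \int[mu]_(x in I) (w x * phi (x + h))
   - \int[mu]_(x in I) (w x * phi (x - h)) =
  2 * (1 - cos (k%:R * h)) * \int[mu]_(x in I) (w x * phi x).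
Proof.
move=> tphi mw iw; have mphi := measurable_trig tphi.
have i0 c : mu.-integrable I (fun x => (w x * phi (x + c))%:E).
  have : mu.-integrable I (fun x => (phi (x + c) * w x)%:E).
    apply: (@integrable_bmul R I (fun x => phi (x + c)) w 1) => //.
      exact: measurable_shiftc.
    by move=> x; exact: (trig_le1 tphi).
  by apply: eq_integrable => // x _; rewrite mulrC.
have i1 : mu.-integrable I (fun x => (w x * phi x)%:E).
  by have := i0 0; apply: eq_integrable => // x _; rewrite addr0.
have E : \int[mu]_(x in I) (w x * phi (x + h)) + \int[mu]_(x in I) (w x * phi (x - h)) =
    (2 * cos (k%:R * h)) * \int[mu]_(x in I) (w x * phi x).
  rewrite -Rintegral_add// -Rintegral_cmul//.
  by apply: eq_Rintegral => x _; rewrite -mulrDr (trig_sum tphi); ring.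
by rewrite -addrA -opprD E; ring.
Qed.

(* The quadratic form of the kernel is diagonal in the trigonometric basis. *)
Lemma form_trig (s : R) k phi (w : R -> R) : 0 < s < 1 -> is_trig k phi ->
  measurable_fun setT w -> periodic w tau -> mu.-integrable I (fun x => (w x)%:E) ->
  (En s w < +oo)%E ->
  \int[mu]_(x in I) \int[mu]_h ((w x - w (x + h)) * (phi x - phi (x + h)) * kc s h) =
  2 * (k%:R `^ (2 * s) * \int[mu]_(x in I) (w x * phi x)).
Proof.
move=> s01 tphi mw pw iw Ew.
have mphi := measurable_trig tphi; have pphi := periodic_trig tphi.
have [_ _ [M [vM vL]]] := C1_facts (trig_C1 tphi).
have Ep : (En s phi < +oo)%E := energy_lip s01 mphi vM vL.
have mG : measurable_fun setT (fun z : R * R =>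
    (w z.1 - w (z.1 + z.2)) * (phi z.1 - phi (z.1 + z.2)) * kc s z.2).
  apply: measurable_funM; last exact: (measurable_snd2 (measurable_kc s)).
  by apply: measurable_funM; exact: measurable_diff2.
rewrite (@Rfubini R I setT (fun x h => (w x - w (x + h)) * (phi x - phi (x + h)) * kc s h) mI measurableT mG).
  transitivity (\int[mu]_h (2 * \int[mu]_(x in I) (w x * phi x) * ((1 - cos (k%:R * h)) * kc s h))).
    apply: eq_Rintegral => h _.
    under eq_Rintegral do rewrite mulrC.
    rewrite Rintegral_cmul//; last first.
      have iws : mu.-integrable I (fun x => (w x - w (x + h))%:E).
        by apply: integrable_sub => //; exact: (shift_integrable mw pw iw).
      have : mu.-integrable I (fun x => ((phi x - phi (x + h)) * (w x - w (x + h)))%:E).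
        apply: (@integrable_bmul R I (fun x => phi x - phi (x + h)) _ 2) => //.
          by apply: measurable_funB => //; exact: measurable_shiftc.
        move=> x; apply: (le_trans (ler_normB _ _)).
        by have := trig_le1 tphi x; have := trig_le1 tphi (x + h); lra.
      by apply: eq_integrable => // x _; rewrite mulrC.
    rewrite (bilinear_shift mw pw iw mphi pphi (trig_le1 tphi)).
    by rewrite (trig_shift_sum h tphi mw iw); ring.
  rewrite Rintegral_cmul//; last exact: symbol_int.
  by rewrite symbolE//; ring.
(* Absolute convergence for the exchange of integrals: [|a b| <= a^2 + b^2] bounds the integrand by
   the two energy densities, both integrable. *)
apply: (@le_lt_trans _ _ (\int[mu]_(x in I) (\int[mu]_h (dsq s w x h)%:E +
     \int[mu]_h (dsq s phi x h)%:E))%E).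
  apply: ge0_le_integral => //.
  - by move=> x _; apply: integral_ge0.
  - apply: measurable_funTS; apply: measurable_eint => //.
    exact: measurableT_comp mG.
  - by apply: measurable_funTS; apply: emeasurable_funD; exact: measurable_dsq_int.
  move=> x _; rewrite -ge0_integralD//; last 4 first.
  - by move=> h _; rewrite lee_fin dsq_ge0.
  - by apply/measurable_EFinP; exact: measurable_dsq1.
  - by move=> h _; rewrite lee_fin dsq_ge0.
  - by apply/measurable_EFinP; exact: measurable_dsq1.
  have md1 (g : R -> R) : measurable_fun setT g -> measurable_fun setT (fun h => g x - g (x + h)).
    move=> mg; apply: measurable_funB => //; apply: (measurableT_comp mg).
    exact: measurable_funD.
  apply: ge0_le_integral => //.
  - apply/measurable_EFinP; apply: measurableT_comp => //.
    apply: measurable_funM; last exact: measurable_kc.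
    by apply: measurable_funM; exact: md1.
  - by apply: emeasurable_funD; apply/measurable_EFinP; exact: measurable_dsq1.
  move=> h _; rewrite -EFinD lee_fin /dsq -mulrDl normrM [`|kc s h|]ger0_norm ?kc_ge0//.
  apply: ler_wpM2r; first exact: kc_ge0.
  set a := w x - _; set b := phi x - _.
  by rewrite ler_norml; have := sqr_ge0 (a + b); have := sqr_ge0 (a - b); have := sqr_ge0 a;
     have := sqr_ge0 b; move=> *; apply/andP; split; nra.
rewrite ge0_integralD//; last 4 first.
- by move=> x _; apply: integral_ge0 => h _; rewrite lee_fin dsq_ge0.
- by apply: measurable_funTS; exact: measurable_dsq_int.
- by move=> x _; apply: integral_ge0 => h _; rewrite lee_fin dsq_ge0.
- by apply: measurable_funTS; exact: measurable_dsq_int.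
exact: lte_add_pinfty.
Qed.

(** Trigonometric functions are admissible test functions because they are [C^1]; the factor 1/2 of
    the form cancels the 2 of [form_trig]. *)
Lemma weak_fourier (s : R) (f u : R -> R) : 0 < s < 1 -> weak_solution s f u ->
  forall k phi, is_trig k phi ->
  k%:R `^ (2 * s) * \int[mu]_(x in I) (per_rep u x * phi x) =
  \int[mu]_(x in I) (f (per_rep u x) * phi x).
Proof.
move=> s01 [Xu sol] k phi tphi.
have [mw uw Ew L2] := X_space_rep s01 Xu.
have pw := per_rep_periodic u.
have mphi := measurable_trig tphi; have pphi := periodic_trig tphi.
have iw := L2_L1 mw L2.
have onI x : I x -> per_rep u x = u x.
  by rewrite /per_itv /= in_itv /= => /andP[h1 h2]; rewrite per_rep_eq// (ltW h1).
have -> : \int[mu]_(x in I) (f (per_rep u x) * phi x) = \int[mu]_(x in I) (f (u x) * phi x).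
  by apply: eq_Rintegral => x /set_mem Ix; rewrite onI.
rewrite -sol; last exact/trig_X_space/(trig_C1 tphi).
have -> : X_form s u phi = 2^-1 * \int[mu]_(x in I) \int[mu]_h
    ((per_rep u x - per_rep u (x + h)) * (phi x - phi (x + h)) * kc s h).
  rewrite /X_form; congr (_ * _); apply: eq_Rintegral => x /set_mem Ix.
  rewrite [RHS]/Rintegral.
  rewrite -(@unfold_kernel R (fun y => (per_rep u x - per_rep u y) * (phi x - phi y)) s x s01).
  - by apply: eq_Rintegral => y /set_mem Iy; rewrite !onI.
  - by apply: measurable_funM; exact: measurable_funB.
  - by move=> y; rewrite pw pphi.
by rewrite (form_trig s01 tphi mw pw iw Ew) mulKf.
Qed.

End weak_fourier.

(** * Sobolev improvement of integrability *)

Section sobolev.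
Context {R : realType}.
Notation mu := (@lebesgue_measure R).
Local Notation tau := ((pi : R) *+ 2).
Local Notation I := (@per_itv R).
Let mI := @measurable_per R.

(** Either [a <= v], or [(a / v)^(q-1) >= 1]. It splits a quantity at the level [v] and pays for the
    large part with its [q]-th power. *)
Lemma young_power (v a q : R) : 0 < v -> 0 <= a -> 1 <= q -> a <= v + v `^ (1 - q) * a `^ q.
Proof.
move=> v0 a0 q1; have [av|va] := leP a v.
  by rewrite (le_trans av)// lerDl mulr_ge0// powR_ge0.
have ap : 0 < a by exact: lt_trans va.
rewrite -[leLHS]add0r lerD ?(ltW v0)//.
rewrite -[q in a `^ q](subrK 1) [a `^ _]powRD; last by rewrite (gt_eqF ap) implybT.
rewrite powRr1// mulrA -[leLHS]mul1r ler_wpM2r//.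
apply: (@le_trans _ _ (v `^ (1 - q) * v `^ (q - 1))).
  rewrite -powRD; last by rewrite (gt_eqF v0) implybT.
  by rewrite addrA subrK subrr powRr0.
by rewrite ler_wpM2l ?powR_ge0// ge0_ler_powR ?nnegrE ?subr_ge0 ?(ltW v0) ?(ltW va).
Qed.

Lemma powR_mono_exp (a p q : R) : 0 <= a -> 0 <= p -> p <= q -> a `^ p <= 1 + a `^ q.
Proof.
move=> a0 p0 pq; have [a1|a1] := leP a 1.
  apply: (@le_trans _ _ 1); last by rewrite lerDl powR_ge0.
  by apply: (@le_trans _ _ (1 `^ p)); [rewrite ge0_ler_powR ?nnegrE|rewrite powR1].
by apply: (@le_trans _ _ (a `^ q)); [rewrite ler_powR// ltW|rewrite lerDr].
Qed.

Lemma measurable_abspow (u : R -> R) (q : R) : measurable_fun setT u ->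
  measurable_fun setT (fun x => `|u x| `^ q).
Proof. by move=> mu_; apply: measurable_powRl; exact: measurableT_comp. Qed.

Section pointwise.
Variables (s q : R) (u : R -> R).
Hypotheses (s01 : 0 < s < 1) (q1 : 1 <= q) (mu_ : measurable_fun setT u) (pu : periodic u tau).
Let N := \int[mu]_(x in I) (`|u x| `^ q).
Hypothesis Nfin : (\int[mu]_(x in I) (`|u x| `^ q)%:E < +oo)%E.

Let NE : (\int[mu]_(x in I) (`|u x| `^ q)%:E)%E = N%:E.
Proof.
rewrite /N /Rintegral fineK// ge0_fin_numE//.
by apply: integral_ge0 => x _; rewrite lee_fin powR_ge0.
Qed.

(* Averaging over 0 < h < r, with r = B^-q where B^(2+2sq) = max(1, D^2). *)
Lemma sobolev_pointwise (x B d : R) : 1 <= B ->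
  (\int[mu]_h (dsq s u x h)%:E <= d%:E)%E -> d <= B `^ (2 + 2 * s * q) ->
  `|u x| <= B * (2 + (frac_cst s)^-1 + N).
Proof.
move=> B1 Dd dB; have [s0 s1] := andP s01; have c0 := frac_cst_gt0 s01.
have B0 : 0 < B by exact: lt_le_trans B1.
have q0 : 0 < q by exact: lt_le_trans q1.
pose r := B `^ (- q).
have r0 : 0 < r by exact: powR_gt0.
have r1 : r <= 1 by rewrite /r -(powRr0 B) ler_powR// oppr_le0 ltW.
pose J : set R := `]0, r[%classic.
have mJ : measurable J by exact: measurable_itv.
have muJ : mu J = r%:E by rewrite /J lebesgue_measure_itv /= lte_fin r0 oppr0 adde0.
have JI : J `<=` I.
  move=> h; rewrite /J /per_itv /= !in_itv /= => /andP[-> hr] /=.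
  apply: (lt_le_trans hr); apply: (le_trans r1).
  by rewrite mulr2n; have := @pi_ge2 R; lra.
have md : measurable_fun setT (dsq s u x) by exact: measurable_dsq1.
have mq : measurable_fun setT (fun h => `|u (x + h)| `^ q).
  by apply: measurable_abspow; apply: (measurableT_comp mu_); exact: measurable_funD.
pose K1 := r `^ (1 + 2 * s) / (frac_cst s * B).
have K10 : 0 <= K1 by rewrite divr_ge0 ?powR_ge0// mulr_ge0// ltW.
pose K2 := B `^ (1 - q).
have K20 : 0 <= K2 by exact: powR_ge0.
(* Both terms of [|u x| <= |u x - u (x + h)| + |u (x + h)|] are split at the level [B]: the first is
   paid for by its square divided by [B], the second by its [q]-th power. On []0, r[] the kernel is
   at least [frac_cst s * r^(-(1+2s))], whence [K1]. *)
have pt h : J h -> `|u x| <= 2 * B + (K1 * dsq s u x h + K2 * `|u (x + h)| `^ q).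
  rewrite /J /= in_itv /= => /andP[h0 hr].
  have a1 : `|u x| <= `|u x - u (x + h)| + `|u (x + h)|.
    by rewrite -[X in `|X| <= _](subrK (u (x + h))) ler_normD.
  have a2 : `|u (x + h)| <= B + K2 * `|u (x + h)| `^ q by exact: young_power.
  have a3 : `|u x - u (x + h)| <= B + (u x - u (x + h)) ^+ 2 / B.
    have := sqr_ge0 (`|u x - u (x + h)| - B); rewrite -lerBlDl ler_pdivlMr//.
    by rewrite -[(u x - _) ^+ 2]real_normK ?num_real//; nra.
  have a4 : (u x - u (x + h)) ^+ 2 / B <= K1 * dsq s u x h.
    rewrite /K1 /dsq /kc /kern (gtr0_norm h0).
    set E := (u x - _) ^+ 2; have E0 : 0 <= E by exact: sqr_ge0.
    have -> : r `^ (1 + 2 * s) / (frac_cst s * B) * (E * (frac_cst s / h `^ (1 + 2 * s))) =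
       E / B * (r `^ (1 + 2 * s) / h `^ (1 + 2 * s)).
      by field; rewrite !gt_eqF// powR_gt0.
    rewrite -[leLHS]mulr1 ler_wpM2l ?divr_ge0 ?(ltW B0)//.
    rewrite ler_pdivlMr ?powR_gt0// mul1r.
    by apply: ge0_ler_powR; rewrite ?nnegrE ?(ltW h0) ?(ltW hr) ?(ltW r0)// addr_ge0// mulr_ge0// ltW.
  by lra.
have Hint : ((r * `|u x|)%:E <= (2 * B * r + K1 * d + K2 * N)%:E)%E.
  have -> : ((r * `|u x|)%:E = \int[mu]_(h in J) (`|u x|)%:E)%E.
    by rewrite integral_cst// EFinM muleC; congr (_ * _)%E; exact/esym/muJ.
  apply: (@le_trans _ _ (\int[mu]_(h in J) ((2 * B)%:E + ((K1 * dsq s u x h)%:E + (K2 * `|u (x + h)| `^ q)%:E)))%E).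
    apply: ge0_le_integral => //.
    - apply: measurable_funTS; apply: emeasurable_funD => //; apply: emeasurable_funD;
        by apply/measurable_EFinP; exact: measurable_funM.
  rewrite ge0_integralD//; last 3 first.
  - by move=> h _; rewrite lee_fin mulr_ge0// ltW.
  - by move=> h _; rewrite -EFinD lee_fin addr_ge0// mulr_ge0// ?dsq_ge0 ?powR_ge0.
  - apply: measurable_funTS; apply: emeasurable_funD;
        by apply/measurable_EFinP; exact: measurable_funM.
  rewrite ge0_integralD//; last 4 first.
  - by move=> h _; rewrite lee_fin mulr_ge0// dsq_ge0.
  - by apply: measurable_funTS; apply/measurable_EFinP; exact: measurable_funM.
  - by move=> h _; rewrite lee_fin mulr_ge0// powR_ge0.
  - by apply: measurable_funTS; apply/measurable_EFinP; exact: measurable_funM.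
  have E1 : (\int[mu]_(h in J) (K1 * dsq s u x h)%:E = K1%:E * \int[mu]_(h in J) (dsq s u x h)%:E)%E.
    by apply: ge0_integral_cmul => //; [exact: measurable_funTS|move=> h _; exact: dsq_ge0].
  have E2 : (\int[mu]_(h in J) (K2 * `|u (x + h)| `^ q)%:E =
      K2%:E * \int[mu]_(h in J) (`|u (x + h)| `^ q)%:E)%E.
    by apply: ge0_integral_cmul => //; exact: measurable_funTS.
  have E3 : (\int[mu]_(h in J) (2 * B)%:E = (2 * B * r)%:E)%E.
    by rewrite integral_cst// [RHS]EFinM; congr (_ * _)%E; exact: muJ.
  rewrite E1 E2 E3.
  rewrite -addrA EFinD EFinD; apply: leeD => //; rewrite !EFinM; apply: leeD.
    apply: lee_pmul => //; first by apply: integral_ge0 => h _; rewrite lee_fin dsq_ge0.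
    apply: le_trans Dd; apply: ge0_subset_integral => //.
    - exact/measurable_EFinP.
    - by move=> h _; rewrite lee_fin dsq_ge0.
  apply: lee_pmul => //; first by apply: integral_ge0 => h _; rewrite lee_fin powR_ge0.
  rewrite -NE -(@ge0_per_shift R (fun y => `|u y| `^ q) x); last 3 first.
  - exact: measurable_abspow.
  - by move=> y; exact: powR_ge0.
  - by move=> y; rewrite pu.
  apply: (@le_trans _ _ (\int[mu]_(h in I) (`|u (x + h)| `^ q)%:E)%E).
    apply: ge0_subset_integral => //.
    - by apply: measurable_funTS; exact/measurable_EFinP.
  by rewrite le_eqVlt; apply/orP; left; apply/eqP; apply: eq_integral => h _; rewrite addrC.
move: Hint; rewrite lee_fin => Hint.
rewrite -(@ler_pM2l _ r)//; apply: (le_trans Hint).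
have N0 : 0 <= N by rewrite -lee_fin -NE; apply: integral_ge0 => y _; rewrite lee_fin powR_ge0.
(* The choice [r = B^(-q)] balances the estimate: the three contributions are all multiples of
   [r B], namely [2 B r], then [K2 = B^(1-q) = r B], and [K1 d], at most [r B / frac_cst s] because
   [r^(1+2s) B^(1+2sq) = r B]. *)
have K2E : K2 = r * B.
  by rewrite /K2 /r -[X in _ * X]powRr1 ?(ltW B0)// -powRD ?(gt_eqF B0) ?implybT// addrC.
have K1d : K1 * d <= r * B * (frac_cst s)^-1.
  apply: (@le_trans _ _ (K1 * B `^ (2 + 2 * s * q))); first by rewrite ler_wpM2l.
  rewrite /K1 /r -powRrM.
  have -> : B `^ (- q * (1 + 2 * s)) / (frac_cst s * B) * B `^ (2 + 2 * s * q) =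
     (B `^ (- q * (1 + 2 * s)) * B `^ (2 + 2 * s * q)) / B / frac_cst s.
    by field; rewrite !gt_eqF.
  apply: ler_wpM2r; first by rewrite invr_ge0 ltW.
  rewrite ler_pdivrMr//.
  apply: (@le_trans _ _ (B `^ (- q) * B `^ 1 * B `^ 1)); last by rewrite powRr1 ?(ltW B0).
  rewrite -!powRD ?(gt_eqF B0) ?implybT//.
  by apply: ler_powR => //; rewrite le_eqVlt; apply/orP; left; apply/eqP; ring.
rewrite K2E; nra.
Qed.

(** The pointwise estimate gives [|u|^(2+2sq) <= K (1 + D2)], with [D2] the energy density, which is
    integrable over a period. Where [D2] is infinite there is nothing to prove. *)
Lemma sobolev_step : (En s u < +oo)%E ->
  (\int[mu]_(x in I) (`|u x| `^ (2 + 2 * s * q))%:E < +oo)%E.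
Proof.
move=> Eu; have [s0 s1] := andP s01; have c0 := frac_cst_gt0 s01.
have q0 : 0 < q by exact: lt_le_trans q1.
pose E := 2 + 2 * s * q.
have E0 : 0 < E by rewrite addr_gt0// !mulr_gt0.
have N0 : 0 <= N by rewrite -lee_fin -NE; apply: integral_ge0 => y _; rewrite lee_fin powR_ge0.
pose K := (2 + (frac_cst s)^-1 + N) `^ E.
pose D2 x := (\int[mu]_h (dsq s u x h)%:E)%E.
have D20 x : (0 <= D2 x)%E by apply: integral_ge0 => h _; rewrite lee_fin dsq_ge0.
have K0 : 0 <= K by exact: powR_ge0.
have H x : ((`|u x| `^ E)%:E <= K%:E * (1%:E + D2 x))%E.
  have [->|Dfin] := eqVneq (D2 x) +oo%E.
    rewrite addey// gt0_muley ?leey// lte_fin powR_gt0//.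
    by rewrite ltr_wpDr// addr_gt0// invr_gt0.
  have DE : D2 x = (fine (D2 x))%:E by rewrite fineK// ge0_fin_numE// ltey.
  have d0 : 0 <= fine (D2 x) by exact: fine_ge0.
  set d := fine (D2 x) in DE d0; rewrite DE -EFinD -EFinM lee_fin.
  (* The smallest level allowed by the pointwise estimate, raised enough to ensure [B >= 1]. *)
  pose B := (1 + d) `^ E^-1.
  have BE : B `^ E = 1 + d by rewrite /B -powRrM mulVf ?gt_eqF// powRr1// addr_ge0.
  have B1 : 1 <= B.
    by rewrite /B -[leLHS](powRr0 (1 + d)) ler_powR ?invr_ge0 ?(ltW E0)// lerDl.
  have b : `|u x| <= B * (2 + (frac_cst s)^-1 + N).
    apply: (@sobolev_pointwise x B d) => //; first by rewrite -DE.
    by rewrite -/E BE lerDr.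
  apply: (@le_trans _ _ ((B * (2 + (frac_cst s)^-1 + N)) `^ E)).
    by rewrite ge0_ler_powR ?nnegrE ?(ltW E0)// (le_trans _ b).
  have ci0 : 0 <= (frac_cst s)^-1 by rewrite invr_ge0 ltW.
  rewrite powRM ?addr_ge0 ?(le_trans ler01 B1)//.
  by rewrite BE mulrC.
have mD : measurable_fun setT D2 by exact: measurable_dsq_int.
apply: (@le_lt_trans _ _ (\int[mu]_(x in I) (K%:E * (1%:E + D2 x)))%E).
  apply: ge0_le_integral => //.
  - by apply: measurable_funTS; apply/measurable_EFinP; exact: measurable_abspow.
  - by apply: measurable_funTS; apply: measurable_funeM; exact: emeasurable_funD.
rewrite ge0_integralZl//; last 2 first.
- by apply: measurable_funTS; exact: emeasurable_funD.
- by move=> x _; rewrite adde_ge0.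
apply: lte_mul_pinfty => //.
rewrite ge0_integralD//; last by apply: measurable_funTS.
apply: lte_add_pinfty => //.
by rewrite integral_cst// mul1e; exact: per_fin.
Qed.

End pointwise.

Lemma sobolev (s Q : R) (u : R -> R) : 0 < s < 1 -> measurable_fun setT u -> periodic u tau ->
  (En s u < +oo)%E -> (\int[mu]_(x in I) (u x ^+ 2)%:E < +oo)%E ->
  0 <= Q -> Q * (1 - 2 * s) < 2 ->
  (\int[mu]_(x in I) (`|u x| `^ Q)%:E < +oo)%E.
Proof.
move=> s01 mu_ pu Eu L2 Q0 hQ; have [s0 s1] := andP s01.
(* A uniform gain: as long as [q < Q], the step [q -> 2 + 2sq] adds [2 - q (1 - 2s)], which is at
   least 2 if [s >= 1/2] and at least [2 - Q (1 - 2s)] otherwise. Starting from [q = 2], finitely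
   many steps therefore pass [Q]. *)
pose e := Num.min 2 (2 - Q * (1 - 2 * s)).
have e0 : 0 < e by rewrite lt_min; apply/andP; split => //; lra.
have H (n : nat) : exists q, [/\ 1 <= q, (\int[mu]_(x in I) (`|u x| `^ q)%:E < +oo)%E &
    Q <= q \/ n%:R * e <= q].
  elim: n => [|n [q [q1 qi h]]].
    exists 2; split; [by lra| |by right; rewrite mul0r].
    by under eq_integral do rewrite powR_mulrn// real_normK ?num_real//.
  have [Qq|qQ] := leP Q q; first by exists q; split => //; left.
  exists (2 + 2 * s * q); split.
  - by have : 0 <= s * q by [rewrite mulr_ge0// ?(ltW s0)// (le_trans _ q1)]; lra.
  - exact: sobolev_step.
  right; case: h => [|h]; first by rewrite leNgt qQ.
  rewrite -natr1 mulrDl mul1r.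
  suff : e <= 2 + 2 * s * q - q by lra.
  rewrite ge_min; have [s2|s2] := leP (1 - 2 * s) 0.
    apply/orP; left; nra.
  apply/orP; right; nra.
have [q [q1 qi h]] := H (Num.truncn (Q / e)).+1.
have Qq : Q <= q.
  case: h => // h; apply: le_trans h; rewrite -ler_pdivrMr//; apply: ltW.
  exact: truncnS_gt.
have : mu.-integrable I (fun x => (1 + `|u x| `^ q)%:E).
  apply: integrable_add => //; first by apply: integrable_cstR => //; exact: per_fin.
  apply: integrable_ge0 => //; first by apply: measurable_funTS; exact: measurable_abspow.
move=> i1.
have i2 : mu.-integrable I (fun x => (`|u x| `^ Q)%:E).
  apply: (integrable_dom mI _ _ i1).
    by apply: measurable_funTS; exact: measurable_abspow.
  by move=> x _; rewrite ger0_norm ?powR_ge0// powR_mono_exp.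
have := integrable_ae_lty i2.
by under eq_integral do rewrite (ger0_norm (powR_ge0 _ _)).
Qed.

End sobolev.

(** * Poisson extensions *)

Section poisson_extension.
Context {R : realType}.
Notation mu := (@lebesgue_measure R).
Local Notation tau := ((pi : R) *+ 2).
Local Notation I := (@per_itv R).
Local Notation Rp := (`]0%R, +oo[%classic : set R).
Let mI := @measurable_per R.
Let mRp : measurable Rp. Proof. exact: measurable_itv. Qed.

Lemma Rp_gt0 (t : R) : Rp t -> 0 < t.
Proof. by rewrite /= in_itv /= andbT. Qed.

(** With [a = e^(t/4)], [rho t >= (a^2 - 1) / 2 = (a - 1)(a + 1) / 2] and [a - 1 >= t/4]. One bound
    thus records both the linear vanishing at 0 and exponential growth, and its negative powers have
    the form [t^(-b) e^(-ct)]. *)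
Lemma rho_ge (t : R) : 0 < t -> t / 8 * expR (t / 4) <= rho t.
Proof.
move=> t0; rewrite /rho /sh.
have e1 : expR (t / 2) = expR (t / 4) ^+ 2 by rewrite expr2 -expRD; congr expR; field.
have e4 : 1 + t / 4 <= expR (t / 4) by exact: expR_ge1Dx.
have b1 : expR (- (t / 2)) <= 1 by rewrite -[leRHS]expR0 ler_expR; lra.
rewrite e1; set a := expR (t / 4) in e4 *; nra.
Qed.

Lemma rho_powN (t b : R) : 0 < t -> 0 <= b ->
  rho t `^ (- b) <= 8 `^ b * (t `^ (- b) * expR (- (b / 4 * t))).
Proof.
move=> t0 b0; have r0 := rho_gt0 t0.
have -> : 8 `^ b * (t `^ (- b) * expR (- (b / 4 * t))) = (t / 8 * expR (t / 4)) `^ (- b).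
  rewrite !powRM ?mulr_ge0 ?(ltW t0) ?expR_ge0 ?invr_ge0// -expRM.
  have -> : (8^-1 : R) `^ (- b) = 8 `^ b by rewrite -powR_inv1// -powRrM mulN1r opprK.
  by rewrite mulrA [8 `^ b * _]mulrC; congr (_ * expR _); field.
rewrite !powRN lef_pV2 ?posrE ?powR_gt0// ?mulr_gt0 ?expR_gt0//.
by rewrite ge0_ler_powR ?nnegrE ?(ltW r0) ?rho_ge// ltW// !mulr_gt0 ?expR_gt0.
Qed.

Lemma rho_sq_inv (t : R) : 0 < t -> (rho t ^+ 2)^-1 <= 64 * t ^- 2 * expR (- (t / 2)).
Proof.
move=> t0; have r0 := rho_gt0 t0; have h := rho_ge t0.
have -> : 64 * t ^- 2 * expR (- (t / 2)) = ((t / 8 * expR (t / 4)) ^+ 2)^-1.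
  have -> : expR (- (t / 2)) = (expR (t / 4) ^+ 2)^-1.
    by rewrite expRN; congr (_ ^-1); rewrite expr2 -expRD; congr expR; field.
  by field; rewrite !gt_eqF// expR_gt0.
have e0 : 0 < t / 8 * expR (t / 4) by rewrite !mulr_gt0 ?expR_gt0.
rewrite lef_pV2 ?posrE ?exprn_gt0// lerXn2r ?nnegrE ?(ltW e0) ?(ltW r0)//.
Qed.

Lemma pk_small (t x : R) : 0 < t <= 1 -> pk t x <= 8 * expR 1 / t.
Proof.
move=> /andP[t0 t1]; apply: (le_trans (pk_le x t0)).
have r0 := rho_gt0 t0; have T0 := @tau_gt0 R.
have T1 : 1 <= tau by rewrite mulr2n; have := @pi_ge2 R; lra.
have E : sh t = 2 * rho t * ch (t / 2).
  rewrite /sh /rho /ch /sh (expRK_half t) (expRK_half (- t)) mulNr; by field.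
have c0 : 0 < ch (t / 2) by rewrite /ch divr_gt0// addr_gt0 ?expR_gt0.
have -> : sh t / (2 * rho t ^+ 2) = ch (t / 2) / rho t by rewrite E; field; rewrite gt_eqF.
have h1 : ch (t / 2) <= expR 1.
  have : expR (t / 2) <= expR 1 by rewrite ler_expR; lra.
  have : expR (- (t / 2)) <= expR 1 by rewrite ler_expR; lra.
  by rewrite /ch; lra.
have h2 : t / 8 <= rho t.
  apply: le_trans (rho_ge t0); rewrite -[leLHS]mulr1 ler_wpM2l ?divr_ge0 ?(ltW t0)//.
  by rewrite -[leLHS]expR0 ler_expR divr_ge0 ?(ltW t0).
apply: (@le_trans _ _ (ch (t / 2) / rho t)).
  by rewrite ler_pdivrMr// -[leLHS]mulr1 ler_wpM2l// divr_ge0 ?ltW.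
rewrite ler_pdivrMr// mulrAC ler_pdivlMr//.
have e1 := expR_gt0 (1 : R); nra.
Qed.

(** Subtraction of the mean replaces the numerator [sinh t] by [cos x - e^(-t)], which is bounded;
    the difference then decays exponentially for large [t]. *)
Lemma pk_sub_mean (t x : R) : 0 < t -> `|pk t x - tau^-1| <= (rho t ^+ 2)^-1.
Proof.
move=> t0; have q0 := qk_gt0 x t0; have qr := qk_ge_rho t x; have r0 := rho_gt0 t0.
have T1 : 1 <= tau by rewrite mulr2n; have := @pi_ge2 R; lra.
have -> : pk t x - tau^-1 = (cos x - expR (- t)) / qk t x / tau.
  rewrite /pk; move: (@tau_gt0 R); move: (tau) => T T0.
  rewrite /qk /ch in q0 *; rewrite /sh; field.
  rewrite (gt_eqF T0) /=.
  by apply/eqP => h; move: q0; lra.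
rewrite normrM [X in _ * X]ger0_norm ?invr_ge0 ?(le_trans ler01 T1)//.
rewrite normrM [X in _ * X * _]ger0_norm ?invr_ge0 ?(ltW q0)//.
have n2 : `|cos x - expR (- t)| <= 2.
  apply: (le_trans (ler_normB _ _)); have := cos_max x.
  have : `|expR (- t)| <= 1 by rewrite ger0_norm ?expR_ge0// -[leRHS]expR0 ler_expR; lra.
  by lra.
rewrite ler_pdivrMr ?(lt_le_trans ltr01 T1)// ler_pdivrMr//.
apply: (le_trans n2); rewrite -mulrA.
rewrite ler_pdivlMl ?exprn_gt0//.
have : 0 < rho t ^+ 2 by rewrite exprn_gt0.
nra.
Qed.

Definition pv (g : R -> R) (t x : R) : R := \int[mu]_(y in I) (pk t (x - y) * g y).

Lemma measurable_pv (g : R -> R) d (T : measurableType d) (a b : T -> R) :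
  measurable_fun setT g -> measurable_fun setT a -> measurable_fun setT b ->
  measurable_fun setT (fun z => pv g (a z) (b z)).
Proof.
move=> mg ma mb; apply: (@measurable_Rint R _ T I (fun z y => pk (a z) (b z - y) * g y)) => //.
apply: measurable_funM; last exact: (measurableT_comp mg).
apply: measurable_pk2; first exact: (measurableT_comp ma).
by apply: measurable_funB => //; exact: (measurableT_comp mb).
Qed.

Section fixed.
Variables (g : R -> R).
Hypotheses (mg : measurable_fun setT g) (ig : mu.-integrable I (fun y => (g y)%:E)).

Lemma pk_mul_integrable (t x : R) : 0 < t -> mu.-integrable I (fun y => (pk t (x - y) * g y)%:E).
Proof.
move=> t0; apply: (@integrable_bmul R I (fun y => pk t (x - y)) g (sh t / (2 * rho t ^+ 2) / tau)) => //.
  exact: measurable_pkx.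
by move=> y; rewrite ger0_norm ?pk_ge0 ?pk_le.
Qed.

Lemma pv_le (t x : R) (h : R -> R) : 0 < t -> mu.-integrable I (fun y => (h y)%:E) ->
  measurable_fun setT h ->
  (forall y, I y -> `|g y| <= h y) -> `|pv g t x| <= \int[mu]_(y in I) (pk t (x - y) * h y).
Proof.
move=> t0 ih mh gh; apply: (le_trans (Rintegral_abs mI (pk_mul_integrable x t0))).
apply: Rintegral_le => //.
- by apply: integrable_abs => //; exact: pk_mul_integrable.
- apply: (@integrable_bmul R I (fun y => pk t (x - y)) h (sh t / (2 * rho t ^+ 2) / tau)) => //.
    exact: measurable_pkx.
  by move=> y; rewrite ger0_norm ?pk_ge0 ?pk_le.
- by move=> y Iy; rewrite normrM ger0_norm ?pk_ge0// ler_wpM2l ?pk_ge0 ?gh.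
Qed.

Lemma pv_decay (t x : R) : 0 < t -> \int[mu]_(y in I) g y = 0 ->
  `|pv g t x| <= (rho t ^+ 2)^-1 * \int[mu]_(y in I) `|g y|.
Proof.
move=> t0 g0; have ip := pk_mul_integrable x t0.
have -> : pv g t x = \int[mu]_(y in I) ((pk t (x - y) - tau^-1) * g y).
  under [RHS]eq_Rintegral do rewrite mulrBl.
  rewrite Rintegral_sub//; last exact: integrable_cmul.
  by rewrite Rintegral_cmul// g0 mulr0 subr0.
have i1 : mu.-integrable I (fun y => ((pk t (x - y) - tau^-1) * g y)%:E).
  apply: (@integrable_bmul R I (fun y => pk t (x - y) - tau^-1) g (rho t ^+ 2)^-1) => //.
    by apply: measurable_funB => //; exact: measurable_pkx.
  by move=> y; exact: pk_sub_mean.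
apply: (le_trans (Rintegral_abs mI i1)).
rewrite -Rintegral_cmul//; last exact: integrable_abs.
apply: Rintegral_le => //; first exact: integrable_abs.
  by apply: integrable_cmul => //; exact: integrable_abs.
by move=> y Iy; rewrite normrM ler_wpM2r ?pk_sub_mean.
Qed.

End fixed.

Lemma pv_symm (g h : R -> R) (t : R) : 0 < t -> measurable_fun setT g -> measurable_fun setT h ->
  mu.-integrable I (fun y => (g y)%:E) -> mu.-integrable I (fun y => (h y)%:E) ->
  \int[mu]_(x in I) (h x * pv g t x) = \int[mu]_(x in I) (g x * pv h t x).
Proof.
move=> t0 mg mh ig ih; pose K := sh t / (2 * rho t ^+ 2) / tau.
have K0 : 0 <= K by apply: le_trans (pk_le 0 t0); exact: pk_ge0.
have mpk : measurable_fun setT (fun z : R * R => pk t (z.1 - z.2)).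
  by apply: measurable_pk2 => //; exact: measurable_funB.
have mF : measurable_fun setT (fun z : R * R => h z.1 * (pk t (z.1 - z.2) * g z.2)).
  apply: measurable_funM; first exact: (measurableT_comp mh).
  by apply: measurable_funM => //; exact: (measurableT_comp mg).
transitivity (\int[mu]_(x in I) \int[mu]_(y in I) (h x * (pk t (x - y) * g y))).
  by apply: eq_Rintegral => x _; rewrite Rintegral_cmul//; exact: pk_mul_integrable.
rewrite (@Rfubini R I I (fun x y => h x * (pk t (x - y) * g y)))//; last first.
  pose Ng := (\int[mu]_(y in I) `|g y|%:E)%E.
  have Ng0 : (0 <= Ng)%E by apply: integral_ge0.
  have Nf : (Ng < +oo)%E by exact: integrable_ae_lty ig.
  have [G GE] : exists G : R, Ng = G%:E by exists (fine Ng); rewrite fineK// ge0_fin_numE.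
  have G0 : 0 <= G by rewrite -lee_fin -GE.
  apply: (@le_lt_trans _ _ (\int[mu]_(x in I) ((K * G) * `|h x|)%:E)%E).
    apply: ge0_le_integral => //.
    - by move=> x _; apply: integral_ge0.
    - apply: measurable_funTS; apply: (@measurable_eint R _ _ I (fun x y => `|h x * (pk t (x - y) * g y)|)) => //.
      exact: measurableT_comp mF.
    - apply/measurable_EFinP; apply: measurable_funTS; apply: measurable_funM => //.
      exact: measurableT_comp.
    move=> x _; rewrite mulrAC EFinM -GE /Ng -ge0_integral_cmul//; last 2 first.
    - by rewrite mulr_ge0.
    - by apply: measurable_funTS; exact: measurableT_comp.
    apply: ge0_le_integral => //.
    - apply/measurable_EFinP; apply: measurable_funTS; apply: measurableT_comp => //.
      apply: measurable_funM => //; apply: measurable_funM => //; exact: measurable_pkx.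
    - apply/measurable_EFinP; apply: measurable_funTS; apply: measurable_funM => //.
      exact: measurableT_comp.
    move=> y _; rewrite lee_fin normrM [X in _ * X]normrM mulrA [`|h x| * _]mulrC ler_wpM2r// ler_wpM2r//.
    by rewrite ger0_norm ?pk_ge0 ?pk_le.
  rewrite ge0_integral_cmul//; last 2 first.
  - by rewrite mulr_ge0.
  - by apply: measurable_funTS; exact: measurableT_comp.
  by apply: lte_mul_pinfty; [rewrite lee_fin mulr_ge0|by []|exact: integrable_ae_lty ih].
apply: eq_Rintegral => y _; rewrite -Rintegral_cmul//; last exact: pk_mul_integrable.
by apply: eq_Rintegral => x _; rewrite -pkN opprB; ring.
Qed.

Lemma pv_trig k phi (t x : R) : 0 < t -> is_trig k phi -> pv phi t x = expR (- t) ^+ k * phi x.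
Proof. by move=> t0 [->|->]; [exact: poisson_cos|exact: poisson_sin]. Qed.

Lemma pv_mass (t x : R) : 0 < t -> pv (fun=> 1) t x = 1.
Proof. by move=> t0; rewrite /pv; under eq_Rintegral do rewrite mulr1; exact: poisson_mass. Qed.

Lemma per_integral_cst (k : R) : (\int[mu]_(x in I) k%:E = (k * tau)%:E)%E.
Proof. by rewrite integral_cst// [RHS]EFinM; congr (_ * _)%E; exact: per_mu. Qed.

Lemma pv_norm1 (g : R -> R) (t : R) : 0 < t -> measurable_fun setT g ->
  mu.-integrable I (fun y => (g y)%:E) -> \int[mu]_(y in I) g y = 0 ->
  (\int[mu]_(x in I) `|pv g t x|%:E <= (64 * tau * expR (- (t / 4)) * \int[mu]_(y in I) `|g y|)%:E)%E.
Proof.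
move=> t0 mg ig g0; set G := \int[mu]_(y in I) `|g y|.
have T1 : 1 <= tau by rewrite mulr2n; have := @pi_ge2 R; lra.
have iG : mu.-integrable I (fun y => (`|g y|)%:E) by exact: integrable_abs.
have mG : measurable_fun setT (fun y => `|g y|) by exact: measurableT_comp.
have G0 : 0 <= G by apply: Rintegral_ge0 => y _.
have mpv : measurable_fun setT (pv g t) by exact: measurable_pv.
(* For [t <= 1] positivity and mass one give a contraction in [L^1], and [64 tau e^(-t/4) >= 1]. For
   [t > 1] the mean-zero decay applies. *)
have [t1|t1] := leP t 1.
  have ipv : mu.-integrable I (fun x => (pv (fun y => `|g y|) t x)%:E).
    apply: (@per_bounded_integrable R _ (sh t / (2 * rho t ^+ 2) / tau * G)).
      exact: measurable_pv.
    move=> x _; apply: (@le_trans _ _ (\int[mu]_(y in I) (sh t / (2 * rho t ^+ 2) / tau * `|g y|))).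
      rewrite ger0_norm; last first.
        by apply: Rintegral_ge0 => y _; rewrite mulr_ge0 ?pk_ge0.
      apply: Rintegral_le => //; first exact: pk_mul_integrable.
        exact: integrable_cmul.
      by move=> y _; rewrite ler_wpM2r ?pk_le.
    by rewrite Rintegral_cmul.
  apply: (@le_trans _ _ (\int[mu]_(x in I) (pv (fun y => `|g y|) t x)%:E)%E).
    apply: ge0_le_integral => //.
    - by apply/measurable_EFinP; apply: measurable_funTS; exact: measurableT_comp.
    - by apply/measurable_EFinP; apply: measurable_funTS; exact: measurable_pv.
    - by move=> x _; rewrite lee_fin; apply: pv_le.
  rewrite -RintegralE// lee_fin.
  have i1 : mu.-integrable I (fun=> (1 : R)%:E) by apply: integrable_cstR => //; exact: per_fin.
  have := @pv_symm (fun y => `|g y|) (fun=> 1) t t0 mG (measurable_cst _) iG i1.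
  under eq_Rintegral do rewrite mul1r.
  under [RHS]eq_Rintegral do rewrite pv_mass// mulr1.
  move=> ->; rewrite -/G -[leLHS]mul1r ler_wpM2r//.
  have : expR (- 1) <= expR (- (t / 4)) by rewrite ler_expR; lra.
  have : 1 / 64 <= expR (- 1 : R).
    have -> : expR (- 1 : R) = expR (- 2^-1) ^+ 2 by rewrite expr2 -expRD; congr expR; field.
    by have := @expR_ge1Dx R (- 2^-1); nra.
  by have := expR_gt0 (- (t / 4)); nra.
apply: (@le_trans _ _ (\int[mu]_(x in I) (64 * expR (- (t / 4)) * G)%:E)%E).
  apply: ge0_le_integral => //.
  - by apply/measurable_EFinP; apply: measurable_funTS; exact: measurableT_comp.
  move=> x _; rewrite lee_fin; have hd := pv_decay ig x t0 g0; apply: (le_trans hd).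
  rewrite ler_wpM2r//; apply: (le_trans (rho_sq_inv t0)).
  apply: ler_pM; rewrite ?mulr_ge0 ?expR_ge0 ?invr_ge0 ?exprn_ge0 ?(ltW t0)//.
    rewrite -[leRHS]mulr1 ler_wpM2l// invf_le1 ?exprn_gt0//.
    by rewrite exprn_ege1// ltW.
  by rewrite ler_expR; lra.
rewrite per_integral_cst lee_fin.
by rewrite le_eqVlt; apply/orP; left; apply/eqP; ring.
Qed.

End poisson_extension.

(** * Representation of weak solutions *)

Section representation.
Context {R : realType}.
Notation mu := (@lebesgue_measure R).
Local Notation tau := ((pi : R) *+ 2).
Local Notation I := (@per_itv R).
Local Notation Rp := (`]0%R, +oo[%classic : set R).
Let mI := @measurable_per R.
Let mRp : measurable Rp. Proof. exact: measurable_itv. Qed.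

(** Euler's Gamma function at [b]. *)
Definition gam (b : R) : R := \int[mu]_(t in Rp) (t `^ (b - 1) * expR (- t)).

Lemma measurable_powexp (b c : R) : measurable_fun setT (fun t : R => t `^ (b - 1) * expR (- (c * t))).
Proof.
apply: measurable_funM; first exact: measurable_powRl.
by apply: measurable_expR_comp; apply: measurableT_comp => //; exact: mulrl_measurable.
Qed.

(** By the substitution [t -> k t]. Divided by [gam b], it writes the inverse symbol [k^(-b)] as an
    integral of the Poisson multipliers [e^(-kt)], which is the source of the representation
    formula. *)
Lemma gam_scale (b k : R) : 0 < b -> 0 < k ->
  \int[mu]_(t in Rp) (t `^ (b - 1) * expR (- (k * t))) = k `^ (- b) * gam b.
Proof.
move=> b0 k0.
have ig c : 0 < c -> mu.-integrable Rp (fun t => (t `^ (b - 1) * expR (- (c * t)))%:E).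
  by move=> c0; exact: gamma_integrable.
pose F : R -> \bar R := (fun t : R => (t `^ (b - 1) * expR (- (1 * t)))%:E) \_ Rp.
have mF : measurable_fun setT F.
  apply/(measurable_restrictT _ _).1 => //.
  by apply/measurable_EFinP; apply: measurable_funTS; exact: measurable_powexp.
have F0 (x : R) : (0 <= F x)%E.
  by apply: erestrict_ge0 => y _; rewrite lee_fin mulr_ge0 ?powR_ge0 ?expR_ge0.
have H := ge0_integral_affine 0 mF F0 k0.
have E1 : (\int[mu]_x F x = (gam b)%:E)%E.
  rewrite /F -integral_mkcond /gam.
  have -> : \int[mu]_(t in Rp) (t `^ (b - 1) * expR (- t)) =
     \int[mu]_(t in Rp) (t `^ (b - 1) * expR (- (1 * t))).
    by apply: eq_Rintegral => t _; rewrite mul1r.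
  by rewrite RintegralE//; exact: ig.
have E2 : (\int[mu]_x F (k * x + 0)%R = (k `^ (b - 1) *
    \int[mu]_(t in Rp) (t `^ (b - 1) * expR (- (k * t))))%:E)%E.
  rewrite -Rintegral_cmul//; last exact: ig.
  rewrite RintegralE//; last by apply: integrable_cmul => //; exact: ig.
  rewrite [RHS]integral_mkcond; apply: eq_integral => x _.
  rewrite /F !patchE addr0 mul1r.
  have -> : (k * x \in Rp) = (x \in Rp).
    by apply/idP/idP; rewrite !inE /= !in_itv /= !andbT pmulr_rgt0.
  case: ifPn => // /set_mem /Rp_gt0 x0; congr EFin.
  by rewrite powRM ?(ltW k0) ?(ltW x0)// mulrA.
move: H; rewrite E1 E2 -EFinM => -[h].
have kp : 0 < k `^ (b - 1) by exact: powR_gt0.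
apply: (mulfI (lt0r_neq0 kp)); rewrite h mulrA -powRD; last by rewrite (gt_eqF k0) implybT.
by rewrite addrAC subrr add0r powR_inv1// ltW.
Qed.

Lemma gam_gt0 (b : R) : 0 < b -> 0 < gam b.
Proof.
move=> b0.
have ig : mu.-integrable Rp (fun t => (t `^ (b - 1) * expR (- (1 * t)))%:E).
  exact: gamma_integrable.
pose J : set R := `]1%R, 2%R[%classic.
have mJ : measurable J by exact: measurable_itv.
have JRp : J `<=` Rp.
  by move=> t; rewrite /J /= !in_itv /= andbT => /andP[t1 _]; exact: lt_trans t1.
(* On []1, 2[] the power lies between 1 and [2^(b-1)], in an order that depends on the sign of
   [b - 1]. *)
pose c := Num.min 1 (2 `^ (b - 1)) * expR (- 2) : R.
have c0 : 0 < c by rewrite mulr_gt0 ?expR_gt0// lt_min ltr01 powR_gt0.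
have cJ t : J t -> c <= t `^ (b - 1) * expR (- (1 * t)).
  rewrite /J /= in_itv /= => /andP[t1 t2]; have t0 : 0 < t by exact: lt_trans t1.
  apply: ler_pM; rewrite ?expR_ge0//.
  - rewrite ge_min; have [b1|b1] := leP 0 (b - 1).
      by rewrite -[X in X <= _](powRr0 t) ler_powR// ltW.
    have hN (x : R) : x `^ (b - 1) = (x `^ (1 - b))^-1 by rewrite -powRN opprB.
    apply/orP; right; rewrite (hN t) (hN 2) lef_pV2 ?posrE ?powR_gt0//.
    by rewrite ge0_ler_powR ?nnegrE ?(ltW t0) ?(ltW t2)//; lra.
  - by rewrite ler_expR; lra.
apply: (@lt_le_trans _ _ c) => //; rewrite -lee_fin.
have -> : gam b = \int[mu]_(t in Rp) (t `^ (b - 1) * expR (- (1 * t))).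
  by apply: eq_Rintegral => t _; rewrite mul1r.
rewrite RintegralE//.
apply: (@le_trans _ _ (\int[mu]_(t in J) (t `^ (b - 1) * expR (- (1 * t)))%:E)%E); last first.
  apply: ge0_subset_integral => //.
  - by apply/measurable_EFinP; apply: measurable_funTS; exact: measurable_powexp.
  - by move=> t _; rewrite lee_fin mulr_ge0 ?powR_ge0 ?expR_ge0.
apply: (@le_trans _ _ (\int[mu]_(t in J) c%:E)%E).
  have muJ : mu J = 1%E.
    rewrite /J lebesgue_measure_itv /= lte_fin ltr1n /= -EFinB; congr EFin; lra.
  rewrite integral_cst// -[leLHS]mule1 le_eqVlt; apply/orP; left; apply/eqP.
  by congr (_ * _)%E; exact/esym.
apply: ge0_le_integral => //.
- by move=> t _; rewrite lee_fin ltW.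
- by apply/measurable_EFinP; apply: measurable_funTS; exact: measurable_powexp.
Qed.

(** On data of mean zero and up to the factor [gam b], the inverse of the operator with symbol
    [|k|^b]. *)
Definition wk (b : R) (g : R -> R) (x : R) : R := \int[mu]_(t in Rp) (t `^ (b - 1) * pv g t x).

Section wk.
Variables (b : R) (g : R -> R).
Hypotheses (b0 : 0 < b) (mg : measurable_fun setT g) (ig : mu.-integrable I (fun y => (g y)%:E))
  (g0 : \int[mu]_(y in I) g y = 0).

Lemma measurable_wk2 : measurable_fun setT (fun z : R * R => z.1 `^ (b - 1) * pv g z.1 z.2).
Proof. by apply: measurable_funM; [exact: measurable_powRl|exact: measurable_pv]. Qed.

Lemma measurable_wk : measurable_fun setT (wk b g).
Proof.
apply: (@measurable_Rint R _ R Rp (fun x t => t `^ (b - 1) * pv g t x)) => //.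
by apply: measurable_funM; [exact: measurable_powRl|exact: measurable_pv].
Qed.

(** Mean zero gives the factor [e^(-t/4)] at large times, and [b > 0] gives convergence at
    [t = 0]. *)
Lemma wk_lty : (\int[mu]_(t in Rp) \int[mu]_(x in I) `|t `^ (b - 1) * pv g t x|%:E < +oo)%E.
Proof.
set G := \int[mu]_(y in I) `|g y|.
have G0 : 0 <= G by apply: Rintegral_ge0 => y _.
have T0 := @tau_gt0 R.
have q0 : 0 < 4^-1 :> R by rewrite invr_gt0.
have igm := gamma_integrable b0 q0.
apply: (@le_lt_trans _ _ (\int[mu]_(t in Rp) ((64 * tau * G) * (t `^ (b - 1) * expR (- (4^-1 * t))))%:E)%E).
  apply: ge0_le_integral => //.
  - by move=> t _; apply: integral_ge0.
  - apply: measurable_funTS; apply: (@measurable_eint R _ R I (fun t x => `|t `^ (b - 1) * pv g t x|)) => //.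
    exact: measurableT_comp measurable_wk2.
  - by apply/measurable_EFinP; apply: measurable_funTS; apply: measurable_funM => //; exact: measurable_powexp.
  move=> t /Rp_gt0 t0.
  have mp : measurable_fun setT (pv g t) by exact: measurable_pv.
  have -> : (\int[mu]_(x in I) `|t `^ (b - 1) * pv g t x|%:E =
     (t `^ (b - 1))%:E * \int[mu]_(x in I) `|pv g t x|%:E)%E.
    rewrite -ge0_integral_cmul//; last 2 first.
    - exact: powR_ge0.
    - by apply: measurable_funTS; exact: measurableT_comp.
    by apply: eq_integral => x _; rewrite normrM ger0_norm// powR_ge0.
  apply: (@le_trans _ _ ((t `^ (b - 1))%:E * (64 * tau * expR (- (t / 4)) * G)%:E)%E).
    by apply: lee_wpmul2l; [rewrite lee_fin powR_ge0|exact: pv_norm1].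
  rewrite -EFinM lee_fin le_eqVlt; apply/orP; left; apply/eqP.
  by rewrite [4^-1 * t]mulrC; ring.
have iK : mu.-integrable Rp (fun t => (64 * tau * G * (t `^ (b - 1) * expR (- (4^-1 * t))))%:E).
  by apply: integrable_cmul.
apply: le_lt_trans (integrable_ae_lty iK).
apply: ge0_le_integral => //.
- by move=> t _; rewrite lee_fin !mulr_ge0 ?powR_ge0 ?expR_ge0// ltW.
- apply/measurable_EFinP; apply: measurable_funTS; apply: measurable_funM => //; exact: measurable_powexp.
- apply/measurable_EFinP; apply: measurable_funTS; apply: measurableT_comp => //.
  by apply: measurable_funM => //; exact: measurable_powexp.
- by move=> t _; rewrite lee_fin ler_norm.
Qed.

Lemma wk_lty' : (\int[mu]_(x in I) \int[mu]_(t in Rp) `|t `^ (b - 1) * pv g t x|%:E < +oo)%E.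
Proof.
rewrite (@Rtonelli R I Rp (fun x t => `|t `^ (b - 1) * pv g t x|))//; first exact: wk_lty.
apply: measurableT_comp => //.
by apply: measurable_funM; [exact: measurable_powRl|exact: measurable_pv].
Qed.

Lemma wk_integrable : mu.-integrable I (fun x => (wk b g x)%:E).
Proof.
apply: (@Rinner_integrable R I Rp (fun x t => t `^ (b - 1) * pv g t x)) => //; last exact: wk_lty'.
by apply: measurable_funM; [exact: measurable_powRl|exact: measurable_pv].
Qed.

Lemma wk_coef k phi : is_trig k phi ->
  \int[mu]_(x in I) (wk b g x * phi x) =
  \int[mu]_(t in Rp) (t `^ (b - 1) * expR (- t) ^+ k * \int[mu]_(x in I) (g x * phi x)).
Proof.
move=> tphi; have mphi := measurable_trig tphi.
have iphi : mu.-integrable I (fun x => (phi x)%:E).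
  by apply: (@per_bounded_integrable R phi 1) => // x _; exact: (trig_le1 tphi).
have mf : measurable_fun setT (fun z : R * R => z.2 `^ (b - 1) * pv g z.2 z.1 * phi z.1).
  apply: measurable_funM; last exact: (measurableT_comp mphi).
  by apply: measurable_funM; [exact: measurable_powRl|exact: measurable_pv].
transitivity (\int[mu]_(x in I) \int[mu]_(t in Rp) (t `^ (b - 1) * pv g t x * phi x)).
  (* The factor [phi x] can enter the time integral only where that integral converges, which is
     known for almost every [x]. *)
  congr fine; apply: ae_eq_integral => //.
  - apply/measurable_EFinP; apply: measurable_funTS; apply: measurable_funM => //; exact: measurable_wk.
  - apply/measurable_EFinP; apply: measurable_funTS.
    exact: (@measurable_Rint R _ R Rp (fun x t => t `^ (b - 1) * pv g t x * phi x)).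
  have := @ae_inner_integrable _ _ (measurableTypeR R) (measurableTypeR R) R mu mu I Rp
     (fun z => z.2 `^ (b - 1) * pv g z.2 z.1) mI mRp.
  move=> /(_ _ wk_lty') H.
  have {}H := H (measurable_funM (measurable_powRl (b - 1) measurable_snd) (measurable_pv mg measurable_snd measurable_fst)).
  apply: aeS H => x H Ix; congr EFin; rewrite /wk mulrC -Rintegral_cmul//; last exact: H.
  by apply: eq_Rintegral => t _; rewrite mulrC.
rewrite (@Rfubini R I Rp (fun x t => t `^ (b - 1) * pv g t x * phi x))//; last first.
  apply: le_lt_trans wk_lty'; apply: ge0_le_integral => //.
  - by move=> x _; apply: integral_ge0.
  - apply: measurable_funTS; apply: (@measurable_eint R _ R Rp (fun x t => `|t `^ (b - 1) * pv g t x * phi x|)) => //.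
    exact: measurableT_comp mf.
  - apply: measurable_funTS; apply: (@measurable_eint R _ R Rp (fun x t => `|t `^ (b - 1) * pv g t x|)) => //.
    apply: measurableT_comp => //.
    by apply: measurable_funM; [exact: measurable_powRl|exact: measurable_pv].
  have mt x : measurable_fun setT (fun t => `|t `^ (b - 1) * pv g t x|).
    apply: measurableT_comp => //.
    by apply: measurable_funM; [exact: measurable_powRl|exact: measurable_pv].
  move=> x _; apply: ge0_le_integral => //.
  - apply/measurable_EFinP; apply: measurable_funTS.
    have -> : (fun t => `|t `^ (b - 1) * pv g t x * phi x|) = (fun t => `|t `^ (b - 1) * pv g t x| * `|phi x|).
      by apply/funext => t; rewrite normrM.
    by apply: measurable_funM; [exact: mt|exact: measurable_cst].
  - by apply/measurable_EFinP; apply: measurable_funTS; exact: mt.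
  - move=> t _; rewrite lee_fin normrM -[leRHS]mulr1 ler_wpM2l//; exact: (trig_le1 tphi).
apply: eq_Rintegral => t /set_mem /Rp_gt0 t0.
have ip : mu.-integrable I (fun x => (phi x * pv g t x)%:E).
  have mpv : measurable_fun setT (pv g t) by exact: measurable_pv.
  apply: (@integrable_bmul R I phi (pv g t) 1) => //; first exact: (trig_le1 tphi).
  apply: integrable_lty_abs => //; first exact: measurable_funTS.
  by apply: le_lt_trans (pv_norm1 t0 mg ig g0) _; rewrite ltry.
under eq_Rintegral do rewrite -mulrA [X in _ * X]mulrC.
rewrite Rintegral_cmul// (pv_symm t0 mg mphi ig iphi).
under eq_Rintegral do rewrite (pv_trig _ t0 tphi) mulrCA.
have igp : mu.-integrable I (fun x => (g x * phi x)%:E).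
  have := @integrable_bmul R I phi g 1 mI mphi (trig_le1 tphi) ig.
  by apply: eq_integrable => // x _; rewrite mulrC.
by rewrite Rintegral_cmul//; ring.
Qed.

End wk.

(** The Poisson operator at time 1 is symmetric and fixes constants, so the integral of [phi] equals
    [e^(-k)] times itself. *)
Lemma trig_mean0 k phi : (0 < k)%N -> is_trig k phi -> \int[mu]_(x in I) phi x = 0.
Proof.
move=> k0 tphi; have mphi := measurable_trig tphi.
have i1 : mu.-integrable I (fun=> (1 : R)%:E) by apply: integrable_cstR => //; exact: per_fin.
have iphi : mu.-integrable I (fun x => (phi x)%:E).
  by apply: (@per_bounded_integrable R phi 1) => // x _; exact: (trig_le1 tphi).
have := @pv_symm R phi (fun=> 1) 1 ltr01 mphi (measurable_cst _) iphi i1.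
under eq_Rintegral do rewrite mul1r (pv_trig _ ltr01 tphi).
under [RHS]eq_Rintegral do rewrite (pv_mass _ ltr01) mulr1.
rewrite Rintegral_cmul// => h.
have e1 : expR (- 1 : R) ^+ k < 1.
  by rewrite exprn_ilt1 ?expR_ge0 ?gtn_eqF// -[ltRHS]expR0 ltr_expR oppr_lt0.
by apply/eqP; move/eqP: h; rewrite -subr_eq0 -[X in _ - X]mul1r -mulrBl mulf_eq0 subr_eq0 (lt_eqF e1).
Qed.

(** The difference [d] of the two sides has no Fourier coefficients, so uniqueness applies.
    Frequency 0 is handled by the mean, because [wk] contributes no mean there; at frequency [k > 0]
    the time integral equals [k^(-b) gam b], which undoes the symbol in the hypothesis. *)
Lemma representation (s : R) (g w : R -> R) : 0 < s ->
  measurable_fun setT w -> mu.-integrable I (fun x => (w x)%:E) ->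
  measurable_fun setT g -> mu.-integrable I (fun x => (g x)%:E) ->
  (forall k phi, is_trig k phi ->
    k%:R `^ (2 * s) * \int[mu]_(x in I) (w x * phi x) = \int[mu]_(x in I) (g x * phi x)) ->
  {ae mu, forall x, I x -> w x = tau^-1 * \int[mu]_(y in I) w y + (gam (2 * s))^-1 * wk (2 * s) g x}.
Proof.
move=> s0 mw iw mg ig hc; have b0 : 0 < 2 * s by rewrite mulr_gt0.
set b := 2 * s in hc b0 *; have T0 := @tau_gt0 R; have G0 := gam_gt0 b0.
have i1 (c : R) : mu.-integrable I (fun=> c%:E) by apply: integrable_cstR => //; exact: per_fin.
(* Frequency 0 of the hypothesis: [0^(2s) = 0], so the data have mean zero. *)
have g0 : \int[mu]_(y in I) g y = 0.
  have := hc 0%N _ (or_introl erefl); rewrite powR0 ?gt_eqF// mul0r => ->.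
  by apply: eq_Rintegral => x _; rewrite mul0r cos0 mulr1.
have iwk := wk_integrable b0 mg ig g0; have mwk := @measurable_wk b g mg.
set m := tau^-1 * _.
pose d x := w x - (m + (gam b)^-1 * wk b g x).
have md : measurable_fun setT d.
  by apply: measurable_funB => //; apply: measurable_funD => //; exact: measurable_funM.
have iwk' : mu.-integrable I (fun x => ((gam b)^-1 * wk b g x)%:E) by exact: integrable_cmul.
have id : mu.-integrable I (fun x => (d x)%:E).
  by apply: integrable_sub => //; exact: integrable_add.
have H k phi : is_trig k phi -> \int[mu]_(x in I) (phi x * d x) = 0.
  move=> tphi; have mphi := measurable_trig tphi.
  have ib (h : R -> R) : mu.-integrable I (fun x => (h x)%:E) ->
      mu.-integrable I (fun x => (h x * phi x)%:E).
    move=> ih; have := @integrable_bmul R I phi h 1 mI mphi (trig_le1 tphi) ih.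
    by apply: eq_integrable => // x _; rewrite mulrC.
  have iphi : mu.-integrable I (fun x => (phi x)%:E).
    by apply: (@per_bounded_integrable R phi 1) => // x _; exact: (trig_le1 tphi).
  have E x : phi x * d x = w x * phi x - (m * phi x + (gam b)^-1 * (wk b g x * phi x)).
    by rewrite /d; ring.
  under eq_Rintegral do rewrite E.
  have j1 : mu.-integrable I (fun x => (m * phi x)%:E) by exact: integrable_cmul.
  have j2 : mu.-integrable I (fun x => ((gam b)^-1 * (wk b g x * phi x))%:E).
    by apply: integrable_cmul => //; exact: ib.
  rewrite Rintegral_sub//; [|exact: ib|exact: integrable_add].
  rewrite Rintegral_add// !Rintegral_cmul//; last exact: ib.
  rewrite (wk_coef b0 mg ig g0 tphi) -(hc k phi tphi).
  case: k tphi => [|k] tphi.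
    rewrite powR0 ?gt_eqF// mul0r.
    have -> : \int[mu]_(t in Rp) (t `^ (b - 1) * expR (- t) ^+ 0 * 0) = 0.
      by under eq_Rintegral do rewrite mulr0; rewrite Rintegral_cst// mul0r.
    rewrite mulr0 addr0.
    have phc : exists c : R, phi = fun=> c.
      case: tphi => ->; [exists 1|exists 0]; apply/funext => x; rewrite mul0r ?cos0 ?sin0//.
    case: phc => c phc; rewrite phc.
    have -> : \int[mu]_(x in I) (w x * c) = c * \int[mu]_(x in I) w x.
      by rewrite -Rintegral_cmul//; apply: eq_Rintegral => x _; rewrite mulrC.
    have -> : \int[mu]_(x in I) c = c * tau.
      by rewrite /Rintegral per_integral_cst.
    by rewrite /m; move: T0; move: (tau) => T T0; field; rewrite gt_eqF.
  have kp : 0 < k.+1%:R :> R by rewrite ltr0n.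
  rewrite (trig_mean0 _ tphi)// mulr0 add0r.
  set c := _ * \int[mu]_(x in I) (w x * phi x).
  have -> : \int[mu]_(t in Rp) (t `^ (b - 1) * expR (- t) ^+ k.+1 * c) = c * (k.+1%:R `^ (- b) * gam b).
    rewrite -gam_scale// -Rintegral_cmul//; last exact: gamma_integrable.
    by apply: eq_Rintegral => t _; rewrite -expRM_natl mulrN mulrC.
  rewrite /c.
  rewrite powRN; field; rewrite !gt_eqF// ?powR_gt0//.
have := fourier_unique id md (fun k => H k _ (or_introl erefl)) (fun k => H k _ (or_intror erefl)).
by apply: aeS => x h Ix; apply/eqP; rewrite -subr_eq0; apply/eqP; exact: h.
Qed.

End representation.

(** * Boundedness *)

Section bounded_solutions.
Context {R : realType}.
Notation mu := (@lebesgue_measure R).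
Local Notation tau := ((pi : R) *+ 2).
Local Notation I := (@per_itv R).
Local Notation Rp := (`]0%R, +oo[%classic : set R).
Let mI := @measurable_per R.
Let mRp : measurable Rp. Proof. exact: measurable_itv. Qed.

Lemma pv_ge0 (g : R -> R) (t x : R) : 0 < t -> (forall y, 0 <= g y) -> 0 <= pv g t x.
Proof. by move=> t0 g0; apply: Rintegral_ge0 => y _; rewrite mulr_ge0 ?pk_ge0. Qed.

Lemma pv_mul_integrable (g h : R -> R) (t : R) : 0 < t -> measurable_fun setT g ->
  mu.-integrable I (fun y => (g y)%:E) -> mu.-integrable I (fun y => (h y)%:E) ->
  mu.-integrable I (fun x => (h x * pv g t x)%:E).
Proof.
move=> t0 mg ig ih; pose K := sh t / (2 * rho t ^+ 2) / tau.
have ia : mu.-integrable I (fun y => (`|g y|)%:E) by exact: integrable_abs.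
have : mu.-integrable I (fun x => (pv g t x * h x)%:E).
  apply: (@integrable_bmul R I (pv g t) h (K * \int[mu]_(y in I) `|g y|)) => //.
    exact: measurable_pv.
  move=> x; apply: (le_trans (Rintegral_abs mI (pk_mul_integrable ig x t0))).
  rewrite -Rintegral_cmul//; apply: Rintegral_le => //.
  - by apply: integrable_abs => //; exact: pk_mul_integrable.
  - exact: integrable_cmul.
  - by move=> y _; rewrite normrM ler_wpM2r// ger0_norm ?pk_ge0 ?pk_le.
by apply: eq_integrable => // x _; rewrite mulrC.
Qed.

Lemma pv_symm_ge0 (g h : R -> R) (t : R) : 0 < t -> measurable_fun setT g -> measurable_fun setT h ->
  mu.-integrable I (fun y => (g y)%:E) -> mu.-integrable I (fun y => (h y)%:E) ->
  (\int[mu]_(x in I) (h x * pv g t x)%:E = \int[mu]_(x in I) (g x * pv h t x)%:E)%E.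
Proof.
move=> t0 mg mh ig ih.
rewrite -[LHS]RintegralE; [|exact: mI|exact: pv_mul_integrable].
rewrite -[RHS]RintegralE; [|exact: mI|exact: pv_mul_integrable].
by rewrite (pv_symm t0 mg mh ig ih).
Qed.

Lemma measurable_powpv (b : R) (g : R -> R) (x : R) : measurable_fun setT g ->
  measurable_fun setT (fun t => t `^ (b - 1) * pv g t x).
Proof.
by move=> mg; apply: measurable_funM; [exact: measurable_powRl|exact: measurable_pv].
Qed.

(** Symmetry is inherited from the Poisson operator at each time. Nonnegativity allows the exchange
    of integrals with both sides possibly infinite. *)
Lemma time_integral_symm (b : R) (D : set R) (g h : R -> R) : measurable D -> D `<=` Rp ->
  measurable_fun setT g -> measurable_fun setT h ->
  mu.-integrable I (fun y => (g y)%:E) -> mu.-integrable I (fun y => (h y)%:E) ->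
  (forall y, 0 <= g y) -> (forall y, 0 <= h y) ->
  (\int[mu]_(x in I) \int[mu]_(t in D) (h x * (t `^ (b - 1) * pv g t x))%:E =
   \int[mu]_(x in I) \int[mu]_(t in D) (g x * (t `^ (b - 1) * pv h t x))%:E)%E.
Proof.
move=> mD DRp mg mh ig ih g0 h0.
have E (k l : R -> R) : measurable_fun setT k -> measurable_fun setT l ->
    mu.-integrable I (fun y => (k y)%:E) -> mu.-integrable I (fun y => (l y)%:E) ->
    (forall y, 0 <= k y) -> (forall y, 0 <= l y) ->
    (\int[mu]_(x in I) \int[mu]_(t in D) (l x * (t `^ (b - 1) * pv k t x))%:E =
     \int[mu]_(t in D) ((t `^ (b - 1))%:E * \int[mu]_(x in I) (l x * pv k t x)%:E))%E.
  move=> mk ml ik il k0 l0.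
  transitivity (\int[mu]_(x in I) \int[mu]_(t in D) `|l x * (t `^ (b - 1) * pv k t x)|%:E)%E.
    apply: eq_integral => x _; apply: eq_integral => t /set_mem /DRp /Rp_gt0 t0.
    by rewrite ger0_norm// !mulr_ge0 ?powR_ge0 ?pv_ge0.
  rewrite (@Rtonelli R I D (fun x t => `|l x * (t `^ (b - 1) * pv k t x)|))//; last first.
    apply: measurableT_comp => //; apply: measurable_funM; first exact: (measurableT_comp ml).
    by apply: measurable_funM; [exact: measurable_powRl|exact: measurable_pv].
  apply: eq_integral => t /set_mem /DRp /Rp_gt0 t0.
  rewrite -ge0_integral_cmul//; last 3 first.
  - exact: powR_ge0.
  - by apply: measurable_funTS; apply: measurable_funM => //; exact: measurable_pv.
  - by move=> x _; rewrite mulr_ge0 ?pv_ge0.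
  by apply: eq_integral => x _; rewrite ger0_norm ?mulr_ge0 ?powR_ge0 ?pv_ge0// mulrCA.
rewrite (E g h mg mh ig ih g0 h0) (E h g mh mg ih ig h0 g0); apply: eq_integral => t /set_mem /DRp /Rp_gt0 t0.
by rewrite (pv_symm_ge0 t0 mg mh).
Qed.

(** * Absorption argument for boundedness *)

Section contraction.
Variables (b m A C : R) (g w a : R -> R).
Hypotheses (b0 : 0 < b) (m1 : 1 < m) (mb : m^-1 < b) (A0 : 0 <= A) (C0 : 0 < C).
Hypotheses (mg : measurable_fun setT g) (ig : mu.-integrable I (fun y => (g y)%:E))
  (g0 : \int[mu]_(y in I) g y = 0) (mw : measurable_fun setT w) (ma : measurable_fun setT a)
  (a1 : forall x, 1 <= a x).
Let W x := 1 + `|w x|.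
Hypotheses (gW : forall x, `|g x| <= C * (a x * W x))
  (iaW : mu.-integrable I (fun x => (a x * W x)%:E))
  (iam : mu.-integrable I (fun x => (a x `^ m)%:E))
  (rep : {ae mu, forall x, I x -> `|w x| <= A + (gam b)^-1 * `|wk b g x|}).

Let N := \int[mu]_(x in I) (a x `^ m).
Let K := 1 + 8 * expR 1 * N.
Let c := C / gam b.
(** Half of the surplus exponent: in [t^(b-1) t^(-1/m) = t^e t^(e-1)] one half keeps the integral
    convergent at 0, the other becomes the small factor [dl^e]. *)
Let e := (b - m^-1) / 2.

Let a0 x : 0 <= a x. Proof. exact: le_trans (a1 x). Qed.
Let N0 : 0 <= N. Proof. by apply: Rintegral_ge0 => x _; exact: powR_ge0. Qed.
Let K0 : 0 < K. Proof. by rewrite ltr_pwDl// !mulr_ge0 ?expR_ge0. Qed.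
Let c0 : 0 < c. Proof. by rewrite divr_gt0// gam_gt0. Qed.
Let e0 : 0 < e. Proof. by rewrite divr_gt0// subr_gt0. Qed.
Let W1 x : 1 <= W x. Proof. by rewrite /W lerDl. Qed.
Let mW : measurable_fun setT W.
Proof. by apply: measurable_funD => //; exact: measurableT_comp. Qed.

Let ia : mu.-integrable I (fun x => (a x)%:E).
Proof.
apply: (integrable_dom mI _ _ iaW); first exact: measurable_funTS.
by move=> x _; rewrite ger0_norm// -[leLHS]mulr1 ler_wpM2l.
Qed.

(** The bound from [L^m] to [L^oo]. The function is split at the level [l = t^(-1/m)]: the low part
    costs [l] by mass one, the high part costs [l^(1-m)] times the supremum [O(1/t)] of the kernel,
    and this level makes the two costs of the same order. *)
Let pva (t x : R) : 0 < t <= 1 -> pv a t x <= K * t `^ (- m^-1).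
Proof.
move=> /andP[t0 t1]; pose l := t `^ (- m^-1); have l0 : 0 < l by exact: powR_gt0.
have m0 : 0 < m by exact: lt_trans m1.
have i1 : mu.-integrable I (fun y => (l * pk t (x - y))%:E).
  by apply: integrable_cmul => //; exact: pk_integrable.
have i2 : mu.-integrable I (fun y => (8 * expR 1 / t * l `^ (1 - m) * a y `^ m)%:E).
  exact: integrable_cmul.
apply: (@le_trans _ _ (\int[mu]_(y in I) (l * pk t (x - y) + 8 * expR 1 / t * l `^ (1 - m) * a y `^ m))).
  apply: Rintegral_le => //; [exact: pk_mul_integrable|exact: integrable_add|].
  move=> y _; have h := young_power l0 (a0 y) (ltW m1).
  apply: (@le_trans _ _ (pk t (x - y) * (l + l `^ (1 - m) * a y `^ m))).
    by rewrite ler_wpM2l ?pk_ge0.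
  rewrite mulrDr mulrC lerD2l -mulrA ler_wpM2r ?mulr_ge0 ?powR_ge0//.
  by rewrite pk_small ?t0.
rewrite Rintegral_add// !Rintegral_cmul//; last exact: pk_integrable.
rewrite poisson_mass// mulr1 -/N.
have -> : 8 * expR 1 / t * l `^ (1 - m) = 8 * expR 1 * l.
  rewrite -!mulrA; congr (_ * (_ * _)); rewrite /l -powRrM -powR_inv1 ?(ltW t0)//.
  rewrite -powRD ?(gt_eqF t0) ?implybT//; congr (_ `^ _).
  by field; rewrite gt_eqF.
by rewrite -/l /K; lra.
Qed.

Section small_time.
Variable dl : R.
Hypotheses (dl0 : 0 < dl) (dl1 : dl <= 1) (dle : c * K * expR 1 * gam e * dl `^ e <= 2^-1).
Let D : set R := `]0%R, dl[%classic.
Let mD : measurable D. Proof. exact: measurable_itv. Qed.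
Let D_in t : D t -> 0 < t < dl. Proof. by rewrite /D /= in_itv. Qed.
Let DRp : D `<=` Rp.
Proof. by move=> t /D_in /andP[t0 _]; rewrite /= in_itv /= andbT. Qed.

Let S (h : R -> R) x := (\int[mu]_(t in D) (t `^ (b - 1) * pv h t x)%:E)%E.

Let mS h : measurable_fun setT h -> measurable_fun setT (S h).
Proof.
move=> mh; apply: (@measurable_eint R _ R D (fun x t => t `^ (b - 1) * pv h t x)) => //.
by apply: measurable_funM; [exact: measurable_powRl|exact: measurable_pv].
Qed.

Let S_ge0 h x : (forall y, 0 <= h y) -> (0 <= S h x)%E.
Proof.
move=> h0; apply: integral_ge0 => t /D_in /andP[t0 _].
by rewrite lee_fin mulr_ge0 ?powR_ge0 ?pv_ge0.
Qed.

Let Sa x : (c%:E * S a x <= (2^-1)%:E)%E.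
Proof.
have ige : mu.-integrable Rp (fun t => (t `^ (e - 1) * expR (- (1 * t)))%:E).
  exact: gamma_integrable.
have gE : (\int[mu]_(t in Rp) (t `^ (e - 1) * expR (- (1 * t)))%:E)%E = (gam e)%:E.
  rewrite -RintegralE//; congr EFin; apply: eq_Rintegral => t _; by rewrite mul1r.
(* The factor [expR 1] compensates for [e^(-t) >= e^(-1)] on []0, dl[]; the inserted exponential
   allows the bound by [gam e]. *)
pose k := K * dl `^ e * expR 1.
have k0 : 0 <= k by rewrite !mulr_ge0 ?expR_ge0 ?powR_ge0// ltW.
have h : (S a x <= (k * gam e)%:E)%E.
  rewrite EFinM -gE -ge0_integral_cmul//; last 2 first.
  - by apply: measurable_funTS; exact: measurable_powexp.
  - by move=> t _; rewrite mulr_ge0 ?powR_ge0 ?expR_ge0.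
  apply: (@le_trans _ _ (\int[mu]_(t in D) (k * (t `^ (e - 1) * expR (- (1 * t))))%:E)%E).
    apply: ge0_le_integral => //.
    - by move=> t /D_in /andP[t0 _]; rewrite lee_fin mulr_ge0 ?powR_ge0 ?pv_ge0.
    - by apply/measurable_EFinP; apply: measurable_funTS; exact: measurable_powpv.
    - apply/measurable_EFinP; apply: measurable_funTS; apply: measurable_funM => //.
      exact: measurable_powexp.
    move=> t /D_in /andP[t0 td]; have t1 : t <= 1 by apply: le_trans dl1; exact: ltW.
    rewrite lee_fin; apply: (@le_trans _ _ (t `^ (b - 1) * (K * t `^ (- m^-1)))).
      by rewrite ler_wpM2l ?powR_ge0// pva ?t0.
    have -> : t `^ (b - 1) * (K * t `^ (- m^-1)) = K * (t `^ e * t `^ (e - 1)).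
      rewrite mulrCA -!powRD ?(gt_eqF t0) ?implybT//; congr (_ * _ `^ _).
      by rewrite /e; field; rewrite gt_eqF// (lt_trans _ m1).
    have -> : k * (t `^ (e - 1) * expR (- (1 * t))) = K * (dl `^ e * t `^ (e - 1) * (expR 1 * expR (- (1 * t)))).
      by rewrite /k; ring.
    rewrite ler_wpM2l ?(ltW K0)// -[leLHS]mulr1; apply: ler_pM; rewrite ?mulr_ge0 ?powR_ge0//.
      by rewrite ler_wpM2r ?powR_ge0// ge0_ler_powR ?nnegrE ?(ltW e0) ?(ltW t0) ?(ltW dl0) ?(ltW td).
    by rewrite -expRD -[leLHS]expR0 ler_expR mul1r subr_ge0.
  apply: ge0_subset_integral => //.
  - apply/measurable_EFinP; apply: measurable_funTS; apply: measurable_funM => //.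
    exact: measurable_powexp.
  - move=> t _; rewrite lee_fin; apply: mulr_ge0 => //.
    by rewrite mulr_ge0 ?powR_ge0 ?expR_ge0.
apply: (@le_trans _ _ (c%:E * (k * gam e)%:E)%E).
  by apply: lee_wpmul2l => //; rewrite lee_fin ltW.
rewrite -EFinM lee_fin; apply: le_trans dle.
by rewrite le_eqVlt; apply/orP; left; apply/eqP; rewrite /k; ring.
Qed.

(** Bounds the contribution of times [t >= dl], where the mean-zero decay gives [64 t^(-2) e^(-t/2)
    <= 64 dl^(-2) e^(-t/2)]. *)
Let tailC := 64 * dl ^- 2 * (\int[mu]_(y in I) `|g y|) *
  \int[mu]_(t in Rp) (t `^ (b - 1) * expR (- (2^-1 * t))).
Let B := 1 + A + (gam b)^-1 * tailC.

Let tailC0 : 0 <= tailC.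
Proof.
rewrite !mulr_ge0 ?invr_ge0 ?exprn_ge0 ?(ltW dl0)//.
  by apply: Rintegral_ge0.
by apply: Rintegral_ge0 => t _; rewrite mulr_ge0 ?powR_ge0 ?expR_ge0.
Qed.

Let B1 : 1 <= B.
Proof. by rewrite /B -addrA lerDl addr_ge0// mulr_ge0// invr_ge0 ltW// gam_gt0. Qed.

Let wk_le x : (`|wk b g x|%:E <= C%:E * S (fun y => (a y * W y)%R) x + tailC%:E)%E.
Proof.
have mt : measurable_fun setT (fun t => t `^ (b - 1) * pv g t x) by exact: measurable_powpv.
have mt' : measurable_fun setT (fun t => `|t `^ (b - 1) * pv g t x|) by exact: measurableT_comp.
have -> : `|wk b g x|%:E = `|fine (\int[mu]_(t in Rp) (t `^ (b - 1) * pv g t x)%:E)%E|%:E by [].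
apply: (le_trans (abse_fine_le _)).
apply: (le_trans (@le_abse_integral _ _ R mu Rp (fun t => (t `^ (b - 1) * pv g t x)%:E) mRp _)).
  by apply/measurable_EFinP; exact: measurable_funTS.
pose D' : set R := `[dl, +oo[%classic.
have mD' : measurable D' by exact: measurable_itv.
have RE : Rp = D `|` D'.
  apply/seteqP; split => t; rewrite /D /D' /= !in_itv /= !andbT => h.
    by have [h1|h1] := ltP t dl; [left; rewrite h|right].
  by case: h => [/andP[]//|]; exact: lt_le_trans.
have DD' : [disjoint D & D'].
  rewrite disj_set2E; apply/eqP/seteqP; split => // t [].
  by rewrite /D /D' /= !in_itv /= andbT => /andP[_ h1] h2; move: (lt_le_trans h1 h2); rewrite ltxx.
rewrite [X in (\int[mu]_(_ in X) _)%E]RE ge0_integral_setU//; last first.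
  by apply/measurable_EFinP; exact: measurable_funTS.
have igt : mu.-integrable Rp (fun t => (t `^ (b - 1) * expR (- (2^-1 * t)))%:E).
  by apply: gamma_integrable => //; rewrite invr_gt0.
apply: leeD.
  rewrite /S -ge0_integral_cmul//; last 3 first.
  - exact: ltW.
  - apply: measurable_funTS; apply: measurable_powpv; exact: measurable_funM.
  - move=> t /D_in /andP[t0 _]; rewrite mulr_ge0 ?powR_ge0// pv_ge0// => y.
    by rewrite mulr_ge0// (le_trans _ (W1 y)).
  apply: ge0_le_integral => //.
  - by apply/measurable_EFinP; apply: measurable_funTS.
  - apply/measurable_EFinP; apply: measurable_funTS; apply: measurable_funM => //.
    by apply: measurable_powpv; exact: measurable_funM.
  move=> t /D_in /andP[t0 _]; rewrite lee_fin normrM ger0_norm ?powR_ge0// mulrCA.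
  rewrite ler_wpM2l ?powR_ge0//.
  have iC : mu.-integrable I (fun y => (C * (a y * W y))%:E) by exact: integrable_cmul.
  apply: (le_trans (pv_le ig x t0 iC _ _)).
  - by apply: measurable_funM => //; exact: measurable_funM.
  - by move=> y _; exact: gW.
  under eq_Rintegral do rewrite mulrCA.
  by rewrite Rintegral_cmul//; apply: pk_mul_integrable.
pose G := \int[mu]_(y in I) `|g y|.
have G0 : 0 <= G by apply: Rintegral_ge0.
have k0 : 0 <= 64 * dl ^- 2 * G by rewrite !mulr_ge0// invr_ge0 exprn_ge0// ltW.
rewrite /tailC -/G EFinM RintegralE// -ge0_integral_cmul//; last 2 first.
- by apply: measurable_funTS; exact: measurable_powexp.
- by move=> t _; rewrite mulr_ge0 ?powR_ge0 ?expR_ge0.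
apply: (@le_trans _ _ (\int[mu]_(t in D') (64 * dl ^- 2 * G * (t `^ (b - 1) * expR (- (2^-1 * t))))%:E)%E).
  apply: ge0_le_integral => //.
  - by apply/measurable_EFinP; apply: measurable_funTS.
  - apply/measurable_EFinP; apply: measurable_funTS; apply: measurable_funM => //.
    exact: measurable_powexp.
  move=> t; rewrite /D' /= in_itv /= andbT => dt; have t0 : 0 < t by exact: lt_le_trans dt.
  rewrite lee_fin normrM ger0_norm ?powR_ge0//.
  have -> : 64 * dl ^- 2 * G * (t `^ (b - 1) * expR (- (2^-1 * t))) =
     t `^ (b - 1) * (64 * dl ^- 2 * expR (- (2^-1 * t)) * G) by ring.
  rewrite ler_wpM2l ?powR_ge0//; have hd := pv_decay ig x t0 g0; apply: (le_trans hd).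
  rewrite -/G ler_wpM2r//; apply: (le_trans (rho_sq_inv t0)).
  rewrite [2^-1 * t]mulrC ler_wpM2r ?expR_ge0// ler_wpM2l//.
  by rewrite lef_pV2 ?posrE ?exprn_gt0// lerXn2r ?nnegrE ?(ltW dl0) ?(ltW t0).
apply: ge0_subset_integral => //.
- apply/measurable_EFinP; apply: measurable_funTS; apply: measurable_funM => //.
  exact: measurable_powexp.
- move=> t _; rewrite lee_fin; apply: mulr_ge0 => //.
  by rewrite mulr_ge0 ?powR_ge0 ?expR_ge0.
- by move=> t; rewrite /D' /= !in_itv /= !andbT; exact: lt_le_trans.
Qed.

(** The excess of [1 + |w|] over the level [2 B]; boundedness means that it vanishes almost
    everywhere. *)
Let z x := Num.max (W x - 2 * B) 0.
Let z0 x : 0 <= z x. Proof. by rewrite le_max lexx orbT. Qed.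
Let mz : measurable_fun setT z.
Proof. by apply: max0_measurable; exact: measurable_funB. Qed.
Let zW x : z x <= W x.
Proof.
have := W1 x; have := B1; rewrite /z /Num.max; case: ifP => _ *; lra.
Qed.
Let Wz x : W x <= 2 * B + z x.
Proof. by rewrite -lerBlDl /z le_max lexx. Qed.
Let iaz : mu.-integrable I (fun x => (a x * z x)%:E).
Proof.
apply: (integrable_dom mI _ _ iaW); first by apply: measurable_funTS; exact: measurable_funM.
by move=> x _; rewrite ger0_norm ?mulr_ge0// ler_wpM2l.
Qed.
Let maz : measurable_fun setT (fun x => a x * z x). Proof. exact: measurable_funM. Qed.

Let S_split x : (S (fun y => (a y * W y)%R) x <= (2 * B)%:E * S a x + S (fun y => (a y * z y)%R) x)%E.
Proof.
have B0 : 0 <= 2 * B by rewrite mulr_ge0// (le_trans _ B1).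
rewrite /S -ge0_integral_cmul//; last 2 first.
- by apply: measurable_funTS; exact: measurable_powpv.
- by move=> t /D_in /andP[t0 _]; rewrite mulr_ge0 ?powR_ge0 ?pv_ge0.
rewrite -ge0_integralD//; last 4 first.
- by move=> t /D_in /andP[t0 _]; rewrite lee_fin mulr_ge0// mulr_ge0 ?powR_ge0 ?pv_ge0.
- apply/measurable_EFinP; apply: measurable_funTS; apply: measurable_funM => //; exact: measurable_powpv.
- move=> t /D_in /andP[t0 _]; rewrite lee_fin mulr_ge0 ?powR_ge0 ?pv_ge0// => y.
  by rewrite mulr_ge0.
- by apply/measurable_EFinP; apply: measurable_funTS; exact: measurable_powpv.
apply: ge0_le_integral => //.
- move=> t /D_in /andP[t0 _]; rewrite lee_fin mulr_ge0 ?powR_ge0 ?pv_ge0// => y.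
  by rewrite mulr_ge0// (le_trans _ (W1 y)).
- by apply/measurable_EFinP; apply: measurable_funTS; apply: measurable_powpv; exact: measurable_funM.
- apply: measurable_funTS; apply: emeasurable_funD; apply/measurable_EFinP; last exact: measurable_powpv.
  by apply: measurable_funM => //; exact: measurable_powpv.
move=> t /D_in /andP[t0 _]; rewrite -EFinD lee_fin mulrCA -mulrDr ler_wpM2l ?powR_ge0//.
have i1 : mu.-integrable I (fun y => (2 * B * (pk t (x - y) * a y))%:E).
  by apply: integrable_cmul => //; exact: pk_mul_integrable.
have i2 : mu.-integrable I (fun y => (pk t (x - y) * (a y * z y))%:E) by exact: pk_mul_integrable.
rewrite /pv -Rintegral_cmul//; last exact: pk_mul_integrable.
rewrite -Rintegral_add//; apply: Rintegral_le => //.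
- exact: pk_mul_integrable.
- exact: integrable_add.
move=> y _.
have -> : 2 * B * (pk t (x - y) * a y) + pk t (x - y) * (a y * z y) =
  pk t (x - y) * (a y * (2 * B + z y)) by ring.
by rewrite ler_wpM2l ?pk_ge0// ler_wpM2l.
Qed.

(** Split [W <= 2 B + z] under the truncated operator. Because [c S(a) <= 1/2], the constant part
    returns at most [B], so [W <= 2 B + c S(a z)]. The inequality is trivial where [S(a z)] is
    infinite. *)
Let z_le : {ae mu, forall x, I x -> ((z x)%:E <= c%:E * S (fun y => (a y * z y)%R) x)%E}.
Proof.
apply: aeS rep => x h Ix; have {}h := h Ix.
have Saz0 : (0 <= S (fun y => (a y * z y)%R) x)%E by apply: S_ge0 => y; rewrite mulr_ge0.
have [Sz|Sz] := eqVneq (S (fun y => (a y * z y)%R) x) +oo%E.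
  by rewrite Sz gt0_muley ?leey// lte_fin.
have [q qE] : exists q : R, S (fun y => (a y * z y)%R) x = q%:E.
  by exists (fine (S (fun y => (a y * z y)%R) x)); rewrite fineK// ge0_fin_numE// ltey.
have q0 : 0 <= q by rewrite -lee_fin -qE.
have Sa0 : (0 <= S a x)%E by exact: S_ge0.
have [r rE] : exists r : R, S a x = r%:E.
  exists (fine (S a x)); rewrite fineK// ge0_fin_numE// ltey; apply/negP => /eqP E.
  by have := Sa x; rewrite E gt0_muley ?lte_fin.
have r2 : c * r <= 2^-1 by have := Sa x; rewrite rE -EFinM lee_fin.
have h1 : (`|wk b g x|%:E <= (C * (2 * B * r + q) + tailC)%:E)%E.
  apply: (le_trans (wk_le x)); rewrite EFinD [(C * _)%:E]EFinM; apply: leeD => //.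
  apply: lee_wpmul2l; first by rewrite lee_fin ltW.
  by rewrite EFinD EFinM -rE -qE.
rewrite lee_fin in h1; rewrite qE -EFinM lee_fin.
have gb := gam_gt0 b0.
have h2 : W x <= B + c * (2 * B * r + q).
  rewrite /W /B /c; apply: (@le_trans _ _ (1 + (A + (gam b)^-1 * (C * (2 * B * r + q) + tailC)))).
    by rewrite lerD2l (le_trans h)// lerD2l ler_wpM2l// invr_ge0 ltW.
  by rewrite le_eqVlt; apply/orP; left; apply/eqP; rewrite /B; ring.
rewrite /z ge_max (mulr_ge0 (ltW c0) q0) andbT.
have := B1; nra.
Qed.

(** Let [J] be the integral of [a z]. Multiplying the inequality for [z] by [a] and using symmetry
    moves the operator from [a z] to [a], where it costs at most 1/2 after the factor [c]: so
    [J <= J / 2]. Since [J] is finite, it is 0, and [a >= 1] gives [z = 0]. The weight [a] is what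
    makes symmetry usable. *)
Lemma bounded_of_contraction : {ae mu, forall x, I x -> `|w x| <= 2 * B}.
Proof.
pose az x := a x * z x.
have az0 x : 0 <= az x by rewrite mulr_ge0.
pose J := (\int[mu]_(x in I) (az x)%:E)%E.
have J0 : (0 <= J)%E by apply: integral_ge0 => x _; rewrite lee_fin.
have maS h : measurable_fun setT h -> measurable_fun setT (fun x => (a x)%:E * S h x)%E.
  by move=> mh; apply: emeasurable_funM; [exact/measurable_EFinP|exact: mS].
have inner (h k : R -> R) x : measurable_fun setT h -> (forall y, 0 <= h y) -> 0 <= k x ->
    ((k x)%:E * S h x = \int[mu]_(t in D) (k x * (t `^ (b - 1) * pv h t x))%:E)%E.
  move=> mh h0 k0; rewrite -ge0_integral_cmul//.
    by apply: measurable_funTS; exact: measurable_powpv.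
  by move=> t /D_in /andP[t0 _]; rewrite mulr_ge0 ?powR_ge0 ?pv_ge0.
have JJ : (J <= (2^-1)%:E * J)%E.
  apply: (@le_trans _ _ (\int[mu]_(x in I) (c%:E * ((a x)%:E * S az x)))%E).
    apply: ae_ge0_le_integral => //.
    - by move=> x _; rewrite lee_fin.
    - by apply/measurable_EFinP; exact: measurable_funTS.
    - move=> x _; rewrite mule_ge0 ?lee_fin ?(ltW c0)// mule_ge0 ?lee_fin//.
      exact: S_ge0.
    - by apply: measurable_funTS; apply: measurable_funeM; exact: maS.
    apply: aeS z_le => x h Ix; rewrite /az EFinM muleCA.
    by apply: lee_wpmul2l; [rewrite lee_fin|exact: h].
  rewrite ge0_integralZl//; last 3 first.
  - by apply: measurable_funTS; exact: maS.
  - by move=> x _; rewrite mule_ge0 ?lee_fin//; exact: S_ge0.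
  - by rewrite lee_fin ltW.
  have -> : (\int[mu]_(x in I) ((a x)%:E * S az x) = \int[mu]_(x in I) ((az x)%:E * S a x))%E.
    transitivity (\int[mu]_(x in I) \int[mu]_(t in D) (a x * (t `^ (b - 1) * pv az t x))%:E)%E.
      by apply: eq_integral => x _; rewrite inner.
    rewrite time_integral_symm//.
    by apply: eq_integral => x _; rewrite inner.
  have mzS : measurable_fun setT (fun x => (az x)%:E * S a x)%E.
    by apply: emeasurable_funM; [exact/measurable_EFinP|exact: mS].
  rewrite -ge0_integralZl//; last 3 first.
  - exact: measurable_funTS.
  - by move=> x _; rewrite mule_ge0 ?lee_fin//; exact: S_ge0.
  - by rewrite lee_fin ltW.
  rewrite -ge0_integral_cmul//; last exact: measurable_funTS.
  apply: ge0_le_integral => //.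
  - move=> x _; rewrite mule_ge0 ?lee_fin ?(ltW c0)// mule_ge0 ?lee_fin//.
    exact: S_ge0.
  - by apply: measurable_funTS; exact: measurable_funeM.
  - by apply/measurable_EFinP; apply: measurable_funTS; exact: measurable_funM.
  move=> x _; rewrite muleCA [leRHS]EFinM [leRHS]muleC.
  by apply: lee_wpmul2l; [rewrite lee_fin|exact: Sa].
have Jfin : (J < +oo)%E.
  have := integrable_ae_lty iaz; congr (_ < _)%E.
  by apply: eq_integral => x _; rewrite ger0_norm// mulr_ge0.
have Jz : J = 0%E.
  move: J0 JJ Jfin; case: J => [j| |] //; rewrite -EFinM !lee_fin => j0 jj _.
  by congr EFin; lra.
have : ae_eq mu I (fun x => (az x)%:E) (cst 0%E).
  apply/ae_eq_integral_abs => //; first by apply/measurable_EFinP; exact: measurable_funTS.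
  by rewrite -[RHS]Jz; apply: eq_integral => x _; rewrite gee0_abs// lee_fin.
apply: aeS => x h Ix; have {h} := h Ix; rewrite /cst => -[h].
have ap : 0 < a x by exact: lt_le_trans (a1 x).
have zx : z x = 0 by move/eqP: h; rewrite mulf_eq0 (gt_eqF ap) => /eqP.
by have := Wz x; rewrite zx /W; lra.
Qed.

End small_time.

Lemma ae_bounded : exists M, {ae mu, forall x, I x -> `|w x| <= M}.
Proof.
(* The denominator is chosen so that [dl^e = 1 / Dn]: the 2 makes the product at most 1/2, the 1
   makes [dl <= 1]. *)
pose Dn := 1 + 2 * (c * K * expR 1 * gam e).
have ge := gam_gt0 e0.
have Q0 : 0 < c * K * expR 1 * gam e.
  by apply: mulr_gt0 => //; apply: mulr_gt0; [exact: mulr_gt0|exact: expR_gt0].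
have Dn1 : 1 <= Dn by rewrite lerDl mulr_ge0// ltW.
pose dl := Dn `^ (- e^-1).
have D0 : 0 < Dn by exact: lt_le_trans Dn1.
have dl0 : 0 < dl by exact: powR_gt0.
have dl1 : dl <= 1 by rewrite -[leRHS](powRr0 Dn) ler_powR// oppr_le0 invr_ge0 ltW.
have dle : c * K * expR 1 * gam e * dl `^ e <= 2^-1.
  rewrite /dl -powRrM mulNr mulVf ?gt_eqF// powR_inv1 ?(ltW D0)// ler_pdivrMr//.
  by rewrite /Dn; lra.
eexists; exact: (bounded_of_contraction dl0 dl1 dle).
Qed.

End contraction.

End bounded_solutions.

(** * Derivatives of the Poisson kernel *)

Section kernel_derivatives.
Context {R : realType}.
Notation mu := (@lebesgue_measure R).
Local Notation tau := ((pi : R) *+ 2).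
Local Notation I := (@per_itv R).
Local Notation Rp := (`]0%R, +oo[%classic : set R).
Let mI := @measurable_per R.

Definition ik (t x : R) : R := (qk t x)^-1.

(** Closed forms of the derivatives of the kernel in [x]. Order three suffices because
    [2s + alpha < 3]; the last formula is also the value at larger indices, for which no derivative
    is claimed. *)
Definition pd (j : nat) (t x : R) : R :=
  match j with
  | 0 => pk t x
  | 1 => sh t / tau * (- (sin x * ik t x ^+ 2))
  | 2 => sh t / tau * (2 * sin x ^+ 2 * ik t x ^+ 3 - cos x * ik t x ^+ 2)
  | _ => sh t / tau * (6 * (sin x * cos x * ik t x ^+ 3) - 6 * (sin x ^+ 3 * ik t x ^+ 4) + sin x * ik t x ^+ 2)
  end.

Lemma is_derive_qk (t x : R) : is_derive x 1 (qk t) (sin x).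
Proof.
have h : is_derive x 1 (fun x : R => ch t - cos x) (0 - - sin x).
  by apply: is_deriveB.
by apply: (is_derive_eq h); rewrite sub0r opprK.
Qed.

Lemma is_derive_ik (t x : R) : 0 < t -> is_derive x 1 (ik t) (- (sin x * ik t x ^+ 2)).
Proof.
move=> t0; have q0 := qk_gt0 x t0.
have h : is_derive x 1 (fun x => (qk t x)^-1) (- (qk t x) ^- 2 *: sin x).
  by apply: is_deriveV; [rewrite gt_eqF|exact: is_derive_qk].
by apply: (is_derive_eq h); rewrite /ik exprVn /GRing.scale /= mulNr mulrC.
Qed.

Lemma is_derive_mulr (f g : R -> R) (x a b : R) : is_derive x 1 f a -> is_derive x 1 g b ->
  is_derive x 1 (fun x => f x * g x) (a * g x + f x * b).
Proof.
move=> hf hg; have h := is_deriveM hf hg.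
by apply: (is_derive_eq h); rewrite /GRing.scale /= addrC [g x * a]mulrC.
Qed.

Lemma is_derive_expr (f : R -> R) n (x a : R) : is_derive x 1 f a ->
  is_derive x 1 (fun x => f x ^+ n.+1) (n.+1%:R * f x ^+ n * a).
Proof.
move=> hf; have := is_deriveX n.+1 hf; rewrite exprfctE => h.
by apply: (is_derive_eq h); rewrite /GRing.scale /= mulr_natl.
Qed.

Lemma is_derive_cmul (f : R -> R) (k x a : R) : is_derive x 1 f a ->
  is_derive x 1 (fun x => k * f x) (k * a).
Proof. by move=> hf; have h := is_deriveZ k hf; apply: (is_derive_eq h). Qed.

Lemma is_derive_pd (j : nat) (t x : R) : (j < 3)%N -> 0 < t ->
  is_derive x 1 (pd j t) (pd j.+1 t x).
Proof.
move=> j3 t0; have hi := is_derive_ik x t0.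
have hs : is_derive x 1 (@sin R) (cos x) by exact: is_derive_sin.
have hc : is_derive x 1 (@cos R) (- sin x) by exact: is_derive_cos.
case: j j3 => [|[|[|j]]] // _.
- have h := is_derive_cmul (sh t / tau) hi.
  have -> : pd 0 t = (fun x => sh t / tau * ik t x).
    by apply/funext => y; rewrite /pd /pk /ik mulrAC.
  exact: h.
- have h := is_derive_cmul (sh t / tau) (is_deriveN (is_derive_mulr hs (is_derive_expr 1 hi))).
  by apply: (is_derive_eq h); rewrite /pd; ring.
- have h1 := is_derive_mulr (is_derive_cmul 2 (is_derive_expr 1 hs)) (is_derive_expr 2 hi).
  have h2 := is_derive_mulr hc (is_derive_expr 1 hi).
  have h := is_derive_cmul (sh t / tau) (is_deriveB h1 h2).
  by apply: (is_derive_eq h); rewrite /pd; ring.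
Qed.

Lemma measurable_pd (j : nat) d (T : measurableType d) (f g : T -> R) :
  measurable_fun setT f -> measurable_fun setT g ->
  measurable_fun setT (fun z => pd j (f z) (g z)).
Proof.
move=> mf mg.
have mi : measurable_fun setT (fun z => ik (f z) (g z)).
  by apply: measurable_funV; exact: measurable_qk2.
have ms : measurable_fun setT (fun z => sin (g z)) by exact: (measurableT_comp measurable_sin).
have mc : measurable_fun setT (fun z => cos (g z)) by exact: (measurableT_comp measurable_cos).
have msh : measurable_fun setT (fun z => sh (f z) / tau).
  by apply: measurable_funM => //; exact: (measurableT_comp measurable_sh).
have mX (h : T -> R) n : measurable_fun setT h -> measurable_fun setT (fun z => h z ^+ n).
  by move=> mh; exact: measurable_funX.
case: j => [|[|[|j]]].
- exact: measurable_pk2.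
- apply: measurable_funM => //; apply: measurableT_comp => //.
  by apply: measurable_funM => //; exact: mX.
- apply: measurable_funM => //; apply: measurable_funB.
    by apply: measurable_funM; [apply: measurable_funM => //|]; exact: mX.
  by apply: measurable_funM => //; exact: mX.
- apply: measurable_funM => //; apply: measurable_funD; last first.
    by apply: measurable_funM => //; exact: mX.
  apply: measurable_funB; apply: measurable_funM => //.
    by apply: measurable_funM; [exact: measurable_funM|exact: mX].
  by apply: measurable_funM; exact: mX.
Qed.

Lemma abs_sin_le (x : R) : `|sin x| <= 2 * `|sin (x / 2)|.
Proof.
have -> : sin x = sin (x / 2 *+ 2) by congr sin; rewrite -mulr_natr; field.
rewrite sin_mulr2n -mulr_natl !normrM [`|2|]ger0_norm//.
rewrite ler_wpM2l// -[leRHS]mul1r ler_wpM2r//; exact: cos_max.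
Qed.

(** With [M] as the distance to the singularity, [ik <= 1 / (2 M^2)] and [|sin x| <= 2 M], so each
    derivative costs a factor [M^-1] relative to the kernel. The third derivative also contains
    [sin x * ik^2], which costs a single [M^-1]; this is the origin of the second summand, relevant
    when [M] is large. *)
Lemma pd_le (j : nat) (t x M : R) : (0 < j <= 3)%N -> 0 < t ->
  M = Num.max (rho t) `|sin (x / 2)| ->
  `|pd j t x| <= 9 * pk t x * (M ^- j + M^-1).
Proof.
move=> j3 t0 ME; have r0 := rho_gt0 t0.
have M0 : 0 < M by rewrite ME lt_max r0.
have q0 := qk_gt0 x t0.
have qM : 2 * M ^+ 2 <= qk t x.
  rewrite qkE ler_pM2l// ME /Num.max; case: ifP => _; last by rewrite lerDl sqr_ge0.
  by rewrite real_normK ?num_real// lerDr sqr_ge0.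
have i0 : 0 < ik t x by rewrite /ik invr_gt0.
have iM : ik t x <= (2 * M ^+ 2)^-1.
  by rewrite /ik lef_pV2 ?posrE// mulr_gt0// exprn_gt0.
have sM : `|sin x| <= 2 * M.
  by apply: (le_trans (abs_sin_le x)); rewrite ler_wpM2l// ME le_max lexx orbT.
have K0 : 0 < sh t / tau by rewrite divr_gt0 ?sh_gt0 ?tau_gt0.
have pE : pk t x = sh t / tau * ik t x by rewrite /pk /ik mulrAC.
have cM : `|cos x| <= 1 by exact: cos_max.
set k := sh t / tau in K0 pE *; set i := ik t x in i0 iM pE *.
set S := `|sin x| in sM *; have S0 : 0 <= S by exact: normr_ge0.
have iN : `|i| = i by rewrite gtr0_norm.
pose N := M^-1; have N0 : 0 < N by rewrite invr_gt0.
have iM' : i <= N ^+ 2 / 2.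
  by apply: (le_trans iM); rewrite invfM mulrC exprVn.
have SiN : S * i <= N.
  apply: (@le_trans _ _ (2 * M * (N ^+ 2 / 2))); first by apply: ler_pM => //; exact: ltW.
  by rewrite le_eqVlt; apply/orP; left; apply/eqP; rewrite /N; field; rewrite gt_eqF.
have MjE n : M ^- n = N ^+ n by rewrite /N exprVn.
have Si0 : 0 <= S * i by rewrite mulr_ge0// ltW.
have Si2 : (S * i) ^+ 2 <= N ^+ 2 by rewrite lerXn2r ?nnegrE ?(ltW N0).
have Si3 : (S * i) ^+ 3 <= N ^+ 3 by rewrite lerXn2r ?nnegrE ?(ltW N0).
have N2 : 0 <= N ^+ 2 by exact: sqr_ge0.
have N3 : 0 <= N ^+ 3 by rewrite exprn_ge0// ltW.
have Sii : S * i * i <= N ^+ 3 / 2.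
  apply: (@le_trans _ _ (N * (N ^+ 2 / 2))); first by apply: ler_pM => //; exact: ltW.
  by rewrite mulrA -exprS.
rewrite MjE -/N pE.
have fin n X : X <= 9 * (N ^+ n + N) * i -> k * X <= 9 * (k * i) * (N ^+ n + N).
  move=> h; have -> : 9 * (k * i) * (N ^+ n + N) = k * (9 * (N ^+ n + N) * i) by ring.
  by rewrite ler_wpM2l// ltW.
have e1 : `|2 * sin x ^+ 2 * i ^+ 3| = 2 * S ^+ 2 * i ^+ 3.
  by rewrite normrM [`|2 * _|]normrM !normrX iN ger0_norm.
have e2 : `|cos x * i ^+ 2| = `|cos x| * i ^+ 2 by rewrite normrM normrX iN.
have e3 : `|6 * (sin x * cos x * i ^+ 3)| = 6 * (S * `|cos x| * i ^+ 3).
  by rewrite normrM [`|_ * i ^+ 3|]normrM [`|sin x * _|]normrM normrX iN ger0_norm.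
have e4 : `|6 * (sin x ^+ 3 * i ^+ 4)| = 6 * (S ^+ 3 * i ^+ 4).
  by rewrite normrM [`|_ * i ^+ 4|]normrM !normrX iN ger0_norm.
have e5 : `|sin x * i ^+ 2| = S * i ^+ 2 by rewrite normrM normrX iN.
case: j j3 => [|[|[|[|j]]]] // _ /=; rewrite -/k -/i normrM (gtr0_norm K0); apply: fin.
- rewrite normrN e5 expr1 expr2 mulrA ler_wpM2r ?(ltW i0)//.
  lra.
- apply: (@le_trans _ _ ((2 * (S * i) ^+ 2 + i) * i)).
    apply: (le_trans (ler_normB _ _)); rewrite e1 e2.
    have -> : (2 * (S * i) ^+ 2 + i) * i = 2 * S ^+ 2 * i ^+ 3 + 1 * i ^+ 2 by ring.
    by rewrite lerD2l ler_wpM2r// exprn_ge0// ltW.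
  rewrite ler_wpM2r ?(ltW i0)//; lra.
- apply: (@le_trans _ _ ((6 * (S * i * i) + 6 * (S * i) ^+ 3 + S * i) * i)).
    apply: (le_trans (ler_normD _ _)); apply: (@le_trans _ _
      (`|6 * (sin x * cos x * i ^+ 3)| + `|6 * (sin x ^+ 3 * i ^+ 4)| + `|sin x * i ^+ 2|)).
      by rewrite lerD2r ler_normB.
    rewrite e3 e4 e5.
    have -> : (6 * (S * i * i) + 6 * (S * i) ^+ 3 + S * i) * i =
      6 * (S * 1 * i ^+ 3) + 6 * (S ^+ 3 * i ^+ 4) + S * i ^+ 2 by ring.
    do 2 rewrite lerD2r; rewrite ler_wpM2l// ler_wpM2r ?exprn_ge0 ?(ltW i0)//.
    by rewrite ler_wpM2l.
  rewrite ler_wpM2r ?(ltW i0)//; lra.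
Qed.

(* The weight |sin(x/2)|^a trades the Hoelder regularity of the data for powers of t. *)
Lemma pd_weight (a : R) (j : nat) : 0 <= a < 1 -> (0 < j <= 3)%N ->
  exists2 C : R, 0 < C & exists2 c : R, 0 < c & forall t x, 0 < t ->
    `|pd j t x| * `|sin (x / 2)| `^ a <= C * t `^ (a - j%:R) * expR (- (c * t)) * pk t x.
Proof.
move=> /andP[a0 a1] j3; have /andP[j0 _] := j3.
have j1 : 1 <= j%:R :> R by rewrite ler1n.
(* Half of the decay rate [(1 - a) / 4] of [rho^(-(1-a))]; the other half absorbs the factor
   [t^(j-1)] that turns [t^(-(1-a))] into [t^(a-j)]. *)
pose c := (1 - a) / 8; have c0 : 0 < c by rewrite divr_gt0// subr_gt0.
have jp : 0 < j%:R :> R by rewrite ltr0n.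
have [P P0 hP] := poly_expR_bound jp c0.
have P1 : 0 < 9 * (8 `^ (j%:R - a) + 8 `^ (1 - a) * P).
  by rewrite mulr_gt0// addr_gt0 ?mulr_gt0 ?powR_gt0.
exists (9 * (8 `^ (j%:R - a) + 8 `^ (1 - a) * P)) => //; exists c => // t x t0.
have r0 := rho_gt0 t0; set s := `|sin (x / 2)|.
have M0 : 0 < Num.max (rho t) s by rewrite lt_max r0.
have p0 := pk_ge0 x t0.
have sM0 : s <= Num.max (rho t) s by rewrite le_max lexx orbT.
have rM0 : rho t <= Num.max (rho t) s by rewrite le_max lexx.
have h := pd_le j3 t0 (erefl (Num.max (rho t) s)).
move: (Num.max _ _) M0 h sM0 rM0 => M M0 h sM0 rM0.
have s0 : 0 <= s by exact: normr_ge0.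
have sM : s `^ a <= M `^ a by rewrite ge0_ler_powR ?nnegrE ?(ltW M0)//.
have Mpow (k : R) : 1 <= k -> M `^ (- k) * M `^ a <= 8 `^ (k - a) * (t `^ (- (k - a)) * expR (- ((k - a) / 4 * t))).
  move=> k1; rewrite -powRD ?(gt_eqF M0) ?implybT//.
  apply: le_trans (rho_powN t0 _); last by lra.
  have -> : - k + a = - (k - a) by ring.
  rewrite !powRN lef_pV2 ?posrE ?powR_gt0//.
  by rewrite ge0_ler_powR ?nnegrE ?(ltW r0) ?(ltW M0)//; lra.
apply: (@le_trans _ _ (9 * pk t x * (M ^- j + M^-1) * M `^ a)).
  by apply: ler_pM => //; exact: powR_ge0.
have -> : 9 * pk t x * (M ^- j + M^-1) * M `^ a =
    9 * pk t x * (M `^ (- j%:R) * M `^ a + M `^ (- 1) * M `^ a).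
  by rewrite powRN powR_mulrn ?(ltW M0)// powR_inv1 ?(ltW M0)//; ring.
have -> : 9 * (8 `^ (j%:R - a) + 8 `^ (1 - a) * P) * t `^ (a - j%:R) * expR (- (c * t)) * pk t x =
  9 * pk t x * (8 `^ (j%:R - a) * (t `^ (- (j%:R - a)) * expR (- (c * t))) +
                8 `^ (1 - a) * (P * t `^ (- (j%:R - a)) * expR (- (c * t)))).
  by rewrite opprB; ring.
apply: ler_wpM2l; first by rewrite mulr_ge0.
apply: lerD.
  apply: (le_trans (Mpow _ j1)); rewrite ler_wpM2l ?powR_ge0// ler_wpM2l ?powR_ge0//.
  by rewrite ler_expR lerN2 ler_wpM2r ?(ltW t0)// /c; lra.
apply: (le_trans (Mpow _ (lexx 1))); rewrite ler_wpM2l ?powR_ge0//.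
have E : expR (- ((1 - a) / 4 * t)) = expR (- (c * t)) * expR (- (c * t)).
  by rewrite -expRD; congr expR; rewrite /c; field.
rewrite E mulrA ler_wpM2r ?expR_ge0//.
have tE : t `^ (- (1 - a)) = t `^ (j%:R - 1) * t `^ (- (j%:R - a)).
  by rewrite -powRD ?(gt_eqF t0) ?implybT//; congr (_ `^ _); ring.
rewrite tE mulrAC ler_wpM2r ?powR_ge0//.
apply: le_trans (hP t (ltW t0)); rewrite ler_wpM2r ?expR_ge0//.
apply: (@le_trans _ _ ((1 + t) `^ (j%:R - 1))).
  by rewrite ge0_ler_powR ?nnegrE ?subr_ge0 ?(ltW t0)//; lra.
by rewrite ler_powR ?lerDl ?(ltW t0)//; lra.
Qed.

Lemma pd_bounded (j : nat) (t : R) : (j <= 3)%N -> 0 < t -> exists K : R, forall x, `|pd j t x| <= K.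
Proof.
move=> j3 t0; pose K := sh t / (2 * rho t ^+ 2) / tau.
have pK x : `|pk t x| <= K by rewrite ger0_norm ?pk_ge0 ?pk_le.
case: j j3 => [|j] j3; first by exists K.
have [C C0 [c c0 h]] := @pd_weight 0 j.+1 ltac:(by rewrite lexx ltr01) j3.
exists (C * t `^ (0 - j.+1%:R) * expR (- (c * t)) * K) => x.
have := h t x t0; rewrite powRr0 mulr1 => /le_trans; apply.
rewrite ler_wpM2l ?mulr_ge0 ?powR_ge0 ?expR_ge0 ?(ltW C0)//.
exact: pk_le.
Qed.

End kernel_derivatives.

(** * Smoothing estimates *)

Section smoothing.
Context {R : realType}.
Notation mu := (@lebesgue_measure R).
Local Notation tau := ((pi : R) *+ 2).
Local Notation I := (@per_itv R).
Local Notation Rp := (`]0%R, +oo[%classic : set R).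
Let mI := @measurable_per R.
Let mRp : measurable Rp. Proof. exact: measurable_itv. Qed.

Lemma is_derive_lipschitz (v v' : R -> R) (M : R) : (forall x : R, is_derive x 1 v (v' x)) ->
  (forall x, `|v' x| <= M) -> forall x y, `|v x - v y| <= M * `|x - y|.
Proof.
move=> dv vM; apply: derivable_lipschitz => x; first by have [] := dv x.
by rewrite derive1E; have [_ ->] := dv x.
Qed.

Lemma is_derive_under_integral (B : set R) (f f' : R -> R -> R) (G : R -> R) (x : R) :
  measurable B -> (forall x, mu.-integrable B (fun y => (f x y)%:E)) ->
  (forall x y : R, B y -> is_derive x 1 (f ^~ y) (f' x y)) ->
  (forall y, 0 <= G y) -> mu.-integrable B (fun y => (G y)%:E) ->
  (forall x y, B y -> `|f' x y| <= G y) ->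
  is_derive x 1 (fun x => \int[mu]_(y in B) f x y) (\int[mu]_(y in B) f' x y).
Proof.
move=> mB intf df G0 iG fG.
have Ix : `]x - 1, x + 1[%classic x by rewrite /= in_itv /= ltrDl ltrBlDr ltrDl ltr01.
have d1 y z : B z -> partial1of2 f y z = f' y z.
  by move=> Bz; rewrite partial1of2E; have [_ ->] := df y z Bz.
have df1 y z : `]x - 1, x + 1[%classic y -> B z -> derivable (f ^~ z) y 1.
  by move=> _ Bz; have [] := df y z Bz.
have ub y z : `]x - 1, x + 1[%classic y -> B z -> `|partial1of2 f y z| <= G z.
  by move=> _ Bz; rewrite d1// fG.
apply: DeriveDef.
  exact: (@derivable_under_integral R _ (measurableTypeR R) mu f B mB x (x - 1) (x + 1) Ix (fun y _ => intf y) df1 G G0 iG ub).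
rewrite -derive1E.
rewrite (@differentiation_under_integral R _ (measurableTypeR R) mu f B mB x (x - 1) (x + 1) Ix (fun y _ => intf y) df1 G G0 iG ub).
by apply: eq_Rintegral => z /set_mem Bz; exact: d1.
Qed.

(** The candidates for the derivatives of [pv] and [wk]; at index 0 they reduce to these by
    computation. *)
Definition pvd (j : nat) (g : R -> R) (t x : R) : R := \int[mu]_(y in I) (pd j t (x - y) * g y).
Definition wkd (b : R) (j : nat) (g : R -> R) (x : R) : R :=
  \int[mu]_(t in Rp) (t `^ (b - 1) * pvd j g t x).

Lemma measurable_pvd (j : nat) (g : R -> R) d (T : measurableType d) (a b : T -> R) :
  measurable_fun setT g -> measurable_fun setT a -> measurable_fun setT b ->
  measurable_fun setT (fun z => pvd j g (a z) (b z)).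
Proof.
move=> mg ma mb; apply: (@measurable_Rint R _ T I (fun z y => pd j (a z) (b z - y) * g y)) => //.
apply: measurable_funM; last exact: (measurableT_comp mg).
apply: measurable_pd; first exact: (measurableT_comp ma).
by apply: measurable_funB => //; exact: (measurableT_comp mb).
Qed.

Lemma pd_mul_integrable (j : nat) (g : R -> R) (t x : R) : (j <= 3)%N -> 0 < t ->
  mu.-integrable I (fun y => (g y)%:E) ->
  mu.-integrable I (fun y => (pd j t (x - y) * g y)%:E).
Proof.
move=> j3 t0 ig; have [K hK] := pd_bounded j3 t0.
apply: (@integrable_bmul R I (fun y => pd j t (x - y)) g K) => //.
by apply: (@measurable_pd R j _ R (fun=> t) (fun y => x - y)) => //; exact: measurable_funB.
Qed.

Lemma is_derive_pvd (j : nat) (g : R -> R) (t x : R) : (j < 3)%N -> 0 < t ->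
  mu.-integrable I (fun y => (g y)%:E) -> is_derive x 1 (pvd j g t) (pvd j.+1 g t x).
Proof.
move=> j3 t0 ig; have [K hK] := pd_bounded j3 t0.
have K0 : 0 <= K by exact: le_trans (hK 0).
apply: (@is_derive_under_integral I (fun x y => pd j t (x - y) * g y)
  (fun x y => pd j.+1 t (x - y) * g y) (fun y => K * `|g y|)) => //.
- by move=> z; apply: pd_mul_integrable => //; exact: ltnW.
- move=> z y _.
  have h1 : is_derive z 1 (fun z : R => z - y) (1 - 0) by apply: is_deriveB.
  have h2 := @is_derive1_comp R (pd j t) (fun z => z - y) z _ _ (is_derive_pd (z - y) j3 t0) h1.
  have h := is_derive_cmul (g y) h2.
  have -> : (fun x0 => pd j t (x0 - y) * g y) = (fun x0 => g y * pd j t (x0 - y)).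
    by apply/funext => x0; rewrite mulrC.
  by apply: (is_derive_eq h); rewrite subr0 mulr1 mulrC.
- by move=> y; rewrite mulr_ge0.
- by apply: integrable_cmul => //; exact: integrable_abs.
- by move=> z y _; rewrite normrM ler_wpM2r.
Qed.

Let i1 : mu.-integrable I (fun=> (1 : R)%:E).
Proof. by apply: integrable_cstR => //; exact: per_fin. Qed.

(** The mass of the kernel does not depend on [x], so differentiating it under the integral gives
    0. *)
Lemma pd_mean0 (j : nat) (t x : R) : (0 < j <= 3)%N -> 0 < t -> pvd j (fun=> 1) t x = 0.
Proof.
case: j => // j /andP[_ j3] t0.
have H (k : nat) (c : R) : (k < 3)%N -> (forall y, pvd k (fun=> 1) t y = c) ->
    forall y, pvd k.+1 (fun=> 1) t y = 0.
  move=> k3 hk y; have [_ <-] := is_derive_pvd y k3 t0 i1.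
  have -> : pvd k (fun=> 1) t = cst c by apply/funext.
  by rewrite derive_cst.
have h1 := H 0%N 1 erefl (fun y => pv_mass y t0).
have h2 := H 1%N 0 erefl h1; have h3 := H 2%N 0 erefl h2.
by case: j j3 => [|[|[|j]]].
Qed.

(** As the derivatives of the kernel integrate to 0, [g y] may be replaced by [g y - g x], whose
    Hoelder bound is the weight in [pd_weight]. The modulus is expressed by [|sin((x - y)/2)|]
    because it has to be periodic like the kernel. *)
Lemma pvd_bound (a A : R) (g : R -> R) (j : nat) : 0 <= a < 1 -> 0 <= A -> (0 < j <= 3)%N ->
  measurable_fun setT g -> mu.-integrable I (fun y => (g y)%:E) ->
  (forall x y, `|g x - g y| <= A * `|sin ((x - y) / 2)| `^ a) ->
  exists2 C : R, 0 < C & exists2 c : R, 0 < c &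
    forall t x, 0 < t -> `|pvd j g t x| <= C * (t `^ (a - j%:R) * expR (- (c * t))).
Proof.
move=> a01 A0 j3 mg ig gA; have [C C0 [c c0 h]] := pd_weight a01 j3.
have j3' : (j <= 3)%N by case/andP: j3.
exists ((A + 1) * C); first by rewrite mulr_gt0// ltr_wpDl.
exists c => // t x t0.
set k := C * t `^ (a - j%:R) * expR (- (c * t)).
have k0 : 0 <= k by rewrite !mulr_ge0 ?powR_ge0 ?expR_ge0// ltW.
have igx : mu.-integrable I (fun y => (g y - g x)%:E).
  by apply: integrable_sub => //; apply: integrable_cstR => //; exact: per_fin.
have ip := pd_mul_integrable x j3' t0 igx.
have -> : pvd j g t x = \int[mu]_(y in I) (pd j t (x - y) * (g y - g x)).
  have E y : pd j t (x - y) * (g y - g x) = pd j t (x - y) * g y - g x * (pd j t (x - y) * 1) by ring.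
  under [RHS]eq_Rintegral do rewrite E.
  have ip1 := pd_mul_integrable x j3' t0 i1.
  rewrite Rintegral_sub//; [|exact: pd_mul_integrable|exact: integrable_cmul].
  by rewrite Rintegral_cmul// [X in g x * X]pd_mean0// mulr0 subr0.
apply: (le_trans (Rintegral_abs mI ip)).
apply: (@le_trans _ _ (\int[mu]_(y in I) (A * k * pk t (x - y)))).
  apply: Rintegral_le => //; [exact: integrable_abs|by apply: integrable_cmul => //; exact: pk_integrable|].
  move=> y _; rewrite normrM -mulrA.
  apply: (@le_trans _ _ (`|pd j t (x - y)| * (A * `|sin ((x - y) / 2)| `^ a))).
    by rewrite ler_wpM2l// distrC.
  by rewrite mulrCA ler_wpM2l// h.
rewrite Rintegral_cmul//; last exact: pk_integrable.
rewrite poisson_mass// mulr1 mulrDl mul1r mulrDl /k -!mulrA lerDl.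
by rewrite !mulr_ge0 ?powR_ge0 ?expR_ge0// ltW.
Qed.

(** The factor [t^0] gives this bound the shape [t^e e^(-ct)] shared by all inputs of the
    interpolation. *)
Lemma pv_exp (g : R -> R) (G : R) : measurable_fun setT g -> (forall x, `|g x| <= G) ->
  \int[mu]_(y in I) g y = 0 -> forall t x, 0 < t ->
  `|pv g t x| <= 64 * tau * G * (t `^ 0 * expR (- (4^-1 * t))).
Proof.
move=> mg gG g0 t x t0; rewrite powRr0 mul1r.
have G0 : 0 <= G by exact: le_trans (gG 0).
have T1 : 1 <= tau by rewrite mulr2n; have := @pi_ge2 R; lra.
have iG : mu.-integrable I (fun=> G%:E) by apply: integrable_cstR => //; exact: per_fin.
have ig : mu.-integrable I (fun y => (g y)%:E).
  by apply: (@per_bounded_integrable R g G).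
have [t1|t1] := leP t 1.
  apply: (le_trans (pv_le ig x t0 iG _ _)) => //.
  under eq_Rintegral do rewrite mulrC.
  rewrite Rintegral_cmul//; last exact: pk_integrable.
  rewrite poisson_mass// mulr1.
  have e1 : expR (- 1) <= expR (- (4^-1 * t)) by rewrite ler_expR; lra.
  have e2 : 1 / 4 <= expR (- 1 : R).
    have -> : expR (- 1 : R) = expR (- 2^-1) ^+ 2 by rewrite expr2 -expRD; congr expR; field.
    by have := @expR_ge1Dx R (- 2^-1); nra.
  have e3 : 1 <= 64 * tau * expR (- (4^-1 * t)) by have := expR_gt0 (- (4^-1 * t)); nra.
  by rewrite mulrAC -[leLHS]mul1r ler_wpM2r.
have hd := pv_decay ig x t0 g0; apply: (le_trans hd).
have h2 : \int[mu]_(y in I) `|g y| <= G * tau.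
  have -> : G * tau = \int[mu]_(y in I) G by rewrite /Rintegral per_integral_cst.
  by apply: Rintegral_le => //; exact: integrable_abs.
have -> : 64 * tau * G * expR (- (4^-1 * t)) = 64 * expR (- (4^-1 * t)) * (G * tau) by ring.
apply: ler_pM => //.
- by rewrite invr_ge0 exprn_ge0// ltW// rho_gt0.
- by apply: Rintegral_ge0.
apply: (le_trans (rho_sq_inv t0)); apply: ler_pM; rewrite ?expR_ge0//.
- by rewrite mulr_ge0// invr_ge0 exprn_ge0// ltW.
- rewrite -[leRHS]mulr1 ler_wpM2l// invf_le1 ?exprn_gt0//.
  by rewrite exprn_ege1// ltW.
- by rewrite ler_expR; lra.
Qed.

Lemma time_integrable (b e c M : R) (f : R -> R) : 0 < b + e -> 0 < c ->
  measurable_fun setT f -> (forall t, 0 < t -> `|f t| <= M * (t `^ e * expR (- (c * t)))) ->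
  mu.-integrable Rp (fun t => (t `^ (b - 1) * f t)%:E) /\
  `|\int[mu]_(t in Rp) (t `^ (b - 1) * f t)| <=
     M * \int[mu]_(t in Rp) (t `^ (b + e - 1) * expR (- (c * t))).
Proof.
move=> be c0 mf fM.
have ig := gamma_integrable be c0.
have iM : mu.-integrable Rp (fun t => (M * (t `^ (b + e - 1) * expR (- (c * t))))%:E).
  by apply: integrable_cmul.
have le t : Rp t -> `|t `^ (b - 1) * f t| <= M * (t `^ (b + e - 1) * expR (- (c * t))).
  move=> /Rp_gt0 t0; rewrite normrM ger0_norm ?powR_ge0//.
  have -> : b + e - 1 = (b - 1) + e by ring.
  rewrite [t `^ (b - 1 + e)]powRD ?(gt_eqF t0) ?implybT//.
  have -> : M * (t `^ (b - 1) * t `^ e * expR (- (c * t))) =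
    t `^ (b - 1) * (M * (t `^ e * expR (- (c * t)))) by ring.
  by rewrite ler_wpM2l ?powR_ge0// fM.
have i : mu.-integrable Rp (fun t => (t `^ (b - 1) * f t)%:E).
  apply: (@integrable_dom _ _ _ mu Rp mRp (fun t => M * (t `^ (b + e - 1) * expR (- (c * t))))) => //.
  apply: measurable_funTS.
  by apply: measurable_funM => //; exact: measurable_powRl.
split => //.
have ia := @Rintegral_abs _ _ _ mu Rp mRp (fun t => t `^ (b - 1) * f t) i.
apply: (le_trans ia).
rewrite -Rintegral_cmul//; apply: Rintegral_le => //; exact: integrable_abs.
Qed.

(** The weighted geometric mean of the two bounds, taken before the integration in [t]; it exchanges
    regularity in [x] for integrability at [t = 0]. *)
Lemma time_interpolation (th D C1 e1 c1 C2 e2 c2 t : R) : 0 <= th <= 1 -> 0 < t -> 0 <= D ->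
  0 <= C1 -> 0 <= C2 ->
  D <= C1 * (t `^ e1 * expR (- (c1 * t))) -> D <= C2 * (t `^ e2 * expR (- (c2 * t))) ->
  D <= C1 `^ (1 - th) * C2 `^ th *
    (t `^ (e1 * (1 - th) + e2 * th) * expR (- ((c1 * (1 - th) + c2 * th) * t))).
Proof.
move=> /andP[th0 th1] t0 D0 C10 C20 h1 h2.
have th1' : 0 <= 1 - th by lra.
have [->|Dn0] := eqVneq D 0; first by rewrite !mulr_ge0 ?powR_ge0 ?expR_ge0.
have Dp : 0 < D by rewrite lt_neqAle eq_sym Dn0.
have DE : D = D `^ (1 - th) * D `^ th.
  by rewrite -powRD ?(gt_eqF Dp) ?implybT// subrK powRr1// ltW.
have E (C e c k : R) : 0 <= C -> (C * (t `^ e * expR (- (c * t)))) `^ k =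
    C `^ k * (t `^ (e * k) * expR (- (c * k * t))).
  move=> C0; rewrite powRM ?mulr_ge0 ?powR_ge0 ?expR_ge0// powRM ?powR_ge0 ?expR_ge0//.
  by rewrite -powRrM -expRM; congr (_ * (_ * expR _)); ring.
rewrite {1}DE.
apply: (@le_trans _ _ ((C1 * (t `^ e1 * expR (- (c1 * t)))) `^ (1 - th) *
  (C2 * (t `^ e2 * expR (- (c2 * t)))) `^ th)).
  by apply: ler_pM; rewrite ?powR_ge0// ge0_ler_powR ?nnegrE// (le_trans D0).
rewrite !E// le_eqVlt; apply/orP; left; apply/eqP.
have -> : expR (- ((c1 * (1 - th) + c2 * th) * t)) =
    expR (- (c1 * (1 - th) * t)) * expR (- (c2 * th * t)).
  by rewrite -expRD; congr expR; ring.
by rewrite [t `^ (_ + _)]powRD ?(gt_eqF t0) ?implybT//; ring.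
Qed.

Lemma time_integral_interp (b th C1 e1 c1 C2 e2 c2 : R) (f : R -> R) : 0 <= th <= 1 ->
  0 <= C1 -> 0 <= C2 ->
  0 < b + (e1 * (1 - th) + e2 * th) -> 0 < c1 * (1 - th) + c2 * th ->
  measurable_fun setT f ->
  (forall t, 0 < t -> `|f t| <= C1 * (t `^ e1 * expR (- (c1 * t)))) ->
  (forall t, 0 < t -> `|f t| <= C2 * (t `^ e2 * expR (- (c2 * t)))) ->
  `|\int[mu]_(t in Rp) (t `^ (b - 1) * f t)| <= C1 `^ (1 - th) * C2 `^ th *
    \int[mu]_(t in Rp) (t `^ (b + (e1 * (1 - th) + e2 * th) - 1) *
       expR (- ((c1 * (1 - th) + c2 * th) * t))).
Proof.
move=> th01 C10 C20 hb hc mf h1 h2.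
apply: (proj2 (time_integrable hb hc mf _)) => t t0.
exact: (time_interpolation th01 t0 _ C10 C20 (h1 t t0) (h2 t t0)).
Qed.

(** * Time integrals of Poisson extensions of Hoelder data *)

Section data.
Variables (a A G b : R) (g : R -> R).
Hypotheses (a01 : 0 <= a < 1) (A0 : 0 <= A) (b0 : 0 < b).
Hypotheses (mg : measurable_fun setT g) (pg : periodic g tau) (gG : forall x, `|g x| <= G)
  (g0 : \int[mu]_(y in I) g y = 0)
  (gA : forall x y, `|g x - g y| <= A * `|sin ((x - y) / 2)| `^ a).

Let ig : mu.-integrable I (fun y => (g y)%:E).
Proof. exact: (@per_bounded_integrable R g G). Qed.

Let mpt j x : measurable_fun setT (fun t => pvd j g t x).
Proof. exact: measurable_pvd. Qed.

Let G0 : 0 <= G. Proof. exact: le_trans (gG 0). Qed.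

Let C0 := 64 * tau * G.
Let C00 : 0 <= C0. Proof. by rewrite !mulr_ge0// ltW// tau_gt0. Qed.

Lemma pvd_exp_bound (j : nat) : (j <= 3)%N -> exists2 C : R, 0 <= C & exists2 e : R,
  (e = if j == 0%N then 0 else a - j%:R) & exists2 c : R, 0 < c &
    forall t x, 0 < t -> `|pvd j g t x| <= C * (t `^ e * expR (- (c * t))).
Proof.
case: j => [|j] j3.
  exists C0 => //; exists 0 => //; exists 4^-1; first by rewrite invr_gt0.
  by move=> t x t0; exact: pv_exp.
have j3' : (0 < j.+1 <= 3)%N by rewrite j3.
have [C C1 [c c0 h]] := pvd_bound a01 A0 j3' mg ig gA.
by exists C; [exact: ltW|exists (a - j.+1%:R) => //; exists c].
Qed.

Lemma wkd_integrable (j : nat) (x : R) : (j <= 3)%N -> j%:R - a < b ->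
  mu.-integrable Rp (fun t => (t `^ (b - 1) * pvd j g t x)%:E).
Proof.
move=> j3 jb; have [C C1 [e eE [c c0 h]]] := pvd_exp_bound j3.
have be : 0 < b + e by rewrite eE; case: eqP => _; [rewrite addr0|lra].
exact: (proj1 (time_integrable be c0 (mpt j x) (fun t t0 => h t x t0))).
Qed.

Lemma wkd_bounded (j : nat) : (j <= 3)%N -> j%:R - a < b -> exists M : R, forall x, `|wkd b j g x| <= M.
Proof.
move=> j3 jb; have [C C1 [e eE [c c0 h]]] := pvd_exp_bound j3.
have be : 0 < b + e by rewrite eE; case: eqP => _; [rewrite addr0|lra].
exists (C * \int[mu]_(t in Rp) (t `^ (b + e - 1) * expR (- (c * t)))) => x.
exact: (proj2 (time_integrable be c0 (mpt j x) (fun t t0 => h t x t0))).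
Qed.

(** The condition on [j] is the convergence at [t = 0] of [t^(b-1) t^(a-j-1)], the majorant of the
    differentiated integrand. *)
Lemma is_derive_wkd (j : nat) (x : R) : (j < 3)%N -> j.+1%:R - a < b ->
  is_derive x 1 (wkd b j g) (wkd b j.+1 g x).
Proof.
move=> j3 jb; have [C C1 [e eE [c c0 h]]] := pvd_exp_bound j3.
have be : 0 < b + e by rewrite eE /=; lra.
have mG : measurable_fun setT (fun t : R => C * (t `^ e * expR (- (c * t)))).
  apply: measurable_funM => //; apply: measurable_funM; first exact: measurable_powRl.
  by apply: measurable_expR_comp; apply: measurableT_comp => //; exact: mulrl_measurable.
have G1 t : 0 <= C * (t `^ e * expR (- (c * t))) by rewrite !mulr_ge0 ?powR_ge0 ?expR_ge0.
apply: (@is_derive_under_integral Rp (fun x t => t `^ (b - 1) * pvd j g t x)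
  (fun x t => t `^ (b - 1) * pvd j.+1 g t x)
  (fun t => t `^ (b - 1) * (C * (t `^ e * expR (- (c * t)))))) => //.
- move=> z; apply: wkd_integrable; first exact: ltnW.
  by move: jb; rewrite -natr1; lra.
- move=> z t /Rp_gt0 t0; apply: is_derive_cmul; exact: is_derive_pvd.
- by move=> t; rewrite mulr_ge0 ?powR_ge0.
- apply: (proj1 (time_integrable be c0 mG (M := C) _)) => t t0.
  by rewrite ger0_norm.
- move=> z t /Rp_gt0 t0; rewrite normrM ger0_norm ?powR_ge0// ler_wpM2l ?powR_ge0//.
  exact: h.
Qed.

Let dist_sub (f1 f2 : R -> R) : mu.-integrable Rp (fun t => (t `^ (b - 1) * f1 t)%:E) ->
  mu.-integrable Rp (fun t => (t `^ (b - 1) * f2 t)%:E) ->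
  \int[mu]_(t in Rp) (t `^ (b - 1) * f1 t) - \int[mu]_(t in Rp) (t `^ (b - 1) * f2 t) =
  \int[mu]_(t in Rp) (t `^ (b - 1) * (f1 t - f2 t)).
Proof.
by move=> h1 h2; rewrite -Rintegral_sub//; apply: eq_Rintegral => t _; rewrite mulrBr.
Qed.

Lemma pvd_lip (j : nat) (C e c : R) : (j < 3)%N ->
  (forall t x, 0 < t -> `|pvd j.+1 g t x| <= C * (t `^ e * expR (- (c * t)))) ->
  forall t x y, 0 < t ->
  `|pvd j g t x - pvd j g t y| <= C * `|x - y| * (t `^ e * expR (- (c * t))).
Proof.
move=> j3 h t x y t0; rewrite mulrAC.
exact: (is_derive_lipschitz (fun z => is_derive_pvd z j3 t0 ig) (fun z => h t z t0)).
Qed.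

(** Interpolates the increment of the [j]-th derivative between its size, of order [t^(a-j)], and
    [|x - y|] times the next derivative, of order [t^(a-j-1)]. The result is of order [t^(a-j-th)],
    integrable in time under the stated condition. *)
Lemma wkd_holder (j : nat) (th : R) : (0 < j < 3)%N -> 0 < th <= 1 -> j%:R + th - a < b ->
  exists M : R, forall x y, `|wkd b j g x - wkd b j g y| <= M * `|x - y| `^ th.
Proof.
move=> /andP[j0 j3] /andP[th0 th1] jb.
have [C1 C10 [e1 e1E [c1 c10 h1]]] := pvd_exp_bound (ltnW j3).
have [C2 C20 [e2 e2E [c2 c20 h2]]] := pvd_exp_bound j3.
rewrite (gtn_eqF j0) in e1E; rewrite /= -natr1 in e2E.
have th01 : 0 <= th <= 1 by rewrite (ltW th0).
have be : 0 < b + (e1 * (1 - th) + e2 * th) by rewrite e1E e2E; lra.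
have cc : 0 < c1 * (1 - th) + c2 * th by rewrite ltr_wpDl ?mulr_gt0// mulr_ge0 ?(ltW c10)// subr_ge0.
have jb' : j%:R - a < b by lra.
set Gm := \int[mu]_(t in Rp) (t `^ (b + (e1 * (1 - th) + e2 * th) - 1) *
       expR (- ((c1 * (1 - th) + c2 * th) * t))).
exists ((2 * C1) `^ (1 - th) * C2 `^ th * Gm) => x y.
rewrite /wkd dist_sub//; last 2 first.
- by apply: wkd_integrable => //; exact: ltnW.
- by apply: wkd_integrable => //; exact: ltnW.
have mf : measurable_fun setT (fun t => pvd j g t x - pvd j g t y) by exact: measurable_funB.
have C10' : 0 <= 2 * C1 by rewrite mulr_ge0.
have C20' : 0 <= C2 * `|x - y| by rewrite mulr_ge0.
apply: (le_trans (time_integral_interp th01 C10' C20' be cc mf _ _)).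
- move=> t t0; apply: (le_trans (ler_normB _ _)); rewrite -mulrA mulr_natl mulr2n.
  by apply: lerD; exact: h1.
- by move=> t t0; exact: pvd_lip.
by rewrite [(C2 * _) `^ th]powRM// le_eqVlt; apply/orP; left; apply/eqP; rewrite /Gm; ring.
Qed.

(** The kernel is a probability density, so the Poisson extension inherits the modulus of continuity
    of [g]. *)
Lemma pv_translate (A' : R) : (forall x y, `|g x - g y| <= A' * `|x - y| `^ a) ->
  forall t x y, 0 < t -> `|pv g t x - pv g t y| <= A' * `|x - y| `^ a.
Proof.
move=> gA' t x y t0.
have E z : pv g t z = \int[mu]_(y in I) (pk t (- y) * g (y + z)).
  rewrite /pv -(@Rper_shift R (fun y => pk t (z - y) * g y) z).
  - by apply: eq_Rintegral => u _; congr (pk t _ * _); ring.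
  - by apply: measurable_funM => //; exact: measurable_pkx.
  - by move=> u; rewrite pg (@periodic_subl R (pk t) z (periodic_pk t)).
have i z : mu.-integrable I (fun u => (pk t (- u) * g (u + z))%:E).
  have := @integrable_bmul R I (fun u => pk t (0 - u)) (fun u => g (u + z)) (sh t / (2 * rho t ^+ 2) / tau) mI.
  move=> /(_ (measurable_pkx t 0)) H.
  have : mu.-integrable I (fun u => (pk t (0 - u) * g (u + z))%:E).
    apply: H; first by move=> u; rewrite ger0_norm ?pk_ge0 ?pk_le.
    exact: (shift_integrable mg pg ig).
  by apply: eq_integrable => // u _; rewrite sub0r.
have ipk : mu.-integrable I (fun u => (pk t (- u))%:E).
  by have := pk_integrable 0 t0; apply: eq_integrable => // u _; rewrite sub0r.
have mass : \int[mu]_(u in I) pk t (- u) = 1.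
  by rewrite -(poisson_mass 0 t0); apply: eq_Rintegral => u _; rewrite sub0r.
rewrite !E -Rintegral_sub//; apply: (le_trans (Rintegral_abs mI _)); first exact: integrable_sub.
rewrite -[leRHS]mulr1 -mass -Rintegral_cmul//.
apply: Rintegral_le => //; [by apply: integrable_abs => //; exact: integrable_sub|exact: integrable_cmul|].
move=> u _; rewrite -mulrBr normrM ger0_norm ?pk_ge0// mulrC ler_wpM2r ?pk_ge0//.
have -> : x - y = (u + x) - (u + y) by ring.
exact: gA'.
Qed.

(** At order 0 the size of [pv] does not improve as [t] tends to 0, so [wkd_holder] has no analogue
    with the same gain. The endpoint used instead is the inherited modulus [|x - y|^a], interpolated
    with the Lipschitz bound of order [t^(a-1)]. *)
Lemma wk_holder (A' gm : R) : 0 <= A' -> (forall x y, `|g x - g y| <= A' * `|x - y| `^ a) ->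
  a < gm <= 1 -> gm - a < b ->
  exists M : R, forall x y, `|wkd b 0 g x - wkd b 0 g y| <= M * `|x - y| `^ gm.
Proof.
move=> A'0 gA' /andP[agm gm1] gb; have [a0 a1] := andP a01.
(* The solution of [a (1 - th) + th = gm]. *)
pose th := (gm - a) / (1 - a).
have a1' : 0 < 1 - a by lra.
have th0 : 0 < th by rewrite divr_gt0// subr_gt0.
have th1 : th <= 1 by rewrite ler_pdivrMr// mul1r; lra.
have thE : th * (1 - a) = gm - a by rewrite /th mulfVK// gt_eqF.
have [C2 C20 [e2 e2E [c2 c20 h2]]] := pvd_exp_bound (isT : (1 <= 3)%N).
rewrite /= in e2E.
have th01 : 0 <= th <= 1 by rewrite (ltW th0).
have be : 0 < b + (0 * (1 - th) + e2 * th) by rewrite e2E; lra.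
have cc : 0 < 0 * (1 - th) + c2 * th by rewrite mul0r add0r mulr_gt0.
set Gm := \int[mu]_(t in Rp) (t `^ (b + (0 * (1 - th) + e2 * th) - 1) *
       expR (- ((0 * (1 - th) + c2 * th) * t))).
exists (A' `^ (1 - th) * C2 `^ th * Gm) => x y.
have i z : mu.-integrable Rp (fun t => (t `^ (b - 1) * pvd 0 g t z)%:E).
  by apply: wkd_integrable => //; lra.
rewrite /wkd dist_sub//.
have mf : measurable_fun setT (fun t => pvd 0 g t x - pvd 0 g t y) by exact: measurable_funB.
have C10' : 0 <= A' * `|x - y| `^ a by rewrite mulr_ge0 ?powR_ge0.
have C20' : 0 <= C2 * `|x - y| by rewrite mulr_ge0.
apply: (le_trans (time_integral_interp th01 C10' C20' be cc mf _ _)).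
- move=> t t0; rewrite powRr0 mul0r oppr0 expR0 !mulr1; exact: pv_translate.
- by move=> t t0; exact: pvd_lip.
rewrite -/Gm !powRM ?powR_ge0// -powRrM.
have -> : `|x - y| `^ gm = `|x - y| `^ (a * (1 - th)) * `|x - y| `^ th.
  have [xy|xy] := eqVneq `|x - y| 0.
    by rewrite xy [in LHS]powR0 ?[X in _ = _ * X]powR0 ?mulr0 ?gt_eqF//; lra.
  by rewrite -powRD ?xy ?implybT//; congr (_ `^ _); lra.
rewrite le_eqVlt; apply/orP; left; apply/eqP; ring.
Qed.

(** The second difference is the increment over [h] of [phi y = pv (y + h) - pv y], whose derivative
    is at most [|h|] times the second derivative. *)
Lemma pv_second_diff (C e c : R) :
  (forall t x, 0 < t -> `|pvd 2 g t x| <= C * (t `^ e * expR (- (c * t)))) ->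
  forall t x h, 0 < t ->
  `|2 * pv g t x - pv g t (x + h) - pv g t (x - h)| <= C * `|h| ^+ 2 * (t `^ e * expR (- (c * t))).
Proof.
move=> H t x h t0.
have L1 := @pvd_lip 1 C e c isT H.
pose phi y := pv g t (y + h) - pv g t y.
have dphi (y : R) : is_derive y 1 phi (pvd 1 g t (y + h) - pvd 1 g t y).
  have h1 : is_derive y 1 (fun z : R => z + h) (1 + 0) by apply: is_deriveD.
  have h2 := @is_derive1_comp R (pv g t) (fun z => z + h) y _ _ (@is_derive_pvd 0 g t (y + h) isT t0 ig) h1.
  have h3 := is_deriveB h2 (@is_derive_pvd 0 g t y isT t0 ig).
  by apply: (is_derive_eq h3); rewrite addr0 mulr1.
have := is_derive_lipschitz dphi (M := C * `|h| * (t `^ e * expR (- (c * t)))).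
move=> /(_ _ (x - h) x); have -> : phi (x - h) - phi x = 2 * pv g t x - pv g t (x + h) - pv g t (x - h).
  by rewrite /phi subrK; ring.
have -> : `|x - h - x| = `|h| by rewrite addrAC subrr add0r normrN.
move=> /(_ _)/le_trans; apply.
  move=> y; have := L1 t (y + h) y t0.
  by have -> : y + h - y = h by ring.
by rewrite le_eqVlt; apply/orP; left; apply/eqP; ring.
Qed.

(** Interpolates between four times the size and [h^2] times the second derivative. It allows
    exponents [2 th > 1], which first increments could not show. *)
Lemma wk_second_diff (th : R) : 0 < th <= 1 -> (2 - a) * th < b ->
  exists2 M : R, 0 <= M & forall x h, `|2 * wkd b 0 g x - wkd b 0 g (x + h) - wkd b 0 g (x - h)| <= M * `|h| `^ (2 * th).
Proof.
move=> /andP[th0 th1] hb; have [a0 a1] := andP a01.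
have [C1 C10 [e1 e1E [c1 c10 h1]]] := pvd_exp_bound (isT : (0 <= 3)%N).
have [C2 C20 [e2 e2E [c2 c20 h2]]] := pvd_exp_bound (isT : (2 <= 3)%N).
rewrite /= in e1E; rewrite /= in e2E.
have th01 : 0 <= th <= 1 by rewrite (ltW th0).
have be : 0 < b + (e1 * (1 - th) + e2 * th) by rewrite e1E e2E; lra.
have cc : 0 < c1 * (1 - th) + c2 * th by rewrite ltr_wpDl ?mulr_gt0// mulr_ge0 ?(ltW c10)// subr_ge0.
set Gm := \int[mu]_(t in Rp) (t `^ (b + (e1 * (1 - th) + e2 * th) - 1) *
       expR (- ((c1 * (1 - th) + c2 * th) * t))).
have Gm0 : 0 <= Gm by apply: Rintegral_ge0 => t _; rewrite mulr_ge0 ?powR_ge0 ?expR_ge0.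
exists ((4 * C1) `^ (1 - th) * C2 `^ th * Gm); first by rewrite !mulr_ge0 ?powR_ge0.
move=> x h.
have i z : mu.-integrable Rp (fun t => (t `^ (b - 1) * pvd 0 g t z)%:E).
  by apply: wkd_integrable => //; have := b0; lra.
have -> : 2 * wkd b 0 g x - wkd b 0 g (x + h) - wkd b 0 g (x - h) =
   \int[mu]_(t in Rp) (t `^ (b - 1) * (2 * pv g t x - pv g t (x + h) - pv g t (x - h))).
  have E t : t `^ (b - 1) * (2 * pv g t x - pv g t (x + h) - pv g t (x - h)) =
    2 * (t `^ (b - 1) * pvd 0 g t x) - t `^ (b - 1) * pvd 0 g t (x + h) - t `^ (b - 1) * pvd 0 g t (x - h).
    by rewrite /pvd /pd /pv; ring.
  under [RHS]eq_Rintegral do rewrite E.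
  have i2 : mu.-integrable Rp (fun t => (2 * (t `^ (b - 1) * pvd 0 g t x))%:E) by exact: integrable_cmul.
  rewrite Rintegral_sub//; last exact: integrable_sub.
  by rewrite Rintegral_sub// Rintegral_cmul.
have mf : measurable_fun setT (fun t => 2 * pv g t x - pv g t (x + h) - pv g t (x - h)).
  by apply: measurable_funB; [apply: measurable_funB; [apply: measurable_funM => //|]|]; exact: measurable_pv.
have C10' : 0 <= 4 * C1 by rewrite mulr_ge0.
have C20' : 0 <= C2 * `|h| ^+ 2 by rewrite mulr_ge0// exprn_ge0.
apply: (le_trans (time_integral_interp th01 C10' C20' be cc mf _ _)).
- move=> t t0; have k1 := h1 t x t0; have k2 := h1 t (x + h) t0; have k3 := h1 t (x - h) t0.
  apply: (le_trans (ler_normB _ _)).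
  apply: (@le_trans _ _ (2 * `|pv g t x| + `|pv g t (x + h)| + `|pv g t (x - h)|)).
    by rewrite lerD2r (le_trans (ler_normB _ _))// lerD2r normrM ger0_norm.
  by rewrite -mulrA; move: k1 k2 k3; rewrite /pv /pvd /pd; lra.
- by move=> t t0; exact: pv_second_diff.
have -> : (C2 * `|h| ^+ 2) `^ th = C2 `^ th * `|h| `^ (2 * th).
  by rewrite powRM ?exprn_ge0// -powR_mulrn// -powRrM.
by rewrite le_eqVlt; apply/orP; left; apply/eqP; rewrite /Gm; ring.
Qed.

End data.

End smoothing.

(** * Hoelder bootstrap *)

Section regularity.
Context {R : realType}.
Notation mu := (@lebesgue_measure R).
Local Notation tau := ((pi : R) *+ 2).
Local Notation I := (@per_itv R).
Local Notation Rp := (`]0%R, +oo[%classic : set R).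
Let mI := @measurable_per R.

Lemma sin_half_lower (u : R) : `|u| <= pi -> `|u| / 8 <= `|sin (u / 2)|.
Proof.
wlog u0 : u / 0 <= u.
  move=> H up; have [u0|u0] := leP 0 u; first exact: H.
  by have := H (- u); rewrite mulNr sinN !normrN; apply => //; lra.
rewrite (ger0_norm u0) => up; set y := u / 2.
have y0 : 0 <= y by rewrite divr_ge0.
have cosb (z : R) : 1 - z ^+ 2 / 2 <= cos z.
  have := one_sub_cos z; have := sin2_le (z / 2); rewrite exprMn; lra.
apply: le_trans (ler_norm _).
have [y1|y1] := leP y 1.
  have [|c /= cy E] := @MVT_segment R sin cos 0 y y0.
    by apply: continuous_subspaceT => z; exact: continuous_sin.
  move: E; rewrite sin0 !subr0 => ->.
  move: cy; rewrite in_itv /= => /andP[c0 cy].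
  have : 1 / 2 <= cos c by apply: le_trans (cosb c); nra.
  by rewrite /y; nra.
rewrite -cosBpihalf; apply: le_trans (cosb _).
have := @pi_ge2 R; have := @pihalf_lt2 R; rewrite /y in y1 *; nra.
Qed.

Lemma abs_sin_half_periodic : periodic (fun x : R => `|sin (x / 2)|) tau.
Proof.
move=> x; have -> : (x + tau) / 2 = x / 2 + pi by rewrite -mulr_natr; field.
by rewrite sinDpi normrN.
Qed.

(** Periodicity of [g] permits replacing [y] by its translate nearest to [x]; at distance at most
    [pi], [|sin(z/2)|] is comparable with [|z|]. *)
Lemma holder_sin (g : R -> R) (a A : R) : 0 <= a -> 0 <= A -> periodic g tau ->
  (forall x y, `|g x - g y| <= A * `|x - y| `^ a) ->
  forall x y, `|g x - g y| <= A * 8 `^ a * `|sin ((x - y) / 2)| `^ a.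
Proof.
move=> a0 A0 pg gA x y; have T0 := @tau_gt0 R.
(* Rounding [(x - y) / tau] to a nearest integer. *)
pose n := Num.floor ((x - y) / tau + 2^-1).
pose z := x - (y + tau *~ n).
have zpi : `|z| <= pi.
  have := Num.Theory.floor_itv ((x - y) / tau + 2^-1); rewrite -/n => /andP[n1 n2].
  rewrite intrD in n2.
  have zE : z = (x - y) / tau * tau - n%:~R * tau.
    by rewrite /z mulfVK ?gt_eqF// -mulrzl; ring.
  have tE : tau = 2 * pi by rewrite mulr_natl.
  move: T0 zE n1 n2; rewrite tE; set q := (x - y) / _; set k := n%:~R => T0 -> n1 n2.
  by rewrite ler_norml; apply/andP; split; nra.
have -> : g y = g (y + tau *~ n) by rewrite (periodicz pg).
apply: (le_trans (gA _ _)); rewrite -/z -mulrA ler_wpM2l//.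
have -> : `|sin ((x - y) / 2)| = `|sin (z / 2)|.
  have := periodicz abs_sin_half_periodic n z; rewrite /z => <-.
  by congr `|sin (_ / 2)|; ring.
rewrite -powRM//; apply: ge0_ler_powR; rewrite ?nnegrE ?mulr_ge0//.
by have := sin_half_lower zpi; lra.
Qed.

(** * The fixed-point equation with a bounded, globally Lipschitz nonlinearity *)

Section bootstrap.
Variables (b L G m0 ka : R) (F v : R -> R).
Hypotheses (b0 : 0 < b) (L0 : 0 <= L) (F_lip : forall x y, `|F x - F y| <= L * `|x - y|)
  (FG : forall x, `|F x| <= G) (mFv : measurable_fun setT (fun x => F (v x)))
  (pv_ : periodic v tau) (mean0 : \int[mu]_(y in I) F (v y) = 0)
  (vE : forall x, v x = m0 + ka * wkd b 0 (fun y => F (v y)) x).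

Let g x := F (v x).
Let pg : periodic g tau. Proof. by move=> x; rewrite /g pv_. Qed.
Let gG x : `|g x| <= G. Proof. exact: FG. Qed.
Let G0 : 0 <= G. Proof. exact: le_trans (FG 0). Qed.

Let vE' x : v x = m0 + ka * wkd b 0 g x.
Proof. exact: vE. Qed.

Let hv (a : R) := exists2 A : R, 0 <= A & forall x y, `|v x - v y| <= A * `|x - y| `^ a.

Let v_diff (a : R) : (exists M : R, forall x y, `|wkd b 0 g x - wkd b 0 g y| <= M * `|x - y| `^ a) -> hv a.
Proof.
move=> [M hM]; exists (`|ka| * `|M|) => [|x y]; first by rewrite mulr_ge0.
have -> : v x - v y = ka * (wkd b 0 g x - wkd b 0 g y).
  by rewrite !vE'; move: (wkd b 0 g x) (wkd b 0 g y) => p q; ring.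
rewrite normrM -mulrA ler_wpM2l// (le_trans (hM x y))// ler_wpM2r ?powR_ge0//.
exact: ler_norm.
Qed.

Let g_holder (a : R) : hv a -> exists2 A : R, 0 <= A & forall x y, `|g x - g y| <= A * `|x - y| `^ a.
Proof.
move=> [A A0 hA]; exists (L * A) => [|x y]; first by rewrite mulr_ge0.
by apply: (le_trans (F_lip _ _)); rewrite -mulrA ler_wpM2l.
Qed.

Let hv0 : hv 0.
Proof.
have h0 x y : `|g x - g y| <= (2 * G) * `|sin ((x - y) / 2)| `^ 0.
  by rewrite powRr0 mulr1 (le_trans (ler_normB _ _))//; have := gG x; have := gG y; lra.
have a01 : 0 <= (0 : R) < 1 by rewrite lexx ltr01.
have A0 : 0 <= 2 * G by rewrite mulr_ge0.
have [|M hM] := wkd_bounded a01 A0 b0 mFv gG mean0 h0 (isT : (0 <= 3)%N).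
  by rewrite subr0.
apply: v_diff; exists (2 * M) => x y; rewrite powRr0 mulr1 (le_trans (ler_normB _ _))//.
have hM' z : `|wkd b 0 g z| <= M by exact: hM.
have h1 := hM' x; have h2 := hM' y.
by move: (`|wkd b 0 g x|) (`|wkd b 0 g y|) h1 h2 => p q h1 h2; lra.
Qed.

Let hv_step (a gm : R) : 0 <= a < 1 -> a < gm <= 1 -> gm - a < b -> hv a -> hv gm.
Proof.
move=> a01 agm gb ha; have [A A0 hA] := g_holder ha.
have [a0 a1] := andP a01.
have h8 : 0 <= A * 8 `^ a by rewrite mulr_ge0 ?powR_ge0.
by apply: v_diff; apply: (wk_holder a01 h8 b0 mFv pg gG mean0 (holder_sin a0 A0 pg hA) A0 hA).
Qed.

(** Boundedness is Hoelder continuity of exponent 0. Each pass through the equation raises the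
    exponent by any amount below [b], capped at 1. *)
Lemma bootstrap_lipschitz : exists2 A : R, 0 <= A & forall x y, `|v x - v y| <= A * `|x - y|.
Proof.
(* [hv_step] gains strictly less than [b]; half of it is a safe fixed increment. *)
pose d := b / 2; have d0 : 0 < d by rewrite divr_gt0.
have H (n : nat) : hv (Num.min 1 (n%:R * d)).
  elim: n => [|n IH]; first by rewrite mul0r min_r ?ler01//; exact: hv0.
  have nd0 : 0 <= n%:R * d by rewrite mulr_ge0 ?ler0n// ltW.
  move: IH; rewrite -natr1 mulrDl mul1r; have [h1|h1] := leP 1 (n%:R * d) => IH.
    by rewrite min_l//; lra.
  apply: (hv_step _ _ _ IH); first by rewrite nd0.
    by rewrite lt_min h1 ltrDl d0 ge_min lexx.
  rewrite ltrBlDr gt_min; apply/orP; right; move: (b0); rewrite /d; lra.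
have [A A0 hA] : hv 1.
  have := H (Num.truncn d^-1).+1; rewrite min_l//.
  by rewrite -ler_pdivrMr// mul1r ltW// truncnS_gt.
exists A => // x y; have := hA x y; by rewrite powRr1.
Qed.

(** The Lipschitz bound serves for [|x - y| <= 1], boundedness of [F] beyond. *)
Lemma data_holder (a : R) : 0 <= a < 1 -> exists2 A : R, 0 <= A &
  forall x y, `|g x - g y| <= A * `|x - y| `^ a.
Proof.
move=> /andP[a0 a1]; have [A A0 hA] := bootstrap_lipschitz.
have LA : 0 <= L * A by rewrite mulr_ge0.
exists (L * A + 2 * G) => [|x y]; first by rewrite addr_ge0// mulr_ge0.
have [r1|r1] := leP `|x - y| 1.
  apply: (@le_trans _ _ (L * A * `|x - y|)).
    by apply: (le_trans (F_lip _ _)); rewrite -mulrA ler_wpM2l.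
  apply: (@le_trans _ _ (L * A * `|x - y| `^ a)); last first.
    by rewrite ler_wpM2r ?powR_ge0// lerDl mulr_ge0.
  rewrite ler_wpM2l//; have [->|r0] := eqVneq `|x - y| 0; first exact: powR_ge0.
  have rp : 0 < `|x - y| by rewrite lt_neqAle eq_sym r0 /=.
  by rewrite -[leLHS](powRr1 (ltW rp)) ger_powR ?rp ?r1// ltW.
apply: (@le_trans _ _ (2 * G)).
  by rewrite (le_trans (ler_normB _ _))//; have := gG x; have := gG y; lra.
have p1 : 1 <= `|x - y| `^ a by rewrite -[leLHS](powRr0 `|x - y|) ler_powR// ltW.
apply: (@le_trans _ _ ((L * A + 2 * G) * 1)); first by rewrite mulr1 lerDr.
by rewrite ler_wpM2l// addr_ge0// mulr_ge0.
Qed.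

Section exponent.
Variable a : R.
Hypothesis a01 : 0 <= a < 1.

Let Dv (j : nat) x := (if j == 0%N then m0 else 0) + ka * wkd b j g x.

Let gA : exists2 A : R, 0 <= A & forall x y, `|g x - g y| <= A * `|sin ((x - y) / 2)| `^ a.
Proof.
have [A A0 hA] := data_holder a01; have [a0 _] := andP a01.
by exists (A * 8 `^ a); [rewrite mulr_ge0 ?powR_ge0|exact: (holder_sin a0 A0 pg hA)].
Qed.

Let is_derive_Dv (j : nat) (x : R) : (j < 3)%N -> j.+1%:R - a < b -> is_derive x 1 (Dv j) (Dv j.+1 x).
Proof.
move=> j3 jb; have [A A0 hA] := gA.
have h := is_derive_wkd a01 A0 b0 mFv gG mean0 hA x j3 jb.
have h2 := is_deriveD (is_derive_cst (if j == 0%N then m0 else 0) x 1) (is_derive_cmul ka h).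
by apply: (is_derive_eq h2); rewrite /Dv.
Qed.

Let derive1nE (m : nat) : (m <= 3)%N -> m%:R - a < b -> forall j, (j <= m)%N -> derive1n j v = Dv j.
Proof.
move=> m3 mb; elim=> [|j IH] jm.
  by rewrite derive1n0; apply/funext => x; rewrite vE /Dv.
rewrite derive1nS IH; last exact: ltnW.
apply/funext => x; rewrite derive1E.
have jb : j.+1%:R - a < b by apply: le_lt_trans mb; rewrite lerD2r ler_nat.
by have [_ ->] := is_derive_Dv x (leq_trans jm m3) jb.
Qed.

Lemma derivatives_bounded (m : nat) : (m <= 2)%N -> m%:R - a < b -> bounded_derivs m v.
Proof.
move=> m2 mb; have m3 : (m <= 3)%N by exact: leqW.
have [A A0 hA] := gA; split => j jm.
  move=> x; rewrite (derive1nE m3 mb (ltnW jm)).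
  have jb : j.+1%:R - a < b by apply: le_lt_trans mb; rewrite lerD2r ler_nat.
  by have [] := is_derive_Dv x (leq_trans jm m3) jb.
rewrite (derive1nE m3 mb jm).
have jb : j%:R - a < b by apply: le_lt_trans mb; rewrite lerD2r ler_nat.
have [M hM] := wkd_bounded a01 A0 b0 mFv gG mean0 hA (leq_trans jm m3) jb.
exists (`|m0| + `|ka| * M) => x; rewrite /Dv (le_trans (ler_normD _ _))//.
apply: lerD; first by case: ifP => // _; rewrite normr0.
by rewrite normrM ler_wpM2l.
Qed.

Lemma derivatives_holder (m : nat) (gm : R) : (m <= 2)%N -> 0 < gm <= 1 -> m%:R + gm - a < b ->
  (m = 0%N -> a < gm) ->
  exists M : R, forall x y, `|derive1n m v x - derive1n m v y| <= M * `|x - y| `^ gm.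
Proof.
move=> m2 /andP[g0 g1] mb ha; have m3 : (m <= 3)%N by exact: leqW.
have mb' : m%:R - a < b by lra.
rewrite (derive1nE m3 mb' (leqnn m)); have [A A0 hA] := gA.
have [M hM] : exists M : R, forall x y, `|wkd b m g x - wkd b m g y| <= M * `|x - y| `^ gm.
  case: m m2 mb ha m3 mb' => [|m] m2 mb ha m3 mb'.
    have [A' A'0 hA'] := data_holder a01.
    apply: (wk_holder a01 A0 b0 mFv pg gG mean0 hA A'0 hA'); first by rewrite ha.
    by move: mb; rewrite add0r.
  by apply: (wkd_holder a01 A0 b0 mFv gG mean0 hA) => //; rewrite g0.
exists (`|ka| * M) => x y.
have -> : Dv m x - Dv m y = ka * (wkd b m g x - wkd b m g y).
  rewrite /Dv; move: (wkd b m g x) (wkd b m g y) (if m == 0%N then m0 else 0) => p q r; ring.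
by rewrite normrM -mulrA ler_wpM2l.
Qed.

Lemma second_diff_bound (th : R) : 0 < th <= 1 -> (2 - a) * th < b -> exists2 M : R, 0 <= M &
  forall x h, `|2 * v x - v (x + h) - v (x - h)| <= M * `|h| `^ (2 * th).
Proof.
move=> th01 hb; have [A A0 hA] := gA.
have [M M0 hM] := wk_second_diff a01 A0 b0 mFv gG mean0 hA th01 hb.
exists (`|ka| * M) => [|x h]; first by rewrite mulr_ge0.
have -> : 2 * v x - v (x + h) - v (x - h) =
  ka * (2 * wkd b 0 g x - wkd b 0 g (x + h) - wkd b 0 g (x - h)).
  rewrite !vE'; move: (wkd b 0 g x) (wkd b 0 g (x + h)) (wkd b 0 g (x - h)) => p q r; ring.
by rewrite normrM -mulrA ler_wpM2l.
Qed.

End exponent.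

Lemma holder_zygmund_regularity (al : R) : b < 2 -> 0 < al < 1 -> holder_zygmund (b + al) v.
Proof.
move=> b2 /andP[al0 al1].
(* The data exponent [a] is placed strictly between [al] and 1, so that [b + al - a < b] holds with
   room to spare. *)
pose d := Num.min (1 - al) b; pose a := al + d / 2.
have d0 : 0 < d by rewrite lt_min b0 andbT subr_gt0.
have d1 : d <= 1 - al by rewrite ge_min lexx.
have d2 : d <= b by rewrite ge_min lexx orbT.
have a01 : 0 <= a < 1 by apply/andP; split; rewrite /a; lra.
have be0 : 0 <= b + al by lra.
have /andP[n1 n2] := truncn_itv be0.
rewrite /holder_zygmund; set n := Num.truncn (b + al) in n1 n2 *.
have n3 : (n < 3)%N by rewrite -(@ltr_nat R); apply: (le_lt_trans n1); lra.
case: ifPn => hnat.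
  have nE : n%:R = b + al by exact: truncnK.
  have np : (0 < n)%N by rewrite -(@ltr_nat R) nE; lra.
  have mE : n.-1%:R = b + al - 1 :> R by rewrite -nE -[in RHS](prednK np) -natr1 addrK.
  have m2 : (n.-1 <= 2)%N by rewrite -ltnS prednK//; exact: ltnW.
  have mb : n.-1%:R - a < b by rewrite mE /a; lra.
  have mb1 : n.-1%:R + 1 - a < b by rewrite mE /a; lra.
  (* For an integer exponent the derivative of order one less is even Lipschitz, because [a > al];
     this is stronger than the Zygmund condition on its second differences. *)
  have [M hM] := derivatives_holder a01 m2 (introT andP (conj ltr01 (lexx 1))) mb1 (fun=> proj2 (andP a01)).
  have lip x y : `|derive1n n.-1 v x - derive1n n.-1 v y| <= M * `|x - y|.
    by have := hM x y; rewrite powRr1.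
  have M0 : 0 <= M.
    by have := lip 1 0; rewrite subr0 normr1 mulr1; exact: le_trans.
  split.
  - exact: (derivatives_bounded a01 m2 mb).
  - move=> x; apply/cvgrPdist_le => e e0.
    have M1 : 0 < M + 1 by lra.
    near=> y; apply: (le_trans (lip x y)).
    apply: (@le_trans _ _ ((M + 1) * `|x - y|)); first by rewrite ler_wpM2r// lerDl.
    rewrite -ler_pdivlMl// mulrC; near: y.
    by apply: (@cvgr_dist_le _ _ _ _ _ id); [exact: cvg_id|rewrite divr_gt0].
  - exists (2 * M) => x h; set D := derive1n n.-1 v in lip *.
    have -> : D (x + h) - 2 * D x + D (x - h) = (D (x + h) - D x) + (D (x - h) - D x) by ring.
    apply: (le_trans (ler_normD _ _)).
    have := lip (x + h) x; have := lip (x - h) x.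
    have -> : x - h - x = - h by ring.
    have -> : x + h - x = h by ring.
    rewrite normrN; lra.
have gm0 : 0 < b + al - n%:R.
  rewrite subr_gt0 lt_neqAle n1 andbT; apply: contra hnat => /eqP <-.
  exact: natr_nat.
have gm1 : b + al - n%:R <= 1 by rewrite -natr1 in n2; lra.
have m2 : (n <= 2)%N by [].
split; first by apply: (derivatives_bounded a01 m2); rewrite /a; lra.
apply: (derivatives_holder a01 m2); first by rewrite gm0.
  by rewrite /a; lra.
by move=> ->; rewrite /a; lra.
Unshelve. all: by end_near. Qed.

End bootstrap.

End regularity.

(** * Pointwise evaluation of the fractional Laplacian *)

Section classical.
Context {R : realType}.
Notation mu := (@lebesgue_measure R).
Local Notation tau := ((pi : R) *+ 2).
Local Notation I := (@per_itv R).
Let mI := @measurable_per R.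

Lemma integral_oppr (f : R -> R) : measurable_fun setT f ->
  (\int[mu]_x (f (- x))%:E = \int[mu]_x (f x)%:E)%E.
Proof.
move=> mf; rewrite [LHS]integral_maxr [RHS]integral_maxr; congr (_ - _)%E.
  apply: (@ge0_integral_oppr R (fun x => (Num.max (f x) 0)%:E)).
    by apply/measurable_EFinP; exact: max0_measurable.
  by move=> x; rewrite lee_fin le_max lexx orbT.
apply: (@ge0_integral_oppr R (fun x => (Num.max (- f x) 0)%:E)).
  by apply/measurable_EFinP; apply: max0_measurable; exact: measurableT_comp.
by move=> x; rewrite lee_fin le_max lexx orbT.
Qed.

Lemma continuous_ae0_per (d : R -> R) : continuous d -> periodic d tau ->
  {ae mu, forall x, I x -> d x = 0} -> forall x, d x = 0.
Proof.
move=> cd pd [N [mN N0 sN]] x.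
have dE : d x = d (x - tau *~ Num.floor (x / tau)) by rewrite -mulrNz periodicz.
rewrite dE; set x0 := x - _.
have T0 := @tau_gt0 R.
have /andP[x00 x0t] : 0 <= x0 < tau.
  have /andP[n1 n2] := Num.Theory.floor_itv (x / tau).
  rewrite intrD in n2.
  move: n1 n2; rewrite ler_pdivlMr// ltr_pdivrMr// mulrDl mul1r => n1 n2.
  rewrite /x0 -mulrzl; apply/andP; split; lra.
apply/eqP; apply: contraT => dx0.
have [r /= r0 hr] : \forall y \near x0, d y != 0.
  have n0 : 0 < `|d x0| by rewrite normr_gt0.
  have h : \forall y \near x0, `|d x0 - d y| < `|d x0| by move/cvgrPdist_lt: (cd x0) => /(_ _ n0).
  near=> y; have : `|d x0 - d y| < `|d x0| by near: y.
  by apply: contraTneq => ->; rewrite subr0 ltxx.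
(* The interval is taken to the right of [x0], to remain in the open period even when [x0 = 0], and
   is cut at [tau]. *)
pose e := Num.min (x0 + r) tau.
have xe : x0 < e by rewrite lt_min x0t andbT ltrDl.
pose J : set R := `]x0, e[%classic.
have JN : J `<=` N.
  move=> y; rewrite /J /= in_itv /= lt_min => /andP[xy /andP[yr yt]].
  apply: sN => /=; apply/not_implyP; split.
    by rewrite /per_itv /= in_itv /= yt andbT; exact: le_lt_trans xy.
  apply/eqP; apply: hr => /=; rewrite distrC gtr0_norm ?subr_gt0//; lra.
have muJ : mu J = (e - x0)%:E.
  by rewrite /J lebesgue_measure_itv /= lte_fin xe -EFinB.
have mJ : measurable J by exact: measurable_itv.
have : (mu J <= mu N)%E by apply: le_measure => //; rewrite inE.
by rewrite muJ N0 lee_fin subr_le0 leNgt xe.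
Unshelve. all: by end_near. Qed.

Lemma ae_per (P : R -> Prop) : (forall x, P (x + tau) <-> P x) ->
  {ae mu, forall x, I x -> P x} -> {ae mu, forall x, P x}.
Proof.
move=> pP hI.
have pz (n : int) x : P (x + tau *~ n) <-> P x.
  have hn (k : nat) y : P (y + tau *~ k%:Z) <-> P y.
    elim: k y => [|k IH] y; first by rewrite mulr0z addr0.
    by rewrite -[k.+1]addn1 PoszD mulrzDr mulr1z addrA pP.
  case: n => k; first exact: hn.
  rewrite NegzE mulrNz; split => h.
    by rewrite -[x](subrK (tau *~ k.+1%:Z)); apply/hn.
  by apply/(hn k.+1); rewrite subrK.
(* No translate of the open period contains a multiple of [tau]; these points are discarded by
   translating the condition [x <> 0]. *)
have ne0 : {ae mu, forall x, x <> 0}.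
  exists [set 0]; split => //; first exact: lebesgue_measure_set1.
  by move=> x /= /contrapT.
have hI' : {ae mu, forall x, (I x -> P x) /\ x <> 0} by apply: aeS2 hI ne0 => x h1 h2.
have H (k : nat) := ae_shift (- (tau *~ int_of_nat k)) hI'.
apply: aeS (ae_foralln H) => x h; have T0 := @tau_gt0 R.
set n := Num.floor (x / tau).
have [_ _ /(_ n Logic.I) [k _ kn]] := int_of_nat_bij.
have [h1 h2] := h k; rewrite kn in h1 h2.
have /andP[n1 n2] := Num.Theory.floor_itv (x / tau); rewrite -/n in n1 n2.
rewrite intrD in n2; move: n1 n2; rewrite ler_pdivlMr// ltr_pdivrMr// mulrDl mul1r => n1 n2.
have nE : tau *~ n = n%:~R * tau by rewrite mulrzl.
apply/(pz (- n)); rewrite mulrNz; apply: h1.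
rewrite /per_itv /= in_itv /= nE; apply/andP; split; last by lra.
by rewrite lt_neqAle eq_sym; apply/andP; split; [apply/eqP; rewrite -nE|lra].
Qed.

(** For [|h| < 1] the left side is exactly [h^2 kern s' h] with [s' = 1 - (th - s)], and
    [s < th <= 1] puts [s'] in []0, 1[]. Both terms on the right are thus covered by
    [kern_min_lty]. *)
Lemma kern_weight_le (s th h : R) : 0 < s -> s < th -> th <= 1 ->
  Num.min 1 (`|h| `^ (2 * th)) * kern s h <=
  Num.min 1 (h ^+ 2) * kern (1 - (th - s)) h + Num.min 1 (h ^+ 2) * kern s h.
Proof.
move=> s0 sth th1.
have min0 : 0 <= Num.min 1 (h ^+ 2) :> R by rewrite le_min ler01 sqr_ge0.
have hh : h ^+ 2 = `|h| ^+ 2 by rewrite real_normK ?num_real.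
have [h1|h1] := leP 1 `|h|.
  have -> : Num.min 1 (h ^+ 2) = 1 by rewrite min_l// hh exprn_ege1.
  apply: (@le_trans _ _ (1 * kern s h)); last first.
    by rewrite lerDr mulr_ge0// invr_ge0 powR_ge0.
  by rewrite ler_wpM2r ?kern_ge0// ge_min lexx.
have -> : Num.min 1 (h ^+ 2) = `|h| ^+ 2.
  by rewrite hh min_r// exprn_ile1// ltW.
apply: (@le_trans _ _ (`|h| ^+ 2 * kern (1 - (th - s)) h)); last first.
  by rewrite lerDl mulr_ge0 ?kern_ge0 ?exprn_ge0.
apply: (@le_trans _ _ (`|h| `^ (2 * th) * kern s h)).
  by rewrite ler_wpM2r ?kern_ge0// ge_min lexx orbT.
rewrite /kern; have [->|h0] := eqVneq `|h| 0.
  rewrite !powR0 ?invr0 ?mulr0//; apply: lt0r_neq0; lra.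
have hp : 0 < `|h| by rewrite lt_neqAle eq_sym h0 /=.
rewrite -powR_mulrn// -!powRN -!powRD ?h0 ?implybT//.
by rewrite le_eqVlt; apply/orP; left; apply/eqP; congr (_ `^ _); ring.
Qed.

(** * The principal value through second differences *)

Section second_differences.
Variables (s th M K : R) (v : R -> R).
Hypotheses (s01 : 0 < s < 1) (sth : s < th) (th1 : th <= 1)
  (cv : continuous v) (pv_ : periodic v tau) (vM : forall x, `|v x| <= M)
  (K0 : 0 <= K) (vK : forall x h, `|2 * v x - v (x + h) - v (x - h)| <= K * `|h| `^ (2 * th)).

Let s0 : 0 < s. Proof. by case/andP: s01. Qed.
Let M0 : 0 <= M. Proof. exact: le_trans (vM 0). Qed.
Let mv : measurable_fun setT v. Proof. exact: continuous_measurable_fun. Qed.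

Let D2 x h := 2 * v x - v (x + h) - v (x - h).
Let bd h := (4 * M + K) * (Num.min 1 (`|h| `^ (2 * th)) * kern s h).

Let mD2 x : measurable_fun setT (D2 x).
Proof.
apply: measurable_funB; first apply: measurable_funB => //; apply: (measurableT_comp mv).
  exact: measurable_funD.
exact: measurable_funB.
Qed.

Let D2_4M x h : `|D2 x h| <= 4 * M.
Proof.
apply: (le_trans (ler_normB _ _)); apply: (@le_trans _ _ (2 * `|v x| + `|v (x + h)| + `|v (x - h)|)).
  by rewrite lerD2r (le_trans (ler_normB _ _))// lerD2r normrM ger0_norm.
by have := vM x; have := vM (x + h); have := vM (x - h); lra.
Qed.

Let D2_le x h : `|D2 x h * kern s h| <= bd h.
Proof.
rewrite normrM [X in _ * X]ger0_norm ?kern_ge0// /bd mulrA ler_wpM2r ?kern_ge0//.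
have b1 := D2_4M x h; have b2 := vK x h; rewrite -/(D2 x h) in b2.
have p0 := powR_ge0 `|h| (2 * th).
have := M0; have := K0; rewrite /Num.min; case: ifP => _ k0 m0; first by lra.
by apply: (le_trans b2); rewrite ler_wpM2r//; lra.
Qed.

Let ibd : mu.-integrable setT (fun h => (bd h)%:E).
Proof.
have imin s' : 0 < s' < 1 -> mu.-integrable setT (fun h : R => (Num.min 1 (h ^+ 2) * kern s' h)%:E).
  move=> s'01; apply: integrable_ge0 => //.
  - apply: measurable_funM; last exact: measurable_kern.
    by apply: measurable_minr => //; exact: exprn_measurable.
  - by move=> h _; rewrite mulr_ge0 ?kern_ge0// le_min ler01 sqr_ge0.
  - exact: kern_min_lty.
have s'01 : 0 < 1 - (th - s) < 1.
  by have := s0; have := sth; have := th1; move=> *; apply/andP; split; lra.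
apply: integrable_cmul => //.
apply: (@integrable_dom _ _ _ mu setT _ (fun h : R => Num.min 1 (h ^+ 2) * kern (1 - (th - s)) h +
  Num.min 1 (h ^+ 2) * kern s h)) => //.
- apply: measurable_funM; last exact: measurable_kern.
  apply: measurable_minr => //; apply: measurable_powRl; exact: normr_measurable.
- move=> h _; rewrite ger0_norm; first exact: kern_weight_le.
  by rewrite mulr_ge0 ?kern_ge0// le_min ler01 powR_ge0.
- by apply: integrable_add => //; exact: imin.
Qed.

Let iD2 x : mu.-integrable setT (fun h => (D2 x h * kern s h)%:E).
Proof.
apply: (@integrable_dom _ _ _ mu setT _ bd) => //.
exact: (measurable_funM (mD2 x) (@measurable_kern R s)).
Qed.

Let Bs (e : R) : set R := [set h : R | e < `|h|].
Let mBs (e : R) : measurable (Bs e).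
Proof.
have := @normr_measurable R setT measurableT `]e, +oo[%classic (measurable_itv _).
rewrite setTI; congr measurable; apply/seteqP; split => h; rewrite /Bs /= in_itv /= andbT //.
Qed.

Let q x h := (v x - v (x + h)) * kern s h.
Let mq x : measurable_fun setT (q x).
Proof.
apply: measurable_funM; last exact: measurable_kern.
apply: measurable_funB => //; apply: (measurableT_comp mv); exact: measurable_funD.
Qed.

Let iq (x e : R) : 0 < e -> mu.-integrable (Bs e) (fun h => (q x h)%:E).
Proof.
move=> e0; have m0 : 0 < Num.min 1 (e ^+ 2) by rewrite lt_min ltr01 exprn_gt0.
pose C := 2 * M / Num.min 1 (e ^+ 2).
have imin : mu.-integrable setT (fun h : R => (Num.min 1 (h ^+ 2) * kern s h)%:E).
  apply: integrable_ge0 => //.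
  - apply: measurable_funM; last exact: measurable_kern.
    by apply: measurable_minr => //; exact: exprn_measurable.
  - by move=> h _; rewrite mulr_ge0 ?kern_ge0// le_min ler01 sqr_ge0.
  - exact: kern_min_lty.
have imin' : mu.-integrable (Bs e) (fun h : R => (C * (Num.min 1 (h ^+ 2) * kern s h))%:E).
  apply: (@integrable_cmul _ _ R mu (Bs e) (mBs e) (fun h => Num.min 1 (h ^+ 2) * kern s h) C).
  exact: (@integrableS _ _ _ mu setT (Bs e) _ measurableT (mBs e) (@subsetT _ _) imin).
apply: (@integrable_dom _ _ _ mu (Bs e) (mBs e) (fun h : R => C * (Num.min 1 (h ^+ 2) * kern s h)) _ _ _ imin').
  exact: (measurable_funTS (mq x)).
move=> h; rewrite /Bs /= => eh.
rewrite /q normrM [X in _ * X]ger0_norm ?kern_ge0// mulrA ler_wpM2r ?kern_ge0//.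
apply: (@le_trans _ _ (2 * M)).
  by rewrite (le_trans (ler_normB _ _))//; have := vM x; have := vM (x + h); lra.
rewrite /C mulrAC ler_pdivlMr// ler_wpM2l ?mulr_ge0//.
rewrite le_min ge_min lexx /= ge_min; apply/orP; right.
have -> : h ^+ 2 = `|h| ^+ 2 by rewrite real_normK ?num_real.
by rewrite lerXn2r ?nnegrE ?(ltW e0)// ltW.
Qed.

Let shift_in (f : R -> R) (x e : R) : measurable_fun setT f ->
  (\int[mu]_(y in [set y : R | (e < `|x - y|)%R]) (f y)%:E = \int[mu]_(h in Bs e) (f (h + x)%R)%:E)%E.
Proof.
move=> mf.
have -> : [set y : R | e < `|x - y|] = [set y : R | Bs e (y - x)].
  by apply/seteqP; split => y; rewrite /Bs /= distrC.
rewrite [LHS]integral_maxr [RHS]integral_maxr; congr (_ - _)%E; apply/esym.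
  apply: (@ge0_integral_shift_in R (fun y => Num.max (f y) 0)) => //.
    exact: max0_measurable.
  by move=> y; rewrite le_max lexx orbT.
apply: (@ge0_integral_shift_in R (fun y => Num.max (- f y) 0)) => //.
  by apply: max0_measurable; exact: measurableT_comp.
by move=> y; rewrite le_max lexx orbT.
Qed.

Let mquot x : measurable_fun setT (frac_quot s v x).
Proof.
apply: measurable_funM; first exact: measurable_funB.
apply: measurable_funV; apply: measurable_powRl; apply: measurableT_comp => //; exact: measurable_funB.
Qed.

Let quotE x h : frac_quot s v x (h + x) = q x h.
Proof.
rewrite /frac_quot /q /kern [h + x]addrC; congr (_ / _ `^ _).
by rewrite opprD addrA subrr add0r normrN.
Qed.

Lemma frac_quot_integrable (x e : R) : 0 < e ->
  mu.-integrable [set y : R | e < `|x - y|] (EFin \o frac_quot s v x).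
Proof.
move=> e0; have mA : measurable [set y : R | e < `|x - y|].
  have -> : [set y : R | e < `|x - y|] = [set y : R | Bs e (y - x)].
    by apply/seteqP; split => y; rewrite /Bs /= distrC.
  exact: (measurable_shift_set (A := Bs e) x (mBs e)).
apply: (@integrable_lty_abs _ _ _ mu [set y : R | e < `|x - y|] (frac_quot s v x)).
  exact: (measurable_funTS (mquot x)).
rewrite (@shift_in (fun y => `|frac_quot s v x y|)); last exact: measurableT_comp.
under eq_integral do rewrite quotE.
exact: (integrable_ae_lty (iq x e0)).
Qed.

Let res (x e : R) : R -> R := (fun h => D2 x h * kern s h) \_ (Bs e).

Let Bs_opp (e h : R) : (- h \in Bs e) = (h \in Bs e).
Proof. by apply/idP/idP; rewrite !inE /Bs /= normrN. Qed.

(** The truncated domain is symmetric, so averaging over [h] and [- h] turns first differences,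
    which need the principal value, into second differences, which are absolutely integrable up to
    [h = 0]. *)
Lemma frac_truncE (x e : R) : 0 < e -> frac_trunc s v x e = 2^-1 * \int[mu]_h res x e h.
Proof.
move=> e0.
have -> : frac_trunc s v x e = \int[mu]_(h in Bs e) q x h.
  rewrite /frac_trunc /Rintegral (@shift_in (frac_quot s v x) x e (mquot x)).
  by congr fine; apply: eq_integral => h _; rewrite quotE.
rewrite Rintegral_mkcond; pose qe : R -> R := q x \_ (Bs e).
have mqe : measurable_fun setT qe.
  exact: ((measurable_restrictT (q x) (mBs e)).1 (measurable_funTS (mq x))).
have iqe : mu.-integrable setT (fun h => (qe h)%:E).
  apply: integrable_lty_abs => //.
  have -> : (fun h => `|qe h|%:E) = (fun h => `|q x h|%:E) \_ (Bs e).
    by apply/funext => h; rewrite /qe !patchE; case: ifP => // _; rewrite normr0.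
  by rewrite -integral_mkcond; exact: (integrable_ae_lty (iq x e0)).
have iqe' : mu.-integrable setT (fun h => (qe (- h))%:E).
  apply: integrable_lty_abs => //; first exact: measurableT_comp.
  rewrite (@integral_oppr (fun h => `|qe h|)); last exact: measurableT_comp.
  exact: integrable_ae_lty.
have E : \int[mu]_h qe (- h) = \int[mu]_h qe h by rewrite /Rintegral integral_oppr.
have -> : \int[mu]_h res x e h = \int[mu]_h (qe h + qe (- h)).
  apply: eq_Rintegral => h _; rewrite /res /qe !patchE Bs_opp; case: ifP => _; last by rewrite addr0.
  by rewrite /q /D2 kernN; ring.
by rewrite (Rintegral_add measurableT iqe iqe') E -/qe; move: (\int[mu]_h qe h) => z; field.
Qed.

Lemma frac_trunc_cvg (x : R) : frac_trunc s v x e @[e --> 0^'+] -->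
  2^-1 * \int[mu]_h (D2 x h * kern s h).
Proof.
apply/cvg_at_rightP => u [u0 ucv].
have -> : (fun n => frac_trunc s v x (u n)) = (fun n => 2^-1 * \int[mu]_h res x (u n) h).
  by apply/funext => n; rewrite frac_truncE.
apply: cvgM; first exact: cvg_cst.
apply: (@Rdominated_cvg _ (measurableTypeR R) R mu setT (fun n => res x (u n)) (fun h => D2 x h * kern s h) bd) => //.
- move=> n; exact: ((measurable_restrictT (fun h => D2 x h * kern s h) (mBs (u n))).1
    (measurable_funTS (measurable_funM (mD2 x) (@measurable_kern R s)))).
- exact: (measurable_funM (mD2 x) (@measurable_kern R s)).
- apply: aeW => h _.
  (* At [h = 0] the second difference vanishes; at any other [h] the truncation is eventually
     inactive. *)
  have [->|h0] := eqVneq h 0.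
    apply: cvg_near_cst; apply: nearW => n; rewrite /res patchE.
    rewrite memNset; first by rewrite [RHS](_ : _ = 0)// /D2 addr0 subr0; ring.
    by rewrite /Bs /= normr0; apply/negP; rewrite -leNgt ltW.
  apply: cvg_near_cst.
  have hp : 0 < `|h| by rewrite normr_gt0.
  have : \forall n \near \oo, u n < `|h| by exact: (cvgr_lt 0 ucv).
  by apply: filterS => n un; rewrite /res patchE mem_set.
- move=> n h _; rewrite /res patchE; case: ifP => _; first exact: D2_le.
  by rewrite [X in `|X|](_ : _ = 0 :> R)// normr0 (le_trans _ (D2_le x h)).
Qed.

Lemma frac_lap_facts (x : R) : frac_lap_ex s v x /\ frac_lap s v x = 2^-1 * \int[mu]_h (D2 x h * kc s h).
Proof.
have cv' := @frac_trunc_cvg x.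
split; first by split; [move=> e; exact: frac_quot_integrable|apply/cvg_ex; exists (2^-1 * \int[mu]_h (D2 x h * kern s h))].
rewrite /frac_lap (cvg_lim _ cv')//.
have -> : \int[mu]_h (D2 x h * kc s h) = frac_cst s * \int[mu]_h (D2 x h * kern s h).
  by rewrite -Rintegral_cmul//; apply: eq_Rintegral => h _; rewrite /kc; ring.
by ring.
Qed.

Let Wf x := \int[mu]_h (D2 x h * kern s h).

Let Wf_continuous : continuous Wf.
Proof.
move=> x.
have Ix : x \in (`]x - 1, x + 1[%classic : set R) by rewrite inE /= in_itv /= ltrDl ltrBlDr ltrDl ltr01.
have cf : {ae mu, forall h : R, setT h -> {in (`]x - 1, x + 1[%classic : set R), continuous ((fun x h => D2 x h * kern s h) ^~ h)}}.
  apply: aeW => h _ y _; apply: cvgM; last exact: cvg_cst.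
  apply: cvgB; first apply: cvgB.
  - by apply: cvgM; [exact: cvg_cst|exact: cv].
  - apply: (@continuous_comp _ _ _ (fun z : R => z + h) v); last exact: cv.
    by apply: cvgD; [exact: cvg_id|exact: cvg_cst].
  - apply: (@continuous_comp _ _ _ (fun z : R => z - h) v); last exact: cv.
    by apply: cvgB; [exact: cvg_id|exact: cvg_cst].
have ub y : `]x - 1, x + 1[%classic y -> {ae mu, forall h : R, setT h -> `|D2 y h * kern s h| <= bd h}.
  by move=> _; apply: aeW => h _; exact: D2_le.
exact: (@continuity_under_integral R _ (measurableTypeR R) mu (fun x h => D2 x h * kern s h) setT measurableT
  (x - 1) (x + 1) (fun y _ => iD2 y) cf bd ibd ub x Ix).
Qed.

Lemma frac_lap_continuous : continuous (frac_lap s v).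
Proof.
have -> : frac_lap s v = (fun x => frac_cst s * (2^-1 * Wf x)).
  apply/funext => x; rewrite (frac_lap_facts x).2.
  have -> : \int[mu]_h (D2 x h * kc s h) = frac_cst s * Wf x.
    by rewrite -Rintegral_cmul//; apply: eq_Rintegral => h _; rewrite /kc; ring.
  by ring.
move=> x; apply: cvgM; first exact: cvg_cst.
apply: cvgM; first exact: cvg_cst.
exact: Wf_continuous.
Qed.

Lemma frac_lap_periodic : periodic (frac_lap s v) tau.
Proof.
move=> x; rewrite !(frac_lap_facts _).2; congr (_ * _); apply: eq_Rintegral => h _.
by rewrite /D2 ![x + tau + _]addrAC !pv_.
Qed.

(** The second differences are moved onto [phi], where they act as multiplication by
    [2 (1 - cos(k h))]; the remaining integral in [h] is the symbol. *)
Lemma frac_lap_coef k phi : is_trig k phi ->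
  \int[mu]_(x in I) (frac_lap s v x * phi x) = k%:R `^ (2 * s) * \int[mu]_(x in I) (v x * phi x).
Proof.
move=> tphi; have mphi := measurable_trig tphi; have pphi := periodic_trig tphi.
have iv : mu.-integrable I (fun x => (v x)%:E) by exact: (@per_bounded_integrable R v M).
have c0 := ltW (frac_cst_gt0 s01).
have mD : measurable_fun setT (fun z : R * R => D2 z.1 z.2).
  apply: measurable_funB; first apply: measurable_funB.
  - by apply: measurable_funM => //; exact: (measurableT_comp mv).
  - by apply: (measurableT_comp mv); exact: measurable_funD.
  - by apply: (measurableT_comp mv); exact: measurable_funB.
have mF : measurable_fun setT (fun z : R * R => D2 z.1 z.2 * kc s z.2 * phi z.1).
  apply: measurable_funM; last exact: (measurableT_comp mphi).
  by apply: measurable_funM => //; exact: (measurable_snd2 (measurable_kc s)).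
have ikc x : mu.-integrable setT (fun h => (D2 x h * kc s h)%:E).
  have := integrable_cmul measurableT (frac_cst s) (iD2 x).
  by apply: eq_integrable => // h _; rewrite /kc; congr EFin; ring.
have fin : (\int[mu]_(x in I) \int[mu]_h `|D2 x h * kc s h * phi x|%:E < +oo)%E.
  have ib : mu.-integrable setT (fun h => (frac_cst s * bd h)%:E) by exact: integrable_cmul.
  have bd0 h : 0 <= bd h by exact: le_trans (D2_le 0 h).
  pose Cb := (\int[mu]_h (frac_cst s * bd h)%:E)%E.
  have Cb0 : (0 <= Cb)%E by apply: integral_ge0 => h _; rewrite lee_fin; apply: mulr_ge0.
  have Cfin : (Cb < +oo)%E.
    have := integrable_ae_lty ib; congr (_ < _)%E; apply: eq_integral => h _.
    by rewrite ger0_norm//; apply: mulr_ge0.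
  apply: (@le_lt_trans _ _ (\int[mu]_(x in I) Cb)%E); last first.
    by rewrite integral_cst// lte_mul_pinfty// ?ge0_fin_numE//; exact: per_fin.
  apply: ge0_le_integral => //.
  - by move=> x _; apply: integral_ge0.
  - apply: measurable_funTS; apply: (@measurable_eint R _ R setT (fun x h => `|D2 x h * kc s h * phi x|)) => //.
    exact: measurableT_comp mF.
  move=> x _; apply: ge0_le_integral => //.
  - apply/measurable_EFinP; apply: measurableT_comp => //.
    exact: (measurable_funM (measurable_funM (mD2 x) (@measurable_kc R s)) (measurable_cst _)).
  - by apply/measurable_EFinP; exact: (integrable_mf ib).
  move=> h _; rewrite lee_fin normrM -[leRHS]mulr1; apply: ler_pM => //; last exact: (trig_le1 tphi).
  by rewrite /kc mulrCA normrM (ger0_norm c0) ler_wpM2l.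
have iR := @Rinner_integrable R I setT (fun x h => D2 x h * kc s h * phi x) mI measurableT mF fin.
transitivity (2^-1 * \int[mu]_(x in I) \int[mu]_h (D2 x h * kc s h * phi x)).
  rewrite -Rintegral_cmul//; apply: eq_Rintegral => x _.
  rewrite (frac_lap_facts x).2 -mulrA; congr (_ * _).
  by rewrite mulrC -Rintegral_cmul//; apply: eq_Rintegral => h _; ring.
rewrite (@Rfubini R I setT (fun x h => D2 x h * kc s h * phi x))//.
transitivity (2^-1 * \int[mu]_h (2 * \int[mu]_(x in I) (v x * phi x) * ((1 - cos (k%:R * h)) * kc s h))).
  congr (_ * _); apply: eq_Rintegral => h _.
  have E x : D2 x h * kc s h * phi x = kc s h * (D2 x h * phi x) by ring.
  under eq_Rintegral do rewrite E.
  rewrite Rintegral_cmul//; last first.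
    apply: (@per_bounded_integrable R _ (4 * M)).
      apply: measurable_funM => //; apply: measurable_funB; last exact: measurable_shiftc.
      by apply: measurable_funB; [exact: measurable_funM|exact: measurable_shiftc].
    move=> x _; rewrite normrM -[leRHS]mulr1; apply: ler_pM => //; exact: (trig_le1 tphi).
  rewrite (second_diff_shift mv pv_ iv mphi pphi (trig_le1 tphi)).
  by rewrite (trig_shift_sum h tphi mv iv); ring.
rewrite Rintegral_cmul//; last exact: symbol_int.
by rewrite symbolE//; field.
Qed.

End second_differences.

End classical.

(** * Conclusion *)

Section nonlinearity.
Context {R : realType}.
Notation mu := (@lebesgue_measure R).
Local Notation tau := ((pi : R) *+ 2).
Local Notation I := (@per_itv R).
Let mI := @measurable_per R.

Lemma locally_lipschitz_ball (f : R -> R) (x : R) :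
  (exists2 U : set R, nbhs x U & [lipschitz f y | y in U]) ->
  exists2 r : R, 0 < r & exists2 k : R, 0 < k &
    forall y z, `|x - y| < r -> `|x - z| < r -> `|f y - f z| <= k * `|y - z|.
Proof.
move=> [U [r /= r0 rU] /pinfty_ex_gt0 [k k0 hk]]; exists r => //; exists k => // y z xy xz.
by apply: (hk (y, z)); split; apply: rU.
Qed.

Lemma locally_lipschitz_continuous (f : R -> R) :
  (forall x : R, exists2 U : set R, nbhs x U & [lipschitz f y | y in U]) -> continuous f.
Proof.
move=> fl x; have [r r0 [k k0 h]] := locally_lipschitz_ball (fl x).
apply/cvgrPdist_le => e e0; near=> y.
have xy : `|x - y| < r by near: y; apply: (@cvgr_dist_lt _ _ _ _ _ id) => //; exact: cvg_id.
apply: (le_trans (h x y _ xy)); first by rewrite subrr normr0.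
rewrite mulrC -ler_pdivlMr//; near: y.
by apply: (@cvgr_dist_le _ _ _ _ _ id); [exact: cvg_id|rewrite divr_gt0].
Unshelve. all: by end_near. Qed.

(** Compactness yields one constant for nearby points; points further apart than [L^-1] satisfy
    [1 <= L |x - y|], and the bound [B] on the values is enough for them. *)
Lemma locally_lipschitz_segment (f : R -> R) (M B : R) :
  (forall x : R, exists2 U : set R, nbhs x U & [lipschitz f y | y in U]) ->
  (forall x, `|x| <= M -> `|f x| <= B) ->
  exists2 L : R, 0 <= L & forall x y, `|x| <= M -> `|y| <= M -> `|f x - f y| <= L * `|x - y|.
Proof.
move=> fl fB.
(* One parameter serves as Lipschitz constant and as inverse radius, so that enlarging it preserves
   the local estimates and the covering argument can be run with [L] tending to infinity. *)
pose P (L x : R) := forall y, `|x - y| < L^-1 -> `|f x - f y| <= L * `|x - y|.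
have cov : near_covering (`[- M, M]%classic : set R).
  by apply/compact_near_coveringP; exact: segment_compact.
have H : \forall L \near +oo, `[- M, M]%classic `<=` P L.
  apply: cov => x _; have [r r0 [k k0 h]] := locally_lipschitz_ball (fl x).
  have r2 : 0 < r / 2 by rewrite divr_gt0.
  near=> x' L; rewrite /P /= => y yL.
  have xx : `|x - x'| < r / 2 by near: x'; apply: (@cvgr_dist_lt _ _ _ _ _ id) => //; exact: cvg_id.
  have kL : k <= L by near: L; apply: nbhs_pinfty_ge; exact: num_real.
  have rL : (r / 2)^-1 <= L by near: L; apply: nbhs_pinfty_ge; exact: num_real.
  have L0 : 0 < L by exact: lt_le_trans kL.
  have Lr : L^-1 <= r / 2 by rewrite -[leRHS]invrK lef_pV2 ?posrE ?invr_gt0.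
  have xr : `|x - x'| < r by lra.
  have yr : `|x - y| < r.
    have -> : x - y = (x - x') + (x' - y) by ring.
    by apply: (le_lt_trans (ler_normD _ _)); lra.
  by apply: (le_trans (h _ _ xr yr)); rewrite ler_wpM2r.
have [L L0 HL] := pinfty_ex_gt0 H.
exists (L + 2 * `|B| * L) => [|x y xM yM].
  by rewrite addr_ge0 ?(ltW L0)// !mulr_ge0 ?(ltW L0).
have d0 : 0 <= `|x - y| by [].
have B0 : 0 <= `|B| by [].
have BL : 0 <= 2 * `|B| * L by rewrite !mulr_ge0 ?(ltW L0).
have [xyL|xyL] := ltP `|x - y| L^-1.
  apply: (@le_trans _ _ (L * `|x - y|)); last by rewrite ler_wpM2r// lerDl.
  by apply: HL => //=; rewrite in_itv /= -ler_norml.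
have Lxy : 1 <= L * `|x - y| by rewrite mulrC -ler_pdivrMr// mul1r.
apply: (@le_trans _ _ (2 * `|B|)).
  rewrite (le_trans (ler_normB _ _))//; have := fB _ xM; have := fB _ yM; have := ler_norm B; lra.
rewrite [leRHS]mulrDl; apply: (@le_trans _ _ (2 * `|B| * (L * `|x - y|))).
  by rewrite -[leLHS]mulr1 ler_wpM2l// mulr_ge0.
by rewrite mulrA lerDr mulr_ge0// ltW.
Unshelve. all: by end_near. Qed.

(** For [s < 1/2] the bound on [p] says [(p - 1)(1 - 2s) < 4s], that is,
    [1/(2s) < 2 / ((p - 1)(1 - 2s))]; [m] is the midpoint of these two numbers. For [s >= 1/2] the
    factor [1 - 2s] is not positive and [m = 2] works. *)
Lemma subcritical_exponent (s p : R) : 0 < s < 1 -> 1 < p ->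
  (s < 2^-1 -> p < (1 + 2 * s) / (1 - 2 * s)) ->
  p * (1 - 2 * s) < 2 /\
  exists m : R, [/\ 1 < m, m^-1 < 2 * s & (p - 1) * m * (1 - 2 * s) < 2].
Proof.
move=> /andP[s0 s1] p1 hp; have [s2|s2] := ltP s 2^-1; last first.
  have h2 : 1 - 2 * s <= 0 by lra.
  split; first by nra.
  exists 2; split; [lra|lra|].
  by apply: le_lt_trans (_ : (p - 1) * 2 * (1 - 2 * s) <= 0) _ => //; nra.
have D0 : 0 < 1 - 2 * s by lra.
have {}hp := hp s2; rewrite ltr_pdivlMr// in hp.
split; first by lra.
set X := (p - 1) * (1 - 2 * s).
have X0 : 0 < X by rewrite mulr_gt0// subr_gt0.
have X4 : X < 4 * s by rewrite /X mulrBl; lra.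
have h1 : 1 < (2 * s)^-1 by rewrite invf_gt1; lra.
have s20 : 0 < 2 * s by lra.
have h2 : (2 * s)^-1 < 2 / X by rewrite ltr_pdivlMr// ltr_pdivrMl//; lra.
exists (((2 * s)^-1 + 2 / X) / 2); set m := _ / 2.
have m1 : (2 * s)^-1 < m by rewrite /m; lra.
have m2 : m < 2 / X by rewrite /m; lra.
split; first by exact: lt_trans m1.
  by rewrite -[ltRHS]invrK ltf_pV2 ?posrE ?invr_gt0// (lt_trans _ m1)// invr_gt0.
by rewrite mulrAC -/X mulrC -ltr_pdivlMr.
Qed.

Lemma weight_integrable (s Q : R) (w : R -> R) : 0 < s < 1 -> measurable_fun setT w ->
  periodic w tau -> (En s w < +oo)%E -> (\int[mu]_(x in I) (w x ^+ 2)%:E < +oo)%E ->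
  0 <= Q -> Q * (1 - 2 * s) < 2 ->
  mu.-integrable I (fun x => ((1 + `|w x|) `^ Q)%:E).
Proof.
move=> s01 mw pw Ew L2 Q0 hQ; have h := sobolev s01 mw pw Ew L2 Q0 hQ.
have mq := measurable_abspow Q mw.
have iq : mu.-integrable I (fun x => (`|w x| `^ Q)%:E).
  by apply: integrable_ge0 => //; exact: measurable_funTS.
have i1 : mu.-integrable I (fun x => (2 `^ Q * (1 + `|w x| `^ Q))%:E).
  apply: integrable_cmul => //; apply: integrable_add => //.
  by apply: integrable_cstR => //; exact: per_fin.
apply: (@integrable_dom _ _ _ mu I mI (fun x => 2 `^ Q * (1 + `|w x| `^ Q))) => //.
  apply: measurable_funTS; apply: measurable_powRl; apply: measurable_funD => //.
  exact: measurableT_comp.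
move=> x _; rewrite ger0_norm ?powR_ge0//; set r := `|w x|; have r0 : 0 <= r by exact: normr_ge0.
have [r1|r1] := leP r 1.
  apply: (@le_trans _ _ (2 `^ Q)); first by rewrite ge0_ler_powR ?nnegrE ?addr_ge0//; lra.
  by rewrite -[leLHS]mulr1 ler_wpM2l ?powR_ge0// lerDl powR_ge0.
apply: (@le_trans _ _ ((2 * r) `^ Q)).
  by rewrite ge0_ler_powR ?nnegrE ?addr_ge0 ?mulr_ge0//; lra.
by rewrite powRM// ler_wpM2l ?powR_ge0// lerDr.
Qed.

End nonlinearity.

(** * Bounded periodic representative of a weak solution *)

Section assembly.
Context {R : realType}.
Notation mu := (@lebesgue_measure R).
Local Notation tau := ((pi : R) *+ 2).
Local Notation I := (@per_itv R).
Let mI := @measurable_per R.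

Lemma pv_ae (g h : R -> R) : measurable_fun setT g -> measurable_fun setT h ->
  {ae mu, forall x, I x -> g x = h x} -> forall t x, pv g t x = pv h t x.
Proof.
move=> mg mh gh t x; rewrite /pv /Rintegral; congr fine.
apply: (@ae_eq_integral _ _ _ mu I (fun y => (pk t (x - y) * h y)%:E) (fun y => (pk t (x - y) * g y)%:E) mI).
- apply/measurable_EFinP; apply: measurable_funTS; apply: measurable_funM => //; exact: measurable_pkx.
- apply/measurable_EFinP; apply: measurable_funTS; apply: measurable_funM => //; exact: measurable_pkx.
by apply: aeS gh => y e Iy; rewrite e.
Qed.

Lemma Rintegral_ae (g h : R -> R) : measurable_fun setT g -> measurable_fun setT h ->
  {ae mu, forall x, I x -> g x = h x} -> \int[mu]_(x in I) g x = \int[mu]_(x in I) h x.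
Proof.
move=> mg mh gh; rewrite /Rintegral; congr fine.
apply: (@ae_eq_integral _ _ _ mu I (fun y => (h y)%:E) (fun y => (g y)%:E) mI).
- by apply/measurable_EFinP; exact: measurable_funTS.
- by apply/measurable_EFinP; exact: measurable_funTS.
by apply: aeS gh => y e Iy; rewrite e.
Qed.

Lemma wk_periodic (b : R) (g : R -> R) : periodic (wk b g) tau.
Proof.
move=> x; apply: eq_Rintegral => t _; congr (_ * _); apply: eq_Rintegral => y _.
by congr (_ * _); rewrite addrAC periodic_pk.
Qed.

Lemma lipschitz_continuous (v : R -> R) (A : R) : 0 <= A ->
  (forall x y, `|v x - v y| <= A * `|x - y|) -> continuous v.
Proof.
move=> A0 h x; apply/cvgrPdist_le => e e0; have A1 : 0 < A + 1 by lra.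
near=> y; apply: (le_trans (h x y)).
apply: (@le_trans _ _ ((A + 1) * `|x - y|)); first by rewrite ler_wpM2r// lerDl.
rewrite mulrC -ler_pdivlMr//; near: y.
by apply: (@cvgr_dist_le _ _ _ _ _ id); [exact: cvg_id|rewrite divr_gt0].
Unshelve. all: by end_near. Qed.

Lemma min_lipschitz (M x y : R) : `|Num.min M x - Num.min M y| <= `|x - y|.
Proof.
have n1 := ler_norm (x - y); have n2 := ler_norm (y - x); rewrite distrC in n2.
rewrite /Num.min; case: (ltP M x) => c1; case: (ltP M y) => c2;
  rewrite ler_norml; apply/andP; split; lra.
Qed.

Lemma max_lipschitz (M x y : R) : `|Num.max M x - Num.max M y| <= `|x - y|.
Proof.
have n1 := ler_norm (x - y); have n2 := ler_norm (y - x); rewrite distrC in n2.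
rewrite /Num.max; case: (ltP M x) => c1; case: (ltP M y) => c2;
  rewrite ler_norml; apply/andP; split; lra.
Qed.

Lemma weak_solution_bounded (s : R) (f u : R -> R) : 0 < s < 1 ->
  (forall x : R, exists2 U : set R, nbhs x U & [lipschitz f y | y in U]) ->
  (exists C p : R, [/\ 0 < C, 1 < p, s < 2^-1 -> p < (1 + 2 * s) / (1 - 2 * s) &
         forall t, `|f t| <= C * (1 + `|t|) `^ p]) ->
  weak_solution s f u ->
  let w := per_rep u in let g := fun x => f (w x) in
  [/\ measurable_fun setT g, mu.-integrable I (fun x => (w x)%:E),
    mu.-integrable I (fun x => (g x)%:E),
    (forall k phi, is_trig k phi ->
      k%:R `^ (2 * s) * \int[mu]_(x in I) (w x * phi x) = \int[mu]_(x in I) (g x * phi x)) &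
    exists M, {ae mu, forall x, I x -> `|w x| <= M}].
Proof.
move=> s01 fl [C [p [C0 p1 hp fg]]] sol w g; have [s0 s1] := andP s01.
have [mw uw Ew L2] := X_space_rep s01 sol.1.
have pw := per_rep_periodic u; rewrite -/w in mw uw Ew L2 pw.
have cf := locally_lipschitz_continuous fl.
have mg : measurable_fun setT g.
  by apply: (measurableT_comp _ mw); exact: continuous_measurable_fun.
have iw := L2_L1 mw L2.
have [hp2 [m [m1 mb hm]]] := subcritical_exponent s01 p1 hp.
have p0 : 0 <= p by lra.
have iW := weight_integrable s01 mw pw Ew L2 p0 hp2.
have m0 : 0 < m by lra.
have pm0 : 0 <= (p - 1) * m by rewrite mulr_ge0; lra.
have iA := weight_integrable s01 mw pw Ew L2 pm0 hm.
(* The growth bound is used as [|f(w)| <= C a (1 + |w|)] with [a] regarded as a fixed coefficient,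
   so that the equation becomes a linear inequality for [1 + |w|]. *)
pose a x := (1 + `|w x|) `^ (p - 1).
have W1 x : 1 <= 1 + `|w x| by rewrite lerDl.
have W0 x : 0 < 1 + `|w x| by exact: lt_le_trans (W1 x).
have aW x : a x * (1 + `|w x|) = (1 + `|w x|) `^ p.
  rewrite /a -{2}[1 + `|w x|]powRr1 ?(ltW (W0 x))// -powRD; last by rewrite (gt_eqF (W0 x)) implybT.
  by rewrite subrK.
have ig : mu.-integrable I (fun x => (g x)%:E).
  apply: (@integrable_dom _ _ _ mu I mI (fun x => C * (1 + `|w x|) `^ p)).
  - exact: measurable_funTS.
  - by move=> x _; exact: fg.
  - exact: integrable_cmul.
have hc := weak_fourier s01 sol; rewrite -/w in hc.
have g0 : \int[mu]_(y in I) g y = 0.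
  have := hc 0%N _ (or_introl erefl); rewrite powR0 ?gt_eqF ?mulr_gt0// mul0r => h0.
  by rewrite [RHS]h0; apply: eq_Rintegral => x _; rewrite mul0r cos0 mulr1.
split => //.
have b0 : 0 < 2 * s by rewrite mulr_gt0.
pose A := `|tau^-1 * \int[mu]_(y in I) w y|.
have gb := gam_gt0 b0.
have rep : {ae mu, forall x, I x -> `|w x| <= A + (gam (2 * s))^-1 * `|wk (2 * s) g x|}.
  apply: aeS (representation s0 mw iw mg ig hc) => x h Ix; rewrite (h Ix).
  apply: (le_trans (ler_normD _ _)); rewrite lerD2l normrM ger0_norm// invr_ge0 ltW//.
have ma : measurable_fun setT a.
  by apply: measurable_powRl; apply: measurable_funD => //; exact: measurableT_comp.
have a1 x : 1 <= a x.
  by rewrite /a -[leLHS](powRr0 (1 + `|w x|)) ler_powR//; lra.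
have A0 : 0 <= A by exact: normr_ge0.
apply: (@ae_bounded R (2 * s) m A C g w a b0 m1 mb A0 C0 mg ig g0 mw ma a1 _ _ _ rep).
- by move=> x; rewrite aW; exact: fg.
- by apply: eq_integrable iW => // x _; rewrite aW.
- by apply: eq_integrable iA => // x _; rewrite /a -powRrM.
Qed.

End assembly.

Theorem theorem1p1 (R : realType) (s : R) (f u : R -> R)
  (s01 : 0 < s < 1)
  (f_lip : forall x : R, exists2 U : set R, nbhs x U & [lipschitz f y | y in U])
  (f_growth : exists C p : R,
     [/\ 0 < C, 1 < p,
         s < 2^-1 -> p < (1 + 2 * s) / (1 - 2 * s) &
         forall t, `|f t| <= C * (1 + `|t|) `^ p])
  (u_sol : weak_solution s f u) :
  exists v : R -> R,
    [/\ {ae lebesgue_measure, forall x, u x = v x},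
        forall alpha : R, 0 < alpha < 1 -> holder_zygmund (2 * s + alpha) v,
        periodic v (pi *+ 2) &
        classical_solution s f v].
Proof.
have [s0 s1] := andP s01; have b0 : 0 < 2 * s by rewrite mulr_gt0.
have [mg iw ig hc [M0 wM0]] := weak_solution_bounded s01 f_lip f_growth u_sol.
have [mw uw _ _] := X_space_rep s01 u_sol.1.
have pw := per_rep_periodic u.
set w := per_rep u in mg iw ig hc wM0 mw uw pw.
pose g x := f (w x); have mI := @measurable_per R.
pose M := Num.max 0 M0; have M_ge0 : 0 <= M by rewrite le_max lexx.
have wM : {ae lebesgue_measure, forall x, per_itv x -> `|w x| <= M}.
  by apply: aeS wM0 => x h Ix; rewrite le_max (h Ix) orbT.
(* Truncation at the essential bound of [w]: [f] composed with [clip] is bounded and globally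
   Lipschitz, and agrees with [f] on all values up to [M]. *)
pose clip x : R := Num.max (- M) (Num.min M x).
have clipM x : `|clip x| <= M.
  rewrite /clip /Num.max /Num.min ler_norml; case: ifP => c1; case: ifP c1 => c2 c1; apply/andP; split; lra.
have clip_id x : `|x| <= M -> clip x = x.
  rewrite ler_norml /clip => /andP[x1 x2]; rewrite (min_idPr x2); exact/max_idPr.
have clip_lip x y : `|clip x - clip y| <= `|x - y|.
  exact: (le_trans (max_lipschitz _ _ _) (min_lipschitz _ _ _)).
have [C [p [C0 p1 hp fg]]] := f_growth.
have fB x : `|x| <= M -> `|f x| <= C * (1 + M) `^ p.
  move=> xM; apply: (le_trans (fg x)); rewrite ler_wpM2l ?(ltW C0)//.
  by rewrite ge0_ler_powR ?nnegrE ?addr_ge0//; lra.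
have [L L0 hL] := locally_lipschitz_segment f_lip fB.
pose F x := f (clip x).
have FL x y : `|F x - F y| <= L * `|x - y|.
  by apply: (le_trans (hL _ _ (clipM x) (clipM y))); rewrite ler_wpM2l.
have FG x : `|F x| <= C * (1 + M) `^ p by exact/fB/clipM.
have rep := representation s0 mw iw mg ig hc.
set m0 := _ * \int[lebesgue_measure]_(y in per_itv) w y in rep.
(* The final representative is the right-hand side of the representation formula, which is defined
   at every point. *)
pose v x := m0 + (gam (2 * s))^-1 * wk (2 * s) g x.
have wv : {ae lebesgue_measure, forall x, per_itv x -> w x = v x} by exact: rep.
have pv_ : periodic v (pi *+ 2) by move=> x; rewrite /v wk_periodic.
have mv : measurable_fun setT v.
  by apply: measurable_funD => //; apply: measurable_funM => //; exact: measurable_wk.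
have mFv : measurable_fun setT (fun x => F (v x)).
  apply: (measurableT_comp _ mv); apply: continuous_measurable_fun.
  exact: (lipschitz_continuous L0 FL).
have gF : {ae lebesgue_measure, forall x, per_itv x -> g x = F (v x)}.
  by apply: aeS2 wv wM => x h1 h2 Ix; rewrite -(h1 Ix) /F clip_id// h2.
(* Poisson integrals do not see null sets, so [f(w)] may be replaced by [F(v)] inside the formula;
   [v] now satisfies a closed equation at every point. *)
have vE x : v x = m0 + (gam (2 * s))^-1 * wkd (2 * s) 0 (fun y => F (v y)) x.
  rewrite /v; congr (_ + _ * _); apply: eq_Rintegral => t _; congr (_ * _).
  exact: (pv_ae mg mFv gF).
have g0 : \int[lebesgue_measure]_(y in per_itv) g y = 0.
  have := hc 0%N _ (or_introl erefl); rewrite powR0 ?gt_eqF// mul0r => h0.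
  by rewrite [RHS]h0; apply: eq_Rintegral => x _; rewrite mul0r cos0 mulr1.
have mean0 : \int[lebesgue_measure]_(y in per_itv) F (v y) = 0.
  by rewrite -[RHS]g0; apply/esym; exact: Rintegral_ae.
have [A A0 vA] := bootstrap_lipschitz b0 L0 FL FG mFv pv_ mean0 vE.
have cv := lipschitz_continuous A0 vA.
have [Mv vM] := continuous_periodic_bounded cv pv_.
have vM1 x : `|v x| <= M.
  (* Twice the positive part of [|v| - M]. It is continuous, periodic and zero almost everywhere,
     hence zero; the essential bound of [w] becomes a pointwise bound for [v]. *)
  pose d x := (`|v x| - M) + `|(`|v x| - M)|.
  have cd0 : continuous (fun x => `|v x| - M).
    move=> y; apply: cvgB; last exact: cvg_cst.
    by apply: continuous_comp; [exact: cv|exact: norm_continuous].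
  have cd : continuous d.
    move=> y; apply: cvgD; first exact: cd0.
    by apply: cvg_norm; exact: cd0.
  have pd : periodic d (pi *+ 2) by move=> y; rewrite /d pv_.
  have dae : {ae lebesgue_measure, forall x, per_itv x -> d x = 0}.
    apply: aeS2 wv wM => y h1 h2 Iy; rewrite /d -(h1 Iy).
    have wM' : `|w y| - M <= 0 by rewrite subr_le0 h2.
    by rewrite [X in _ + X](ler0_norm wM') subrr.
  have := continuous_ae0_per cd pd dae x; rewrite /d.
  by have := normr_ge0 (`|v x| - M); lra.
have a01 : 0 <= (2^-1 : R) < 1 by apply/andP; split; lra.
(* With data exponent 1/2, the second-difference bound requires [(3/2) th < 2s], that is,
   [th < 4s/3], and the principal value requires [s < th <= 1]. The midpoint of [s] and
   [min(1, 4s/3)] satisfies all of these. *)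
pose th := (s + Num.min 1 (4 / 3 * s)) / 2.
have sth : s < th by rewrite /th; have : s < Num.min 1 (4 / 3 * s) by [rewrite lt_min s1; lra]; lra.
have th1 : th <= 1 by rewrite /th; have : Num.min 1 (4 / 3 * s) <= 1 by [rewrite ge_min lexx]; lra.
have th0 : 0 < th <= 1 by rewrite th1 andbT (lt_trans s0).
have hth : (2 - 2^-1) * th < 2 * s.
  rewrite /th; have : Num.min 1 (4 / 3 * s) <= 4 / 3 * s by rewrite ge_min lexx orbT.
  by lra.
have [K K0 vK] := second_diff_bound b0 L0 FL FG mFv pv_ mean0 vE a01 th0 hth.
(* Both sides are continuous and periodic with the same Fourier coefficients: those on the left are
   [k^(2s)] times the coefficients of [v], which equals [w] almost everywhere, and the weak equation
   identifies them with those of [f(w)]. *)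
have lapE x : frac_lap s v x = F (v x).
  pose d x := frac_lap s v x - F (v x).
  have cl := @frac_lap_continuous R s th Mv K v s01 sth th1 cv vM K0 vK.
  have cd : continuous d.
    move=> y; apply: cvgB; first exact: cl.
    apply: (@continuous_comp _ _ _ v F); first exact: cv.
    exact: (lipschitz_continuous L0 FL).
  have pd : periodic d (pi *+ 2).
    by move=> y; rewrite /d (frac_lap_periodic s01 sth th1 cv pv_ vM K0 vK) pv_.
  have md : measurable_fun setT d by exact: continuous_measurable_fun.
  have ml : measurable_fun setT (frac_lap s v) by exact: continuous_measurable_fun.
  have [Md dM] := continuous_periodic_bounded cd pd.
  have [Ml lM] := continuous_periodic_bounded cl (frac_lap_periodic s01 sth th1 cv pv_ vM K0 vK).
  have id_ : lebesgue_measure.-integrable per_itv (fun x => (d x)%:E).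
    by apply: (@per_bounded_integrable R d Md).
  have il : lebesgue_measure.-integrable per_itv (fun x => (frac_lap s v x)%:E).
    by apply: (@per_bounded_integrable R _ Ml).
  have iF : lebesgue_measure.-integrable per_itv (fun x => (F (v x))%:E).
    by apply: (@per_bounded_integrable R _ (C * (1 + M) `^ p)).
  have H k phi : is_trig k phi -> \int[lebesgue_measure]_(x in per_itv) (phi x * d x) = 0.
    move=> tphi; have mphi := measurable_trig tphi.
    have ib (h : R -> R) : lebesgue_measure.-integrable per_itv (fun x => (h x)%:E) ->
        lebesgue_measure.-integrable per_itv (fun x => (h x * phi x)%:E).
      move=> ih; have := @integrable_bmul R per_itv phi h 1 mI mphi (trig_le1 tphi) ih.
      by apply: eq_integrable => // y _; rewrite mulrC.
    have E y : phi y * d y = frac_lap s v y * phi y - F (v y) * phi y by rewrite /d; ring.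
    under eq_Rintegral do rewrite E.
    rewrite Rintegral_sub//; [|exact: ib|exact: ib].
    rewrite (frac_lap_coef s01 sth th1 cv pv_ vM K0 vK tphi).
    have -> : \int[lebesgue_measure]_(x in per_itv) (v x * phi x) =
        \int[lebesgue_measure]_(x in per_itv) (w x * phi x).
      apply/esym; apply: Rintegral_ae; [exact: measurable_funM|exact: measurable_funM|].
      by apply: aeS wv => y h Iy; rewrite (h Iy).
    have -> : \int[lebesgue_measure]_(x in per_itv) (F (v x) * phi x) =
        \int[lebesgue_measure]_(x in per_itv) (g x * phi x).
      apply/esym; apply: Rintegral_ae; [exact: measurable_funM|exact: measurable_funM|].
      by apply: aeS gF => y h Iy; rewrite (h Iy).
    by rewrite hc// subrr.
  have dae := fourier_unique id_ md (fun k => H k _ (or_introl erefl)) (fun k => H k _ (or_intror erefl)).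
  by apply/eqP; rewrite -subr_eq0; apply/eqP; exact: (continuous_ae0_per cd pd dae x).
exists v; split => //.
- have wv' : {ae lebesgue_measure, forall x, w x = v x}.
    by apply: (@ae_per R (fun x => w x = v x)) => // x; rewrite pw pv_.
  by apply: aeS2 uw wv' => x -> ->.
- move=> al al01; apply: (holder_zygmund_regularity b0 L0 FL FG mFv pv_ mean0 vE) => //.
  by lra.
- move=> x; have [ex _] := @frac_lap_facts R s th Mv K v s01 sth th1 cv vM K0 vK x.
  by split => //; rewrite lapE /F clip_id.
Qed.
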